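(* For every $f\in\mathcal D(\mathbb R^{n_1}\times\mathbb R^{n_2})$ there exist functions $\psi_0,\psi_1,\psi_2,\psi_3\in\mathcal D(\mathbb R^2)$ such that for all $(t_1,t_2)\in\mathbb R^*\times\mathbb R^*$ $$M_{\mathcal Q_1,\mathcal Q_2}f(t_1,t_2)=\psi_0(t_1,t_2)+\eta_1(t_1)\psi_1(t_1,t_2)+\eta_2(t_2)\psi_2(t_1,t_2)+\eta_1(t_1)\eta_2(t_2)\psi_3(t_1,t_2).$$
   Context: $\mathcal D(M)$ denotes the space of compactly supported $C^\infty$ functions on $M$, $Y$ is the Heaviside function, $\mathbb R^*=\mathbb R\setminus\{0\}$. For $j=1,2$ fix integers $p_j,q_j\ge1$, $n_j=p_j+q_j$, and $\mathcal Q_j(x_1,\dots,x_{n_j})=\sum_{i=1}^{p_j}x_i^2-\sum_{i=1}^{q_j}x_{p_j+i}^2$ on $\mathbb R^{n_j}$. For $f\in\mathcal D(\mathbb R^{n_1}\times\mathbb R^{n_2})$, $M_{\mathcal Q_1,\mathcal Q_2}f\in C^\infty(\mathbb R^*\times\mathbb R^* )\cap L^1(\mathbb R^2)$ is the function characterized by $$\int_{\mathbb R^{n_1}\times\mathbb R^{n_2}}F(\mathcal Q_1(x),\mathcal Q_2(y))f(x,y)\,dx\,dy=\int_{\mathbb R^2}F(t_1,t_2)M_{\mathcal Q_1,\mathcal Q_2}f(t_1,t_2)\,dt_1\,dt_2\quad\text{for all }F\in\mathcal D(\mathbb R^2).$$ $\eta_j$ is the singularity function of $\mathcal Q_j$,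 defined on $\mathbb R^*$ by: $\eta_j(t)=Y(t)t^{n_j/2-1}$ if $p_j$ is odd and $q_j$ even; $\eta_j(t)=Y(-t)(-t)^{n_j/2-1}$ if $p_j$ is even and $q_j$ odd; $\eta_j(t)=\frac12\mathrm{sgn}(t)t^{n_j/2-1}$ if both are even; $\eta_j(t)=t^{n_j/2-1}\log|t|$ if both are odd. *)

(* Defs.v *)
From HB Require Import structures.
From mathcomp Require Import all_boot all_order all_algebra.
From mathcomp Require Import all_classical all_reals all_analysis.
Set Implicit Arguments.
Unset Strict Implicit.
Unset Printing Implicit Defensive.
Import Order.TTheory GRing.Theory Num.Theory.
Import numFieldNormedType.Exports.
Local Open Scope classical_set_scope.
Local Open Scope ring_scope.

Section test_functions.
Context {R : realType} {V : normedModType R}.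
Implicit Types (f : V -> R) (U : set V).

Definition iter_derive f (vs : seq V) : V -> R :=
  foldr (fun v g => 'D_v g) f vs.

(* On a finite-dimensional V and an open U this is f \in C^oo(U): directional
   derivatives of every order exist and are continuous at every point of U. *)
Definition smooth_on U f : Prop :=
  forall (vs : seq V) (x : V), U x ->
    (forall v : V, derivable (iter_derive f vs) x v) /\
    {for x, continuous (iter_derive f vs)}.

Definition test_function f : Prop :=
  smooth_on [set: V] f /\ compact (closure [set x | f x != 0]).

End test_functions.

(* The library's own sigma-finiteness instance for product measures is shadowed
   by the one for subprobabilities. *)
Lemma product_measure1_sigma_finite d1 d2 (T1 : measurableType d1)
    (T2 : measurableType d2) (R : realType)
    (m1 : {sigma_finite_measure set T1 -> \bar R})
    (m2 : {sigma_finite_measure set T2 -> \bar R}) :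
  sigma_finite setT (m1 \x m2)%E.
Proof.
have /sigma_finiteP[F [TF ndF Foo]] := sigma_finiteT m1.
have /sigma_finiteP[G [TG ndG Goo]] := sigma_finiteT m2.
exists (fun n => F n `*` G n).
  rewrite -setXTT TF TG predeqE => -[x y]; split.
    move=> [/= [n _ Fnx] [k _ Gky]]; exists (maxn n k) => //; split.
    - by move: x Fnx; exact/subsetPset/ndF/leq_maxl.
    - by move: y Gky; exact/subsetPset/ndG/leq_maxr.
  by move=> [n _ []/= ? ?]; split; exists n.
move=> k; have [? ?] := Foo k; have [? ?] := Goo k.
split; first exact: measurableX.
by rewrite product_measure1E// lte_mul_pinfty// ge0_fin_numE.
Qed.

Section lebesgue_on_tuples.
Context (R : realType).
Local Open Scope ereal_scope.

Definition tuple_consp n (z : measurableTypeR R * n.-tuple (measurableTypeR R)) :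
  n.+1.-tuple (measurableTypeR R) := [tuple of z.1 :: z.2].

Definition tuple_unconsp n (t : n.+1.-tuple (measurableTypeR R)) :
  measurableTypeR R * n.-tuple (measurableTypeR R) :=
  (thead t, [tuple of behead t]).

(* Lebesgue measure on R^n, carried by n.-tuple because row vectors have no
   measurable structure in the library. *)
Fixpoint lebesgue_tuple n : set (n.-tuple (measurableTypeR R)) -> \bar R :=
  match n with
  | 0 => \d_[tuple]
  | m.+1 => pushforward (@lebesgue_measure R \x @lebesgue_tuple m)
              (@tuple_consp m)
  end.

Lemma measurable_tuple_consp n : measurable_fun setT (@tuple_consp n).
Proof. exact: measurable_cons. Qed.

Lemma measurable_tuple_unconsp n : measurable_fun setT (@tuple_unconsp n).
Proof.
apply/measurable_fun_pair; first exact: measurable_tnth.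
exact: measurable_behead.
Qed.

Lemma tuple_conspK n : cancel (@tuple_consp n) (@tuple_unconsp n).
Proof. by move=> [x t]; congr pair; exact/val_inj. Qed.

Let lebesgue_tuple_sigma_finite_measure n :
  exists m : {sigma_finite_measure set (n.-tuple (measurableTypeR R)) -> \bar R},
    @lebesgue_tuple n = m :> (set _ -> \bar R).
Proof.
elim: n => [|n [m mE]] /=.
  by exists (\d_([tuple] : 0.-tuple (measurableTypeR R))).
pose mu := pushforward (@lebesgue_measure R \x m) (@tuple_consp n).
have mc := @measurable_tuple_consp n.
pose mum : {measure set (n.+1.-tuple (measurableTypeR R)) -> \bar R} :=
  measure_function_pushforward__canonical__measure_function_Measure
    (@lebesgue_measure R \x m)%E mc.
have sf : sigma_finite setT mu.
  have [F FT Foo] := product_measure1_sigma_finite (@lebesgue_measure R) m.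
  exists (fun k => @tuple_unconsp n @^-1` F k).
    by rewrite -preimage_bigcup -FT preimage_setT.
  move=> k; have [mF oo] := Foo k; split.
    by rewrite -[X in measurable X]setTI; exact: measurable_tuple_unconsp.
  rewrite /mu /pushforward -comp_preimage.
  by rewrite (_ : _ \o _ = id) //; apply/funext => z; exact: tuple_conspK.
pose X := Measure_isSigmaFinite.Build _ _ _ mum sf.
pose mus : {sigma_finite_measure set _ -> \bar R} :=
  HB.pack (mum : set _ -> \bar R) (Measure.class mum) X.
by exists mus; rewrite mE.
Qed.

Let lebesgue_tuple0 n : @lebesgue_tuple n set0 = 0.
Proof. by have [m ->] := lebesgue_tuple_sigma_finite_measure n. Qed.

Let lebesgue_tuple_ge0 n A : 0 <= @lebesgue_tuple n A.
Proof. by have [m ->] := lebesgue_tuple_sigma_finite_measure n. Qed.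

Let lebesgue_tuple_semi_sigma_additive n : semi_sigma_additive (@lebesgue_tuple n).
Proof.
have [m ->] := lebesgue_tuple_sigma_finite_measure n.
exact: measure_semi_sigma_additive.
Qed.

HB.instance Definition _ n := isMeasure.Build _ _ _ (@lebesgue_tuple n)
  (@lebesgue_tuple0 n) (@lebesgue_tuple_ge0 n)
  (@lebesgue_tuple_semi_sigma_additive n).

Let lebesgue_tuple_sigma_finite n : sigma_finite setT (@lebesgue_tuple n).
Proof.
have [m ->] := lebesgue_tuple_sigma_finite_measure n; exact: sigma_finiteT.
Qed.

HB.instance Definition _ n := Measure_isSigmaFinite.Build _ _ _
  (@lebesgue_tuple n) (@lebesgue_tuple_sigma_finite n).

End lebesgue_on_tuples.

Arguments lebesgue_tuple R n _ : clear implicits.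

Section quadratic_forms.
Context {R : realType}.

Definition row_of_tuple n (t : n.-tuple (measurableTypeR R)) : 'rV[R]_n :=
  \row_i tnth t i.

Definition quad_form (p q : nat) (x : 'rV[R]_(p + q)) : R :=
  \sum_(i < p) x ord0 (lshift q i) ^+ 2 - \sum_(i < q) x ord0 (rshift p i) ^+ 2.

Definition heaviside (t : R) : R := (0 < t)%R%:R.

(* Only the values at t != 0 matter. When p and q have the same parity the
   exponent (p + q) / 2 - 1 is a natural number, and t may be negative. *)
Definition singularity_fun (p q : nat) (t : R) : R :=
  let a : R := (p + q)%N%:R / 2 - 1 in
  let k := ((p + q)./2).-1 in
  match odd p, odd q with
  | true, false => heaviside t * t `^ a
  | false, true => heaviside (- t) * (- t) `^ a
  | false, false => 2^-1 * Num.sg t * t ^+ k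
  | true, true => t ^+ k * ln `|t|
  end.

Definition off_axes : set (R * R) := [set t | t.1 != 0 /\ t.2 != 0].

(* Mf is a representative of M_{Q_1,Q_2} f; the characterization determines it
   uniquely on off_axes, its values on the (null) axes being irrelevant. *)
Definition is_quad_average (p1 q1 p2 q2 : nat)
    (f : 'rV[R]_(p1 + q1) * 'rV[R]_(p2 + q2) -> R) (Mf : R * R -> R) : Prop :=
  [/\ smooth_on off_axes Mf,
      (@lebesgue_measure R \x @lebesgue_measure R)%E.-integrable setT
        (fun t : measurableTypeR R * measurableTypeR R => (Mf t)%:E) &
      forall F : R * R -> R, test_function F ->
        (\int[lebesgue_tuple R (p1 + q1) \x lebesgue_tuple R (p2 + q2)]_z
           (F (quad_form (row_of_tuple z.1), quad_form (row_of_tuple z.2)) *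
            f (row_of_tuple z.1, row_of_tuple z.2))%:E =
         \int[@lebesgue_measure R \x @lebesgue_measure R]_t (F t * Mf t)%:E)%E].

End quadratic_forms.

(* Main.v *)
(* Testing Mf against products F1(t1) F2(t2) determines it off the axes, so by
   Fubini it suffices to find the density of one form Q at a time, the other
   variables being parameters.  Peel off the coordinates one by one.  By
   Whitney's theorem the even part of f in a coordinate x is a smooth function
   of u = x^2, and dx becomes the weight u_+^(-1/2) du; a Beta integral merges
   the weights u_+^(p/2-1) and v_+^(q/2-1) of two coordinate groups of the same
   sign into (u + v)_+^((p+q)/2-1).  What remains is the density
   int_v (s + v)_+^(p/2-1) v_+^(q/2-1) g(s + v, v) dv of a difference.  If q (or,
   by symmetry, p) is even, one weight is a polynomial, and the density is a
   smooth function plus s_+^((p+q)/2-1) times another one.  If both are odd, it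
   reduces to J(s) = int_0^oo G(s cosh y) dy, and
   J(s) + (1/pi) ln|s| int_0^pi G(s cos phi) dphi is smooth: the operator
   d/ds s d/ds maps this expression to s times one of the same kind up to a
   smooth term, which drives an induction on the order of differentiability. *)
Require Import Defs.
From mathcomp Require Import all_boot all_order all_algebra.
From mathcomp Require Import all_classical all_reals all_analysis.
From mathcomp Require Import measurable_realfun.
From mathcomp Require Import ring lra zify.
Set Implicit Arguments.
Unset Strict Implicit.
Unset Printing Implicit Defensive.
Import Order.TTheory GRing.Theory Num.Theory.
Import numFieldNormedType.Exports.
Local Open Scope classical_set_scope.
Local Open Scope ring_scope.

(** * Smooth functions with bounds *)

(** The model of the odd case is the pair of Bessel functions: for G(x) = e^(-x) and s > 0 the two
    integrals are K_0(s) and pi I_0(s), and K_0 + ln s I_0 is smooth. For a general G the Bessel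
    equation is replaced by the identity for d/ds s d/ds, with G'' in the role of the solution. The
    difficulty is to integrate that identity from s = 0: s J'(s) plus its logarithmic companion must
    first be shown to tend to 0, and the factor 1/pi is what makes the terms of order 0 cancel. The
    inner integral becomes J under v = (|s| cosh y - s) / 2, because dv/dy is then exactly sqrt(v (s
    + v)). Every density must be smooth jointly in s and in all variables not yet treated. These
    live in an arbitrary normed space [W], not assumed locally compact, so bounds on all derivatives
    belong to the notion of smoothness and travel through each reduction. Smoothness across s = 0,
    or across u = 0 in Whitney's theorem, is proved each time in the same way: off the hyperplane
    the derivative is an expression of the same family, this expression is continuous everywhere,
    and a removable singularity lemma closes the induction. *)

Section is_deriveP.
Context {R : realType} {V : normedModType R}.
Implicit Types (f g : V -> R) (x u v : V).

(** Clearing the denominator of the difference quotient makes h = 0 harmless; restriction to a line,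
    composition and locality then become rewriting inside the bound. *)
Lemma is_deriveP f x v (d : R) :
  is_derive x v f d <-> (forall e, 0 < e -> exists2 r, 0 < r &
    forall h, `|h| < r -> `|f (h *: v + x) - f x - h * d| <= e * `|h|).
Proof.
split=> [[dfx <-] e e0|H].
- move: dfx; rewrite /derivable => dfx.
  have /cvgrPdist_le /(_ e e0) : h^-1 *: ((f \o shift x) (h *: v) - f x) @[h --> 0^'] --> 'D_v f x.
    by move: dfx; rewrite /derive.
  rewrite /dnbhs near_withinE => /nbhs_ballP[r /= r0 Hr].
  exists r => // h hr; have [->|h0] := eqVneq h 0.
    by rewrite scale0r add0r subrr mul0r subrr !normr0 mulr0.
  have := Hr h; rewrite /ball/= sub0r normrN => /(_ hr h0).
  rewrite distrC => hle.
  have -> : f (h *: v + x) - f x - h * 'D_v f x =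
     h * (h^-1 *: (f (h *: v + x) - f x) - 'D_v f x).
    by rewrite mulrBr /GRing.scale/= mulrA divff// mul1r.
  by rewrite normrM mulrC ler_wpM2r.
- have cv : h^-1 *: ((f \o shift x) (h *: v) - f x) @[h --> 0^'] --> d.
    apply/cvgrPdist_le => e e0; have [r r0 Hr] := H e e0.
    rewrite /dnbhs near_withinE; apply/nbhs_ballP; exists r => //= h.
    rewrite /ball/= sub0r normrN => hr h0.
    have := Hr h hr; rewrite [X in _ -> X <= _]distrC.
    have -> : f (h *: v + x) - f x - h * d =
       h * (h^-1 *: (f (h *: v + x) - f x) - d).
      by rewrite mulrBr /GRing.scale/= mulrA divff// mul1r.
    by rewrite normrM mulrC ler_pM2r// normr_gt0.
  by split; [apply/cvg_ex; exists d|exact/cvg_lim].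
Qed.

End is_deriveP.

(** * Mean value theorem along a line; derivatives in scaled and added directions *)

Section mean_value.
Context {R : realType} {V : normedModType R}.
Implicit Types (f g : V -> R) (x u v : V).

Lemma is_derive_unique f x v (d d' : R) :
  is_derive x v f d -> is_derive x v f d' -> d = d'.
Proof. by move=> [_ <-] [_ <-]. Qed.

Lemma is_derive_line f x v t (d : R) :
  is_derive (t *: v + x) v f d <-> is_derive t 1 (fun s : R => f (s *: v + x)) d.
Proof.
split=> /is_deriveP H; apply/is_deriveP => e e0; have [r r0 Hr] := H e e0;
  exists r => // h hr; have := Hr h hr.
- by rewrite /= [_ *: 1]mulr1 scalerDl addrA.
- by rewrite /= [_ *: 1]mulr1 scalerDl addrA.
Qed.

(** The two conditions on s say that s lies between 0 and t, for either sign of t: the later uses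
    have increments of unknown sign. *)
Lemma line_MVT f (df : V -> R) x v (t : R) :
  (forall s, `|s| <= `|t| -> 0 <= s * t -> is_derive (s *: v + x) v f (df (s *: v + x))) ->
  exists2 s, `|s| <= `|t| /\ 0 <= s * t &
    f (t *: v + x) - f x = t * df (s *: v + x).
Proof.
move=> H; pose F (s : R) := f (s *: v + x).
have dF s : `|s| <= `|t| -> 0 <= s * t -> is_derive s 1 F (df (s *: v + x)).
  by move=> st s0; apply/is_derive_line/H.
have F0 : F 0 = f x by rewrite /F scale0r add0r.
have cF a b : (forall s, a <= s <= b -> `|s| <= `|t| /\ 0 <= s * t) ->
    {within `[a, b], continuous F}.
  move=> ab; apply: derivable_within_continuous => s.
  rewrite in_itv/= => /ab[s1 s2]; by have [] := dF s s1 s2.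
have [t0|t0|t0] := ltgtP t 0.
- have ab s : t <= s <= 0 -> `|s| <= `|t| /\ 0 <= s * t.
    move=> /andP[s1 s2]; rewrite !ler0_norm ?(ltW t0)//; split; first lra.
    by rewrite nmulr_lge0.
  have dF' c : c \in `]t, 0[ -> is_derive c 1 F (df (c *: v + x)).
    by rewrite in_itv/= => /andP[c1 c2]; apply: dF; apply ab; rewrite !ltW.
  have [c cI cE] := MVT t0 dF' (cF t 0 ab).
  move: cI; rewrite in_itv/= => /andP[c1 c2].
  exists c; first by apply: ab; rewrite !ltW.
  by move: cE; rewrite F0 sub0r /F => cE; rewrite -opprB cE; ring.
- have ab s : 0 <= s <= t -> `|s| <= `|t| /\ 0 <= s * t.
    move=> /andP[s1 s2]; rewrite !ger0_norm ?(ltW t0)//; split => //.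
    by rewrite mulr_ge0// ltW.
  have dF' c : c \in `]0, t[ -> is_derive c 1 F (df (c *: v + x)).
    by rewrite in_itv/= => /andP[c1 c2]; apply: dF; apply ab; rewrite !ltW.
  have [c cI cE] := MVT t0 dF' (cF 0 t ab).
  move: cI; rewrite in_itv/= => /andP[c1 c2].
  exists c; first by apply: ab; rewrite !ltW.
  by move: cE; rewrite F0 subr0 /F => ->; ring.
- exists 0; first by rewrite normr0 t0 normr0 mulr0.
  by rewrite t0 scale0r add0r subrr mul0r.
Qed.

Lemma is_derive_dirZ f x v (a d : R) :
  is_derive x v f d -> is_derive x (a *: v) f (a * d).
Proof.
move=> /is_deriveP H; apply/is_deriveP => e e0.
have [->|a0] := eqVneq a 0.
  exists 1 => // h _; rewrite scale0r scaler0 add0r mul0r mulr0 !subrr normr0.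
  by rewrite mulr_ge0// ltW.
have a0' : 0 < `|a| by rewrite normr_gt0.
have [r r0 Hr] := H (e / `|a|) (divr_gt0 e0 a0').
exists (r / `|a|); first exact: divr_gt0.
move=> h; rewrite ltr_pdivlMr// => hr.
have := Hr (h * a); rewrite normrM => /(_ hr).
have -> : e / `|a| * (`|h| * `|a|) = e * `|h| by field; rewrite gt_eqF.
by rewrite scalerA mulrA.
Qed.

(** Move by h v first, then by h u. The second increment is handled by the mean value theorem, so
    continuity at x of the derivative along u takes the place of total differentiability. *)
Lemma is_derive_dirD f (du : V -> R) x u v (dv : R) :
  (forall y, is_derive y u f (du y)) -> is_derive x v f dv ->
  {for x, continuous du} -> is_derive x (u + v) f (du x + dv).
Proof.
move=> Hu /is_deriveP Hv cu; apply/is_deriveP => e e0.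
have e2 : 0 < e / 2 by rewrite divr_gt0.
have [r r0 Hr] := Hv _ e2.
have /cvgrPdist_le/(_ _ e2) := cu.
rewrite near_map => /nbhs_ballP[s /= s0 Hs].
pose K := `|u| + `|v| + 1.
have K0 : 0 < K by rewrite /K ltr_wpDl// addr_ge0.
exists (Num.min r (s / K)); first by rewrite lt_min r0 divr_gt0.
move=> h; rewrite lt_min => /andP[hr]; rewrite ltr_pdivlMr// => hs.
have [t [ht _] tE] := @line_MVT f du (h *: v + x) u h (fun y _ _ => Hu _).
have -> : f (h *: (u + v) + x) - f x - h * (du x + dv) =
  h * (du (t *: u + (h *: v + x)) - du x) + (f (h *: v + x) - f x - h * dv).
  have -> : f (h *: (u + v) + x) = f (h *: u + (h *: v + x)) by rewrite scalerDr addrA.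
  by rewrite mulrBr -tE; ring.
rewrite (le_trans (ler_normD _ _))// [e]splitr mulrDl lerD//; last exact: Hr.
rewrite normrM mulrC ler_wpM2r// distrC; apply: Hs; rewrite -ball_normE/=.
rewrite opprD addrA addrC opprD !addrA subrK -opprD normrN.
apply: le_lt_trans hs; rewrite (le_trans (ler_normD _ _))// !normrZ.
rewrite /K addrC; have := normr_ge0 u; have := normr_ge0 v; have := normr_ge0 h; nra.
Qed.

End mean_value.

(** * C^k functions with bounded derivatives, bounded linear maps, bounded support *)

Section bounded_Ck.
Context {R : realType}.

Definition region (V : normedModType R) (b : bool) (M : R) : set V :=
  [set x | b || (`|x| <= M)].

(* C^k functions whose derivatives are bounded on V if b, and only on the balls
   of V otherwise. *)
Fixpoint Ckb (V : normedModType R) (b : bool) (k : nat) (f : V -> R) : Prop :=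
  [/\ continuous f,
      forall M, exists C, forall x, region b M x -> `|f x| <= C &
      if k is k'.+1 then
        forall v, (forall x, derivable f x v) /\ Ckb b k' ('D_v f)
      else True].

Definition smoothb (V : normedModType R) b (f : V -> R) := forall k, Ckb b k f.

Section basic.
Context {V : normedModType R}.
Implicit Types (f g : V -> R) (b : bool).

Lemma Ckb_continuous b k f : Ckb b k f -> continuous f.
Proof. by case: k => [|k] []. Qed.

Lemma Ckb_bounded b k f : Ckb b k f ->
  forall M, exists C, forall x, region b M x -> `|f x| <= C.
Proof. by case: k => [|k] []. Qed.

Lemma Ckb_derive b k f v : Ckb b k.+1 f -> Ckb b k ('D_v f).
Proof. by move=> [_ _ /(_ v)[]]. Qed.

Lemma Ckb_is_derive b k f x v : Ckb b k.+1 f -> is_derive x v f ('D_v f x).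
Proof. by move=> [_ _ /(_ v)[df _]]; exact: derivableP. Qed.

Lemma CkbS b k f : continuous f ->
  (forall M, exists C, forall x, region b M x -> `|f x| <= C) ->
  (forall v, exists2 g, Ckb b k g & forall x, is_derive x v f (g x)) ->
  Ckb b k.+1 f.
Proof.
move=> cf bf H; split => // v; have [g gk gd] := H v; split.
  by move=> x; case: (gd x).
suff -> : 'D_v f = g by [].
by apply/funext => x; case: (gd x).
Qed.

Lemma Ckb_pred b k f : Ckb b k.+1 f -> Ckb b k f.
Proof.
elim: k f => [|k IH] f; first by move=> [].
move=> [cf bf H]; split => // v; have [dv Hv] := H v.
by split => //; exact: IH.
Qed.

Lemma Ckb_weaken b k f : Ckb true k f -> Ckb b k f.
Proof.
elim: k f => [|k IH] f [cf bf H]; split => //.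
- by move=> M; have [C HC] := bf M; exists C => x _; exact: HC.
- by move=> M; have [C HC] := bf M; exists C => x _; exact: HC.
- by move=> v; have [dv Hv] := H v; split => //; exact: IH.
Qed.

Lemma Ckb_cst b k (c : R) : Ckb b k (fun _ : V => c).
Proof.
elim: k c => [|k IH] c.
  split => //; first exact: cst_continuous.
  by move=> M; exists `|c|.
apply: CkbS; first exact: cst_continuous.
  by move=> M; exists `|c|.
by move=> v; exists (fun=> 0) => // x; exact: is_derive_cst.
Qed.

Lemma CkbD b k f g : Ckb b k f -> Ckb b k g -> Ckb b k (fun x => f x + g x).
Proof.
have bd f' g' (M : R) : (exists C, forall x, region b M x -> `|f' x| <= C) ->
    (exists C, forall x, region b M x -> `|g' x| <= C) ->
    exists C, forall x : V, region b M x -> `|f' x + g' x| <= C.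
  move=> [C HC] [D HD]; exists (C + D) => x rx.
  by rewrite (le_trans (ler_normD _ _))// lerD ?HC ?HD.
have cD f' g' : continuous f' -> continuous g' -> continuous (fun x : V => f' x + g' x).
  by move=> cf cg x; apply: cvgD; [exact: cf|exact: cg].
elim: k f g => [|k IH] f g.
  by move=> [cf bf _] [cg bg _]; split=> //; [exact: cD|move=> M; exact: bd].
move=> fk gk; apply: CkbS.
- by apply: cD; [exact: Ckb_continuous fk|exact: Ckb_continuous gk].
- by move=> M; apply: bd; [exact: (Ckb_bounded fk)|exact: (Ckb_bounded gk)].
- move=> v; exists (fun x => 'D_v f x + 'D_v g x).
    by apply: IH; exact: Ckb_derive.
  move=> x; apply: (@is_deriveD _ _ _ f g).
    exact: Ckb_is_derive fk.
  exact: Ckb_is_derive gk.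
Qed.

Lemma CkbM b k f g : Ckb b k f -> Ckb b k g -> Ckb b k (fun x => f x * g x).
Proof.
have bd f' g' (M : R) : (exists C, forall x, region b M x -> `|f' x| <= C) ->
    (exists C, forall x, region b M x -> `|g' x| <= C) ->
    exists C, forall x : V, region b M x -> `|f' x * g' x| <= C.
  move=> [C HC] [D HD]; exists (C * D) => x rx.
  by rewrite normrM ler_pM ?HC ?HD.
have cD f' g' : continuous f' -> continuous g' -> continuous (fun x : V => f' x * g' x).
  by move=> cf cg x; apply: cvgM; [exact: cf|exact: cg].
elim: k f g => [|k IH] f g.
  by move=> [cf bf _] [cg bg _]; split=> //; [exact: cD|move=> M; exact: bd].
move=> fk gk; apply: CkbS.
- by apply: cD; [exact: Ckb_continuous fk|exact: Ckb_continuous gk].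
- by move=> M; apply: bd; [exact: (Ckb_bounded fk)|exact: (Ckb_bounded gk)].
- move=> v; exists (fun x => f x * 'D_v g x + g x * 'D_v f x).
    by apply: CkbD; apply: IH; (exact: Ckb_derive || exact: Ckb_pred).
  move=> x; apply: (@is_deriveM _ _ f g).
    exact: Ckb_is_derive fk.
  exact: Ckb_is_derive gk.
Qed.

Lemma CkbZ b k (c : R) f : Ckb b k f -> Ckb b k (fun x => c * f x).
Proof. exact/CkbM/Ckb_cst. Qed.

Lemma CkbN b k f : Ckb b k f -> Ckb b k (fun x => - f x).
Proof.
move=> fk; rewrite (_ : (fun _ => _) = (fun x => -1 * f x)); first exact: CkbZ.
by apply/funext => x; rewrite mulN1r.
Qed.

Lemma CkbX b k n f : Ckb b k f -> Ckb b k (fun x => f x ^+ n).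
Proof.
move=> fk; elim: n => [|n IH].
  rewrite (_ : (fun _ => _) = (fun=> 1)); first exact: Ckb_cst.
  by apply/funext => x; rewrite expr0.
rewrite (_ : (fun _ => _) = (fun x => f x * f x ^+ n)); first exact: CkbM.
by apply/funext => x; rewrite exprS.
Qed.

End basic.

Section bounded_linear.
Implicit Types V : normedModType R.

Definition blin V (V' : normedModType R) (L : V -> V') :=
  (forall (h : R) x y, L (h *: x + y) = h *: L x + L y) /\
  exists K, forall x, `|L x| <= K * `|x|.

Lemma blinD V (V' : normedModType R) (L : V -> V') x y : blin L -> L (x + y) = L x + L y.
Proof. by move=> [H _]; rewrite -[x in LHS]scale1r H scale1r. Qed.

Lemma blin_0 V (V' : normedModType R) (L : V -> V') : blin L -> L 0 = 0.
Proof.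
move=> Ll; have := blinD 0 0 Ll; rewrite addr0 => /eqP.
by rewrite -subr_eq subrr => /eqP.
Qed.

Lemma blinZ V (V' : normedModType R) (L : V -> V') (h : R) x : blin L -> L (h *: x) = h *: L x.
Proof. by move=> Ll; have [H _] := Ll; rewrite -[h *: x]addr0 H blin_0// addr0. Qed.

Lemma blinB V (V' : normedModType R) (L : V -> V') x y : blin L -> L (x - y) = L x - L y.
Proof. by move=> Ll; rewrite blinD// -scaleN1r blinZ// scaleN1r. Qed.

Lemma blin_continuous V (V' : normedModType R) (L : V -> V') : blin L -> continuous L.
Proof.
move=> Ll x; have [_ [K HK]] := Ll; apply/cvgrPdist_le => e e0.
apply/nbhs_ballP; exists (e / (`|K| + 1)); first by rewrite /= divr_gt0// ltr_wpDl.
move=> y; rewrite -ball_normE/= ltr_pdivlMr ?ltr_wpDl// => /ltW xy.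
rewrite -(blinB _ _ Ll) (le_trans (HK _))// (le_trans _ xy)// mulrC ler_wpM2l//.
by rewrite (le_trans (ler_norm K))// lerDl.
Qed.

Lemma blin_id V : blin (@id V).
Proof. by split=> [//|]; exists 1 => x; rewrite mul1r. Qed.

Lemma blin_zero V (V' : normedModType R) : blin (fun _ : V => 0 : V').
Proof.
split=> [h x y|]; first by rewrite scaler0 addr0.
by exists 0 => x; rewrite normr0 mul0r.
Qed.

Lemma blin_comp V V' (V'' : normedModType R) (L : V' -> V'') (L' : V -> V') :
  blin L -> blin L' -> blin (fun x => L (L' x)).
Proof.
move=> [Ll [K HK]] [L'l [K' HK']]; split=> [h x y|]; first by rewrite L'l Ll.
exists (`|K| * K') => x.
rewrite (le_trans (HK _))// (le_trans (ler_wpM2r _ (ler_norm K)))//.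
by rewrite -mulrA ler_wpM2l.
Qed.

Lemma blin_add V (V' : normedModType R) (L L' : V -> V') :
  blin L -> blin L' -> blin (fun x => L x + L' x).
Proof.
move=> [Ll [K HK]] [L'l [K' HK']]; split=> [h x y|].
  by rewrite L'l Ll scalerDr addrACA.
exists (K + K') => x.
by rewrite (le_trans (ler_normD _ _))// mulrDl lerD.
Qed.

Lemma blin_scale V (V' : normedModType R) (c : R) (L : V -> V') :
  blin L -> blin (fun x => c *: L x).
Proof.
move=> [Ll [K HK]]; split=> [h x y|].
  by rewrite Ll scalerDr !scalerA [c * h]mulrC.
exists (`|c| * K) => x.
by rewrite normrZ -mulrA ler_wpM2l.
Qed.

Lemma blin_opp V (V' : normedModType R) (L : V -> V') :
  blin L -> blin (fun x => - L x).
Proof.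
move=> Ll; rewrite (_ : (fun _ => _) = (fun x => -1 *: L x)); first exact: blin_scale.
by apply/funext => x; rewrite scaleN1r.
Qed.

Lemma blin_mul V (c : R) (L : V -> R) : blin L -> blin (fun x => c * L x).
Proof. exact: blin_scale. Qed.

Lemma blin_pair V V' (V'' : normedModType R) (L : V -> V') (L' : V -> V'') :
  blin L -> blin L' -> blin (fun x => (L x, L' x)).
Proof.
move=> [Ll [K HK]] [L'l [K' HK']]; split=> [h x y|].
  by rewrite L'l Ll.
exists (Num.max K K') => x.
rewrite prod_normE/= ge_max; apply/andP; split.
  by rewrite (le_trans (HK _))// ler_wpM2r// le_max lexx.
by rewrite (le_trans (HK' _))// ler_wpM2r// le_max lexx orbT.
Qed.

Lemma blin_fst V V' (V'' : normedModType R) (L : V -> V' * V'') :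
  blin L -> blin (fun x => (L x).1).
Proof.
move=> [Ll [K HK]]; split=> [h x y|]; first by rewrite Ll.
by exists K => x; rewrite (le_trans _ (HK _))// prod_normE le_max lexx.
Qed.

Lemma blin_snd V V' (V'' : normedModType R) (L : V -> V' * V'') :
  blin L -> blin (fun x => (L x).2).
Proof.
move=> [Ll [K HK]]; split=> [h x y|]; first by rewrite Ll.
by exists K => x; rewrite (le_trans _ (HK _))// prod_normE le_max lexx orbT.
Qed.

Lemma Ckb_blin V k (L : V -> R) : blin L -> Ckb false k L.
Proof.
move=> Ll.
have bd : forall M, exists C, forall x : V, region false M x -> `|L x| <= C.
  move=> M; have [_ [K HK]] := Ll; exists (`|K| * M) => x; rewrite /region/= => xM.
  by rewrite (le_trans (HK _))// (le_trans (ler_wpM2r _ (ler_norm K)))// ler_wpM2l.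
case: k => [|k]; first by split=> //; exact: blin_continuous.
apply: CkbS => //; first exact: blin_continuous.
move=> v; exists (fun=> L v); first exact: Ckb_cst.
move=> x; apply/is_deriveP => e e0; exists 1 => // h _.
by rewrite (blinD _ _ Ll) (blinZ _ _ Ll) addrK subrr normr0 mulr_ge0// ltW.
Qed.

Lemma is_derive_comp_blin V (V' : normedModType R) (L : V -> V') (a : V') (f : V' -> R) x v (d : R) :
  blin L -> is_derive (a + L x) (L v) f d -> is_derive x v (fun x => f (a + L x)) d.
Proof.
move=> Ll /is_deriveP H; apply/is_deriveP => e e0; have [r r0 Hr] := H e e0.
exists r => // h hr; have := Hr h hr.
by rewrite (blinD _ _ Ll) (blinZ _ _ Ll) addrCA.
Qed.

Lemma Ckb_comp_blin V (V' : normedModType R) b k (a : V') (L : V -> V') (f : V' -> R) :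
  blin L -> Ckb b k f -> Ckb b k (fun x => f (a + L x)).
Proof.
move=> Ll; have [_ [K HK]] := Ll.
have bd g M : (forall M, exists C, forall x, region b M x -> `|g x| <= C) ->
    exists C, forall x, region b M x -> `|g (a + L x)| <= C.
  move=> /(_ (`|a| + `|K| * M))[C HC]; exists C => x; rewrite /region/= => xM.
  apply: HC; rewrite /region/=; case: (b) xM => //= xM.
  rewrite (le_trans (ler_normD _ _))// lerD2l.
  by rewrite (le_trans (HK _))// (le_trans (ler_wpM2r _ (ler_norm K)))// ler_wpM2l.
have cD (g : V' -> R) : continuous g -> continuous (fun x => g (a + L x)).
  move=> cg x; apply: (@continuous_comp _ _ _ (fun x => a + L x) g); last exact: cg.
  by apply: cvgD; [exact: cvg_cst|exact: blin_continuous].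
elim: k f => [|k IH] f.
  by move=> [cf bf _]; split => //; [exact: cD|move=> M; exact: bd].
move=> fk; apply: CkbS; [exact/cD/(Ckb_continuous fk)|move=> M; exact/bd/(Ckb_bounded fk)|].
move=> v; exists (fun x => 'D_(L v) f (a + L x)); first by apply: (IH (derive f ^~ (L v))); exact: Ckb_derive.
move=> x; apply: is_derive_comp_blin => //; exact: Ckb_is_derive fk.
Qed.

Lemma Ckb_comp_lin V (V' : normedModType R) b k (L : V -> V') (f : V' -> R) :
  blin L -> Ckb b k f -> Ckb b k (fun x => f (L x)).
Proof.
move=> Ll /(Ckb_comp_blin 0 Ll).
by rewrite (_ : (fun _ => _) = (fun x => f (L x)))//; apply/funext => x; rewrite add0r.
Qed.

End bounded_linear.

Section bounded_support.
Implicit Types V : normedModType R.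

Definition bsupp V (f : V -> R) := exists M, forall x, M < `|x| -> f x = 0.

Lemma bsupp_derive V (f : V -> R) v : bsupp f -> bsupp ('D_v f).
Proof.
move=> [M HM]; exists M => x Mx.
have [_ ->//] : is_derive x v f 0.
apply/is_deriveP => e e0.
have v1 : 0 < `|v| + 1 by rewrite ltr_wpDl.
exists ((`|x| - M) / (`|v| + 1)); first by rewrite divr_gt0// subr_gt0.
move=> h; rewrite ltr_pdivlMr// => hr.
rewrite !HM// ?subrr ?mulr0 ?subr0 ?normr0 ?mulr_ge0// ?ltW//.
have : `|x| <= `|h *: v + x| + `|h *: v|.
  by rewrite -[X in `|X| <= _](addrK (h *: v)) [x + _]addrC ler_normB.
rewrite normrZ; have := normr_ge0 v; have := normr_ge0 h; nra.
Qed.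

(** All derivatives vanish off the ball that contains the support, so their bounds on that ball are
    global. *)
Lemma Ckb_bsupp V b k (f : V -> R) : bsupp f -> Ckb false k f -> Ckb b k f.
Proof.
elim: k f => [|k IH] f bf fk; have [M HM] := bf.
all: have bd : forall M, exists C, forall x, region b M x -> `|f x| <= C.
1,3: move=> N; have [C HC] := Ckb_bounded fk M; exists (Num.max 0 C) => x _;
  have [xM|Mx] := leP `|x| M; [by rewrite le_max HC ?orbT|
  by rewrite HM// normr0 le_max lexx].
- by case: fk => cf _ _; split.
- case: fk => cf _ Hf; split=> // v; have [dv Hv] := Hf v; split=> //.
  by apply: IH => //; exact: bsupp_derive.
Qed.

Lemma bsuppD V (f g : V -> R) : bsupp f -> bsupp g -> bsupp (fun x => f x + g x).
Proof.
move=> [M HM] [N HN]; exists (Num.max M N) => x; rewrite gt_max => /andP[Mx Nx].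
by rewrite HM// HN// addr0.
Qed.

Lemma bsuppMr V (f g : V -> R) : bsupp f -> bsupp (fun x => g x * f x).
Proof. by move=> [M HM]; exists M => x Mx; rewrite HM// mulr0. Qed.

Lemma bsupp_comp V (V' : normedModType R) (f : V' -> R) (L : V -> V') (K : R) :
  (forall x, `|x| <= K * `|L x|) -> bsupp f -> bsupp (fun x => f (L x)).
Proof.
move=> LK [M HM]; exists (`|K| * `|M|) => x Mx; apply: HM; rewrite ltNge.
apply/negP => LM; move: Mx; rewrite ltNge => /negP; apply.
rewrite (le_trans (LK x))// (le_trans (ler_wpM2r _ (ler_norm K)))// ler_wpM2l//.
by rewrite (le_trans LM)// ler_norm.
Qed.

(** The substitute for D(V) when V need not be locally compact: bounded instead of compact support,
    and globally bounded derivatives of every order. On R^2 it gives back the test functions. *)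
Definition tfun V (f : V -> R) := smoothb true f /\ bsupp f.

Lemma tfun_derive V (f : V -> R) v : tfun f -> tfun ('D_v f).
Proof.
by move=> [sf bf]; split; [move=> k; exact: (Ckb_derive v (sf k.+1))|exact: bsupp_derive].
Qed.

Lemma tfunD V (f g : V -> R) : tfun f -> tfun g -> tfun (fun x => f x + g x).
Proof.
by move=> [sf bf] [sg bg]; split; [move=> k; exact: CkbD|exact: bsuppD].
Qed.

Lemma tfunM V (f g : V -> R) : tfun f -> smoothb false g -> tfun (fun x => g x * f x).
Proof.
move=> [sf bf] sg; have bfg : bsupp (fun x => g x * f x) by exact: bsuppMr.
by split=> // k; apply: Ckb_bsupp => //; apply: CkbM => //; exact: Ckb_weaken.
Qed.

Lemma tfunZ V (c : R) (f : V -> R) : tfun f -> tfun (fun x => c * f x).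
Proof. by move=> bf; apply: tfunM => // k; exact: Ckb_cst. Qed.

Lemma tfun_bounded V (f : V -> R) : tfun f -> exists2 C, 0 <= C & forall x, `|f x| <= C.
Proof.
move=> [sf _]; have [C HC] := Ckb_bounded (sf 0%N) 0; exists C.
  by rewrite (le_trans _ (HC 0 _)).
by move=> x; exact: HC.
Qed.

Lemma tfun_continuous V (f : V -> R) : tfun f -> continuous f.
Proof. by move=> [sf _]; exact: Ckb_continuous (sf 0%N). Qed.

End bounded_support.

End bounded_Ck.

(** * Superpositions and removable singularities *)

Section superposition.
Context {R : realType}.

(** Dominated convergence is a statement on sequences; this carries it over to the continuity of
    integrals in a parameter. *)
Lemma sequential_continuous (V : normedModType R) (f : V -> R) (x : V) :
  (forall u : nat -> V, u n @[n --> \oo] --> x -> f (u n) @[n --> \oo] --> f x) ->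
  {for x, continuous f}.
Proof.
move=> H; apply/cvgrPdist_le => e e0; apply: contrapT => ne.
have /choice[u uP] (n : nat) : exists y : V, `|x - y| < n.+1%:R^-1 /\ e < `|f x - f y|.
  apply: contrapT => nex; apply: ne; apply/nbhs_ballP; exists n.+1%:R^-1 => //=.
  move=> y; rewrite -ball_normE/= => xy; rewrite leNgt; apply/negP => fy.
  by apply: nex; exists y.
have ux : u n @[n --> \oo] --> x.
  apply/cvgrPdist_lt => d d0.
  near=> n; have [un _] := uP n; apply: (lt_trans un); near: n.
  exact: (near_infty_natSinv_lt (PosNum d0)).
have /cvgrPdist_lt/(_ _ e0) := H u ux.
move=> [N _ /(_ N (leqnn N))]; have [_ eN] := uP N.
by move=> /=; rewrite ltNge (ltW eN).
Unshelve. all: by end_near. Qed.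

Context d (T : measurableType d) (mu : {measure set T -> \bar R}) (D : set T).
Context (mD : measurable D).
Context {V V' : normedModType R} (b : bool).
Context (a : T -> V') (L0 L1 : V -> V') (al : T -> R).
Context (L0l : blin L0).
Context (L1l : blin L1).
Let A t x := a t + L0 x + al t *: L1 x.
Context (bA : b \/ exists K, forall t, D t -> `|a t| <= K /\ `|al t| <= K).
Context (mA : forall f : V' -> R, continuous f ->
  forall x, measurable_fun D (fun t => f (A t x))).

(** The argument of f is affine in x, and its slope depends on t only through the scalar [al t].
    Differentiation in x therefore stays in the family and multiplies the weight c by 1 or by [al],
    which is why all [moments] of c are required. Dilation integrals and sums over Seeley's nodes
    are both of this form. *)
Definition superpose (c : T -> R) (f : V' -> R) (x : V) : R :=
  \int[mu]_(t in D) (c t * f (a t + L0 x + al t *: L1 x)).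

Definition moments (c : T -> R) := forall m : nat,
  mu.-integrable D (EFin \o (fun t => c t * al t ^+ m)).

Lemma moments_integrable c : moments c -> mu.-integrable D (EFin \o c).
Proof.
move=> /(_ 0%N); apply: eq_integrable => // t _.
by rewrite /= expr0 mulr1.
Qed.

Lemma moments_mul c : moments c -> moments (fun t => c t * al t).
Proof.
move=> mc m; apply: eq_integrable (mc m.+1) => // t _.
by rewrite /= exprS mulrA.
Qed.

Lemma superpose_region M : exists N, forall t x, D t ->
  region b M x -> region b N (A t x).
Proof.
case: bA => [bt|[K HK]]; first by exists 0 => t x _ _; rewrite /region/= bt.
have [_ [K0 HK0]] := L0l; have [_ [K1 HK1]] := L1l.
exists (K + `|K0| * M + K * (`|K1| * M)) => t x Dt; rewrite /region/=.
case: (b) => //= xM.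
have [atK altK] := HK t Dt; have K_ge0 := le_trans (normr_ge0 _) atK.
rewrite (le_trans (ler_normD _ _))// lerD//.
  rewrite (le_trans (ler_normD _ _))// lerD//.
  by rewrite (le_trans (HK0 _))// (le_trans (ler_wpM2r _ (ler_norm K0)))// ler_wpM2l.
rewrite normrZ ler_pM//.
by rewrite (le_trans (HK1 _))// (le_trans (ler_wpM2r _ (ler_norm K1)))// ler_wpM2l.
Qed.

Lemma superpose_bound (f : V' -> R) M : (forall M, exists C, forall x, region b M x -> `|f x| <= C) ->
  exists2 C, 0 <= C & forall t x, D t -> region b M x -> `|f (A t x)| <= C.
Proof.
move=> bf; have [N HN] := superpose_region M; have [C HC] := bf N.
exists (Num.max 0 C); first by rewrite le_max lexx.
by move=> t x Dt xM; rewrite le_max HC ?orbT//; exact: HN.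
Qed.

Lemma superpose_integrable c f x : mu.-integrable D (EFin \o c) -> Ckb b 0 f ->
  mu.-integrable D (EFin \o (fun t => c t * f (A t x))).
Proof.
move=> ic [cf bf _]; have [C C0 HC] := superpose_bound `|x| bf.
apply: (@le_integrable _ _ _ mu D mD _ (fun t => (C%:E * (c t)%:E)%E)).
- apply/measurable_EFinP; apply: measurable_funM; last exact: mA.
  by apply/measurable_EFinP; exact: measurable_int ic.
- move=> t Dt /=; rewrite lee_fin !normrM [leRHS]mulrC ler_wpM2l// (ger0_norm C0).
  by apply: HC => //; rewrite /region/= lexx orbT.
- exact: integrableZl.
Qed.

Lemma superpose_bounded c f : mu.-integrable D (EFin \o c) -> Ckb b 0 f ->
  forall M, exists C, forall x, region b M x -> `|superpose c f x| <= C.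
Proof.
move=> ic cf M; have [_ bf _] := cf.
have [C C0 HC] := superpose_bound M bf.
have iac : mu.-integrable D (EFin \o (fun t => `|c t|)).
  exact: integrable_norm.
exists (\int[mu]_(t in D) (C * `|c t|)) => x xM.
apply: le_trans (le_normr_Rintegral mD (superpose_integrable x ic cf)) _.
apply: le_Rintegral => //.
- apply: (@integrable_norm _ _ _ mu D (fun t => c t * f (A t x))).
  exact: superpose_integrable.
- rewrite (_ : _ \o _ = fun t => (C%:E * (`|c t|)%:E)%E) ?integrableZl//.
- by move=> t Dt; rewrite normrM mulrC ler_wpM2r//; exact: HC.
Qed.

Lemma superpose_map_continuous t : continuous (A t).
Proof.
move=> x; apply: cvgD; first by apply: cvgD; [exact: cvg_cst|exact: blin_continuous].
by apply: cvgZr; exact: blin_continuous.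
Qed.

Lemma superpose_continuous c f : mu.-integrable D (EFin \o c) -> Ckb b 0 f ->
  continuous (superpose c f).
Proof.
move=> ic cf x; have [cof bf _] := cf.
apply: sequential_continuous => u ux.
have [C C0 HC] := superpose_bound (`|x| + 1) bf.
have /cvgrPdist_lt/(_ _ ltr01)[N _ HN] := ux.
rewrite -(cvg_shiftn N) /=.
have uN n : region b (`|x| + 1) (u (n + N)%N).
  have := HN (n + N)%N (leq_addl _ _); rewrite /= => /ltW xu.
  rewrite /region/=; apply/orP; right.
  have -> : u (n + N)%N = x - (x - u (n + N)%N) by rewrite opprB addrC subrK.
  by rewrite (le_trans (ler_normB _ _))// lerD2l.
apply: fine_cvg; rewrite fineK; last first.
  exact: (integrable_fin_num mD (superpose_integrable x ic cf)).
apply: (@dominated_cvg _ _ _ mu D mD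
  (fun n t => (c t * f (A t (u (n + N)%N)))%:E) (fun t => (c t * f (A t x))%:E)
  (fun t => (C%:E * (`|c t|)%:E)%E)) => //.
- move=> n; apply: (measurable_int mu).
  exact: (superpose_integrable (u (n + N)%N) ic cf).
- move=> t Dt; apply: cvg_EFin; first by near=> n.
  apply: cvgM; first exact: cvg_cst.
  have : f (A t (u n)) @[n --> \oo] --> f (A t x).
    apply: (@cvg_comp _ _ _ _ (fun y => f (A t y)) _ (nbhs x)) => //.
    apply: continuous_comp; first exact: superpose_map_continuous.
    exact: cof.
  by rewrite -(cvg_shiftn N).
- by apply: integrableZl => //; exact: integrable_norm.
- move=> n t Dt; rewrite -EFinM lee_fin normrM mulrC ler_wpM2r//.
  exact: HC.
Unshelve. all: by end_near. Qed.

Lemma superpose_derive_dir f t x v : Ckb b 1 f ->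
  is_derive (A t x) (L0 v + al t *: L1 v) f
    ('D_(L0 v) f (A t x) + al t * 'D_(L1 v) f (A t x)).
Proof.
move=> f1; apply: (@is_derive_dirD _ _ f ('D_(L0 v) f)).
- move=> y; exact: Ckb_is_derive f1.
- apply: is_derive_dirZ; exact: Ckb_is_derive f1.
- exact: (Ckb_continuous (Ckb_derive (L0 v) f1)).
Qed.

Lemma superpose_is_derive c f x v : moments c -> Ckb b 1 f ->
  is_derive x v (superpose c f)
    (superpose c ('D_(L0 v) f) x + superpose (fun t => c t * al t) ('D_(L1 v) f) x).
Proof.
move=> mc f1.
have ic := moments_integrable mc.
have ica := moments_integrable (moments_mul mc).
have f00 := Ckb_derive (L0 v) f1; have f01 := Ckb_derive (L1 v) f1.
pose F (h : R) t := c t * f (A t (h *: v + x)).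
pose dF h t := c t * 'D_(L0 v) f (A t (h *: v + x)) +
  (c t * al t) * 'D_(L1 v) f (A t (h *: v + x)).
have Aline h t : A t (h *: v + x) = h *: (L0 v + al t *: L1 v) + A t x.
  rewrite /A (blinD _ _ L0l) (blinD _ _ L1l) (blinZ _ _ L0l) (blinZ _ _ L1l).
  by rewrite !scalerDr !scalerA [al t * h]mulrC [a t + _]addrCA addrACA.
have FdF (h : R) t : is_derive h 1 (fun s : R => F s t) (dF h t).
  have -> : dF h t = c t * ('D_(L0 v) f (A t (h *: v + x)) + al t * 'D_(L1 v) f (A t (h *: v + x))).
    by rewrite /dF mulrDr mulrA.
  apply: (@is_deriveZ _ _ _ (fun h : R => f (A t (h *: v + x))) (c t)).
  rewrite (_ : (fun _ => _) = (fun h => f (h *: (L0 v + al t *: L1 v) + A t x))); last first.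
    by apply/funext => s; rewrite Aline.
  apply: (@is_derive_line R V' f (A t x) (L0 v + al t *: L1 v) h _).1.
  by rewrite -Aline; exact: superpose_derive_dir.
(* For h in ]-1, 1[ the points h v + x stay in the ball of radius |v| + |x|; the bounds there
   produce the integrable majorant [G] of the derivative in h. *)
have [C0 C00 HC0] := superpose_bound (`|v| + `|x|) (Ckb_bounded f00).
have [C1 C10 HC1] := superpose_bound (`|v| + `|x|) (Ckb_bounded f01).
pose G t := C0 * `|c t| + C1 * `|c t * al t|.
have iG : mu.-integrable D (EFin \o G).
  rewrite (_ : _ \o _ = (fun t => C0%:E * (`|c t|)%:E) \+ (fun t => C1%:E * (`|c t * al t|)%:E))%E//.
  apply: integrableD => //; apply: integrableZl => //; exact: integrable_norm.
have I0 : `]-1, 1[%classic (0 : R) by rewrite /= in_itv/= ltrN10 ltr01.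
have hv h : `]-1, 1[%classic (h : R) -> region b (`|v| + `|x|) (h *: v + x).
  rewrite /= in_itv/= => /andP[h1 h2]; rewrite /region/=; apply/orP; right.
  rewrite (le_trans (ler_normD _ _))// lerD2r normrZ ler_piMl//.
  by rewrite ler_norml !ltW.
have intF h : `]-1, 1[%classic (h : R) -> mu.-integrable D (EFin \o F h).
  by move=> Ih; exact: superpose_integrable (Ckb_pred f1).
have derF (h : R) t : `]-1, 1[%classic h -> D t -> derivable (fun s => F s t) h 1.
  by move=> Ih _; case: (FdF h t).
have G_ge0 t : 0 <= G t by rewrite addr_ge0// mulr_ge0.
have Gub (h : R) t : `]-1, 1[%classic h -> D t -> `|partial1of2 F h t| <= G t.
  move=> Ih Dt; rewrite partial1of2E; have [_ ->] := FdF h t.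
  rewrite (le_trans (ler_normD _ _))// lerD// normrM mulrC ler_wpM2r//.
    by apply: HC0 => //; exact: hv.
  by apply: HC1 => //; exact: hv.
have Ad : derivable (fun h : R => superpose c f (h *: v + x)) 0 1.
  exact: (derivable_under_integral mD I0 intF derF G_ge0 iG Gub).
have Ad0 : derive1 (fun h : R => superpose c f (h *: v + x)) 0 = \int[mu]_(t in D) dF 0 t.
  transitivity (\int[mu]_(t in D) partial1of2 F 0 t).
    exact: (differentiation_under_integral mD I0 intF derF G_ge0 iG Gub).
  by apply: eq_Rintegral => t _; rewrite /partial1of2 derive1E; case: (FdF 0 t).
have : is_derive (0 : R) 1 (fun h : R => superpose c f (h *: v + x)) (\int[mu]_(t in D) dF 0 t).
  by split; [exact: Ad|rewrite -Ad0 derive1E].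
move=> /(@is_derive_line R V (superpose c f) x v 0 _).2; rewrite scale0r add0r.
suff -> : \int[mu]_(t in D) dF 0 t = superpose c ('D_(L0 v) f) x +
    superpose (fun t => c t * al t) ('D_(L1 v) f) x by [].
have i0 := superpose_integrable x ic f00.
have i1 := superpose_integrable x ica f01.
rewrite /superpose -(RintegralD mD i0 i1).
by apply: eq_Rintegral => t _; rewrite /dF scale0r add0r.
Qed.

Lemma superpose_Ckb k c f : moments c -> Ckb b k f -> Ckb b k (superpose c f).
Proof.
elim: k c f => [|k IH] c f mc fk.
  by split => //; [exact/superpose_continuous/fk/moments_integrable|
    exact/superpose_bounded/fk/moments_integrable].
have f0 : Ckb b 0 f by elim: {IH} k fk => [|k IH] /Ckb_pred.
have f1 : Ckb b 1 f by elim: {IH} k fk => [|k IH] // /Ckb_pred.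
apply: CkbS.
- exact/superpose_continuous/f0/moments_integrable.
- exact/superpose_bounded/f0/moments_integrable.
- move=> v; exists (fun x => superpose c ('D_(L0 v) f) x +
    superpose (fun t => c t * al t) ('D_(L1 v) f) x).
    by apply: CkbD; apply: IH; [|exact: Ckb_derive|exact: moments_mul|exact: Ckb_derive].
  by move=> x; exact: superpose_is_derive.
Qed.

End superposition.

(** * Removable singularities on a hyperplane, and the chain rule in the first variable *)

Section removable.
Context {R : realType} {W : normedModType R}.

(** The mean value theorem applies to segments off the hyperplane x.1 = 0. The segment is pushed off
    it by a small [de], and the continuity of f and h absorbs the displacement. *)
Lemma removable_derive (f h : R * W -> R) (v : R * W) :
  continuous f -> continuous h ->
  (forall x : R * W, x.1 != 0 -> is_derive x v f (h x)) ->
  forall x, is_derive x v f (h x).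
Proof.
move=> cf ch H x; have [x10|] := eqVneq x.1 0; last exact: H.
apply/is_deriveP => e e0.
have /cvgrPdist_le/(_ _ e0) := ch x.
move=> /nbhs_ballP[r /= r0 Hr].
exists (r / 2 / (`|v| + 1)); first by rewrite !divr_gt0// ltr_wpDl.
move=> t; rewrite ltr_pdivlMr ?ltr_wpDl// => tr.
have [->|t0] := eqVneq t 0.
  by rewrite scale0r add0r mul0r subrr subr0 !normr0 mulr0.
apply/ler_addgt0Pr => eta eta0.
have /cvgrPdist_le/(_ _ (divr_gt0 eta0 (ltr0Sn _ 1))) := cf (t *: v + x).
move=> /nbhs_ballP[d1 /= d10 H1].
have /cvgrPdist_le/(_ _ (divr_gt0 eta0 (ltr0Sn _ 1))) := cf x.
move=> /nbhs_ballP[d2 /= d20 H2].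
pose de := Num.min (r / 2) (Num.min d1 d2) / 2.
have m0 : 0 < Num.min (r / 2) (Num.min d1 d2) by rewrite !lt_min d10 d20 divr_gt0.
have de0 : 0 < de by rewrite divr_gt0.
have dem : de < Num.min (r / 2) (Num.min d1 d2).
  by rewrite /de ltr_pdivrMr// ltr_pMr// ltr1n.
move: dem; rewrite !lt_min => /andP[der /andP[ded1 ded2]].
(* The push takes the sign of v.1 t, so that the displaced segment moves away from the hyperplane
   and never crosses it. *)
pose si : R := if 0 <= v.1 * t then de else - de.
have nsi : `|si| = de by rewrite /si; case: ifP; rewrite ?normrN gtr0_norm.
pose x' := (si, 0) + x.
have nx' : `|x - x'| = de.
  rewrite /x' opprD addrC addrNK normrN prod_normE/= normr0 nsi.
  by apply/max_idPl/ltW.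
have [s [st s0] sE] : exists2 s, `|s| <= `|t| /\ 0 <= s * t &
    f (t *: v + x') - f x' = t * h (s *: v + x').
  apply: line_MVT => s st s0; apply: H.
  rewrite /x' /= x10 addr0 /si.
  have tt0 : 0 < t * t by rewrite -expr2 exprn_even_gt0.
  have [vt|vt] := leP 0 (v.1 * t).
    rewrite gt_eqF// ltr_wpDl//.
    rewrite -(pmulr_lge0 _ tt0) (_ : _ * _ = (s * t) * (v.1 * t)); first exact: mulr_ge0.
    by rewrite /GRing.scale/=; ring.
  rewrite lt_eqF// ltr_wnDl// ?oppr_lt0//.
  rewrite -(pmulr_lle0 _ tt0) (_ : _ * _ = (s * t) * (v.1 * t)); first exact: (mulr_ge0_le0 s0 (ltW vt)).
  by rewrite /GRing.scale/=; ring.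
have -> : f (t *: v + x) - f x - t * h x =
  t * (h (s *: v + x') - h x) + ((f (t *: v + x) - f (t *: v + x')) - (f x - f x')).
  by rewrite mulrBr -sE; ring.
rewrite (le_trans (ler_normD _ _))// lerD//.
  rewrite normrM mulrC ler_wpM2r// distrC; apply: Hr.
  rewrite -ball_normE/= (_ : x - _ = (x - x') - s *: v); last first.
    by rewrite opprD [- (s *: v) - _]addrC addrA.
  rewrite (le_lt_trans (ler_normB _ _))// nx' normrZ.
  have := normr_ge0 v; have := normr_ge0 s; have := normr_ge0 t; nra.
rewrite (le_trans (ler_normB _ _))// [eta]splitr lerD//.
  apply: H1; rewrite -ball_normE/= opprD addrACA subrr add0r.
  by rewrite nx'.
by apply: H2; rewrite -ball_normE/= nx'.
Qed.

(** Since p is only known to be differentiable at u, its increment q is used as the length of a step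
    along the first axis, where the mean value theorem applies to f; the remaining increment is
    along the second factor. *)
Lemma is_derive_curve b (f : R * W -> R) (p : R -> R) (u dp : R) (w : W) (v : R * W) :
  Ckb b 1 f -> is_derive u 1 p dp ->
  is_derive (u, w) v (fun x => f (p x.1, x.2))
    (v.1 * (dp * 'D_(1, 0) f (p u, w)) + 'D_(0, v.2) f (p u, w)).
Proof.
move=> f1 /is_deriveP dpu; apply/is_deriveP => e e0 /=.
pose D1 := 'D_((1 : R), (0 : W)) f.
have cD1 : continuous D1 by exact: Ckb_continuous (Ckb_derive _ f1).
pose x0 := (p u, w).
pose K := `|v.1 * dp| + 1; pose C := `|D1 x0| + 1.
have K0 : 0 < K by rewrite ltr_wpDl.
have C0 : 0 < C by rewrite ltr_wpDl.
have e3 : 0 < e / 3 by rewrite divr_gt0.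
have /is_deriveP/(_ _ e3)[r1 r10 Hr1] : is_derive x0 ((0 : R), v.2) f ('D_(0, v.2) f x0).
  exact: Ckb_is_derive f1.
have /cvgrPdist_le/(_ _ (divr_gt0 e3 K0))/nbhs_ballP[r2 /= r20 Hr2] := cD1 x0.
(* The error of the linear approximation of p enters twice: the first bound controls its product
   with [D1 x0], the second keeps |q| below K |t|. *)
pose m := Num.min (e / 3 / C) 1.
have m0 : 0 < m by rewrite lt_min ltr01 divr_gt0.
have v10 : 0 < `|v.1| + 1 by rewrite ltr_wpDl.
have [r3 r30 Hr3] := dpu _ (divr_gt0 m0 v10).
have v20 : 0 < `|v.2| + 1 by rewrite ltr_wpDl.
exists (Num.min r1 (Num.min (r2 / (K + (`|v.2| + 1))) (r3 / (`|v.1| + 1)))).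
  by rewrite !lt_min r10 !divr_gt0// addr_gt0.
move=> t; rewrite !lt_min => /andP[tr1 /andP[]].
have Kv0 : 0 < K + (`|v.2| + 1) by rewrite addr_gt0.
rewrite !ltr_pdivlMr// => tr2 tr3.
pose q := p (t * v.1 + u) - p u.
have qE : `|q - t * v.1 * dp| <= m * `|t|.
  have := Hr3 (t * v.1); rewrite normrM [_ *: 1]mulr1 => Hq.
  have tv : `|t| * `|v.1| < r3 by have := normr_ge0 t; nra.
  rewrite (le_trans (Hq tv))// -mulrA ler_wpM2l ?(ltW m0)// ler_pdivrMl// mulrC ler_wpM2r//.
  by rewrite lerDl.
have qK : `|q| <= K * `|t|.
  have -> : q = (q - t * v.1 * dp) + t * v.1 * dp by ring.
  have tvE : `|t * v.1 * dp| = `|v.1 * dp| * `|t| by rewrite -mulrA normrM mulrC.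
  rewrite (le_trans (ler_normD _ _))// tvE /K mulrDl mul1r addrC lerD2l.
  by rewrite (le_trans qE)// ler_piMl// /m ge_min lexx orbT.
have [s [sq _] sE] := @line_MVT _ _ f D1 (p u, t *: v.2 + w) (1, 0) q
  (fun s _ _ => Ckb_is_derive _ _ f1).
have E1 : f (p (t * v.1 + u), t *: v.2 + w) - f (p u, t *: v.2 + w) =
   q * D1 (s *: (1, 0) + (p u, t *: v.2 + w)).
  rewrite -sE; congr (f _ - _).
  apply/pair_equal_spec; split => /=; first by rewrite [q *: 1]mulr1 /q subrK.
  by rewrite scaler0 add0r.
have -> : f (p (t * v.1 + u), t *: v.2 + w) - f (p u, w) -
   t * (v.1 * (dp * 'D_(1, 0) f (p u, w)) + 'D_(0, v.2) f (p u, w)) =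
  q * (D1 (s *: (1, 0) + (p u, t *: v.2 + w)) - D1 x0) +
  (q - t * v.1 * dp) * D1 x0 +
  (f (t *: (0, v.2) + x0) - f x0 - t * 'D_(0, v.2) f x0).
  rewrite mulrBr -E1 /D1 /x0.
  have -> : t *: ((0 : R), v.2) + (p u, w) = (p u, t *: v.2 + w).
    by apply/pair_equal_spec; split => //=; rewrite scaler0 add0r.
  ring.
rewrite (_ : e = e / 3 + e / 3 + e / 3); last by field.
rewrite (le_trans (ler_normD _ _))// [leRHS]mulrDl lerD//; last exact: Hr1.
rewrite (le_trans (ler_normD _ _))// [leRHS]mulrDl lerD//.
  have -> : e / 3 * `|t| = (K * `|t|) * (e / 3 / K) by field; rewrite gt_eqF.
  rewrite normrM ler_pM// distrC; apply: Hr2.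
  rewrite -ball_normE/= (_ : x0 - _ = (- s, - (t *: v.2))); last first.
    apply/pair_equal_spec; split => /=.
      by rewrite [s *: 1]mulr1 opprD addrCA subrr addr0.
    by rewrite scaler0 add0r opprD addrCA subrr addr0.
  rewrite prod_normE/= gt_max !normrN normrZ; apply/andP; split.
    have := normr_ge0 v.2; have := normr_ge0 t; nra.
  have := normr_ge0 v.2; have := normr_ge0 t; nra.
rewrite normrM (_ : e / 3 * `|t| = (e / 3 / C * `|t|) * C); last first.
  by field; rewrite gt_eqF.
rewrite ler_pM//; last by rewrite /C lerDl.
by rewrite (le_trans qE)// ler_wpM2r// /m ge_min lexx.
Qed.

End removable.

Lemma continuous_mkpair {R : realType} {T : topologicalType} {V V' : normedModType R}
  (f : T -> V) (g : T -> V') :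
  continuous f -> continuous g -> continuous (fun x => (f x, g x)).
Proof.
move=> cf cg x; apply: (@cvg_pair _ _ _ (nbhs x) (nbhs (f x)) (nbhs (g x))).
- exact: cf.
- exact: cg.
Qed.

Lemma continuous_app {T U V : topologicalType} (f : U -> V) (g : T -> U) :
  continuous f -> continuous g -> continuous (fun x => f (g x)).
Proof. by move=> cf cg x; exact: (continuous_comp (cg x) (cf _)). Qed.

(** * Integrated dilations of the first variable *)

Section dilation.
Context {R : realType} {W : normedModType R}.
Context d (T : measurableType d) (mu : {measure set T -> \bar R}) (D : set T).
Context (mD : measurable D).
Context (al : T -> R) (b : bool).
Context (mal : measurable_fun D al).
Context (bal : b \/ exists K, forall t, D t -> `|al t| <= K).

Definition dilate (c : T -> R) (f : R * W -> R) (x : R * W) : R :=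
  \int[mu]_(t in D) (c t * f (al t * x.1, x.2)).

Let L0 (x : R * W) : R * W := (0, x.2).
Let L1 (x : R * W) : R * W := (x.1, 0).

Let L0l : blin L0.
Proof. apply: blin_pair; [exact: blin_zero|exact/blin_snd/blin_id]. Qed.

Let L1l : blin L1.
Proof. apply: blin_pair; [exact/blin_fst/blin_id|exact: blin_zero]. Qed.

Let AE t x : (0 : R * W) + L0 x + al t *: L1 x = (al t * x.1, x.2).
Proof. by apply/pair_equal_spec; split => /=; rewrite ?scaler0 !add0r ?addr0. Qed.

Lemma dilateE c f : dilate c f = superpose mu D (fun=> 0) L0 L1 al c f.
Proof.
apply/funext => x; apply: eq_Rintegral => t _.
by rewrite -AE.
Qed.

Let mA (f : R * W -> R) : continuous f ->
  forall x, measurable_fun D (fun t => f (0 + L0 x + al t *: L1 x)).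
Proof.
move=> cf x; rewrite (_ : (fun _ => _) = (fun u => f (u * x.1, x.2)) \o al); last first.
  by apply/funext => t; rewrite AE.
have cg : continuous (fun u : R => ((u * x.1, x.2) : R * W)).
  apply: continuous_mkpair; last exact: cst_continuous.
  by move=> u; apply: cvgM; [exact: cvg_id|exact: cvg_cst].
have cfg := continuous_app cf cg.
exact: (measurableT_comp (continuous_measurable_fun cfg) mal).
Qed.

Let bA : b \/ exists K, forall t, D t -> `|0 : R * W| <= K /\ `|al t| <= K.
Proof.
case: bal => [->|[K HK]]; [by left|right].
exists K => t Dt; split; last exact: HK.
by rewrite normr0 (le_trans _ (HK _ Dt)).
Qed.

Lemma dilate_Ckb k c f : moments mu D al c -> Ckb b k f -> Ckb b k (dilate c f).
Proof. by move=> mc fk; rewrite dilateE; exact: superpose_Ckb. Qed.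

Lemma dilate_is_derive c (f : R * W -> R) (x v : R * W) : moments mu D al c -> Ckb b 1 f ->
  is_derive x v (dilate c f)
    (dilate c ('D_(0, v.2) f) x + dilate (fun t => c t * al t) ('D_(v.1, 0) f) x).
Proof.
move=> mc fk; rewrite !dilateE.
exact: (superpose_is_derive mD L0l L1l bA mA x v mc fk).
Qed.

Lemma dilate_integrable c (f : R * W -> R) (x : R * W) : mu.-integrable D (EFin \o c) -> Ckb b 0 f ->
  mu.-integrable D (EFin \o (fun t => c t * f (al t * x.1, x.2))).
Proof.
move=> ic fk; have := superpose_integrable mD L0l L1l bA mA x ic fk.
by apply: eq_integrable => // t _ /=; rewrite AE.
Qed.

End dilation.

Lemma Ckb_dir_scale {R : realType} {V : normedModType R} b k (f : V -> R) v (a : R) :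
  Ckb b k.+1 f -> 'D_(a *: v) f = (fun x => a * 'D_v f x).
Proof.
move=> fk; apply/funext => x.
by have [_ ->] := is_derive_dirZ a (Ckb_is_derive x v fk).
Qed.

Section inverse.
Context {R : realType} {V : normedModType R}.

Lemma CkbV b k (f : V -> R) (e : R) : 0 < e -> (forall x, e <= f x) ->
  Ckb b k f -> Ckb b k (fun x => (f x)^-1).
Proof.
move=> e0 fe; have f0 x : 0 < f x := lt_le_trans e0 (fe x).
have bd M : exists C, forall x, region b M x -> `|(f x)^-1| <= C.
  exists e^-1 => x _; rewrite gtr0_norm ?invr_gt0// lef_pV2 ?posrE//.
have cV : continuous f -> continuous (fun x => (f x)^-1).
  by move=> cf x; apply: cvgV; [rewrite gt_eqF|exact: cf].
elim: k => [|k IH] fk; first by split=> //; exact/cV/(Ckb_continuous fk).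
apply: CkbS => //; first exact/cV/(Ckb_continuous fk).
move=> v; exists (fun x => - ((f x)^-1 * (f x)^-1 * 'D_v f x)).
  apply/CkbN/CkbM; last exact: Ckb_derive.
  by apply: CkbM; apply: IH; exact: Ckb_pred.
move=> x; split; first by apply: derivableV; [rewrite gt_eqF|case: (Ckb_is_derive x v fk)].
rewrite deriveV ?gt_eqF//; last by case: (Ckb_is_derive x v fk).
by rewrite /GRing.scale/= expr2 invfM mulNr.
Qed.

End inverse.

(** * Cut-offs *)

Section flat_function.
Context {R : realType}.

(** The powers of 1/x are carried along because they make the family closed under differentiation:
    the derivative of [flat n] is a combination of [flat n.+1] and [flat n.+2]. *)
Definition flat (n : nat) (x : R) : R := if 0 < x then x^-1 ^+ n * expR (- x^-1) else 0.

(** With z = y / (n + 1), e^y is the (n + 1)-st power of e^z; n of its factors satisfy y <= (n + 1)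
    e^z and the last one is at least 1. *)
Lemma pow_expRN (n : nat) (y : R) : 0 <= y -> y ^+ n * expR (- y) <= n.+1%:R ^+ n.
Proof.
move=> y0; rewrite expRN ler_pdivrMr ?expR_gt0//.
have -> : expR y = expR (y / n.+1%:R) ^+ n.+1.
  by rewrite -expRM_natl; congr expR; field.
rewrite exprS mulrCA; apply: (@le_trans _ _ (n.+1%:R ^+ n * expR (y / n.+1%:R) ^+ n)).
  rewrite -exprMn; apply: lerXn2r; rewrite ?nnegrE// ?mulr_ge0// ?expR_ge0//.
  rewrite mulrC -ler_pdivrMr// (le_trans _ (expR_ge1Dx _))// lerDr//.
rewrite ler_peMl ?mulr_ge0 ?exprn_ge0 ?expR_ge0//.
by rewrite (le_trans _ (expR_ge1Dx _))// lerDl divr_ge0.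
Qed.

Lemma flat_ge0 n x : 0 <= flat n x.
Proof.
rewrite /flat; case: ifPn => // x0.
by rewrite mulr_ge0 ?expR_ge0// exprn_ge0// invr_ge0 ltW.
Qed.

Lemma flat_bound n x : `|flat n x| <= n.+1%:R ^+ n.
Proof.
rewrite ger0_norm ?flat_ge0// /flat; case: ifPn => [x0|_]; last exact: exprn_ge0.
by apply: pow_expRN; rewrite invr_ge0 ltW.
Qed.

Lemma flat_small n x : `|flat n x| <= n.+2%:R ^+ n.+1 * `|x|.
Proof.
rewrite {1}/flat; case: ifPn => [x0|_]; last by rewrite normr0 mulr_ge0.
have -> : x^-1 ^+ n * expR (- x^-1) = flat n.+1 x * x.
  by rewrite /flat x0 exprS; field; rewrite gt_eqF.
by rewrite normrM ler_wpM2r// flat_bound.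
Qed.

Lemma flat_is_derive_neq0 n (x : R) : x != 0 ->
  is_derive x 1 (flat n) (- n%:R * flat n.+1 x + flat n.+2 x).
Proof.
move=> xn0; have [x0|x0|] := ltgtP x 0; last by move/eqP; rewrite (negbTE xn0).
  rewrite /flat !ltNge !(ltW x0)/= mulr0 addr0.
  apply/is_deriveP => e e0; exists (- x); first by rewrite oppr_gt0.
  move=> h hx; have hx0 : h + x < 0 by move: hx; rewrite ltr_norml opprK => /andP[_]; lra.
  rewrite /flat [h *: 1]mulr1 !ltNge (ltW hx0) (ltW x0)/= mulr0 !subr0 normr0.
  by rewrite mulr_ge0// ltW.
pose g (y : R) := y^-1 ^+ n * expR (- y^-1).
have dg : is_derive x 1 g (- n%:R * flat n.+1 x + flat n.+2 x).
  have dV : is_derive x 1 (fun y : R => y^-1) (- x ^- 2).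
    apply: is_derive_eq; last exact: mulr1.
    by apply: (@is_deriveV _ id); rewrite ?gt_eqF.
  have dN : is_derive x 1 (fun y : R => - y^-1) (x ^- 2).
    by rewrite -[x ^- 2]opprK; exact: is_deriveN.
  have dE : is_derive x 1 (fun y : R => expR (- y^-1)) (expR (- x^-1) * x ^- 2).
    by apply: (@is_derive1_comp _ expR (fun y => - y^-1)); exact: is_derive_expR.
  have := is_deriveM (@is_deriveX _ _ _ n x 1 _ dV) dE.
  rewrite exprfctE mulrfctE => dM; apply: (is_derive_eq dM).
  rewrite /flat x0 /GRing.scale/=.
  case: (n) => [|m]; first by rewrite oppr0 !mul0r mulr0 expr0; field; rewrite gt_eqF.
  by rewrite /= !exprS; field; rewrite gt_eqF.
apply/is_deriveP => e e0; have /is_deriveP/(_ _ e0)[r r0 Hr] := dg.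
exists (Num.min r x); first by rewrite lt_min r0.
move=> h; rewrite lt_min => /andP[hr hx].
have hx0 : 0 < h + x by move: hx; rewrite ltr_norml => /andP[+ _]; lra.
have fg y : 0 < y -> flat n y = g y by move=> y0; rewrite /flat y0.
by have := Hr h hr; rewrite (fg _ x0) fg// [h *: 1]mulr1.
Qed.

Lemma flat_continuous n : continuous (flat n).
Proof.
move=> x; have [->|x0] := eqVneq x 0.
  apply/cvgrPdist_le => e e0; have n0 : 0 < n.+2%:R ^+ n.+1 :> R by rewrite exprn_gt0.
  apply/nbhs_ballP; exists (e / n.+2%:R ^+ n.+1); first exact: divr_gt0.
  move=> y; rewrite /ball/= sub0r normrN ltr_pdivlMr// => /ltW ye.
  rewrite {1}/flat ltxx sub0r normrN (le_trans (flat_small _ _))//.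
  by rewrite mulrC.
have [df _] := flat_is_derive_neq0 n x0.
exact/differentiable_continuous/derivable1_diffP.
Qed.

Lemma flat_is_derive n (x : R) : is_derive x 1 (flat n) (- n%:R * flat n.+1 x + flat n.+2 x).
Proof.
(* A dummy second coordinate brings the singular point 0 under [removable_derive]. *)
pose F (z : R * R) := flat n z.1.
pose H (z : R * R) := - n%:R * flat n.+1 z.1 + flat n.+2 z.1.
have fstl : blin (fun z : R * R => z.1) by exact/blin_fst/blin_id.
have inl : blin (fun u : R => (u, 0 : R)).
  by apply: blin_pair; [exact: blin_id|exact: blin_zero].
have c1 m : continuous (fun z : R * R => flat m z.1).
  by move=> z; apply: (@continuous_comp _ _ _ fst (flat m)); [exact: cvg_fst|exact: flat_continuous].
have cH : continuous H.
  move=> z; apply: cvgD; last exact: c1.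
  by apply: cvgM; [exact: cvg_cst|exact: c1].
have dF : forall z : R * R, is_derive z (1, 0) F (H z).
  apply: removable_derive => //; first exact: c1.
  move=> z z0; rewrite (_ : F = (fun y => flat n (0 + y.1))); last first.
    by apply/funext => y; rewrite add0r.
  apply: (@is_derive_comp_blin R _ _ (fun z : R * R => z.1) 0 (flat n)) => //=.
  by rewrite add0r; exact: flat_is_derive_neq0.
rewrite (_ : flat n = (fun u => F (0 + (u, 0)))); last first.
  by apply/funext => u; rewrite add0r.
apply: (@is_derive_comp_blin R _ _ (fun u : R => (u, 0 : R)) 0 F) => //=.
by rewrite add0r; exact: dF.
Qed.

Lemma flat_Ckb n k : Ckb true k (flat n).
Proof.
elim: k n => [|k IH] n.
  split=> //; first exact: flat_continuous.
  by move=> M; exists (n.+1%:R ^+ n) => x _; exact: flat_bound.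
apply: CkbS; first exact: flat_continuous.
  by move=> M; exists (n.+1%:R ^+ n) => x _; exact: flat_bound.
move=> v; exists (fun x => v * (- n%:R * flat n.+1 x + flat n.+2 x)).
  by apply/CkbZ/CkbD; [exact/CkbZ/IH|exact: IH].
move=> x; rewrite -{1}[v]mulr1; apply: is_derive_dirZ.
exact: flat_is_derive.
Qed.

Lemma flat_gt0 (x : R) : 0 < x -> 0 < flat 0 x.
Proof. by move=> x0; rewrite /flat x0 mulr_gt0 ?expR_gt0// exprn_gt0// invr_gt0. Qed.

Lemma flat0_homo x y : x <= y -> flat 0 x <= flat 0 y.
Proof.
rewrite /flat; case: ifPn => x0; last by move=> _; exact: (flat_ge0 0).
move=> xy; have y0 := lt_le_trans x0 xy; rewrite y0 !expr0 !mul1r.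
by rewrite ler_expR lerN2 lef_pV2.
Qed.

Definition hat (c d x : R) : R := flat 0 (d - (x - c)) * flat 0 (d + (x - c)).

Lemma hat_Ckb c d k : Ckb true k (hat c d).
Proof.
apply: CkbM.
  rewrite (_ : (fun _ => _) = (fun x => flat 0 ((d + c) + - x))); last first.
    by apply/funext => x; congr flat; ring.
  by apply: (@Ckb_comp_blin _ _ _ _ _ _ (fun x : R => - x)); [exact/blin_opp/blin_id|exact: flat_Ckb].
rewrite (_ : (fun _ => _) = (fun x => flat 0 ((d - c) + x))); last first.
  by apply/funext => x; congr flat; ring.
by apply: (@Ckb_comp_blin _ _ _ _ _ _ (fun x : R => x)); [exact/blin_id|exact: flat_Ckb].
Qed.

Lemma hat_supp c d x : d <= `|x - c| -> hat c d x = 0.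
Proof.
rewrite ler_normr /hat /flat => /orP[] h.
  by rewrite ifF ?mul0r//; apply/negbTE; rewrite -leNgt subr_le0.
by rewrite mulrC ifF ?mul0r//; apply/negbTE; rewrite -leNgt; lra.
Qed.

Lemma hat_tfun c d : tfun (hat c d).
Proof.
split; first by move=> k; exact: hat_Ckb.
exists (`|c| + d) => x cx; apply: hat_supp.
have : `|x| <= `|x - c| + `|c| by rewrite -{1}[x](subrK c) ler_normD.
lra.
Qed.

Lemma hat_ge0 c d x : 0 <= hat c d x.
Proof. by rewrite mulr_ge0// flat_ge0. Qed.

Lemma hat_gt0 c d x : `|x - c| < d -> 0 < hat c d x.
Proof.
rewrite ltr_norml => /andP[h1 h2].
by rewrite mulr_gt0// flat_gt0; lra.
Qed.

Definition cutoff (x : R) : R := flat 0 (x + 1) / (flat 0 (x + 1) + flat 0 (- x)).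

Lemma cutoff_Ckb k : Ckb true k cutoff.
Proof.
have f1 : Ckb true k (fun x : R => flat 0 (x + 1)).
  rewrite (_ : (fun _ => _) = (fun x => flat 0 (1 + x))); last first.
    by apply/funext => x; rewrite addrC.
  by apply: (@Ckb_comp_blin _ _ _ _ _ _ (fun x : R => x)); [exact/blin_id|exact: flat_Ckb].
have f2 : Ckb true k (fun x : R => flat 0 (- x)).
  by apply: (@Ckb_comp_lin _ _ _ _ _ (fun x : R => - x)); [exact/blin_opp/blin_id|exact: flat_Ckb].
apply: CkbM => //; apply: (@CkbV _ _ _ _ _ (flat 0 (2^-1 : R))).
- by apply: flat_gt0; lra.
(* One of x + 1 and - x is always at least 1/2, which keeps the denominator of [cutoff] away from
   0. *)
- move=> x; have [x0|x0] := leP (- 2^-1) x.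
    rewrite -[leLHS]addr0 lerD ?flat_ge0//; apply: flat0_homo; lra.
  by rewrite -[leLHS]add0r lerD ?flat_ge0//; apply: flat0_homo; lra.
- exact: CkbD.
Qed.

Lemma cutoff_eq1 (x : R) : 0 <= x -> cutoff x = 1.
Proof.
move=> x0; rewrite /cutoff {3}/flat ltNge oppr_le0 x0/= addr0 divff// gt_eqF//.
by apply: flat_gt0; lra.
Qed.

Lemma cutoff_eq0 (x : R) : x <= -1 -> cutoff x = 0.
Proof.
move=> x0; rewrite /cutoff {1}/flat ltNge (_ : x + 1 <= 0) ?mul0r//; lra.
Qed.

End flat_function.

(** * Whitney's theorem on even functions, by Seeley's reflection *)

Section counting_series.
Context {R : realType}.

Let cnt : {measure set nat -> \bar R} := @counting nat R.

Lemma nat_measurable_fun d (T : measurableType d) (D : set nat) (f : nat -> T) :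
  measurable_fun D f.
Proof. by []. Qed.

(** Seeley's series are read as integrals against the counting measure, so that the results on
    superpositions differentiate them term by term. *)
Lemma counting_integrable (a : nat -> R) (C : R) : (forall k, `|a k| <= C * 2^-1 ^+ k) ->
  cnt.-integrable setT (EFin \o a).
Proof.
move=> aC; have C0 : 0 <= C.
  by have := aC 0%N; rewrite expr0 mulr1; exact: le_trans.
apply: (@le_integrable _ _ _ cnt setT _ _ (EFin \o (fun k => C * 2^-1 ^+ k))) => //.
  move=> k _ /=; rewrite lee_fin [X in _ <= X]ger0_norm//.
  by rewrite mulr_ge0// exprn_ge0.
apply/integrableP; split => //.
rewrite ge0_integral_count//.
apply: (@le_lt_trans _ _ ((C * (1 - 2^-1)^-1)%:E)); last by rewrite ltry.
apply: lime_le; first by apply: is_cvg_nneseries => // n _ _; rewrite lee_fin.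
apply: nearW => n.
rewrite (eq_bigr (fun k => (C * 2^-1 ^+ k)%:E)); last first.
  by move=> k _ /=; rewrite ger0_norm// mulr_ge0// exprn_ge0.
rewrite sumEFin lee_fin; have := @geometric_le_lim R n C 2^-1 C0.
rewrite /series/= => -> //; rewrite gtr0_norm//; lra.
Qed.

(** Nonnegative series are limits of their partial sums; the general case is a = (a + |a|) - |a|. *)
Lemma counting_cvg (a : nat -> R) : cnt.-integrable setT (EFin \o a) ->
  (\sum_(0 <= k < n) a k) @[n --> \oo] --> \int[cnt]_k a k.
Proof.
have ge0case (b : nat -> R) : (forall k, 0 <= b k) -> cnt.-integrable setT (EFin \o b) ->
    (\sum_(0 <= k < n) b k) @[n --> \oo] --> \int[cnt]_k b k.
  move=> b0 ib; apply: (@fine_cvg _ _ _ _ (fun n => (\sum_(0 <= k < n) b k)%:E)); rewrite fineK; last exact: integrable_fin_num ib.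
  rewrite ge0_integral_count; last by move=> k; exact: b0.
  rewrite (_ : (fun n => (\sum_(0 <= k < n) b k)%:E) =
      (fun n => \sum_(0 <= k < n) (b k)%:E)%E); last first.
    by apply/funext => n; rewrite sumEFin.
  by apply: is_cvg_nneseries => n _ _; rewrite lee_fin.
move=> ia; have iab : cnt.-integrable setT (EFin \o (fun k => `|a k|)).
  exact: integrable_norm.
have iap : cnt.-integrable setT (EFin \o (fun k => a k + `|a k|)).
  by rewrite (_ : _ \o _ = (EFin \o a) \+ (EFin \o (fun k => `|a k|%R)))%E//; exact: integrableD.
have -> : \int[cnt]_k a k = \int[cnt]_k (a k + `|a k|) - \int[cnt]_k `|a k|.
  rewrite -(RintegralB measurableT iap iab).
  by apply: eq_Rintegral => k _; rewrite addrK.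
have c1 : (\sum_(0 <= k < n) (a k + `|a k|)) @[n --> \oo] --> \int[cnt]_k (a k + `|a k|).
  by apply: ge0case => // k; rewrite -lerBlDr sub0r lerNnormlW.
have c2 : (\sum_(0 <= k < n) `|a k|) @[n --> \oo] --> \int[cnt]_k `|a k|.
  exact: ge0case.
have -> : (fun n => \sum_(0 <= k < n) a k) =
    (fun n => \sum_(0 <= k < n) (a k + `|a k|) - \sum_(0 <= k < n) `|a k|).
  by apply/funext => n; rewrite -sumrB; apply: eq_bigr => k _; rewrite addrK.
exact: (cvgB c1 c2).
Qed.

End counting_series.

(** * Seeley's weights and their even moments *)

Section seeley_weights.
Context {R : realType}.

Let cnt : {measure set nat -> \bar R} := @counting nat R.

(* Theta-like weights e_j = 16^(-j(j+1)/2): the measure sum_(k in Z) (-1)^k 16^(-k(k-1)/2)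
   at the point 16^k has vanishing moments, so dividing it by (1 + x) yields moments
   proportional to (-1)^n.  The index k = j+1 >= 1 is coded by 2j+1, k = -j by 2j, and the
   nodes 4^k are the square roots of 16^k. *)
Let e (j : nat) : R := (4 ^+ (j * j.+1))^-1.

Definition seeley_node (k : nat) : R :=
  if odd k then 4 ^+ k./2.+1 else (4 ^+ k./2)^-1.

Definition seeley_weight (k : nat) : R :=
  if odd k then (-1) ^+ k./2.+1 * e k./2 / (1 + 16 ^+ k./2.+1)
  else (-1) ^+ k./2 * e k./2 / (1 + (16 ^+ k./2)^-1).

Let e_gt0 j : 0 < e j. Proof. by rewrite invr_gt0 exprn_gt0. Qed.

Let four_pow_half k : (4 ^+ k./2)^-1 <= 2 * 2^-1 ^+ k :> R.
Proof.
have E : (4 : R) ^+ k./2 = 2 ^+ (k./2.*2) by rewrite -muln2 mulnC exprM (_ : 2 ^+ 2 = 4)//; ring.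
rewrite E -{2}[k]odd_double_half exprD !exprVn mulrA ler_peMl ?invr_ge0 ?exprn_ge0//.
case: (odd k); rewrite ?expr1 ?expr0; lra.
Qed.

(** In exponents of 4 this is (j + 1) m + j <= j (j + 1) + m^2 + m, that is, j m <= j^2 + m^2. *)
Let e_bound m j : e j * (4 ^+ j.+1) ^+ m <= 4 ^+ (m * m + m) * (4 ^+ j)^-1.
Proof.
rewrite /e -exprM mulrC ler_pdivrMr ?exprn_gt0// mulrAC ler_pdivlMr ?exprn_gt0//.
by rewrite -!exprD ler_eXn2l ?ltr1n//; nia.
Qed.

Lemma seeley_bound m k : `|seeley_weight k * seeley_node k ^+ m| <=
  2 * 4 ^+ (m * m + m) * 2^-1 ^+ k.
Proof.
suff H : `|seeley_weight k * seeley_node k ^+ m| <= 4 ^+ (m * m + m) * (4 ^+ k./2)^-1.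
  apply: (le_trans H).
  by rewrite -mulrA [leRHS]mulrCA ler_wpM2l ?exprn_ge0// four_pow_half.
set j := k./2.
have num (s : nat) (x D : R) : 0 <= x -> 1 <= D -> `|(-1) ^+ s * e j / D * x| <= e j * x.
  move=> x0 D1; have D0 : 0 < D by apply: lt_le_trans D1.
  rewrite !normrM normrX normrN1 expr1n mul1r (ger0_norm x0) ger0_norm ?(ltW (e_gt0 _))//.
  rewrite ler_wpM2r// ler_piMr ?(ltW (e_gt0 _))// gtr0_norm ?invr_gt0//.
  by rewrite invf_le1.
rewrite /seeley_weight /seeley_node -/j; case: ifPn => _.
  apply: (le_trans (num _ _ _ _ _)); rewrite ?exprn_ge0// ?lerDl ?exprn_ge0//.
apply: (le_trans (num _ _ _ _ _)); rewrite ?exprn_ge0 ?invr_ge0 ?exprn_ge0// ?lerDl ?invr_ge0 ?exprn_ge0//.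
have a1 : 1 <= 4 ^+ j :> R by rewrite exprn_ege1// ler1n.
have a0 : 0 < 4 ^+ j :> R by rewrite exprn_gt0.
apply: (@le_trans _ _ ((4 ^+ j)^-1 * 1)).
  rewrite ler_pM ?invr_ge0 ?exprn_ge0 ?invr_ge0 ?exprn_ge0//.
    by rewrite lef_pV2 ?posrE ?exprn_gt0// ler_eXn2l ?ltr1n//; nia.
  by rewrite exprn_ile1 ?invr_ge0 ?invf_le1// ltW.
by rewrite mulr1 ler_peMl ?invr_ge0 ?exprn_ge0// exprn_ege1// ler1n.
Qed.

Lemma seeley_integrable m :
  cnt.-integrable setT (EFin \o (fun k => seeley_weight k * seeley_node k ^+ m)).
Proof. by apply: counting_integrable => k; exact: seeley_bound. Qed.

(** The contribution of the two points 16^(j+1) and 16^(-j) to the n-th moment of the measure before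
    its division by 1 + x. *)
Let U n j : R := (-1) ^+ j.+1 * e j * (16 ^+ j.+1) ^+ n + (-1) ^+ j * e j * ((16 ^+ j)^-1) ^+ n.

(** Adding two consecutive even moments produces the factor 1 + x, where x is the square of the
    node; it cancels the denominator of the weight. *)
Let moment_sum n N :
  \sum_(0 <= k < N.*2) (seeley_weight k * seeley_node k ^+ (n.*2) +
     seeley_weight k * seeley_node k ^+ (n.+1.*2)) = \sum_(0 <= j < N) U n j.
Proof.
elim: N => [|N IH]; first by rewrite !big_geq.
rewrite doubleS !big_nat_recr//= IH -addrA; congr (_ + _).
have sq16 i : (4 ^+ i) ^+ 2 = 16 ^+ i :> R.
  by rewrite -exprM mulnC exprM (_ : (4 : R) ^+ 2 = 16)//; ring.
rewrite /seeley_weight /seeley_node /= !odd_double/= uphalf_double !doubleK.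
rewrite -[n.*2]mul2n -[n.+1.*2]mul2n !exprM !exprVn !sq16 /U !exprS !exprVn.
have a0 : 1 + 16 * 16 ^+ N != 0 :> R by rewrite gt_eqF// addr_gt0// mulr_gt0// exprn_gt0.
have b0 : 1 + (16 ^+ N)^-1 != 0 :> R by rewrite gt_eqF// addr_gt0// invr_gt0 exprn_gt0.
have c0 : 16 ^+ N != 0 :> R by rewrite expf_neq0.
have b1 : 1 + 16 ^+ N != 0 :> R by rewrite gt_eqF// addr_gt0// exprn_gt0.
have d0 : (16 ^+ N) ^+ n != 0 :> R by rewrite !expf_neq0.
move: a0 b0 b1 c0 d0; set y := _ ^+ n; set z := 16 ^+ N; set x := (16 * z) ^+ n.
move=> a0 b0 b1 c0 d0; field.
by rewrite d0 a0 c0 (addrC z 1) b1.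
Qed.

(** The shift k -> k + 1 multiplies the full two-sided sum by -16^(n+1) when n becomes n + 1. On the
    symmetric window only the two boundary terms are left over. *)
Let U_rec n N : \sum_(0 <= j < N.+1) U n.+1 j =
  - 16 ^+ n.+1 * (\sum_(0 <= j < N.+1) U n j +
    (-1) ^+ N.+1 * (e N.+1 * ((16 ^+ N.+1)^-1) ^+ n - e N * (16 ^+ N.+1) ^+ n)).
Proof.
have eS j : e j.+1 = e j / (16 ^+ j.+1).
  rewrite /e -invfM -(_ : (4 : R) ^+ 2 = 16); last by ring.
  by rewrite -exprM -exprD; congr (_ ^+ _)^-1; lia.
have p0 i : 16 ^+ i != 0 :> R by rewrite expf_neq0.
elim: N => [|N IH].
  rewrite !big_nat1 /U eS /e mul0n !expr0 !invr1 !expr1n !expr1 !mulN1r !mulr1 !exprVn.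
  by rewrite !mul1r ?expr0 ?mulr1 [16 ^+ n.+1]exprS; field; rewrite p0.
rewrite big_nat_recr// IH [in RHS]big_nat_recr//= /U !eS.
rewrite !exprVn -!exprM !(mulnC _ n) !(mulnC _ n.+1) !exprM.
rewrite ![(_ ^+ n.+1) ^+ _]exprS.
rewrite !exprS !exprMn; field.
by rewrite !expf_neq0.
Qed.

Let e_cvg0 n : (e N * (16 ^+ N.+1) ^+ n) @[N --> \oo] --> 0.
Proof.
have q1 : `|4^-1| < 1 :> R by rewrite gtr0_norm// invf_lt1// ltr1n.
apply: (@squeeze_cvgr _ _ _ _ (fun=> 0) (fun N => 4 ^+ (n.*2 * n.*2 + n.*2) * 4^-1 ^+ N)).
- apply: nearW => N; apply/andP; split; first by rewrite mulr_ge0 ?exprn_ge0// ltW.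
  have -> : 16 ^+ N.+1 = (4 ^+ N.+1) ^+ 2 :> R.
    by rewrite -exprM mulnC exprM (_ : (4 : R) ^+ 2 = 16)//; ring.
  by rewrite -exprM mul2n exprVn; exact: e_bound.
- exact: cvg_cst.
- exact: cvg_geometric.
Qed.

(** For n = 0 the two points of each pair cancel; the recursion propagates this, because its
    boundary terms tend to 0 faster than any geometric growth in the nodes. *)
Let U_cvg0 n : (\sum_(0 <= j < N) U n j) @[N --> \oo] --> 0.
Proof.
elim: n => [|n IH].
  rewrite (_ : (fun N => _) = fun=> 0); first exact: cvg_cst.
  apply/funext => N; apply: big1 => j _.
  by rewrite /U !expr0 !mulr1 exprS mulN1r mulNr addNr.
rewrite -cvg_shiftS/=.
pose r N := (-1) ^+ N.+1 * (e N.+1 * ((16 ^+ N.+1)^-1) ^+ n - e N * (16 ^+ N.+1) ^+ n).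
have cr : r N @[N --> \oo] --> 0.
  apply: norm_cvg0; apply: (@squeeze_cvgr _ _ _ _ (fun=> 0)
    (fun N => e N.+1 * (16 ^+ N.+2) ^+ 0 + e N * (16 ^+ N.+1) ^+ n)).
  - apply: nearW => N; rewrite normr_ge0/= normrM normrX normrN1 expr1n mul1r.
    rewrite (le_trans (ler_normB _ _))// lerD//.
      rewrite expr0 normrM (gtr0_norm (e_gt0 _)) ler_wpM2l ?(ltW (e_gt0 _))//.
      rewrite ger0_norm ?exprn_ge0 ?invr_ge0 ?exprn_ge0//.
      by rewrite exprn_ile1 ?invr_ge0 ?exprn_ge0// invf_le1 ?exprn_gt0// exprn_ege1// ler1n.
    by rewrite ger0_norm// mulr_ge0 ?exprn_ge0// ltW.
  - exact: cvg_cst.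
  - rewrite -[X in _ --> X]addr0; apply: cvgD; last exact: e_cvg0.
    by have := e_cvg0 0; rewrite -cvg_shiftS.
have cS : (\sum_(0 <= j < N.+1) U n j) @[N --> \oo] --> 0.
  by have := IH; rewrite -cvg_shiftS.
have c0 : (fun _ : nat => - (16 : R) ^+ n.+1) N @[N --> \oo] --> - (16 : R) ^+ n.+1.
  exact: cvg_cst.
have cc := cvgM c0 (cvgD cS cr).
rewrite (_ : (fun N => \sum_(0 <= j < N.+1) U n.+1 j) =
  (fun N => - 16 ^+ n.+1 * (\sum_(0 <= j < N.+1) U n j + r N))); last first.
  by apply/funext => N; rewrite U_rec.
move: cc; rewrite addr0 mulr0 => cc; exact: cc.
Qed.

Let even_partial (u : nat -> R) (l : R) : u n @[n --> \oo] --> l ->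
  u n.*2 @[n --> \oo] --> l.
Proof.
move=> /cvgrPdist_lt H; apply/cvgrPdist_lt => eps /H[N _ HN].
exists N => // n /= Nn; apply: HN => /=.
by rewrite (leq_trans Nn)// -addnn leq_addr.
Qed.

Definition seeley_moment n := \int[cnt]_k (seeley_weight k * seeley_node k ^+ n.*2).

Lemma seeley_momentS n : seeley_moment n.+1 = - seeley_moment n.
Proof.
apply/eqP; rewrite -addr_eq0 addrC; apply/eqP.
have iD := integrableD measurableT (seeley_integrable n.*2) (seeley_integrable n.+1.*2).
rewrite /seeley_moment -(RintegralD measurableT (seeley_integrable n.*2) (seeley_integrable n.+1.*2)).
have /even_partial := counting_cvg iD.
under eq_fun do rewrite moment_sum.
by move=> /cvg_unique; apply => //; exact: U_cvg0.
Qed.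

Lemma seeley_momentE n : seeley_moment n = (-1) ^+ n * seeley_moment 0.
Proof.
elim: n => [|n IH]; first by rewrite expr0 mul1r.
by rewrite seeley_momentS IH exprS mulN1r mulNr.
Qed.

(** The weights are normalised through division by this moment. *)
Lemma seeley_moment0_gt0 : 0 < seeley_moment 0.
Proof.
have e16 j : e j <= (16 ^+ j)^-1.
  have -> : (16 : R) = 4 ^+ 2 by ring.
  by rewrite /e -exprM lef_pV2 ?posrE ?exprn_gt0// ler_eXn2l ?ltr1n//; nia.
(* The first pair gives 15/34 >= 1/3 + 1/15. Each later pair costs at most e_(N+1) <= 16^(-(N+1)),
   which is exactly the decrease of the second term. *)
have S N : 3^-1 + (16 ^+ N)^-1 / 15 <= \sum_(0 <= k < N.+1.*2) seeley_weight k * seeley_node k ^+ 0.*2.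
  elim: N => [|N IH].
    rewrite !big_nat_recr//= big_geq// /seeley_weight/= /e mul0n !expr0 !mulr1.
    rewrite [leRHS](_ : _ = 15 / 34); [lra|by rewrite !expr1; field].
  have w1 : seeley_weight N.+1.*2 = (-1) ^+ N.+1 * e N.+1 / (1 + (16 ^+ N.+1)^-1).
    by rewrite /seeley_weight odd_double doubleK.
  have w2 : seeley_weight N.+1.*2.+1 = (-1) ^+ N.+2 * e N.+1 / (1 + 16 ^+ N.+2).
    by rewrite /seeley_weight /= odd_double uphalf_double.
  rewrite doubleS; set M := N.+1.*2; set G := fun k : nat => _.
  rewrite (big_nat_recr _ _ _ (leq0n M.+1)) (big_nat_recr _ _ _ (leq0n M))/=.
  rewrite /G /M !expr0 !mulr1 w1 w2 -[X in _ <= X]addrA.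
  have E16 : (16 ^+ N.+1)^-1 = (16 ^+ N)^-1 / 16 :> R by rewrite exprS invfM mulrC.
  have pos (D : R) : 1 <= D -> 0 <= e N.+1 / D <= e N.+1.
    move=> D1; have D0 : 0 < D by apply: lt_le_trans D1.
    by rewrite divr_ge0 ?(ltW (e_gt0 _)) ?(ltW D0)//= ler_piMr ?(ltW (e_gt0 _))// invf_le1.
  have /andP[P1 P2] := pos (1 + 16 ^+ N.+2) ltac:(by rewrite lerDl exprn_ge0).
  have /andP[P3 P4] := pos (1 + (16 ^+ N.+1)^-1) ltac:(by rewrite lerDl invr_ge0 exprn_ge0).
  have := e16 N.+1; rewrite E16 => eN.
  have : - e N.+1 <= (-1) ^+ N.+1 * e N.+1 / (1 + (16 ^+ N.+1)^-1) +
      (-1) ^+ N.+2 * e N.+1 / (1 + 16 ^+ N.+2).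
    have [s1|s1] : (-1 : R) ^+ N.+1 = 1 \/ (-1 : R) ^+ N.+1 = -1.
      by rewrite -signr_odd; case: (odd _); [right; rewrite expr1|left; rewrite expr0].
    rewrite [(-1) ^+ N.+2]exprS s1 mulr1 !mul1r !mulN1r mulNr; lra.
    rewrite [(-1) ^+ N.+2]exprS s1 mulrN1 opprK !mul1r !mulN1r mulNr; lra.
  by move: IH; rewrite E16 /G /M; lra.
have /even_partial/cvgrPdist_lt/(_ 3^-1 ltac:(lra))[N _ /(_ N.+1 (leqnSn N))/=] :=
  counting_cvg (seeley_integrable 0.*2).
have := S N; have p0 : 0 <= (16 ^+ N)^-1 :> R by rewrite invr_ge0 exprn_ge0.
rewrite /seeley_moment ltr_norml => SN /andP[+ _]; lra.
Qed.

End seeley_weights.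

(* Seeley's weights: the functional g |-> sum_k a_k g(l_k x) mimics g(i x) on even Taylor
   jets. *)
Lemma seeley_sequence (R : realType) : exists a l : nat -> R,
  (forall m, (@counting nat R).-integrable setT (EFin \o (fun k => a k * l k ^+ m))) /\
  (forall n, \int[@counting nat R]_k (a k * l k ^+ n.*2) = (-1) ^+ n).
Proof.
exists (fun k => (seeley_moment 0)^-1 * seeley_weight k); exists seeley_node.
have m0 := @seeley_moment0_gt0 R.
split=> [m|n].
  rewrite (_ : _ \o _ = (fun k => ((seeley_moment 0)^-1)%:E *
      (seeley_weight k * seeley_node k ^+ m)%:E)%E).
    exact/integrableZl/seeley_integrable.
  by apply/funext => k /=; rewrite -EFinM mulrA.
under eq_Rintegral do rewrite -mulrA.
rewrite RintegralZl//; last exact: seeley_integrable.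
rewrite -/(seeley_moment n) (seeley_momentE n) mulrCA mulVf ?mulr1//.
by rewrite gt_eqF.
Qed.

(** * Hadamard's lemma and derivatives of even functions *)

Section hadamard.
Context {R : realType} {W : normedModType R}.
Implicit Types (f : R * W -> R) (x : R * W).

Definition had (f : R * W -> R) : R * W -> R :=
  dilate (@lebesgue_measure R) `[0, 1]%classic (fun t : R => t) (fun=> 1) f.

Lemma had_moments : moments (@lebesgue_measure R) `[0, 1]%classic (fun t : R => t) (fun=> 1).
Proof.
move=> m; apply: continuous_compact_integrable; first exact: segment_compact.
apply: continuous_subspaceT => x; apply: cvgM; first exact: cvg_cst.
exact: exprn_continuous.
Qed.

Lemma had_Ckb b k f : Ckb b k f -> Ckb b k (had f).
Proof.
apply: dilate_Ckb => //.
- by right; exists 1 => t /=; rewrite in_itv/= => /andP[t0 t1]; rewrite ger0_norm.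
- exact: had_moments.
Qed.

Lemma hadamard b f x : Ckb b 1 f ->
  f x - f (0, x.2) = x.1 * had ('D_(1, 0) f) x.
Proof.
move=> f1; have f0 : Ckb b 0 ('D_(1, 0) f) := Ckb_derive _ f1.
pose L (t : R) : R * W := (t * x.1, 0).
have Ll : blin L.
  by apply: blin_pair; [rewrite /= ; under eq_fun do rewrite mulrC; exact/blin_mul/blin_id|exact: blin_zero].
pose F (t : R) := f ((0, x.2) + L t).
have FE t : F t = f (t * x.1, x.2).
  by rewrite /F; congr f; apply/pair_equal_spec; split => /=; rewrite ?add0r ?addr0.
have dF (t : R) : is_derive t 1 F (x.1 * 'D_(1, 0) f (t * x.1, x.2)).
  apply: (@is_derive_comp_blin _ _ _ L (0, x.2) f) => //.
  have -> : L 1 = x.1 *: (1, 0).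
    by apply/pair_equal_spec; split => /=; rewrite ?scaler0// mul1r [_ *: 1]mulr1.
  have -> : (0, x.2) + L t = (t * x.1, x.2).
    by apply/pair_equal_spec; split => /=; rewrite ?add0r ?addr0.
  exact: is_derive_dirZ (Ckb_is_derive _ _ f1).
have cF : continuous F.
  by move=> t; case: (dF t) => dt _; exact/differentiable_continuous/derivable1_diffP.
have cL : continuous (fun t : R => (t * x.1, x.2) : R * W).
  apply: continuous_mkpair; last exact: cst_continuous.
  by move=> u; apply: cvgM; [exact: cvg_id|exact: cvg_cst].
have cdF : continuous (fun t : R => x.1 * 'D_(1, 0) f (t * x.1, x.2)).
  move=> t; apply: cvgM; first exact: cvg_cst.
  exact: (continuous_app (Ckb_continuous f0) cL).
have ftc : (\int[@lebesgue_measure R]_(t in `[0%R, 1%R]) (x.1 * 'D_(1, 0) f (t * x.1, x.2))%:E =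
    (F 1)%:E - (F 0)%:E)%E.
  apply: continuous_FTC2 => //.
  - exact: continuous_subspaceT.
  - split; first by move=> t _; case: (dF t).
      by apply: cvg_at_right_filter; exact: cF.
    by apply: cvg_at_left_filter; exact: cF.
  - by move=> t _; rewrite derive1E; case: (dF t).
have -> : f x - f (0, x.2) = F 1 - F 0.
  by rewrite !FE mul1r mul0r -surjective_pairing.
rewrite /had /dilate; under eq_Rintegral do rewrite mul1r.
rewrite -RintegralZl//.
  by rewrite /Rintegral ftc.
apply: continuous_compact_integrable; first exact: segment_compact.
apply: continuous_subspaceT.
exact: (continuous_app (Ckb_continuous f0) cL).
Qed.

Definition even1 f := forall x, f (- x.1, x.2) = f x.

Lemma even1_derive1 b f x : even1 f -> Ckb b 1 f ->
  'D_(1, 0) f (- x.1, x.2) = - 'D_(1, 0) f x.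
Proof.
move=> ef f1; pose r (x : R * W) : R * W := (- x.1, x.2).
have rl : blin r by apply: blin_pair; [exact/blin_opp/blin_fst/blin_id|exact/blin_snd/blin_id].
have d1 : is_derive x (1, 0) f (- 'D_(1, 0) f (r x)).
  rewrite {1}(_ : f = fun x => f (0 + r x)); last first.
    by apply/funext => y; rewrite add0r ef.
  apply: is_derive_comp_blin => //; rewrite add0r.
  have -> : r (1, 0) = -1 *: (1, 0).
    by apply/pair_equal_spec; split => /=; rewrite ?scaler0// [_ *: 1]mulr1.
  rewrite -[X in is_derive _ _ _ X]mulN1r; apply: is_derive_dirZ; exact: Ckb_is_derive f1.
by have [_ ->] := d1; rewrite opprK.
Qed.

Lemma even1_derive1_0 b f w : even1 f -> Ckb b 1 f -> 'D_(1, 0) f (0, w) = 0.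
Proof.
move=> ef f1; have := even1_derive1 (0, w) ef f1; rewrite /= oppr0.
lra.
Qed.

Lemma even1_derive2 b f : even1 f -> Ckb b 2 f -> even1 ('D_(1, 0) ('D_(1, 0) f)).
Proof.
move=> ef f2 x; have f1 : Ckb b 1 ('D_(1, 0) f) := Ckb_derive _ f2.
pose r (x : R * W) : R * W := (- x.1, x.2).
have rl : blin r by apply: blin_pair; [exact/blin_opp/blin_fst/blin_id|exact/blin_snd/blin_id].
have d1 : is_derive x (1, 0) (fun y => 'D_(1, 0) f (0 + r y)) (-1 * 'D_(1, 0) ('D_(1, 0) f) (r x)).
  apply: (@is_derive_comp_blin _ _ _ r 0 ('D_(1, 0) f)) => //; rewrite add0r.
  have -> : r (1, 0) = -1 *: (1, 0).
    by apply/pair_equal_spec; split => /=; rewrite ?scaler0// [_ *: 1]mulr1.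
  apply: is_derive_dirZ; exact: Ckb_is_derive f1.
have d2 : is_derive x (1, 0) (fun y => 'D_(1, 0) f (0 + r y)) (- 'D_(1, 0) ('D_(1, 0) f) x).
  rewrite (_ : (fun _ => _) = (fun y => - 'D_(1, 0) f y)); last first.
    by apply/funext => y; rewrite add0r (even1_derive1 _ ef (Ckb_pred f2)).
  by apply: is_deriveN; exact: Ckb_is_derive f1.
have := is_derive_unique d1 d2; rewrite mulN1r => /oppr_inj //.
Qed.

Lemma even1_deriveW b f w : even1 f -> Ckb b 1 f -> even1 ('D_(0, w) f).
Proof.
move=> ef f1 x; pose r (x : R * W) : R * W := (- x.1, x.2).
have rl : blin r by apply: blin_pair; [exact/blin_opp/blin_fst/blin_id|exact/blin_snd/blin_id].
have d1 : is_derive x (0, w) f ('D_(0, w) f (r x)).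
  rewrite {1}(_ : f = fun x => f (0 + r x)); last first.
    by apply/funext => y; rewrite add0r ef.
  apply: is_derive_comp_blin => //; rewrite add0r.
  have -> : r (0, w) = (0, w) by rewrite /r/= oppr0.
  exact: Ckb_is_derive f1.
by have [_ ->] := d1.
Qed.

Lemma even1_had f : even1 f -> even1 (had f).
Proof.
move=> ef x; apply: eq_Rintegral => t _ /=.
by rewrite mulrN; have /= -> := ef (t * x.1, x.2).
Qed.

End hadamard.

(** * An even function as a smooth function of the square, with the reflected part on u < 0 *)

Section whitney.
Context {R : realType} {W : normedModType R}.
Implicit Types (f : R * W -> R) (x : R * W) (a : nat -> R).
Context (l : nat -> R).

Let cnt : {measure set nat -> \bar R} := @counting nat R.

Local Notation S := (dilate cnt setT l).

Let weights a := moments cnt setT l a /\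
  forall n, \int[cnt]_k (a k * l k ^+ n.*2) = (-1) ^+ n.

(** Differentiation of [glue] in u replaces the weights a by - a l^2; these have the same even
    moments, so the induction can go on. *)
Let weightsS a : weights a -> weights (fun k => - (a k * l k ^+ 2)).
Proof.
move=> [ma ia]; split=> [m|n].
  have := integrableN (ma m.+2); apply: eq_integrable => // k _ /=.
  by rewrite !exprS expr0; congr EFin; ring.
transitivity (\int[cnt]_k (-1 * (a k * l k ^+ n.+1.*2))).
  by apply: eq_Rintegral => k _; rewrite doubleS !exprS expr0; ring.
by rewrite (RintegralZl _ measurableT (ma _)) ia exprS !mulN1r opprK.
Qed.

Let mS d (T : measurableType d) (g : nat -> T) : measurable_fun setT g.
Proof. exact: nat_measurable_fun. Qed.

Let S_Ckb k a f : moments cnt setT l a -> Ckb true k f -> Ckb true k (S a f).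
Proof. by move=> ma fk; apply: dilate_Ckb => //; left. Qed.

Let D00 f : 'D_(0, 0) f = fun=> 0.
Proof. by apply/funext => x; exact: derive0. Qed.

Let S0 a x : S a (fun=> 0) x = 0.
Proof.
rewrite /dilate; under eq_Rintegral do rewrite mulr0.
by rewrite Rintegral_cst// mul0r.
Qed.

Let S_deriveW a f w x : moments cnt setT l a -> Ckb true 1 f ->
  'D_(0, w) (S a f) x = S a ('D_(0, w) f) x.
Proof.
move=> ma f1.
have [_ ->] := dilate_is_derive measurableT (mS l) (or_introl erefl) x (0, w) ma f1.
have D0 : 'D_(((0 : R), w).1, 0) f = fun=> 0 := D00 f.
by rewrite D0 [X in _ + X]S0 addr0.
Qed.

Let S_derive1 a f x : moments cnt setT l a -> Ckb true 1 f ->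
  'D_(1, 0) (S a f) x = S (fun k => a k * l k) ('D_(1, 0) f) x.
Proof.
move=> ma f1.
have [_ ->] := dilate_is_derive measurableT (mS l) (or_introl erefl) x (1, 0) ma f1.
have D0 : 'D_(0, ((1 : R), (0 : W)).2) f = fun=> 0 := D00 f.
by rewrite D0 [X in X + _]S0 add0r.
Qed.

Let S_at0 a f w : weights a -> S a f (0, w) = f (0, w).
Proof.
move=> [ma /(_ 0%N) i0]; rewrite /dilate/=.
under eq_Rintegral do rewrite mulr0.
rewrite (RintegralZr _ measurableT (moments_integrable measurableT ma)).
move: i0; under eq_Rintegral do rewrite expr0 mulr1.
by move=> ->; rewrite expr0 mul1r.
Qed.

(** [Num.sqrt] is 0 on negative numbers and, for Seeley weights, S a f agrees with f at x.1 = 0. So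
    one of the first two terms always cancels the last: with u = x.1 this is f(sqrt u) for u >= 0
    and S a f (sqrt (- u)) for u <= 0, where S a f stands for f on the imaginary axis. *)
Let glue a f x := f (Num.sqrt x.1, x.2) + S a f (Num.sqrt (- x.1), x.2) - f (0, x.2).

Let glue_bounded a f M : moments cnt setT l a -> Ckb true 0 f ->
  exists C, forall x, region true M x -> `|glue a f x| <= C.
Proof.
move=> ma f0; have [C HC] := Ckb_bounded f0 0.
have S0' : Ckb true 0 (S a f) by exact: S_Ckb.
have [D HD] := Ckb_bounded S0' 0.
exists (C + D + C) => x _; rewrite /glue.
by rewrite (le_trans (ler_normB _ _))// lerD ?HC// (le_trans (ler_normD _ _))// lerD ?HC ?HD.
Qed.

Let glue_continuous a f : moments cnt setT l a -> Ckb true 0 f ->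
  continuous (glue a f).
Proof.
move=> ma f0 x; have cf := Ckb_continuous f0; have cS := Ckb_continuous (S_Ckb ma f0).
have c1 : continuous (fun x : R * W => x.1) by move=> y; exact: cvg_fst.
have c2 : continuous (fun x : R * W => x.2) by move=> y; exact: cvg_snd.
have c1N : continuous (fun x : R * W => - x.1) by move=> y; apply: cvgN; exact: c1.
have cs : continuous (fun x : R * W => Num.sqrt x.1) by exact: continuous_app (@sqrt_continuous R) c1.
have csN : continuous (fun x : R * W => Num.sqrt (- x.1)) by exact: continuous_app (@sqrt_continuous R) c1N.
apply: cvgB; first apply: cvgD.
- exact: (continuous_app cf (continuous_mkpair cs c2)).
- exact: (continuous_app cS (continuous_mkpair csN c2)).
- by apply: (continuous_app cf (continuous_mkpair (@cst_continuous _ _ (0 : R)) c2)).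
Qed.

(** For even f this is f'(x) / (2 x), the derivative of u -> f(sqrt u) at u = x^2, written without a
    division. *)
Let half_had f := fun x => 2^-1 * had ('D_(1, 0) ('D_(1, 0) f)) x.

Let half_hadE f x : even1 f -> Ckb true 2 f ->
  'D_(1, 0) f x = 2 * x.1 * half_had f x.
Proof.
move=> ef f2; have f1 : Ckb true 1 ('D_(1, 0) f) := Ckb_derive _ f2.
have := hadamard x f1.
rewrite (even1_derive1_0 x.2 ef (Ckb_pred f2)) subr0 => ->.
by rewrite /half_had; field.
Qed.

Let is_derive_sqrt_neg (u : R) : u < 0 -> is_derive u 1 (@Num.sqrt R) 0.
Proof.
move=> u0; apply/is_deriveP => e e0; exists (- u); first by rewrite oppr_gt0.
move=> h hu; have hu0 : h + u < 0 by move: hu; rewrite ltr_norml opprK => /andP[_]; lra.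
rewrite [h *: 1]mulr1 (ler0_sqrtr (ltW hu0)) (ler0_sqrtr (ltW u0)) mulr0 !subr0 normr0.
by rewrite mulr_ge0// ltW.
Qed.

Let is_derive_sqrtN (u d : R) : is_derive (- u) 1 (@Num.sqrt R) d ->
  is_derive u 1 (fun u : R => Num.sqrt (- u)) (- d).
Proof.
move=> du; have dN : is_derive u 1 (fun u : R => - u) (-1) by exact: is_deriveNid.
have := is_derive1_comp du dN; rewrite mulrN1; exact.
Qed.

(** The derivative in u is again a [glue], for f'(x) / (2 x) and the weights - a l^2. Both sides of
    u = 0 give the same formula, whose continuity is already known. *)
Let glue_derive a f x v : weights a -> smoothb true f -> even1 f -> x.1 != 0 ->
  is_derive x v (glue a f)
   (v.1 * glue (fun k => - (a k * l k ^+ 2)) (half_had f) x + glue a ('D_(0, v.2) f) x).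
Proof.
move=> wa sf ef x0; have [ma _] := wa.
have wa' := weightsS wa; have [ma' _] := wa'.
have f1 := sf 1%N; have f2 := sf 2%N.
have S1 := S_Ckb ma f1.
have F0 : Ckb true 0 (half_had f).
  by apply: CkbZ; apply: had_Ckb; exact: Ckb_derive (Ckb_derive _ f2).
have dC : is_derive x v (fun x => f (0, x.2)) ('D_(0, v.2) f (0, x.2)).
  pose L (x : R * W) : R * W := (0, x.2).
  have Ll : blin L by apply: blin_pair; [exact: blin_zero|exact/blin_snd/blin_id].
  rewrite (_ : (fun _ => _) = fun x => f (0 + L x)); last by apply/funext => y; rewrite add0r.
  apply: is_derive_comp_blin => //; rewrite add0r; exact: Ckb_is_derive f1.
case: x x0 dC => u w /= u0 dC.
have [su [sNu [d1 d2 d1E]]] : exists su sNu : R, [/\ is_derive u 1 (@Num.sqrt R) su,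
    is_derive u 1 (fun u : R => Num.sqrt (- u)) sNu &
    su * 'D_(1, 0) f (Num.sqrt u, w) +
    sNu * 'D_(1, 0) (S a f) (Num.sqrt (- u), w) =
    glue (fun k => - (a k * l k ^+ 2)) (half_had f) (u, w)].
  have SE : 'D_(1, 0) (S a f) (Num.sqrt (- u), w) =
      S (fun k => a k * l k) ('D_(1, 0) f) (Num.sqrt (- u), w).
    exact: S_derive1.
  have [un|up|ue] := ltgtP u 0; last by move/eqP: ue; rewrite (negbTE u0).
    exists 0, (- (2 * Num.sqrt (- u))^-1); split.
    - exact: is_derive_sqrt_neg.
    - by apply: is_derive_sqrtN; apply: is_derive1_sqrt; rewrite oppr_gt0.
    - rewrite SE /glue/= (ler0_sqrtr (ltW un)) mul0r add0r [half_had f _ + _]addrC addrK.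
      set y := Num.sqrt (- u); have y0 : 0 < y by rewrite sqrtr_gt0 oppr_gt0.
      (* Differentiating f (l y) gives one factor l, and f' (l y) = 2 l y [half_had] f (l y) gives
         the second. *)
      have -> : S (fun k => a k * l k) ('D_(1, 0) f) (y, w) =
          - 2 * y * S (fun k => - (a k * l k ^+ 2)) (half_had f) (y, w).
        rewrite /dilate -RintegralZl//; last first.
          exact: (dilate_integrable measurableT (mS l) (or_introl erefl) (y, w)
            (moments_integrable measurableT ma') F0).
        apply: eq_Rintegral => k _ /=.
        by rewrite half_hadE//=; ring.
      by field; rewrite gt_eqF.
  exists (2 * Num.sqrt u)^-1, (- 0); split.
  - exact: is_derive1_sqrt.
  - by apply: is_derive_sqrtN; apply: is_derive_sqrt_neg; rewrite oppr_lt0.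
  - have Nu0 : - u <= 0 by rewrite oppr_le0 ltW.
    rewrite SE /glue/= (ler0_sqrtr Nu0) oppr0 mul0r addr0 S_at0// addrK half_hadE//=.
    by field; rewrite gt_eqF// sqrtr_gt0.
have dA := is_derive_curve w v f1 d1.
have dB := is_derive_curve w v S1 d2.
have := is_deriveB (is_deriveD dA dB) dC.
move=> H; apply: (is_derive_eq H).
rewrite -d1E S_deriveW// /glue/=; ring.
Qed.

Let glue_Ckb k a f : weights a -> smoothb true f -> even1 f -> Ckb true k (glue a f).
Proof.
elim: k a f => [|k IH] a f wa sf ef; have [ma _] := wa.
  split=> //; first exact: glue_continuous.
  by move=> M; exact: glue_bounded.
have wa' := weightsS wa.
have sF : smoothb true (half_had f).
  by move=> n; apply: CkbZ; apply: had_Ckb; exact: Ckb_derive (Ckb_derive _ (sf n.+2)).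
have eF : even1 (half_had f).
  by move=> x; rewrite /half_had (even1_had (even1_derive2 ef (sf 2%N))).
apply: CkbS.
- exact: glue_continuous.
- by move=> M; exact: glue_bounded.
- move=> v.
  have dv n : Ckb true n ('D_(0, v.2) f) by exact: Ckb_derive (sf n.+1).
  have gk : Ckb true k (fun x => v.1 * glue (fun k => - (a k * l k ^+ 2)) (half_had f) x +
      glue a ('D_(0, v.2) f) x).
    apply: CkbD; first by apply: CkbZ; exact: IH.
    by apply: IH => //; exact: even1_deriveW (sf 1%N).
  exists (fun x => v.1 * glue (fun k => - (a k * l k ^+ 2)) (half_had f) x +
      glue a ('D_(0, v.2) f) x) => //.
  apply: removable_derive.
  + exact: glue_continuous.
  + exact: Ckb_continuous gk.
  + by move=> x x0; exact: glue_derive.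
Qed.

Lemma whitney_even_weights a f : weights a -> tfun f -> even1 f ->
  exists2 g : R * W -> R, tfun g & forall x, f x = g (x.1 ^+ 2, x.2).
Proof.
move=> wa [sf [M HM]] ef.
(* The nodes may be arbitrarily small, so the reflected part need not have bounded support; the
   cut-off removes u <= -1 and is 1 on the range u >= 0 of squares. *)
exists (fun x => cutoff x.1 * glue a f x); last first.
  move=> [x w] /=; rewrite cutoff_eq1 ?sqr_ge0// mul1r /glue/=.
  rewrite (ler0_sqrtr (_ : - x ^+ 2 <= 0)) ?oppr_le0 ?sqr_ge0// S_at0// addrK.
  rewrite sqrtr_sqr; have [x0|x0] := ger0P x; first by [].
  by rewrite -(ef (x, w)).
split.
  move=> k; apply: CkbM; last exact: glue_Ckb.
  apply: (@Ckb_comp_lin _ _ _ _ _ (fun x : R * W => x.1)); first exact/blin_fst/blin_id.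
  exact: cutoff_Ckb.
(* |M| serves w, M^2 serves u = x^2, and 1 covers the transition zone -1 < u < 0 of the cut-off. *)
exists (`|M| + M ^+ 2 + 1) => -[u w] uwM.
have [Mw|wM] := ltP M `|w|.
  have z t : f (t, w) = 0 by apply: HM; rewrite prod_normE lt_max Mw orbT.
  have -> : glue a f (u, w) = 0; last by rewrite mulr0.
  rewrite /glue /= !z subr0 add0r /dilate; under eq_Rintegral do rewrite z mulr0.
  by rewrite Rintegral_cst// mul0r.
have M0 : 0 <= M := le_trans (normr_ge0 w) wM.
have M2 := sqr_ge0 M.
move: uwM; rewrite prod_normE/= lt_max (ger0_norm M0) => /orP[uM|]; last lra.
have [uN|u1] := leP u (-1); first by rewrite cutoff_eq0// mul0r.
have u0 : 0 <= u by move: uM; rewrite ltr_normr => /orP[]; lra.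
rewrite (ger0_norm u0) in uM.
have uN : - u <= 0 by rewrite oppr_le0.
rewrite /glue/= (ler0_sqrtr uN) S_at0// addrK HM ?mulr0//.
rewrite prod_normE/= lt_max ger0_norm ?sqrtr_ge0//.
have : M < Num.sqrt u; last by move=> ->.
by rewrite -[M]ger0_norm// -sqrtr_sqr ltr_sqrt; lra.
Qed.

End whitney.

Theorem whitney_even (R : realType) (W : normedModType R) (f : R * W -> R) :
  tfun f -> (forall x w, f (- x, w) = f (x, w)) ->
  exists2 g : R * W -> R, tfun g & forall x w, f (x, w) = g (x ^+ 2, w).
Proof.
move=> tf ef; have [a [l [ma ia]]] := seeley_sequence R.
have [|g tg gE] := @whitney_even_weights R W l a f (conj ma ia) tf.
  by move=> [x w]; exact: ef.
by exists g => // x w; exact: gE.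
Qed.

(** * Dilations integrated over a compact interval *)

Section interval_dilation.
Context {R : realType} {W : normedModType R}.
Context (a b : R) (al : R -> R).
Context (cal : continuous al).
Implicit Types (f : R * W -> R) (c : R -> R) (x v : R * W).

Local Notation leb := (@lebesgue_measure R).

Definition idil c f : R * W -> R := dilate leb `[a, b]%classic al c f.

Lemma itv_continuous_integrable c : continuous c ->
  leb.-integrable `[a, b]%classic (EFin \o c).
Proof.
move=> cc; apply: continuous_compact_integrable; first exact: segment_compact.
exact: continuous_subspaceT.
Qed.

Lemma itv_moments c : continuous c -> moments leb `[a, b]%classic al c.
Proof.
move=> cc m; apply: itv_continuous_integrable => x; apply: cvgM; first exact: cc.
exact: (continuous_app (@exprn_continuous R m) cal).
Qed.

Lemma itv_bounded (c : R -> R) : continuous c ->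
  exists K, forall t, `[a, b]%classic t -> `|c t| <= K.
Proof.
move=> cc; have [ab|ba] := leP a b; last first.
  exists 0 => t /=; rewrite in_itv/= => /andP[at_ tb].
  by have := le_trans at_ tb; rewrite leNgt ba.
have cn : {within `[a, b], continuous (fun t => `|c t|)}.
  apply: continuous_subspaceT => t; apply: (@cvg_norm _ _ _ (nbhs t)); exact: cc.
have [t _ Ht] := EVT_max ab cn.
by exists `|c t| => s sab; apply: Ht.
Qed.

Let mal : measurable_fun `[a, b]%classic al.
Proof. by apply: measurable_funTS; exact: continuous_measurable_fun. Qed.

Lemma idil_Ckb bb k c f : continuous c -> Ckb bb k f -> Ckb bb k (idil c f).
Proof.
move=> cc; apply: dilate_Ckb => //; first by right; exact: itv_bounded.
exact: itv_moments.
Qed.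

Lemma idil_is_derive bb c f x v : continuous c -> Ckb bb 1 f ->
  is_derive x v (idil c f)
    (v.1 * idil (fun t => c t * al t) ('D_(1, 0) f) x + idil c ('D_(0, v.2) f) x).
Proof.
move=> cc f1.
have mI : measurable (`[a, b]%classic : set (measurableTypeR R)) by exact: measurable_itv.
have ba : bb \/ exists K, forall t, `[a, b]%classic t -> `|al t| <= K.
  by right; exact: itv_bounded.
have H := dilate_is_derive mI mal ba x v (itv_moments cc) f1.
apply: (is_derive_eq H); rewrite addrC; congr (_ + _).
have f0 : Ckb bb 0 ('D_(1, 0) f) := Ckb_derive _ f1.
rewrite /idil /dilate -(RintegralZl _ mI); last first.
  apply: (dilate_integrable mI mal ba x _ f0); apply: itv_continuous_integrable => t.
  by apply: cvgM; [exact: cc|exact: cal].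
apply: eq_Rintegral => t _; rewrite mulrCA; congr (_ * _).
have -> : (v.1, 0) = v.1 *: ((1 : R), (0 : W)).
  by apply/pair_equal_spec; split => /=; rewrite ?scaler0// [_ *: 1]mulr1.
by have [_ ->] := is_derive_dirZ v.1 (Ckb_is_derive (al t * x.1, x.2) (1, 0) f1).
Qed.

Lemma idil_integrable bb c f x : continuous c -> Ckb bb 0 f ->
  leb.-integrable `[a, b]%classic (EFin \o (fun t => c t * f (al t * x.1, x.2))).
Proof.
move=> cc f0.
have mI : measurable (`[a, b]%classic : set (measurableTypeR R)) by exact: measurable_itv.
have ba : bb \/ exists K, forall t, `[a, b]%classic t -> `|al t| <= K.
  by right; exact: itv_bounded.
exact: (dilate_integrable mI mal ba x (itv_continuous_integrable cc) f0).
Qed.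

Let mI : measurable (`[a, b]%classic : set (measurableTypeR R)).
Proof. exact: measurable_itv. Qed.

Lemma idilD bb c c' f x : continuous c -> continuous c' -> Ckb bb 0 f ->
  idil (fun t => c t + c' t) f x = idil c f x + idil c' f x.
Proof.
move=> cc cc' f0; rewrite /idil /dilate.
rewrite -(RintegralD mI (idil_integrable x cc f0) (idil_integrable x cc' f0)).
by apply: eq_Rintegral => t _; rewrite mulrDl.
Qed.

Lemma idilZ bb (k : R) c f x : continuous c -> Ckb bb 0 f ->
  idil (fun t => k * c t) f x = k * idil c f x.
Proof.
move=> cc f0; rewrite /idil /dilate -(RintegralZl k mI (idil_integrable x cc f0)).
by apply: eq_Rintegral => t _; rewrite mulrA.
Qed.

Lemma idil_bound bb c f x K : a <= b -> continuous c -> Ckb bb 0 f ->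
  (forall t, `[a, b]%classic t -> `|c t * f (al t * x.1, x.2)| <= K) ->
  `|idil c f x| <= K * (b - a).
Proof.
move=> ab cc f0 HK; have ic := idil_integrable x cc f0.
apply: le_trans (le_normr_Rintegral mI ic) _.
have iK : leb.-integrable `[a, b]%classic (EFin \o (fun=> K)).
  by apply: itv_continuous_integrable; exact: cst_continuous.
apply: le_trans (le_Rintegral mI _ iK HK) _; first exact: (integrable_norm ic).
rewrite Rintegral_cst//= lebesgue_measure_itv/= lte_fin.
by move: ab; rewrite le_eqVlt => /orP[/eqP ->|->]; rewrite ?ltxx ?subrr ?mulr0//= -EFinD.
Qed.

End interval_dilation.

Lemma Rintegral_FTC {R : realType} (F f : R -> R) (a b : R) : a <= b ->
  (forall t : R, is_derive t 1 F (f t)) -> continuous f ->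
  \int[@lebesgue_measure R]_(t in `[a, b]) f t = F b - F a.
Proof.
rewrite le_eqVlt => /orP[/eqP <-|ab] dF cf.
  by rewrite set_itv1 Rintegral_set1 subrr.
have cF : continuous F.
  by move=> t; case: (dF t) => dt _; exact/differentiable_continuous/derivable1_diffP.
rewrite /Rintegral (continuous_FTC2 (F := F) ab)//.
- exact: continuous_subspaceT.
- split; first by move=> t _; case: (dF t).
    by apply: cvg_at_right_filter; exact: cF.
  by apply: cvg_at_left_filter; exact: cF.
- by move=> t _; rewrite derive1E; case: (dF t).
Qed.

Lemma is_derive_local {R : realType} {V : normedModType R} (f g : V -> R) (x v : V) (d r : R) :
  0 < r -> (forall y, `|y - x| < r -> f y = g y) -> is_derive x v g d -> is_derive x v f d.
Proof.
move=> r0 fg /is_deriveP H; apply/is_deriveP => e e0; have [q q0 Hq] := H e e0.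
have v0 : 0 < `|v| + 1 by rewrite ltr_wpDl.
exists (Num.min q (r / (`|v| + 1))); first by rewrite lt_min q0 divr_gt0.
move=> h; rewrite lt_min ltr_pdivlMr// => /andP[hq hr].
rewrite !fg ?subrr ?normr0 ?addrK//; first exact: Hq.
by rewrite normrZ (le_lt_trans _ hr)// ler_wpM2l// lerDl.
Qed.

Lemma continuous_local {R : realType} {V : normedModType R} (f g : V -> R) (x : V) (r : R) :
  0 < r -> (forall y, `|y - x| < r -> f y = g y) -> {for x, continuous g} -> {for x, continuous f}.
Proof.
move=> r0 fg /cvgrPdist_lt H; apply/cvgrPdist_lt => e /H/nbhs_ballP[q /= q0 Hq].
apply/nbhs_ballP; exists (Num.min q r); first by rewrite /= lt_min q0.
move=> y; rewrite -ball_normE/= lt_min => /andP[yq yr].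
rewrite (fg x) ?subrr ?normr0// (fg y); last by rewrite distrC.
by apply: Hq; rewrite -ball_normE.
Qed.

(** * The logarithmic singularity *)

Section hyperbolic.
Context {R : realType}.

Definition ch (y : R) := (expR y + expR (- y)) / 2.
Definition sh (y : R) := (expR y - expR (- y)) / 2.

Lemma is_derive_expRN (y : R) : is_derive y 1 (fun y : R => expR (- y)) (- expR (- y)).
Proof.
have dN : is_derive y 1 (fun u : R => - u) (-1) by exact: is_deriveNid.
have := is_derive1_comp (is_derive_expR (- y)) dN; rewrite mulrN1; exact.
Qed.

Lemma is_derive_ch (y : R) : is_derive y 1 ch (sh y).
Proof.
have H := is_deriveD (is_derive_expR y) (is_derive_expRN y).
have := is_deriveM H (is_derive_cst (2^-1 : R) y 1).
by move=> H'; apply: (is_derive_eq H'); rewrite /sh /GRing.scale/= mulr0 add0r mulrC.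
Qed.

Lemma is_derive_sh (y : R) : is_derive y 1 sh (ch y).
Proof.
have H := is_deriveB (is_derive_expR y) (is_derive_expRN y).
have := is_deriveM H (is_derive_cst (2^-1 : R) y 1).
by move=> H'; apply: (is_derive_eq H'); rewrite /ch /GRing.scale/= mulr0 add0r mulrC opprK.
Qed.

Lemma ch_continuous : continuous ch.
Proof.
by move=> y; case: (is_derive_ch y) => dt _; exact/differentiable_continuous/derivable1_diffP.
Qed.

Lemma sh_continuous : continuous sh.
Proof.
by move=> y; case: (is_derive_sh y) => dt _; exact/differentiable_continuous/derivable1_diffP.
Qed.

Lemma ch_sqr y : ch y * ch y = 1 + sh y * sh y.
Proof.
have : expR y * expR (- y) = 1 by rewrite -expRD subrr expR0.
by rewrite /ch /sh; nra.
Qed.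

Lemma ch_ge1 y : 1 <= ch y.
Proof.
have := ch_sqr y; have : 0 < ch y by rewrite divr_gt0// addr_gt0// expR_gt0.
nra.
Qed.

Lemma ch_ge_sqr y : 0 <= y -> y ^+ 2 / 4 <= ch y.
Proof.
move=> y0; rewrite /ch; have := expR_ge1Dxn 1 y0; have := expR_gt0 (- y).
rewrite (_ : 2`! = 2)%N//; lra.
Qed.

End hyperbolic.

Lemma is_derive_slice_comp {R : realType} {W : normedModType R} b (f : R * W -> R)
    (p : R -> R) (u dp : R) (w : W) :
  Ckb b 1 f -> is_derive u 1 p dp ->
  is_derive u 1 (fun t => f (p t, w)) (dp * 'D_(1, 0) f (p u, w)).
Proof.
move=> f1 dpu; have := is_derive_curve w (1, 0) f1 dpu => /is_deriveP H.
apply: (iffRL (@is_deriveP R R (fun t : R => f (p t, w)) u 1 _)) => e /H[r r0 Hr].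
exists r; first exact: r0.
move=> h hr; move: (Hr h hr).
have D0 : 'D_(0, 0) f (p u, w) = 0.
  have [_ ->//] : is_derive (p u, w) (0 : R * W) f 0.
  have [H1 H2] := Ckb_is_derive (p u, w) 0 f1.
  have := is_derive_dirZ 0 (Ckb_is_derive (p u, w) 0 f1).
  by rewrite scale0r mul0r.
have -> : h *: ((1 : R), (0 : W)) + (u, w) = (h *: (1 : R) + u, w).
  by apply/pair_equal_spec; split; rewrite //= scaler0 add0r.
by cbn [fst snd]; rewrite D0 mul1r addr0.
Qed.

Lemma continuous_mul {R : realType} {T : topologicalType} (f g : T -> R) :
  continuous f -> continuous g -> continuous (fun x => f x * g x).
Proof. by move=> cf cg x; apply: continuousM; [exact: cf|exact: cg]. Qed.

Lemma continuous_add {R : realType} {T : topologicalType} (f g : T -> R) :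
  continuous f -> continuous g -> continuous (fun x => f x + g x).
Proof. by move=> cf cg x; apply: continuousD; [exact: cf|exact: cg]. Qed.

(** * The hyperbolic integral and its truncation to compact intervals *)

Section cosh_integral.
Context {R : realType} {W : normedModType R}.
Implicit Types (G : R * W -> R) (c : R -> R) (x v : R * W).

Local Notation leb := (@lebesgue_measure R).

(* J 1 G (s, w) = int_|s|^oo G(t, w) / sqrt(t^2 - s^2) dt. *)
Definition Jint c G x : R := \int[leb]_(y in `[0, +oo[) (c y * G (`|x.1| * ch y, x.2)).

Context (M : R).
Context (M0 : 0 <= M).
Let supp G := forall x, M < `|x| -> G x = 0.

(** G (|s| cosh y, w) vanishes once |s| cosh y > M, and cosh y >= y^2 / 4 shows that this happens
    for y > Y. The half-line integral becomes one over a compact interval, which can be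
    differentiated in s. *)
Lemma JintE c G x Y : supp G -> 0 <= Y -> 4 * M < `|x.1| * Y ^+ 2 ->
  Jint c G x = idil 0 Y ch c G (`|x.1|, x.2).
Proof.
move=> sG Y0 MY; rewrite /Jint /idil /dilate Rintegral_mkcond [RHS]Rintegral_mkcond.
apply: eq_Rintegral => y _; rewrite !patchE.
have [yI|yI] := boolP (y \in `[0, +oo[%classic); last first.
  rewrite ifF//; apply/negbTE; apply: contra yI; rewrite !inE/= !in_itv/=.
  by move=> /andP[->].
have y0 : 0 <= y by move: yI; rewrite inE/= in_itv/= andbT.
case: ifPn => [_|yY]; first by rewrite /= mulrC [ch y * _]mulrC mulrC.
have {}yY : Y < y by move: yY; rewrite notin_setE/= in_itv/= y0/= => /negP; rewrite -ltNge.
rewrite sG ?mulr0// prod_normE/= lt_max; apply/orP; left.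
rewrite normrM normr_id (ger0_norm (le_trans ler01 (ch_ge1 y))).
have h1 : Y ^+ 2 <= y ^+ 2 by rewrite lerXn2r ?nnegrE// ltW.
have h2 := ch_ge_sqr y0; have h3 := normr_ge0 x.1.
have : `|x.1| * Y ^+ 2 <= 4 * (`|x.1| * ch y) by rewrite [leRHS]mulrCA ler_wpM2l//; lra.
lra.
Qed.

(** Chosen so that s Jcut(s)^2 = 4 M + 1 for s > 0, just above the threshold of [JintE]. *)
Definition Jcut (s : R) : R := Num.sqrt ((4 * M + 1) / s).

Lemma Jcut_ge0 s : 0 <= Jcut s. Proof. exact: sqrtr_ge0. Qed.

Lemma JcutP s t : 0 < s -> s <= t -> 4 * M < t * Jcut s ^+ 2.
Proof.
move=> s0 st; rewrite sqr_sqrtr ?divr_ge0 ?addr_ge0 ?mulr_ge0// ?(ltW s0)//.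
rewrite mulrA ltr_pdivlMr//.
have : (4 * M) * s <= t * (4 * M) by rewrite mulrC ler_wpM2r// mulr_ge0.
nra.
Qed.

(** The truncation is taken for half of x.1, so that one compact interval serves a whole
    neighbourhood of x. *)
Lemma Jint_near c G x y : supp G -> 0 < x.1 -> `|y - x| < x.1 / 2 ->
  Jint c G y = idil 0 (Jcut (x.1 / 2)) ch c G y /\ 0 < y.1.
Proof.
move=> sG x0; rewrite prod_normE gt_max => /andP[/= + _].
rewrite ltr_norml => /andP[h1 h2]; have y0 : x.1 / 2 <= y.1 by lra.
have y0' : 0 < y.1 by apply: lt_le_trans y0; rewrite divr_gt0.
split=> //; rewrite (@JintE c G y (Jcut (x.1 / 2)))// ?Jcut_ge0//.
  by rewrite gtr0_norm// -surjective_pairing.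
by rewrite gtr0_norm//; apply: JcutP => //; rewrite divr_gt0.
Qed.

Lemma Jint_at c G x : supp G -> 0 < x.1 -> Jint c G x = idil 0 (Jcut x.1) ch c G x.
Proof.
move=> sG x0; rewrite (@JintE c G x (Jcut x.1))// ?Jcut_ge0//.
  by rewrite gtr0_norm// -surjective_pairing.
by rewrite gtr0_norm//; apply: JcutP.
Qed.

Let supp_derive G v : supp G -> supp ('D_v G).
Proof.
move=> sG x Mx; have [_ ->//] : is_derive x v G 0.
have d0 : is_derive x v (fun _ : R * W => (0 : R)) 0 by exact: is_derive_cst.
apply: (@is_derive_local _ _ _ _ _ _ _ (`|x| - M) _ _ d0); first by rewrite subr_gt0.
move=> y xy; apply: sG.
have : `|x| <= `|y| + `|y - x|.
  by rewrite -{1}[x](subrK y) -[`|y - x|]normrN opprB addrC ler_normD.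
lra.
Qed.

Lemma Jint_is_derive bb c G x v : supp G -> continuous c -> Ckb bb 1 G -> 0 < x.1 ->
  is_derive x v (Jint c G)
    (v.1 * Jint (fun y => c y * ch y) ('D_(1, 0) G) x + Jint c ('D_(0, v.2) G) x).
Proof.
move=> sG cc G1 x0; have x2 : 0 < x.1 / 2 by rewrite divr_gt0.
have xx : `|x - x| < x.1 / 2 by rewrite subrr normr0.
rewrite (Jint_near _ (supp_derive _ sG) x0 xx).1 (Jint_near _ (supp_derive _ sG) x0 xx).1.
apply: (@is_derive_local _ _ _ (idil 0 (Jcut (x.1 / 2)) ch c G) _ _ _ (x.1 / 2)) => //.
  by move=> y xy; have [] := Jint_near c sG x0 xy.
by apply: (idil_is_derive _ _ _ _ _ _ G1) => //; exact: ch_continuous.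
Qed.

Lemma Jint_continuous_at bb c G x : supp G -> continuous c -> Ckb bb 0 G -> 0 < x.1 ->
  {for x, continuous (Jint c G)}.
Proof.
move=> sG cc G0 x0; have x2 : 0 < x.1 / 2 by rewrite divr_gt0.
apply: (@continuous_local _ _ _ (idil 0 (Jcut (x.1 / 2)) ch c G) _ (x.1 / 2)) => //.
  by move=> y xy; have [] := Jint_near c sG x0 xy.
by apply: (Ckb_continuous (idil_Ckb _ _ _ cc G0)); exact: ch_continuous.
Qed.

(* Boundary terms vanish at the cut-off, so sinh(y) G(s cosh y) integrates to zero. *)
Lemma Jint_parts bb G x : supp G -> Ckb bb 1 G -> 0 < x.1 ->
  Jint ch G x + x.1 * Jint (fun y => sh y * sh y) ('D_(1, 0) G) x = 0.
Proof.
move=> sG G1 x0; have G0 := Ckb_pred G1.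
have g0 : Ckb bb 0 ('D_(1, 0) G) := Ckb_derive _ G1.
have sg := supp_derive (1, 0) sG.
have css : continuous (fun y : R => sh y * sh y).
  by move=> y; apply: continuousM; exact: sh_continuous.
have csZ : continuous (fun y : R => x.1 * (sh y * sh y)).
  by apply: continuous_mul; [exact: cst_continuous|exact: css].
pose Y := Jcut x.1; have Y0 : 0 <= Y by exact: Jcut_ge0.
pose F y := sh y * G (ch y * x.1, x.2).
pose dF y := ch y * G (ch y * x.1, x.2) +
   x.1 * (sh y * sh y * 'D_(1, 0) G (ch y * x.1, x.2)).
have cx : continuous (fun y : R => (ch y * x.1, x.2)).
  apply: continuous_mkpair; last exact: cst_continuous.
  by apply: continuous_mul; [exact: ch_continuous|exact: cst_continuous].
have c1 : continuous (fun y : R => G (ch y * x.1, x.2)).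
  exact: (continuous_app (Ckb_continuous G0) cx).
have c2 : continuous (fun y : R => 'D_(1, 0) G (ch y * x.1, x.2)).
  exact: (continuous_app (Ckb_continuous g0) cx).
have FE : \int[leb]_(y in `[0, Y]) dF y = F Y - F 0.
  apply: (Rintegral_FTC Y0) => [y|].
    have dp : is_derive y 1 (fun y : R => ch y * x.1) (sh y * x.1).
      have := is_deriveM (is_derive_ch y) (is_derive_cst (x.1 : R) y 1).
      by move=> H; apply: (is_derive_eq H); rewrite /GRing.scale/= mulr0 add0r mulrC.
    have := is_deriveM (is_derive_sh y) (is_derive_slice_comp x.2 G1 dp).
    by move=> H; apply: (is_derive_eq H); rewrite /dF /GRing.scale/=; ring.
  apply: continuous_add; first exact: continuous_mul ch_continuous c1.
  apply: continuous_mul; first exact: cst_continuous.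
  exact: continuous_mul css c2.
have F0 : F 0 = 0 by rewrite /F /sh oppr0 subrr mul0r mul0r.
have FY : F Y = 0.
  rewrite /F sG ?mulr0// prod_normE/= lt_max; apply/orP; left.
  rewrite normrM (gtr0_norm x0) ger0_norm; last exact: (le_trans ler01 (ch_ge1 _)).
  have := ch_ge_sqr Y0; have := JcutP x0 (lexx _); rewrite -/Y => h1 h2.
  have : x.1 * (Y ^+ 2 / 4) <= x.1 * ch Y by rewrite ler_wpM2l// ltW.
  lra.
rewrite !Jint_at// -(idilZ 0 (Jcut x.1) ch_continuous x.1 x css g0).
rewrite /idil /dilate -/Y.
have mI : measurable (`[0, Y]%classic : set (measurableTypeR R)) by exact: measurable_itv.
rewrite -(RintegralD mI (idil_integrable 0 Y ch_continuous x ch_continuous G0)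
   (idil_integrable 0 Y ch_continuous x csZ g0)).
transitivity (F Y - F 0); last by rewrite F0 FY subrr.
rewrite -FE; apply: eq_Rintegral => y _.
by rewrite /dF; congr (_ + _); rewrite -mulrA.
Qed.

End cosh_integral.

(** * The trigonometric average *)

Section symmetric_average.
Context {R : realType} {W : normedModType R}.
Implicit Types (G : R * W -> R) (c : R -> R) (x v : R * W).

Let cosN (t : R) : R := - cos t.

Lemma cosN_continuous : continuous cosN.
Proof. by move=> t; apply: continuousN; exact: continuous_cos. Qed.

Let cC := @continuous_cos R.
Let cN := cosN_continuous.
Let sC := @continuous_sin R.

(* The symmetrization makes cavg 1 1 G even in the first variable. *)
Definition cavg c (c' : R -> R) G x : R := 2^-1 * (idil 0 pi cos c G x + idil 0 pi cosN c' G x).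

Lemma cavg_Ckb b k c (c' : R -> R) G : continuous c -> continuous c' -> Ckb b k G -> Ckb b k (cavg c c' G).
Proof.
move=> cc cc' Gk; apply: CkbZ; apply: CkbD; first exact: (idil_Ckb 0 pi cC cc Gk).
exact: (idil_Ckb 0 pi cN cc' Gk).
Qed.

Lemma cavg_is_derive b c (c' : R -> R) G x v : continuous c -> continuous c' -> Ckb b 1 G ->
  is_derive x v (cavg c c' G)
    (v.1 * cavg (fun t => c t * cos t) (fun t => - (c' t * cos t)) ('D_(1, 0) G) x
     + cavg c c' ('D_(0, v.2) G) x).
Proof.
move=> cc cc' G1.
have H := is_deriveD (idil_is_derive 0 pi cC x v cc G1) (idil_is_derive 0 pi cN x v cc' G1).
have {}H := is_deriveZ 2^-1 H; apply: (is_derive_eq H); rewrite /cavg /GRing.scale/=.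
have -> : (fun t : R => c' t * cosN t) = (fun t => - (c' t * cos t)).
  by apply/funext => t; rewrite mulrN.
have aux (k u a b' d e : R) : k * (u * a + b' + (u * d + e)) = u * (k * (a + d)) + k * (b' + e).
  by ring.
exact: aux.
Qed.

Lemma cavg_even c G (s : R) (w : W) : cavg c c G (- s, w) = cavg c c G (s, w).
Proof.
rewrite /cavg addrC; congr (_ * (_ + _)); apply: eq_Rintegral => t _ /=.
  by rewrite /cosN mulrNN.
by rewrite /cosN mulrN mulNr.
Qed.

Lemma cavg_bound b c (c' : R -> R) G x K : continuous c -> continuous c' -> Ckb b 0 G ->
  (forall t, `|c t| <= 1) -> (forall t, `|c' t| <= 1) -> (forall y, `|G y| <= K) ->
  `|cavg c c' G x| <= pi * K.
Proof.
move=> cc cc' G0 c1 c1' GK.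
have p0 := pi_ge0 R.
have K0 : 0 <= K by apply: le_trans (GK 0).
have h1 : `|idil 0 pi cos c G x| <= K * (pi - 0).
  apply: (idil_bound cC p0 cc G0) => t _; rewrite normrM -[K]mul1r.
  by rewrite ler_pM.
have h2 : `|idil 0 pi cosN c' G x| <= K * (pi - 0).
  apply: (idil_bound cN p0 cc' G0) => t _; rewrite normrM -[K]mul1r.
  by rewrite ler_pM.
rewrite /cavg normrM ger0_norm//.
have := ler_normD (idil 0 pi cos c G x) (idil 0 pi cosN c' G x).
by move: h1 h2; rewrite subr0 [K * _]mulrC; lra.
Qed.

Let mI : measurable (`[0, pi]%classic : set (measurableTypeR R)).
Proof. exact: measurable_itv. Qed.

(** Integrate the derivative of sin t G (al(t) x.1, x.2) over [0, pi], at both ends of which sin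
    vanishes. The sign e treats cos and - cos together. *)
Lemma idil_cos_parts b (al : R -> R) (e : R) G x : Ckb b 1 G ->
  (forall t, al t = e * cos t) -> e * e = 1 ->
  idil 0 pi al al G x = x.1 * idil 0 pi al (fun t => sin t * sin t) ('D_(1, 0) G) x.
Proof.
move=> G1 alE e1; have G0 := Ckb_pred G1.
have g0 : Ckb b 0 ('D_(1, 0) G) := Ckb_derive _ G1.
have ca : continuous al.
  rewrite (_ : al = (fun t => e * cos t)); last exact/funext.
  by apply: continuous_mul; [exact: cst_continuous|exact: cC].
have css : continuous (fun t : R => sin t * sin t) by exact: continuous_mul.
have csZ : continuous (fun t : R => - x.1 * (sin t * sin t)).
  by apply: continuous_mul; [exact: cst_continuous|exact: css].
pose F t := e * (sin t * G (al t * x.1, x.2)).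
pose dF t := al t * G (al t * x.1, x.2) + - x.1 * (sin t * sin t) * 'D_(1, 0) G (al t * x.1, x.2).
have cx : continuous (fun t : R => (al t * x.1, x.2)).
  apply: continuous_mkpair; last exact: cst_continuous.
  by apply: continuous_mul; [exact: ca|exact: cst_continuous].
have c1 : continuous (fun y : R => G (al y * x.1, x.2)).
  exact: (continuous_app (Ckb_continuous G0) cx).
have c2 : continuous (fun y : R => 'D_(1, 0) G (al y * x.1, x.2)).
  exact: (continuous_app (Ckb_continuous g0) cx).
have FE : \int[@lebesgue_measure R]_(y in `[0, pi]) dF y = F pi - F 0.
  apply: (Rintegral_FTC (pi_ge0 R)) => [t|].
    have dp : is_derive t 1 (fun y : R => al y * x.1) (- (e * sin t) * x.1).
      have := is_deriveZ (e * x.1) (is_derive_cos t).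
      rewrite (_ : (e * x.1) \*: _ = (fun y => al y * x.1)); last first.
        by apply/funext => y; rewrite /= alE /GRing.scale/=; ring.
      by move=> H; apply: (is_derive_eq H); rewrite /GRing.scale/=; ring.
    have := is_deriveZ e (is_deriveM (is_derive_sin t) (is_derive_slice_comp x.2 G1 dp)).
    move=> H; apply: (is_derive_eq H); rewrite /dF /GRing.scale/= alE.
    have -> : - x.1 * (sin t * sin t) = - (e * e) * x.1 * (sin t * sin t).
      by rewrite e1 mulN1r.
    move: ('D_(1, 0) G _) (G _) => D D'.
    ring.
  apply: continuous_add; first exact: continuous_mul ca c1.
  exact: continuous_mul csZ c2.
have F0 : F pi - F 0 = 0 by rewrite /F sin0 sinpi !mul0r !mulr0 subrr.
apply/eqP; rewrite -subr_eq0 -mulNr; apply/eqP.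
rewrite -(idilZ 0 pi ca (- x.1) x css g0) /idil /dilate.
rewrite -(RintegralD mI (idil_integrable 0 pi ca x ca G0) (idil_integrable 0 pi ca x csZ g0)).
transitivity (F pi - F 0); last exact: F0.
by rewrite -FE; apply: eq_Rintegral.
Qed.

Lemma cavg_parts b G x : Ckb b 1 G ->
  cavg cos cosN G x = x.1 * cavg (fun t => sin t * sin t) (fun t => sin t * sin t) ('D_(1, 0) G) x.
Proof.
move=> G1; rewrite /cavg (idil_cos_parts (e := 1) x G1); [|by move=> t; rewrite mul1r|by rewrite mul1r].
rewrite (idil_cos_parts (e := -1) x G1); [|by move=> t; rewrite mulN1r|by rewrite mulrNN mul1r].
by rewrite -mulrDr mulrCA.
Qed.

Lemma cavg_split b G x : Ckb b 0 G ->
  cavg (fun=> 1) (fun=> 1) G x =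
  cavg (fun t => sin t * sin t) (fun t => sin t * sin t) G x +
  cavg (fun t => cos t * cos t) (fun t => cos t * cos t) G x.
Proof.
move=> G0; rewrite /cavg.
have css : continuous (fun t : R => sin t * sin t) by exact: continuous_mul.
have ccc : continuous (fun t : R => cos t * cos t) by exact: continuous_mul.
have E : (fun _ : R => 1 : R) = (fun t => sin t * sin t + cos t * cos t).
  by apply/funext => t; rewrite -!expr2 addrC cos2Dsin2.
rewrite E (idilD 0 pi cC x css ccc G0) (idilD 0 pi cN x css ccc G0).
by rewrite -mulrDr addrACA.
Qed.

Lemma cavg0 b G (w : W) : Ckb b 0 G -> cavg (fun=> 1) (fun=> 1) G (0, w) = pi * G (0, w).
Proof.
move=> G0; rewrite /cavg.
have H al : idil 0 pi al (fun=> 1) G (0, w) = pi * G (0, w).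
  rewrite /idil /dilate; under eq_Rintegral do rewrite /= mulr0 mul1r.
  by rewrite Rintegral_cst//= lebesgue_measure_itv/= lte_fin pi_gt0 -EFinD/= subr0 mulrC.
by rewrite !H; lra.
Qed.

End symmetric_average.

Lemma Rintegral_zero {R : realType} d (T : measurableType d) (mu : {measure set T -> \bar R})
  (D : set T) : \int[mu]_(t in D) (0 : R) = 0.
Proof. by rewrite /Rintegral integral0. Qed.

(** * The second-order identity for the regularised integral *)

Section log_singularity.
Context {R : realType} {W : normedModType R}.
Implicit Types (G : R * W -> R) (x v : R * W).

Local Notation one := (fun _ : R => 1 : R).
Local Notation cosN := (fun t : R => - cos t).

Definition Javg G := cavg one one G.
Definition Jreg G x : R := Jint one G x + ln `|x.1| * (pi^-1 * Javg G x).

(** For x.1 > 0 this is x.1 times the derivative of [Jreg G] in the first variable; the middle term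
    comes from differentiating the logarithm. *)
Definition Jrad G x : R :=
  x.1 * Jint ch ('D_(1, 0) G) x + pi^-1 * Javg G x
  + ln x.1 * (pi^-1 * (x.1 * cavg cos cosN ('D_(1, 0) G) x)).

Definition Jsin G := cavg (fun t => sin t * sin t) (fun t => sin t * sin t)
  ('D_(1, 0) ('D_(1, 0) G)).

Let c1 : continuous one. Proof. exact: cst_continuous. Qed.
Let cC := @continuous_cos R.
Let cN := @cosN_continuous R.

Lemma Javg_Ckb b k G : Ckb b k G -> Ckb b k (Javg G).
Proof. exact: cavg_Ckb. Qed.

Lemma Jsin_Ckb b k G : Ckb b k.+2 G -> Ckb b k (Jsin G).
Proof.
move=> Gk; have css : continuous (fun t : R => sin t * sin t).
  by apply: continuous_mul; exact: continuous_sin.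
by apply: cavg_Ckb => //; do 2 apply: Ckb_derive.
Qed.

Lemma is_derive_fst (g : R -> R) x v (d : R) :
  is_derive (x.1 : R) 1 g d -> is_derive x v (fun y => g y.1) (v.1 * d).
Proof.
move=> /(is_derive_dirZ v.1); rewrite [v.1 *: 1]mulr1 => H.
apply: (iffRL (is_deriveP _ _ _ _)) => e e0.
by have [r r0 Hr] := iffLR (is_deriveP _ _ _ _) H e e0; exists r.
Qed.

Lemma is_derive_lnabs x v : 0 < x.1 -> is_derive x v (fun y => ln `|y.1|) (v.1 / x.1).
Proof.
move=> x0; have := is_derive_fst v (is_derive1_ln x0).
apply: (is_derive_local x0) => y yx; rewrite gtr0_norm//.
move: yx; rewrite prod_normE gt_max => /andP[/= + _].
by rewrite ltr_norml => /andP[h1 h2]; lra.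
Qed.

Lemma Jreg_even G x : Jreg G (- x.1, x.2) = Jreg G x.
Proof.
rewrite /Jreg /Javg cavg_even/= normrN -surjective_pairing; congr (_ + _).
by rewrite /Jint /= normrN.
Qed.

Lemma tfun_supp G : tfun G -> exists2 M, 0 <= M & forall x, M < `|x| -> G x = 0.
Proof.
move=> [_ [M HM]]; exists `|M| => // x Mx; apply: HM.
by rewrite (le_lt_trans (ler_norm M)).
Qed.

Lemma Jreg_is_derive G x v : tfun G -> 0 < x.1 ->
  is_derive x v (Jreg G) (v.1 * (Jrad G x / x.1) + Jreg ('D_(0, v.2) G) x).
Proof.
move=> tG x0; have [M M0 sG] := tfun_supp tG.
have G1 : Ckb true 1 G := tG.1 1%N.
have H1 := Jint_is_derive M0 v sG c1 G1 x0.
have H2 := is_deriveZ pi^-1 (cavg_is_derive x v c1 c1 G1).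
have H3 := is_deriveD H1 (is_deriveM (is_derive_lnabs v x0) H2).
apply: (is_derive_eq H3); rewrite /Jreg /Jrad /Javg /GRing.scale/= (gtr0_norm x0).
have -> : (fun y : R => 1 * ch y) = ch by apply/funext => y; rewrite mul1r.
have -> : (fun t : R => 1 * cos t) = cos by apply/funext => y; rewrite mul1r.
have -> : (fun t : R => - (1 * cos t)) = cosN by apply/funext => y; rewrite mul1r.
move: (Jint _ _ _) (Jint _ _ _) (cavg _ _ _ _) (cavg _ _ _ _) (cavg _ _ _ _) (pi^-1) (ln _).
move=> J1 J2 a1 a2 a3 p l; have -> : p *: a1 = p * a1 by [].
field; exact: lt0r_neq0.
Qed.

Lemma cavg_is_derive1 b c (c' : R -> R) G x : continuous c -> continuous c' -> Ckb b 1 G ->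
  is_derive x (1, 0) (cavg c c' G)
    (cavg (fun t => c t * cos t) (fun t => - (c' t * cos t)) ('D_(1, 0) G) x).
Proof.
move=> cc cc' G1.
apply: (is_derive_eq (cavg_is_derive x ((1 : R), (0 : W)) cc cc' G1)).
have DG : 'D_(0, 0) G = (fun=> 0).
  have := Ckb_dir_scale ((0 : R), (0 : W)) 0 G1.
  rewrite scale0r => -> ; apply/funext => y; exact: mul0r.
cbn [fst snd]; rewrite mul1r -[RHS]addr0; congr (_ + _).
have i0 : cavg c c' (fun _ : R * W => 0 : R) x = 0.
  rewrite /cavg /idil /dilate.
  by do 2 (under eq_Rintegral do rewrite mulr0; rewrite Rintegral_zero); rewrite addr0 mulr0.
by etransitivity; [|exact: i0]; congr (cavg _ _ _ _); exact: DG.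
Qed.

Lemma Javg_is_derive1 G x : tfun G ->
  is_derive x (1, 0) (Javg G) (cavg cos cosN ('D_(1, 0) G) x).
Proof.
move=> tG; apply: (is_derive_eq (cavg_is_derive1 x c1 c1 (tG.1 1%N))).
have -> : (fun t : R => 1 * cos t) = cos by apply/funext => y; rewrite mul1r.
by have -> : (fun t : R => - (1 * cos t)) = cosN by apply/funext => y; rewrite mul1r.
Qed.

(** Write cosh^2 = 1 + sinh^2 and 1 = sin^2 + cos^2. [Jint_parts] cancels the sinh^2 term against
    the cosh term, and [cavg_parts] turns the cos average of G' into s times the sin^2 average of
    G''. One copy of the latter completes the logarithmic term to a full average; two copies without
    logarithm remain as the smooth term. *)
Lemma Jrad_is_derive G x : tfun G -> 0 < x.1 ->
  is_derive x (1, 0) (Jrad G)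
    (x.1 * (Jreg ('D_(1, 0) ('D_(1, 0) G)) x + 2 * (pi^-1 * Jsin G x))).
Proof.
move=> tG x0; have [M M0 sG] := tfun_supp tG.
have tg := tfun_derive ((1 : R), (0 : W)) tG; have [M' M0' sg] := tfun_supp tg.
have tgg := tfun_derive ((1 : R), (0 : W)) tg; have [M'' M0'' sgg] := tfun_supp tgg.
have G1 : Ckb true 1 G := tG.1 1%N.
have g1 : Ckb true 1 ('D_(1, 0) G) := tg.1 1%N.
have gg0 : Ckb true 0 ('D_(1, 0) ('D_(1, 0) G)) := tgg.1 0%N.
have did : is_derive (x.1 : R) 1 (id : R -> R) 1 by exact: is_derive_id.
have df := is_derive_fst ((1 : R), (0 : W)) did.
have D0 (G' : R * W -> R) : Ckb true 1 G' -> 'D_(0, 0) G' = (fun=> 0).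
  move=> G'1; have := Ckb_dir_scale ((0 : R), (0 : W)) 0 G'1.
  rewrite scale0r => -> ; apply/funext => y; exact: mul0r.
have I0 c : Jint c (fun _ : R * W => 0 : R) x = 0.
  by rewrite /Jint; under eq_Rintegral do rewrite mulr0; rewrite Rintegral_zero.
have Dg : 'D_(0, 0) ('D_(1, 0) G) = (fun=> 0) by exact: D0.
have J1 : is_derive x (1, 0) (Jint ch ('D_(1, 0) G))
    (Jint (fun y => ch y * ch y) ('D_(1, 0) ('D_(1, 0) G)) x).
  apply: (is_derive_eq (Jint_is_derive M0' ((1 : R), (0 : W)) sg ch_continuous g1 x0)).
  cbn [fst snd]; rewrite mul1r -[RHS]addr0; congr (_ + _).
  by etransitivity; [|exact: (I0 ch)]; congr (Jint _ _ _); exact: Dg.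
have A1 := Javg_is_derive1 x tG.
have A2 : is_derive x (1, 0) (cavg cos cosN ('D_(1, 0) G))
    (cavg (fun t => cos t * cos t) (fun t => cos t * cos t) ('D_(1, 0) ('D_(1, 0) G)) x).
  apply: (is_derive_eq (cavg_is_derive1 x cC cN g1)).
  have -> //: (fun t : R => - (- cos t * cos t)) = (fun t => cos t * cos t).
  by apply/funext => y; rewrite mulNr opprK.
have H1 := is_deriveM df J1.
have H2 := is_deriveZ pi^-1 A1.
have H3 := is_deriveM df A2.
have H4 : is_derive x (1, 0) (fun y => ln y.1 * (pi^-1 * (y.1 * cavg cos cosN ('D_(1, 0) G) y)))
  (ln x.1 * (pi^-1 * (x.1 * cavg (fun t => cos t * cos t) (fun t => cos t * cos t)
           ('D_(1, 0) ('D_(1, 0) G)) x + cavg cos cosN ('D_(1, 0) G) x * (1 * 1)))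
   + pi^-1 * (x.1 * cavg cos cosN ('D_(1, 0) G) x) * (1 / x.1)).
  exact: (is_deriveM (is_derive_fst ((1 : R), (0 : W)) (is_derive1_ln x0)) (is_deriveZ pi^-1 H3)).
have H5 := is_deriveD (is_deriveD H1 H2) H4.
apply: (is_derive_eq H5); rewrite /Jreg /Javg /GRing.scale/= (gtr0_norm x0).
rewrite (cavg_parts x g1) (cavg_split x gg0) -/(Jsin G).
have P := Jint_parts M0' sg g1 x0.
have S : Jint (fun y => ch y * ch y) ('D_(1, 0) ('D_(1, 0) G)) x =
  Jint one ('D_(1, 0) ('D_(1, 0) G)) x + Jint (fun y => sh y * sh y) ('D_(1, 0) ('D_(1, 0) G)) x.
  have -> : (fun y : R => ch y * ch y) = (fun y => 1 + sh y * sh y).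
    by apply/funext => y; rewrite ch_sqr.
  have cs : continuous (fun y : R => sh y * sh y).
    by apply: continuous_mul; exact: sh_continuous.
  rewrite !(Jint_at M0'' _ sgg x0).
  exact: (idilD 0 _ ch_continuous x c1 cs gg0).
move: P; rewrite S.
move: (Jint _ _ _) (Jint one _ _) (Jint ch _ _) (cavg _ _ _ _) (Jsin G x) (pi^-1) (ln _).
move=> j3 j2 j1 a1 a2 p l /eqP; rewrite addr_eq0 => /eqP ->.
field; exact: lt0r_neq0.
Qed.

End log_singularity.

Lemma slice_MVT {R : realType} {W : normedModType R} (f df : R * W -> R) (w : W) (s t : R) :
  s <= t -> (forall u, s <= u <= t -> is_derive (u, w) (1, 0) f (df (u, w))) ->
  exists2 u, s <= u <= t & f (t, w) - f (s, w) = (t - s) * df (u, w).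
Proof.
move=> st H; have ts0 : 0 <= t - s by rewrite subr_ge0.
have E (u : R) : u *: ((1 : R), (0 : W)) + (s, w) = (u + s, w).
  by apply/pair_equal_spec; split; rewrite /= ?scaler0 ?add0r// [_ *: 1]mulr1.
have B u : `|u| <= `|t - s| -> 0 <= u * (t - s) -> s <= u + s <= t.
  rewrite (ger0_norm ts0) ler_norml => /andP[h1 h2] h3.
  by apply/andP; split; nra.
have [|u [u1 u2]] := @line_MVT R _ f df (s, w) (1, 0) (t - s).
  by move=> u u1 u2; rewrite E; apply: H; exact: B.
by rewrite !E subrK => Eu; exists (u + s) => //; exact: B.
Qed.

(** * Growth of the regularised integral near s = 0 *)

Section log_estimates.
Context {R : realType} {W : normedModType R}.
Implicit Types (G : R * W -> R) (x v : R * W).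

Local Notation one := (fun _ : R => 1 : R).
Local Notation cosN := (fun t : R => - cos t).
Local Notation dh G := ('D_((1 : R), (0 : W)) G).

Let c1 : continuous one. Proof. exact: cst_continuous. Qed.
Let cC := @continuous_cos R.
Let cN := @cosN_continuous R.

(** Used with r = sqrt s: it trades the logarithm for powers of sqrt s, the scale on which the
    hyperbolic integrals are bounded as well. *)
Lemma norm_ln_le (r : R) : 0 < r -> `|ln (r ^+ 2)| <= 2 * (r + r^-1).
Proof.
move=> r0; have rV : 0 < r^-1 by rewrite invr_gt0.
rewrite lnXn// normrMn -[leLHS]mulr_natl ler_wpM2l//.
rewrite ler_norml; apply/andP; split.
  rewrite lerNl -lnV ?posrE// (le_trans (ltW (ln_sublinear rV)))// lerDr ltW//.
by rewrite (le_trans (ltW (ln_sublinear r0)))// lerDl ltW.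
Qed.

Lemma pi_gt0R : 0 < pi :> R. Proof. exact: pi_gt0. Qed.

Lemma Javg_bound G x (K : R) : tfun G -> (forall y, `|G y| <= K) -> `|pi^-1 * Javg G x| <= K.
Proof.
move=> tG GK; have p0 := pi_gt0R.
rewrite normrM gtr0_norm ?invr_gt0// mulrC ler_pdivrMr// mulrC.
by apply: (cavg_bound x c1 c1 (tG.1 0%N)) => // t; rewrite normr1.
Qed.

(** The truncated interval has length sqrt((4 M + 1) / x.1), hence the power -1/2. The bound is
    crude, but a factor x.1 will compensate it wherever it is used near 0. *)
Lemma Jint_boundc (M : R) (c : R -> R) G x (K : R) : 0 <= M -> (forall y, M < `|y| -> G y = 0) -> tfun G -> 0 < x.1 ->
  continuous c -> (forall t, 0 <= t -> `|c t| <= 1) -> (forall y, `|G y| <= K) ->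
  `|Jint c G x| <= K * Num.sqrt (4 * M + 1) * (Num.sqrt x.1)^-1.
Proof.
move=> M0 sG tG x0 cc cb GK; rewrite (Jint_at M0 _ sG x0).
have G0 := tG.1 0%N; have Y0 := Jcut_ge0 M x.1.
have K0 : 0 <= K by apply: le_trans (GK 0).
have JE : Jcut M x.1 = Num.sqrt (4 * M + 1) * (Num.sqrt x.1)^-1.
  by rewrite /Jcut sqrtrM ?addr_ge0 ?mulr_ge0// sqrtrV ?ltW.
rewrite -mulrA -JE -[X in _ * X]subr0.
apply: (idil_bound ch_continuous Y0 cc G0) => t /=.
rewrite in_itv/= => /andP[t0 _]; rewrite normrM -[K]mul1r.
by rewrite ler_pM// cb.
Qed.

Lemma Jreg_bound G : tfun G -> exists2 C, 0 <= C & forall x, 0 < x.1 ->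
  `|Jreg G x| <= C * (Num.sqrt x.1 + (Num.sqrt x.1)^-1).
Proof.
move=> tG; have [M M0 sG] := tfun_supp tG; have [K K0 GK] := tfun_bounded tG.
have q0 := sqrtr_ge0 (4 * M + 1).
exists (K * Num.sqrt (4 * M + 1) + 2 * K); first by rewrite addr_ge0// mulr_ge0.
move=> x x0; have h1 : `|Jint one G x| <= K * Num.sqrt (4 * M + 1) * (Num.sqrt x.1)^-1.
  by apply: (Jint_boundc M0 sG tG x0) => // t _; rewrite normr1.
have h2 := Javg_bound x tG GK.
have r0 : 0 < Num.sqrt x.1 by rewrite sqrtr_gt0.
have h3 := norm_ln_le r0; rewrite sqr_sqrtr ?(ltW x0)// in h3.
rewrite /Jreg (le_trans (ler_normD _ _))// mulrDl lerD//.
  by rewrite (le_trans h1)// ler_wpM2l ?mulr_ge0// lerDr ltW.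
rewrite (gtr0_norm x0) normrM mulrAC ler_pM//.
Qed.

(** Both terms equal G (0, x.2) at x.1 = 0, thanks to the factor 1/pi, and both have bounded
    derivatives in the first variable. *)
Lemma Javg_near G : tfun G -> exists2 C, 0 <= C & forall x, 0 < x.1 ->
  `|pi^-1 * Javg G x - G x| <= C * x.1.
Proof.
move=> tG; have tg := tfun_derive ((1 : R), (0 : W)) tG.
have [K K0 gK] := tfun_bounded tg; exists (2 * K); first by rewrite mulr_ge0.
move=> x x0; have p0 := pi_gt0R.
have G1 := tG.1 1%N; have A1 : Ckb true 1 (Javg G) by exact: Javg_Ckb.
have [s1 _ E1] := slice_MVT (df := dh G) (w := x.2) (ltW x0)
  (fun u _ => Ckb_is_derive _ ((1 : R), (0 : W)) G1).
have [s2 _ E2] := slice_MVT (df := 'D_(1, 0) (Javg G)) (w := x.2) (ltW x0)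
  (fun u _ => Ckb_is_derive _ ((1 : R), (0 : W)) A1).
rewrite -surjective_pairing subr0 in E1 E2.
have bA y : `|'D_(1, 0) (Javg G) y| <= pi * K.
  have [_ ->] := Javg_is_derive1 y tG.
  by apply: (cavg_bound y cC cN (tg.1 0%N)) => // t; rewrite ?normrN ler_norml cos_geN1 cos_le1.
have E0 : Javg G (0, x.2) = pi * G (0, x.2) by exact: (cavg0 _ (tG.1 0%N)).
have -> : pi^-1 * Javg G x - G x =
   pi^-1 * (Javg G x - Javg G (0, x.2)) - (G x - G (0, x.2)).
  by rewrite E0 mulrBr mulKf ?(lt0r_neq0 p0)//; ring.
rewrite E1 E2 (le_trans (ler_normB _ _))// [2 * K]mulr_natl mulr2n mulrDl lerD//.
  rewrite mulrCA normrM (gtr0_norm x0) mulrC ler_wpM2r ?(ltW x0)//.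
  by rewrite normrM gtr0_norm ?invr_gt0// mulrC ler_pdivrMr// mulrC.
by rewrite normrM (gtr0_norm x0) mulrC ler_wpM2r ?(ltW x0).
Qed.

(* s ch y = s sh y + s e^-y, and s sh(y) G'(s ch y) is an exact derivative in y. *)
Lemma Jint_ch_near (M : R) G x : 0 <= M -> (forall y, M < `|y| -> G y = 0) ->
  (forall y, M < `|y| -> dh G y = 0) -> tfun G -> 0 < x.1 ->
  x.1 * Jint ch (dh G) x = - G x + x.1 * Jint (fun y => expR (- y)) (dh G) x.
Proof.
move=> M0 sG sg tG x0; have G1 := tG.1 1%N; have tg := tfun_derive ((1 : R), (0 : W)) tG.
have g0 := tg.1 0%N; have G0 := tG.1 0%N.
have ce : continuous (fun y : R => expR (- y)).
  by move=> y; case: (is_derive_expRN y) => dt _; exact/differentiable_continuous/derivable1_diffP.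
rewrite !(Jint_at M0 _ sg x0); set Y := Jcut M x.1.
have E : ch = (fun y : R => sh y + expR (- y)) by apply/funext => y; rewrite /ch /sh; field.
rewrite {2}E (idilD 0 Y ch_continuous x sh_continuous ce g0) mulrDr; congr (_ + _).
have Y0 : 0 <= Y by exact: Jcut_ge0.
have cx : continuous (fun y : R => (ch y * x.1, x.2)).
  apply: continuous_mkpair; last exact: cst_continuous.
  by apply: continuous_mul; [exact: ch_continuous|exact: cst_continuous].
have c2 : continuous (fun y : R => dh G (ch y * x.1, x.2)).
  exact: (continuous_app (Ckb_continuous g0) cx).
have csZ : continuous (fun y : R => x.1 * sh y).
  by apply: continuous_mul; [exact: cst_continuous|exact: sh_continuous].
rewrite -(idilZ 0 Y ch_continuous x.1 x sh_continuous g0) /idil /dilate.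
pose F y := G (ch y * x.1, x.2).
have FE : \int[@lebesgue_measure R]_(y in `[0, Y]) (x.1 * sh y * dh G (ch y * x.1, x.2)) = F Y - F 0.
  apply: (Rintegral_FTC Y0) => [y|]; last exact: continuous_mul.
  have dp : is_derive y 1 (fun y : R => ch y * x.1) (sh y * x.1).
    have := is_deriveM (is_derive_ch y) (is_derive_cst (x.1 : R) y 1).
    by move=> H; apply: (is_derive_eq H); rewrite /GRing.scale/= mulr0 add0r mulrC.
  apply: (is_derive_eq (is_derive_slice_comp x.2 G1 dp)).
  by rewrite [sh y * _]mulrC.
rewrite FE /F; have ch0 : ch 0 = 1 :> R by rewrite /ch oppr0 expR0; lra.
rewrite ch0 mul1r -surjective_pairing sG ?add0r//.
rewrite prod_normE/= lt_max; apply/orP; left.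
rewrite normrM (gtr0_norm x0) ger0_norm; last exact: (le_trans ler01 (ch_ge1 _)).
have := ch_ge_sqr Y0; have := JcutP M0 x0 (lexx _); rewrite -/Y => h1 h2.
have : x.1 * (Y ^+ 2 / 4) <= x.1 * ch Y by rewrite ler_wpM2l// ltW.
lra.
Qed.

(** The boundary term - G of [Jint_ch_near] and the average cancel to order x.1; what is left is of
    order sqrt x.1 near 0. Hence [Jrad] tends to 0, the initial value that allows its derivative to
    be integrated from 0. *)
Lemma Jrad_small G : tfun G -> exists2 C, 0 <= C & forall x, 0 < x.1 ->
  `|Jrad G x| <= C * (Num.sqrt x.1 * (1 + x.1)).
Proof.
move=> tG; have tg := tfun_derive ((1 : R), (0 : W)) tG.
have [M0 M00 sG0] := tfun_supp tG; have [M1 M10 sg1] := tfun_supp tg.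
pose M := Num.max M0 M1.
have MM : 0 <= M by rewrite le_max M00.
have sG y : M < `|y| -> G y = 0 by rewrite gt_max => /andP[h _]; exact: sG0.
have sg y : M < `|y| -> dh G y = 0 by rewrite gt_max => /andP[_ h]; exact: sg1.
have [K K0 gK] := tfun_bounded tg; have [C C0 HC] := Javg_near tG.
have q0 := sqrtr_ge0 (4 * M + 1).
exists (K * Num.sqrt (4 * M + 1) + C + 2 * K); first by rewrite !addr_ge0// ?mulr_ge0.
move=> x x0.
have r0 : 0 < Num.sqrt x.1 by rewrite sqrtr_gt0.
have rE : Num.sqrt x.1 ^+ 2 = x.1 by rewrite sqr_sqrtr ?ltW.
have h3 := norm_ln_le r0; rewrite rE in h3.
have h1 : `|Jint (fun y => expR (- y)) (dh G) x| <= K * Num.sqrt (4 * M + 1) * (Num.sqrt x.1)^-1.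
  apply: (Jint_boundc MM sg tg x0) => //.
    by move=> y; case: (is_derive_expRN y) => dt _; exact/differentiable_continuous/derivable1_diffP.
  by move=> t t0; rewrite gtr0_norm ?expR_gt0// -[1]expR0 ler_expR oppr_le0.
have h2 := HC x x0.
have h4 : `|pi^-1 * cavg cos cosN (dh G) x| <= K.
  have p0 := pi_gt0R; rewrite normrM gtr0_norm ?invr_gt0// mulrC ler_pdivrMr// mulrC.
  by apply: (cavg_bound x cC cN (tg.1 0%N)) => // t; rewrite ?normrN ler_norml cos_geN1 cos_le1.
rewrite /Jrad (Jint_ch_near MM sG sg tG x0).
set J := Jint _ _ _ in h1 *; set A := pi^-1 * Javg G x in h2 *; set B := cavg _ _ _ _ in h4 *.
have -> : - G x + x.1 * J + A + ln x.1 * (pi^-1 * (x.1 * B)) =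
  x.1 * J + (A - G x) + ln x.1 * (x.1 * (pi^-1 * B)) by ring.
set q := Num.sqrt (4 * M + 1) in h1 q0 *.
move: h1 h2 h3 h4; set lx := ln x.1; set B' := pi^-1 * B; set A' := A - G x.
move: r0 rE; set r := Num.sqrt x.1 => r0 rE h1 h2 h3 h4.
clearbody lx B' A' r q J.
rewrite (le_trans (ler_normD _ _))// mulrDl lerD//; last first.
  rewrite !normrM (gtr0_norm x0).
  apply: le_trans (ler_pM _ _ h3 (ler_wpM2l (ltW x0) h4)) _ => //.
    by rewrite mulr_ge0// ltW.
  rewrite -!rE le_eqVlt; apply/orP; left; apply/eqP.
  by field; exact: lt0r_neq0.
rewrite (le_trans (ler_normD _ _))// mulrDl lerD//.
  rewrite normrM (gtr0_norm x0).
  apply: le_trans (ler_wpM2l (ltW x0) h1) _.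
  have -> : x.1 * (K * q * r^-1) = K * q * r.
    by rewrite -rE; field; exact: lt0r_neq0.
  by rewrite ler_wpM2l ?mulr_ge0// ler_peMr ?(ltW r0)// lerDl ltW.
apply: le_trans h2 _; rewrite ler_wpM2l// -rE; nra.
Qed.

End log_estimates.

(** * Continuous extension across s = 0 *)

Section log_extension.
Context {R : realType} {W : normedModType R}.
Implicit Types (G : R * W -> R) (x v : R * W).

Local Notation one := (fun _ : R => 1 : R).
Local Notation dh G := ('D_((1 : R), (0 : W)) G).

Let c1 : continuous one. Proof. exact: cst_continuous. Qed.

(** [Jrad] tends to 0 and its derivative is bounded on ]0, 1], because the factor x.1 absorbs the
    growth of [Jreg]; the mean value theorem improves sqrt x.1 to x.1. *)
Lemma Jrad_le G : tfun G -> exists2 C, 0 <= C & forall x, 0 < x.1 <= 1 ->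
  `|Jrad G x| <= C * x.1.
Proof.
move=> tG; have tg := tfun_derive ((1 : R), (0 : W)) tG.
have tgg := tfun_derive ((1 : R), (0 : W)) tg.
have [C C0 HC] := Jrad_small tG; have [D D0 HD] := Jreg_bound tgg.
have [K K0 HK] : exists2 K, 0 <= K & forall x, `|Jsin G x| <= K.
  have [k Hk] := Ckb_bounded (Jsin_Ckb (tG.1 2%N)) 0; exists k; last by move=> x; exact: Hk.
  by apply: le_trans (Hk 0 _).
have p0 : 0 < pi^-1 :> R by rewrite invr_gt0 pi_gt0.
pose B := 2 * D + 2 * (pi^-1 * K).
have B0 : 0 <= B by rewrite addr_ge0// !mulr_ge0// ltW.
have Hd u w : 0 < u <= 1 ->
    `|u * (Jreg (dh (dh G)) (u, w) + 2 * (pi^-1 * Jsin G (u, w)))| <= B.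
  move=> /andP[u0 u1]; have r0 : 0 < Num.sqrt u by rewrite sqrtr_gt0.
  have rE : Num.sqrt u ^+ 2 = u by rewrite sqr_sqrtr ?ltW.
  rewrite mulrDr (le_trans (ler_normD _ _))// lerD//.
    rewrite normrM (gtr0_norm u0).
    apply: le_trans (ler_wpM2l (ltW u0) (HD (u, w) u0)) _ => /=.
    rewrite mulrCA mulrC ler_wpM2r//.
    move: r0 rE; move: (Num.sqrt u) => r r0 rE.
    have -> : u * (r + r^-1) = r * (u + 1) by rewrite -rE; field; exact: lt0r_neq0.
    have : r <= 1 by nra.
    nra.
  rewrite normrM (gtr0_norm u0) -[leRHS]mul1r ler_pM ?(ltW u0)//.
  by rewrite normrM ger0_norm// ler_wpM2l// normrM gtr0_norm// ler_wpM2l// ltW.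
exists B => // -[s w]; rewrite -[(s, w).1]/s => /andP[s0 s1]; apply/ler_addgt0Pr => e e0.
have C1 : 0 < 2 * C + 1 by rewrite ltr_wpDl// mulr_ge0.
(* A starting point close enough to 0 for [Jrad_small] to give |Jrad G (u, w)| <= e: its bound C
   sqrt u (1 + u) is at most 2 C e / (2 C + 1). *)
pose u := Num.min s ((e / (2 * C + 1)) ^+ 2).
have q0 : 0 < e / (2 * C + 1) by rewrite divr_gt0.
have u0 : 0 < u by rewrite lt_min s0 exprn_gt0.
have us : u <= s by rewrite ge_min lexx.
have ue : Num.sqrt u <= e / (2 * C + 1).
  rewrite -[leRHS]gtr0_norm// -sqrtr_sqr ler_wsqrtr// ge_min.
  by apply/orP; right.
have [|z /andP[uz zs] E] := slice_MVT (f := Jrad G) (w := w)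
    (df := fun x => x.1 * (Jreg (dh (dh G)) x + 2 * (pi^-1 * Jsin G x))) us.
  by move=> y /andP[uy _]; apply: Jrad_is_derive => //=; exact: lt_le_trans uy.
have hu := HC (u, w) u0; have r0 := sqrtr_ge0 u.
have {}hu : `|Jrad G (u, w)| <= e.
  apply: le_trans hu _ => /=; apply: le_trans (_ : C * (e / (2 * C + 1) * 2) <= _).
    rewrite ler_wpM2l// ler_pM// ?addr_ge0// ?(ltW u0)//.
    by rewrite (_ : 2 = 1 + 1)// lerD2l (le_trans us s1).
  rewrite mulrCA mulrAC mulrA ler_pdivrMr// -mulrA ler_wpM2l ?(ltW e0)// mulrC lerDl ler01//.
have -> : Jrad G (s, w) = (Jrad G (s, w) - Jrad G (u, w)) + Jrad G (u, w) by rewrite subrK.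
rewrite (le_trans (ler_normD _ _))// lerD// E normrM mulrC -[(z, w).1]/z.
have su0 : 0 <= s - u by rewrite subr_ge0.
rewrite ler_pM//; last by rewrite ger0_norm// gerBl ltW.
apply: Hd; apply/andP; split; first exact: lt_le_trans uz.
exact: le_trans zs s1.
Qed.

Lemma Jreg_zero x : Jreg (fun _ : R * W => 0 : R) x = 0.
Proof.
rewrite /Jreg /Javg /cavg /idil /dilate /Jint.
do 2 (under eq_Rintegral do rewrite mulr0; rewrite Rintegral_zero).
by rewrite addr0 !mulr0 addr0.
Qed.

Lemma Jreg_lip G : tfun G -> exists2 C, 0 <= C & forall s t w,
  0 < s <= 1 -> 0 < t <= 1 -> `|Jreg G (t, w) - Jreg G (s, w)| <= C * `|t - s|.
Proof.
move=> tG; have [C C0 HC] := Jrad_le tG; exists C => //.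
have H s t w : 0 < s -> s <= t -> t <= 1 -> `|Jreg G (t, w) - Jreg G (s, w)| <= C * `|t - s|.
  move=> s0 st t1.
  have [|z /andP[sz zt] ->] := slice_MVT (f := Jreg G) (w := w)
    (df := fun x => Jrad G x / x.1) st.
    move=> y /andP[sy _]; have y0 : 0 < y by exact: lt_le_trans sy.
    have := Jreg_is_derive (x := (y, w)) ((1 : R), (0 : W)) tG y0.
    have D0 : 'D_(0, 0) G = (fun=> 0).
      have := Ckb_dir_scale ((0 : R), (0 : W)) 0 (tG.1 1%N).
      by rewrite scale0r => -> ; apply/funext => ?; exact: mul0r.
    move=> H; apply: (is_derive_eq H); cbn [fst snd]; rewrite mul1r -[RHS]addr0; congr (_ + _).
    by etransitivity; [|exact: (Jreg_zero (y, w))]; congr (Jreg _ _); exact: D0.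
  have z0 : 0 < z by exact: lt_le_trans sz.
  rewrite normrM mulrC ler_wpM2r//= normrM normfV (gtr0_norm z0) ler_pdivrMr//.
  by apply: (HC (z, w)); rewrite /= z0/= (le_trans zt).
move=> s t w /andP[s0 s1] /andP[t0 t1]; have [st|/ltW ts] := leP s t; first exact: H.
by rewrite distrC [`|t - s|]distrC; exact: H.
Qed.

(** Any sequence tending to 0 from the right would do, since [Jreg G] is Lipschitz in the first
    variable on ]0, 1], uniformly in the second. *)
Definition Jext G x : R :=
  if x.1 == 0 then lim (Jreg G (n.+1%:R^-1, x.2) @[n --> \oo]) else Jreg G x.

Lemma JextE G x : x.1 != 0 -> Jext G x = Jreg G x.
Proof. by rewrite /Jext => /negbTE ->. Qed.

Lemma Jext_even G x : Jext G (- x.1, x.2) = Jext G x.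
Proof. by rewrite /Jext /= oppr_eq0 Jreg_even. Qed.

Lemma Jext_near G : tfun G -> exists2 C, 0 <= C & forall s w, 0 < s <= 1 ->
  `|Jext G (0, w) - Jreg G (s, w)| <= C * s.
Proof.
move=> tG; have [C C0 HC] := Jreg_lip tG; exists C => // s w s01.
(* By the Lipschitz bound every J(s) - C s lies below every J(t) + C t, so the supremum of the
   former is within C t of J(t) for all t in ]0, 1]; it is the limit at 0. *)
pose A := [set y | exists2 s, 0 < s <= 1 & y = Jreg G (s, w) - C * s].
have ubA t : 0 < t <= 1 -> ubound A (Jreg G (t, w) + C * t).
  move=> t01 _ [u u01 ->].
  have := HC t u w t01 u01 => /(le_trans (ler_norm _)) h1.
  have h2 : C * `|u - t| <= C * (u + t).
    rewrite ler_wpM2l// (le_trans (ler_normB _ _))//.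
    by case/andP: t01 => t0 _; case/andP: u01 => u0 _; rewrite !gtr0_norm.
  lra.
have one01 : 0 < (1 : R) <= 1 by rewrite ltr01 lexx.
have LP t : 0 < t <= 1 -> `|sup A - Jreg G (t, w)| <= C * t.
  move=> t01; rewrite ler_norml; apply/andP; split.
    rewrite lerBrDl; apply: ub_le_sup; last by exists t.
    by exists (Jreg G (1, w) + C * 1); exact: ubA.
  rewrite lerBlDl; apply: ge_sup; last exact: ubA.
  by exists (Jreg G (t, w) - C * t); exists t.
suff <- : sup A = Jext G (0, w) by exact: LP.
rewrite /Jext /= eqxx; apply/esym/cvg_lim => //.
have Cp : 0 < C + 1 by rewrite ltr_wpDl.
apply/cvgrPdist_le => e e0; near=> n.
apply: le_trans (LP _ _) _.
  by rewrite invr_gt0 ltr0Sn/= invf_le1 ?ltr0Sn// ler1n.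
apply: le_trans (_ : (C + 1) * n.+1%:R^-1 <= _).
  by rewrite ler_wpM2r// lerDl.
rewrite mulrC -ler_pdivlMr// ltW//; near: n.
exact: (near_infty_natSinv_lt (PosNum (divr_gt0 e0 Cp))).
Unshelve. all: by end_near. Qed.

Lemma Jreg_continuous_at G x : tfun G -> 0 < x.1 -> {for x, continuous (Jreg G)}.
Proof.
move=> tG x0; have [M M0 sG] := tfun_supp tG.
apply: continuousD; first exact: (Jint_continuous_at M0 sG c1 (tG.1 0%N)).
apply: continuousM; last first.
  apply: continuousM; first exact: cst_continuous.
  exact: (Ckb_continuous (Javg_Ckb (tG.1 0%N))).
apply: (continuous_local x0 (g := fun y => ln y.1)) => [y yx|].
  rewrite gtr0_norm//; move: yx; rewrite prod_normE gt_max => /andP[/= + _].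
  by rewrite ltr_norml => /andP[h1 h2]; lra.
apply: continuous_comp; first exact: cvg_fst.
exact: continuous_ln.
Qed.

Lemma Jext_continuous G : tfun G -> continuous (Jext G).
Proof.
move=> tG.
have pos x : 0 < x.1 -> {for x, continuous (Jext G)}.
  move=> x0; apply: (continuous_local x0 (g := Jreg G)); last exact: Jreg_continuous_at.
  move=> y; rewrite prod_normE gt_max => /andP[/= + _].
  by rewrite ltr_norml => /andP[h1 h2]; rewrite JextE// gt_eqF//; lra.
move=> x; have [x0|x0|x0] := ltgtP x.1 0.
- have -> : Jext G = Jext G \o (fun y => (- y.1, y.2)).
    by apply/funext => y /=; rewrite Jext_even.
  apply: continuous_comp; last by apply: pos; rewrite /= oppr_gt0.
  apply: (continuous_mkpair (f := fun y : R * W => - y.1) (g := snd)).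
    by move=> y; apply: continuousN; exact: cvg_fst.
  by move=> y; exact: cvg_snd.
- exact: pos.
have [C C0 HC] := Jext_near tG.
have HE s w : `|s| <= 1 -> `|Jext G (0, w) - Jext G (s, w)| <= C * `|s|.
  move=> s1; have [->|s0] := eqVneq s 0; first by rewrite subrr normr0 mulr0.
  wlog sp : s s0 s1 / 0 < s.
    move=> H; have [?|sn] := ltP 0 s; first exact: H.
    have sN : 0 < - s by rewrite oppr_gt0 lt_neqAle s0.
    rewrite -(Jext_even G (s, w)) -[`|s|]normrN.
    by apply: (H (- s)); rewrite ?oppr_eq0 ?normrN.
  have h := HC s w; rewrite -(@JextE G (s, w) s0) in h.
  by rewrite (gtr0_norm sp); apply: h; rewrite sp -(gtr0_norm sp).
apply/cvgrPdist_le => e e0.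
(* Points near s = 0 are compared at height d, where continuity in both variables is known. Passing
   to that height at x and at y, the difference there and the return to y.1 cost at most e / 4
   each. *)
pose d := Num.min 1 (e / (4 * C + 1)).
have C1 : 0 < 4 * C + 1 by rewrite ltr_wpDl// mulr_ge0.
have d0 : 0 < d by rewrite lt_min ltr01 divr_gt0.
have d1 : d <= 1 by rewrite ge_min lexx.
have Cd : C * d <= e / 4.
  have : d <= e / (4 * C + 1) by rewrite ge_min lexx orbT.
  rewrite ler_pdivlMr// => h.
  have := e0; have := d0; nra.
have cd : {for (d, x.2), continuous (Jext G)} by exact: pos.
have /cvgrPdist_le/(_ _ (divr_gt0 e0 (ltr0Sn _ 3)))/nbhs_ballP[q /= q0 Hq] := cd.
change (nbhs x (fun t => `|Jext G x - Jext G t| <= e)).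
apply/nbhs_ballP; exists (Num.min q d); first by rewrite /= lt_min q0.
move=> y; rewrite -ball_normE/= lt_min prod_normE /= x0 sub0r normrN !gt_max.
move=> /andP[/andP[y1q y2q] /andP[y1d _]].
have -> : Jext G x - Jext G y = (Jext G (0, x.2) - Jext G (d, x.2)) +
   (Jext G (d, x.2) - Jext G (d, y.2)) - (Jext G (0, y.2) - Jext G (d, y.2))
   + (Jext G (0, y.2) - Jext G (y.1, y.2)).
  by rewrite -x0 -!surjective_pairing; lra.
have dn : `|d| = d by rewrite gtr0_norm.
have h1 := HE d x.2; have h2 := HE d y.2; rewrite dn in h1 h2.
have h3 : `|Jext G (d, x.2) - Jext G (d, y.2)| <= e / 4.
  by apply: Hq; rewrite -ball_normE/= prod_normE/= subrr normr0 gt_max q0.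
have h4 := HE y.1 y.2 (le_trans (ltW y1d) d1).
have h5 : C * `|y.1| <= e / 4.
  by apply: le_trans Cd; rewrite ler_wpM2l// ltW.
have {}h1 := h1 d1; have {}h2 := h2 d1.
rewrite (le_trans (ler_normD _ _))// (le_trans (lerD (ler_normB _ _) (lexx _)))//.
rewrite (le_trans (lerD (lerD (ler_normD _ _) (lexx _)) (lexx _)))//; lra.
Qed.

Lemma Jext_bounded G M : tfun G -> exists C, forall x, `|x| <= M -> `|Jext G x| <= C.
Proof.
move=> tG; have [C C0 HC] := Jext_near tG; have [D D0 HD] := Jreg_bound tG.
exists (3 * C + D * (2 + 2) + D * (`|M| + 2)) => x xM.
have x1M : `|x.1| <= `|M|.
  by rewrite (le_trans _ (ler_norm M))// (le_trans _ xM)// prod_normE le_max lexx.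
have M0 := normr_ge0 M.
wlog x0 : x xM x1M / 0 <= x.1.
  move=> H; have [?|/ltW xn] := leP 0 x.1; first exact: H.
  have xE : `|(- x.1, x.2)| = `|x| by rewrite !prod_normE/= normrN.
  by rewrite -Jext_even; apply: H; rewrite ?xE//= ?normrN// oppr_ge0.
have one01 : 0 < (1 : R) <= 1 by rewrite ltr01 lexx.
have h1 := HD (1, x.2) ltr01; rewrite /= sqrtr1 invr1 in h1.
have h2 := HC 1 x.2 one01.
have h3 : `|Jext G (0, x.2)| <= D * 2 + C.
  rewrite -(subrK (Jreg G (1, x.2)) (Jext G (0, x.2))) (le_trans (ler_normD _ _))//; lra.
have DM : 0 <= D * `|M| by rewrite mulr_ge0.
have [xe|xn0] := eqVneq x.1 0.
  by rewrite [x]surjective_pairing xe; apply: le_trans h3 _; lra.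
have xp : 0 < x.1 by rewrite lt_def xn0.
have [x1|x1] := leP x.1 1.
  have h4 : `|Jext G (0, x.2) - Jreg G x| <= C.
    rewrite [x in Jreg G x]surjective_pairing.
    have x01 : 0 < x.1 <= 1 by rewrite xp.
    by apply: le_trans (HC x.1 x.2 x01) _; exact: ler_piMr.
  rewrite JextE// -(subKr (Jext G (0, x.2)) (Jreg G x)) (le_trans (ler_normB _ _))//; lra.
rewrite JextE// (le_trans (HD x xp))//.
have r1 : 1 <= Num.sqrt x.1 by rewrite -[leLHS]sqrtr1 ler_wsqrtr// ltW.
have rV : (Num.sqrt x.1)^-1 <= 1 by rewrite invf_le1// (lt_le_trans ltr01).
have rx : Num.sqrt x.1 <= `|M|.
  apply: le_trans x1M; rewrite gtr0_norm// -[leRHS]sqr_sqrtr ?(ltW xp)//.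
  by rewrite expr2 ler_peMr// (le_trans ler01).
have : D * (Num.sqrt x.1 + (Num.sqrt x.1)^-1) <= D * (`|M| + 2) by rewrite ler_wpM2l//; lra.
lra.
Qed.

End log_extension.

(** * Smoothness of the extension *)

Section log_smooth.
Context {R : realType} {W : normedModType R}.
Implicit Types (G : R * W -> R) (x v : R * W).

Local Notation dh G := ('D_((1 : R), (0 : W)) G).

Let Jker G x := Jext (dh (dh G)) x + 2 * (pi^-1 * Jsin G x).

Let Jker_continuous G : tfun G -> continuous (Jker G).
Proof.
move=> tG; have tgg : tfun (dh (dh G)) by do 2 apply: tfun_derive.
apply: continuous_add; first exact: Jext_continuous.
apply: continuous_mul; first exact: cst_continuous.
apply: continuous_mul; first exact: cst_continuous.
exact: (Ckb_continuous (Jsin_Ckb (tG.1 2%N))).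
Qed.

Let idc : continuous (id : R -> R). Proof. by move=> ?; exact: cvg_id. Qed.

(** Integrating the derivative of t -> Jrad G (t x.1, x.2) from 0 to 1 gives x.1^2 times a dilation
    average. One factor x.1 pays for the division, so the derivative of [Jreg] in s is s times an
    average of continuous functions. *)
Lemma Jrad_integral G x : tfun G -> 0 < x.1 ->
  Jrad G x / x.1 = x.1 * idil 0 1 id id (Jker G) x.
Proof.
move=> tG x0; pose f (t : R) : R := x.1 * (t * x.1 * Jker G (t * x.1, x.2)).
(* At t = 0 the value 0 is the right limit, by [Jrad_small]; for t < 0 it is a filler. *)
pose F (t : R) : R := if 0 < t then Jrad G (t * x.1, x.2) else 0.
have cl : continuous (fun t : R => t * x.1).
  by apply: continuous_mul; [exact: idc|exact: cst_continuous].
have ck : continuous (fun t : R => Jker G (t * x.1, x.2)).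
  apply: (continuous_app (Jker_continuous tG)).
  by apply: continuous_mkpair; [exact: cl|exact: cst_continuous].
have cf : continuous f.
  by apply: continuous_mul; [exact: cst_continuous|exact: continuous_mul].
have dF (t : R) : 0 < t -> is_derive t 1 F (f t).
  move=> t0; have tx : 0 < t * x.1 by rewrite mulr_gt0.
  have := is_derive_dirZ x.1 (Jrad_is_derive (x := (t * x.1, x.2)) tG tx).
  move=> /is_deriveP H.
  have d1 : is_derive t 1 (fun t : R => Jrad G (t * x.1, x.2)) (f t).
    apply: (iffRL (@is_deriveP R R _ t 1 _)) => e /H[r r0 Hr].
    exists r; first exact: r0.
    move=> h hr; move: (Hr h hr).
    have -> : h *: (x.1 *: ((1 : R), (0 : W))) + (t * x.1, x.2) = ((h *: (1 : R) + t) * x.1, x.2).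
      apply/pair_equal_spec; split; rewrite /= ?scaler0 ?add0r// mulrDl.
      by rewrite [x.1 *: 1]mulr1 [h *: 1]mulr1.
    by rewrite /f /Jker JextE//= gt_eqF.
  apply: (is_derive_local (V := R) t0 _ d1) => y; rewrite ltr_norml => /andP[h1 h2].
  by rewrite /F ifT//; lra.
have FE : \int[@lebesgue_measure R]_(t in `[0, 1]) f t = F 1 - F 0.
  have cF (t : R) : 0 < t -> {for t, continuous F}.
    by move=> /dF[d _]; exact/differentiable_continuous/derivable1_diffP.
  rewrite /Rintegral (continuous_FTC2 (F := F) (@ltr01 R))//.
  - exact: continuous_subspaceT.
  - split; first by move=> t; rewrite in_itv/= => /andP[t0 _]; case: (dF t t0).
      rewrite /F ltxx; have [C C0 HC] := Jrad_small tG.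
      have K0 : 0 < C * (Num.sqrt x.1 * (1 + x.1)) + 1.
        by rewrite ltr_wpDl// mulr_ge0// mulr_ge0 ?sqrtr_ge0// addr_ge0// ltW.
      apply/cvgrPdist_le => e e0; near=> t.
      have t0 : 0 < t by near: t; exact: nbhs_right_gt.
      rewrite t0 sub0r normrN; apply: le_trans (HC _ _) _ => /=; first by rewrite mulr_gt0.
      have t1 : t <= 1 by near: t; exact: nbhs_right_le.
      have ht : Num.sqrt t * (C * (Num.sqrt x.1 * (1 + x.1)) + 1) <= e.
        rewrite -ler_pdivlMr//.
        rewrite -[leRHS]gtr0_norm ?(divr_gt0 e0 K0)// -sqrtr_sqr ler_wsqrtr//.
        by near: t; apply: nbhs_right_le; rewrite exprn_gt0// divr_gt0.
      apply: le_trans ht; rewrite [leRHS]mulrDr [Num.sqrt t * 1]mulr1 -[leLHS]addr0 lerD ?sqrtr_ge0//.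
      rewrite [Num.sqrt t * _]mulrCA ler_wpM2l// sqrtrM ?(ltW t0)// -mulrA ler_wpM2l ?sqrtr_ge0//.
      by rewrite ler_wpM2l ?sqrtr_ge0// lerD2l ger_pMl.
    by apply: cvg_at_left_filter; apply: cF.
  - by move=> t; rewrite in_itv/= => /andP[t0 _]; rewrite derive1E; case: (dF t t0).
have F10 : F 1 - F 0 = Jrad G x.
  by rewrite /F ltr01 ltxx mul1r -surjective_pairing subr0.
have mI : measurable (`[0, 1]%classic : set (measurableTypeR R)) by exact: measurable_itv.
rewrite -F10 -FE /idil /dilate.
have it : (@lebesgue_measure R).-integrable `[0, 1]%classic
   (EFin \o (fun t => t * Jker G (t * x.1, x.2))).
  by apply: itv_continuous_integrable; apply: continuous_mul.
have -> : \int[@lebesgue_measure R]_(t in `[0, 1]) f t =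
   x.1 * x.1 * \int[@lebesgue_measure R]_(t in `[0, 1]) (t * Jker G (t * x.1, x.2)).
  rewrite -(RintegralZl _ mI it); apply: eq_Rintegral => t _; rewrite /f; ring.
by rewrite mulrAC mulfK// gt_eqF.
Unshelve. all: by end_near. Qed.

Let reflect x : R * W := (- x.1, x.2).

Let idil_even G x : (forall y, G (reflect y) = G y) ->
  idil 0 1 id id G (reflect x) = idil 0 1 id id G x.
Proof.
move=> GE; apply: eq_Rintegral => t _; congr (_ * _); rewrite -[RHS]GE.
by rewrite /reflect /= mulrN.
Qed.

Let Jker_even G y : Jker G (reflect y) = Jker G y.
Proof.
have e1 : Jext (dh (dh G)) (reflect y) = Jext (dh (dh G)) y := Jext_even _ y.
have e2 : Jsin G (reflect y) = Jsin G y by case: y {e1} => s w; exact: cavg_even.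
exact: (f_equal2 (fun a b => a + 2 * (pi^-1 * b)) e1 e2).
Qed.

(** The derivative of Jext G in s is s times a dilation average of Jext G'' and a smooth term, and
    the derivatives along W are extensions for derivatives of G. If all extensions are C^k, all are
    therefore C^(k+1); the induction quantifies over G, since each round consumes two derivatives of
    it. *)
Theorem Jext_smooth G : tfun G -> smoothb false (Jext G).
Proof.
move=> + k; elim: k G => [|k IH] G tG.
  split=> // [|M]; first exact: Jext_continuous.
  by have [C HC] := Jext_bounded M tG; exists C => x; exact: HC.
have tgg : tfun (dh (dh G)) by do 2 apply: tfun_derive.
pose H := idil 0 1 id id (Jker G).
have Hk : Ckb false k H.
  apply: idil_Ckb => //; apply: CkbD; first exact: IH.
  by apply: CkbZ; apply: CkbZ; apply: Ckb_weaken; apply: Jsin_Ckb; exact: (tG.1 k.+2).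
have HE x : H (reflect x) = H x.
  by rewrite /H; apply: idil_even => y; exact: Jker_even.
apply: CkbS; first exact: Jext_continuous.
  by move=> M; have [C HC] := Jext_bounded M tG; exists C => x; exact: HC.
move=> v; pose h v x := v.1 * (x.1 * H x) + Jext ('D_(0, v.2) G) x.
have hk : Ckb false k (h v).
  apply: CkbD; last by apply: IH; exact: tfun_derive.
  by apply: CkbZ; apply: CkbM => //; apply: Ckb_blin; exact/blin_fst/blin_id.
exists (h v) => //.
have pos x u : 0 < x.1 -> is_derive x u (Jext G) (h u x).
  move=> x0; apply: (is_derive_local x0 (g := Jreg G)).
    move=> y; rewrite prod_normE gt_max => /andP[/= + _].
    by rewrite ltr_norml => /andP[h1 h2]; rewrite JextE// gt_eqF//; lra.
  apply: (is_derive_eq (Jreg_is_derive u tG x0)).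
  by rewrite (Jrad_integral tG x0) /h JextE// gt_eqF.
apply: removable_derive => [||x].
- exact: Jext_continuous.
- exact: Ckb_continuous hk.
(* For x.1 < 0 the formula is reflected: Jext and H are even in the first variable, and v.1 x.1 does
   not change when both signs do. *)
case: (ltgtP x.1 0) => // x0 _; last exact: pos.
have rx0 : 0 < (reflect x).1 by rewrite /= oppr_gt0.
have := pos (reflect x) (reflect v) rx0 => /is_deriveP Hd.
apply: (iffRL (is_deriveP _ _ _ _)) => e /Hd[r r0 Hr].
exists r; first exact: r0.
move=> t tr; move: (Hr t tr).
have -> : t *: reflect v + reflect x = reflect (t *: v + x).
  by apply/pair_equal_spec; split => //=; rewrite scalerN opprD.
have -> : h (reflect v) (reflect x) = h v x.
  rewrite /h HE; cbn [fst snd reflect]; rewrite mulNr [- x.1 * _]mulNr mulrN opprK.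
  by rewrite -[RHS]/(v.1 * (x.1 * H x) + Jext ('D_(0, v.2) G) x) (Jext_even _ x).
by rewrite (Jext_even G (t *: v + x)) (Jext_even G x).
Qed.

End log_smooth.

(** * Substitution, Fubini and half powers *)

Section substitution.
Context {R : realType}.
Implicit Types (a b c : R) (F f G : R -> R).
Local Notation leb := (@lebesgue_measure R).

(** G may blow up at the ends of the interval, as half powers do. The substitution is made on
    [a + d_n, b - d_n], and both sides converge by monotone convergence. *)
Lemma ge0_substitution_open F f G a b : a < b ->
  (forall x : R, is_derive x 1 F (f x)) -> continuous f ->
  (forall x, a < x < b -> 0 < f x) ->
  (forall y, F a < y < F b -> {for y, continuous G}) ->
  (forall y, F a < y < F b -> 0 <= G y) ->
  (\int[leb]_(y in `]F a, F b[) (G y)%:E = \int[leb]_(x in `]a, b[) (G (F x) * f x)%:E)%E.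
Proof.
move=> ab dF cf f0 cG G0.
have cF : continuous F.
  by move=> x; case: (dF x) => dx _; exact/differentiable_continuous/derivable1_diffP.
have F'E : derive1 F = f by apply/funext => x; rewrite derive1E; case: (dF x).
have incF x y : a <= x -> x < y -> y <= b -> F x < F y.
  move=> ax xy yb.
  have [c cxy E] := @MVT _ F f x y xy (fun z _ => dF z) (continuous_subspaceT cF).
  rewrite -subr_gt0 E mulr_gt0 ?subr_gt0// f0//.
  by move: cxy; rewrite in_itv/= => /andP[h1 h2]; rewrite (le_lt_trans ax h1) (lt_le_trans h2 yb).
pose d (n : nat) : R := (b - a) / 2 * n.+1%:R^-1.
have ba0 : 0 < (b - a) / 2 by rewrite divr_gt0// subr_gt0.
have d0 n : 0 < d n by rewrite mulr_gt0// invr_gt0.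
have dle n m : (n <= m)%N -> d m <= d n.
  by move=> nm; rewrite ler_pM2l// lef_pV2 ?posrE// ler_nat.
have dmid n : d n <= (b - a) / 2.
  by rewrite -[leRHS]mulr1 ler_pM2l// invf_le1// ler1n.
have an n : a + d n <= b - d n by move: (dmid n); lra.
have dsmall e : 0 < e -> exists n, d n < e.
  move=> e0; have /cvgrPdist_lt/(_ e e0) : (d n @[n --> \oo] --> (b - a) / 2 * 0).
    by apply: cvgM; [exact: cvg_cst|exact: cvg_harmonic].
  case=> n _ /(_ n (leqnn n)) /=; rewrite mulr0 sub0r normrN gtr0_norm// => h.
  by exists n.
pose A n : set R := `[a + d n, b - d n]%classic.
pose B n : set R := `[F (a + d n), F (b - d n)]%classic.
have AE : `]a, b[%classic = \bigcup_n A n.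
  apply/seteqP; split => x /=; rewrite in_itv/=.
    move=> /andP[ax xb].
    have [|n] := dsmall (Num.min (x - a) (b - x)); first by rewrite lt_min !subr_gt0 ax.
    by rewrite lt_min => /andP[h1 h2]; exists n => //; rewrite /A/= in_itv/=; apply/andP; split; lra.
  move=> [n _]; rewrite /A/= in_itv/= => /andP[h1 h2]; have := d0 n => h3.
  by apply/andP; split; lra.
have BE : `]F a, F b[%classic = \bigcup_n B n.
  apply/seteqP; split => y /=; rewrite in_itv/=.
    move=> /andP[ay yb].
    have /cvgrPdist_lt/(_ (y - F a)) := cF a; rewrite subr_gt0 => /(_ ay)/nbhs_ballP[r1 /= r10 H1].
    have /cvgrPdist_lt/(_ (F b - y)) := cF b; rewrite subr_gt0 => /(_ yb)/nbhs_ballP[r2 /= r20 H2].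
    have [|n] := dsmall (Num.min r1 r2); first by rewrite lt_min r10.
    rewrite lt_min => /andP[h1 h2]; exists n => //; rewrite /B/= in_itv/=; apply/andP; split.
      have := H1 (a + d n); rewrite /ball/= opprD addNKr normrN gtr0_norm// => /(_ h1).
      by rewrite ltr_norml => /andP[h3 h4]; lra.
    have := H2 (b - d n); rewrite /ball/= opprB addrC subrK gtr0_norm// => /(_ h2).
    by rewrite ltr_norml => /andP[h3 h4]; lra.
  move=> [n _]; rewrite /B/= in_itv/= => /andP[h1 h2]; have := d0 n => h3.
  have := an n => h4.
  apply/andP; split; first by apply: lt_le_trans h1; apply: incF; lra.
  by apply: le_lt_trans h2 _; apply: incF; lra.
have ndA : nondecreasing_seq A.
  move=> n m nm; apply/subsetPset => x; rewrite /A/B/= !in_itv/= => /andP[h1 h2].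
  by have := dle _ _ nm; move=> h; apply/andP; split; lra.
have incF' x y : a <= x -> x <= y -> y <= b -> F x <= F y.
  by move=> ax; rewrite le_eqVlt => /predU1P[->//|xy] yb; apply/ltW/incF.
have ndB : nondecreasing_seq B.
  move=> n m nm; apply/subsetPset => x; rewrite /A/B/= !in_itv/= => /andP[h1 h2].
  have h := dle _ _ nm; have hn := d0 n; have hm := d0 m; have hh := an n.
  apply/andP; split; first by apply: le_trans h1; apply: incF'; lra.
  by apply: le_trans h2 _; apply: incF'; lra.
have BG n y : B n y -> F a < y < F b.
  move=> By; have : `]F a, F b[%classic y by rewrite BE; exists n.
  by rewrite /= in_itv.
have AG n x : A n x -> a < x < b.
  move=> Ax; have : `]a, b[%classic x by rewrite AE; exists n.
  by rewrite /= in_itv.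
have FG x : a < x < b -> F a < F x < F b.
  by move=> /andP[h1 h2]; rewrite !incF// ltW.
have mo c c' : measurable (`]c, c'[%classic : set (measurableTypeR R)) by exact: measurable_itv.
have mG : measurable_fun (`]F a, F b[%classic : set (measurableTypeR R)) G.
  apply: open_continuous_measurable_fun; first exact: interval_open.
  by move=> y; rewrite inE/= in_itv/=; exact: cG.
have cGF x : a < x < b -> {for x, continuous (fun x => G (F x) * f x)}.
  move=> xab; apply: continuousM; last exact: cf.
  by apply: (@continuous_comp _ _ _ F G); [exact: cF|apply: cG; exact: FG].
have mGF : measurable_fun (`]a, b[%classic : set (measurableTypeR R)) (fun x => G (F x) * f x).
  apply: open_continuous_measurable_fun; first exact: interval_open.
  by move=> y; rewrite inE/= in_itv/=; exact: cGF.
have H1 : (\int[leb]_(y in B n) (G y)%:E @[n --> \oo] -->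
    \int[leb]_(y in `]F a, F b[) (G y)%:E)%E.
  rewrite BE; apply: ge0_nondecreasing_set_cvg_integral => //.
  - by move=> i; exact: measurable_itv.
  - move=> i; apply/measurable_EFinP; apply: measurable_funS mG; first exact: mo.
    by rewrite BE; exact: bigcup_sup.
  - by move=> i x Bx; rewrite lee_fin G0//; exact: BG Bx.
have H2 : (\int[leb]_(x in A n) (G (F x) * f x)%:E @[n --> \oo] -->
    \int[leb]_(x in `]a, b[) (G (F x) * f x)%:E)%E.
  rewrite AE; apply: ge0_nondecreasing_set_cvg_integral => //.
  - by move=> i; exact: measurable_itv.
  - move=> i; apply/measurable_EFinP; apply: measurable_funS mGF; first exact: mo.
    by rewrite AE; exact: bigcup_sup.
  - move=> i x Ax; have xab := AG _ _ Ax.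
    by rewrite lee_fin mulr_ge0// ?G0 ?FG// ltW// f0.
have EAB n : (\int[leb]_(y in B n) (G y)%:E = \int[leb]_(x in A n) (G (F x) * f x)%:E)%E.
  have h3 := d0 n.
  rewrite /B (@integration_by_substitution_increasing _ F G _ _ (an n)).
  - by rewrite F'E.
  - move=> x y; rewrite !in_itv/= => /andP[x1 _] /andP[_ y2] xy.
    by apply: incF => //; lra.
  - by rewrite F'E => x _; exact: cf.
  - by rewrite F'E; apply: (cvgP (f (a + d n))); apply: cvg_at_right_filter; exact: cf.
  - by rewrite F'E; apply: (cvgP (f (b - d n))); apply: cvg_at_left_filter; exact: cf.
  - split; first by move=> x _; case: (dF x).
      by apply: cvg_at_right_filter; exact: cF.
    by apply: cvg_at_left_filter; exact: cF.
  - apply: continuous_in_subspaceT => y; rewrite inE => By.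
    by apply: cG; exact: (BG n).
have H3 : (\int[leb]_(y in B n) (G y)%:E @[n --> \oo] -->
    \int[leb]_(x in `]a, b[) (G (F x) * f x)%:E)%E.
  by under eq_fun do rewrite EAB.
exact: (cvg_unique _ H1 H3).
Qed.

(** Positive and negative parts are transformed separately with extended values, so the two sides
    agree also where the integral is a conventional value. *)
Lemma substitution_open F f G a b : a < b ->
  (forall x : R, is_derive x 1 F (f x)) -> continuous f ->
  (forall x, a < x < b -> 0 < f x) ->
  (forall y, F a < y < F b -> {for y, continuous G}) ->
  \int[leb]_(y in `]F a, F b[) G y = \int[leb]_(x in `]a, b[) (G (F x) * f x).
Proof.
move=> ab dF cf f0 cG; rewrite /Rintegral; congr fine.
rewrite integralE [RHS]integralE.
have pE (H : R -> R) : ((fun x => (H x)%:E)^\+ = (fun x => (Num.max (H x) 0)%R%:E))%E.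
  by apply/funext => x; rewrite funeposE EFin_max.
have nE (H : R -> R) : ((fun x => (H x)%:E)^\- = (fun x => (Num.max (- H x) 0)%R%:E))%E.
  by apply/funext => x; rewrite funenegE EFin_max.
have cM (H : R -> R) y : {for y, continuous H} -> {for y, continuous (fun x => Num.max (H x) 0)}.
  by move=> cH; apply: continuous_max; [exact: cH|exact: cst_continuous].
rewrite !pE !nE; congr (_ - _)%E.
  rewrite (ge0_substitution_open ab dF cf f0); last 2 first.
  - by move=> y yab; apply: cM; exact: cG.
  - by move=> y _; rewrite le_max lexx orbT.
  apply: eq_integral => x; rewrite inE/= in_itv/= => xab.
  by rewrite maxr_pMl ?(ltW (f0 _ xab))// mul0r.
rewrite (ge0_substitution_open (G := fun x => Num.max (- G x) 0) ab dF cf f0); last 2 first.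
- by move=> y yab; apply: (cM (fun x => - G x)); apply: continuousN; exact: cG.
- by move=> y _; rewrite le_max lexx orbT.
apply: eq_integral => x; rewrite inE/= in_itv/= => xab.
by rewrite maxr_pMl ?(ltW (f0 _ xab))// mul0r mulNr.
Qed.

End substitution.

(** * Iterated real-valued integrals *)

Section Rintegral_fubini.
Context {R : realType} d1 d2 (T1 : measurableType d1) (T2 : measurableType d2).
Context (m1 : {sigma_finite_measure set T1 -> \bar R})
  (m2 : {sigma_finite_measure set T2 -> \bar R}).
Context (phi : T1 * T2 -> R) (a : T1 -> R).
Context (mphi : measurable_fun setT phi).
Context (ia : m1.-integrable setT (EFin \o a)).
Context (Ha : forall x, (\int[m2]_y `|phi (x, y)|%:E <= (a x)%:E)%E).

Let mE : measurable_fun setT (EFin \o phi). Proof. exact/measurable_EFinP. Qed.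

Lemma Rfubini_integrable : (m1 \x m2)%E.-integrable setT (EFin \o phi).
Proof.
apply/(integrable12ltyP m1 m2 mE).
have /integrableP[ma La] := ia.
apply: le_lt_trans La; apply: ge0_le_integral => //.
- by move=> x _; apply: integral_ge0.
- apply: (measurable_fun_fubini_tonelli_F (m2 := m2) (fun z => `|phi z|%:E)) => //.
  by apply/measurable_EFinP; exact: measurableT_comp.
- exact: measurableT_comp.
- by move=> x _ /=; apply: le_trans (Ha x) _; rewrite lee_fin ler_norm.
Qed.

Lemma Rfubini_slice x : m2.-integrable setT (fun y => (phi (x, y))%:E).
Proof.
apply/integrableP; split.
  by apply/measurable_EFinP; exact: measurableT_comp (measurable_pair1 x).
by apply: le_lt_trans (ltry (a x)); exact: Ha.
Qed.

Lemma Rfubini12 : \int[(m1 \x m2)%E]_z phi z = \int[m1]_x \int[m2]_y phi (x, y).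
Proof.
rewrite /Rintegral -(integral12_prod_meas1 Rfubini_integrable); congr fine.
apply: eq_integral => x _; rewrite /fubini_F fineK//.
exact: (integrable_fin_num measurableT (Rfubini_slice x)).
Qed.

Lemma Rfubini21 : \int[(m1 \x m2)%E]_z phi z = \int[m2]_y \int[m1]_x phi (x, y).
Proof.
rewrite /Rintegral -(integral21_prod_meas1 Rfubini_integrable); congr fine.
have mG := measurable_fubini_G Rfubini_integrable.
(* Slices in the other order are integrable only almost everywhere, and only there does [fine] agree
   with the inner integral. *)
apply: ae_eq_integral => //.
  by apply/measurable_EFinP; apply: measurableT_comp.
have := ae_integrable2 Rfubini_integrable; apply: filterS => y iy _ /=.
by rewrite fineK//; exact: (integrable_fin_num measurableT iy).
Qed.

Lemma Rfubini : \int[m1]_x \int[m2]_y phi (x, y) = \int[m2]_y \int[m1]_x phi (x, y).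
Proof. by rewrite -Rfubini12 Rfubini21. Qed.

End Rintegral_fubini.

(** * Lebesgue measure under translation and reflection *)

Section lebesgue_isometry.
Context {R : realType}.
Local Notation leb := (@lebesgue_measure R).
Local Notation mR := (measurableTypeR R).

(** Half-open intervals determine Lebesgue measure, so a map that preserves their length has
    Lebesgue measure as its image measure. *)
Lemma ge0_pushforward (phi : R -> R) (g : R -> \bar R) :
  measurable_fun setT (phi : mR -> mR) ->
  (forall a b, leb (phi @^-1` `]a, b]) = leb `]a, b]%classic) ->
  measurable_fun setT (g : mR -> \bar R) -> (forall x, 0 <= g x)%E ->
  (\int[leb]_x g (phi x) = \int[leb]_x g x)%E.
Proof.
move=> mphi H mg g0.
pose mu : {measure set mR -> \bar R} :=
  measure_function_pushforward__canonical__measure_function_Measure leb mphi.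
have E A : measurable A -> leb A = mu A.
  apply: lebesgue_measure_unique => X [[a b] _ <-] /=.
  by rewrite /mu /= /pushforward H.
rewrite [RHS](eq_measure_integral mu); last by move=> A mA _; exact: E.
by rewrite [RHS](ge0_integral_pushforward mphi)// preimage_setT.
Qed.

Lemma integrable_isometry (phi h : R -> R) :
  measurable_fun setT (phi : mR -> mR) ->
  (forall a b, leb (phi @^-1` `]a, b]) = leb `]a, b]%classic) ->
  leb.-integrable setT (EFin \o h) -> leb.-integrable setT (EFin \o (fun x => h (phi x))).
Proof.
move=> mphi H /integrableP[mh Lh]; apply/integrableP; split.
  exact: (measurableT_comp mh mphi).
by rewrite (ge0_pushforward (g := fun x => `|(h x)%:E|)%E mphi H)//; exact: measurableT_comp.
Qed.

Lemma Rintegral_pushforward (phi h : R -> R) :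
  measurable_fun setT (phi : mR -> mR) ->
  (forall a b, leb (phi @^-1` `]a, b]) = leb `]a, b]%classic) ->
  measurable_fun setT (h : mR -> R) ->
  \int[leb]_x h (phi x) = \int[leb]_x h x.
Proof.
move=> mphi H mh.
have ge g := ge0_pushforward (g := g) mphi H.
rewrite /Rintegral; congr fine; rewrite integralE [RHS]integralE; congr (_ - _)%E.
  have mp : measurable_fun setT ((fun x => (h x)%:E)^\+%E : mR -> \bar R).
    by apply: measurable_funepos; exact/measurable_EFinP.
  have := ge _ mp (fun x => funepos_ge0 _ x); apply: etrans.
  by apply: eq_integral => x _; rewrite !funeposE.
have mn : measurable_fun setT ((fun x => (h x)%:E)^\-%E : mR -> \bar R).
  by apply: measurable_funeneg; exact/measurable_EFinP.
have := ge _ mn (fun x => funeneg_ge0 _ x); apply: etrans.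
by apply: eq_integral => x _; rewrite !funenegE.
Qed.

Lemma lebesgue_shift (c a b : R) :
  leb ((fun x : R => x + c) @^-1` `]a, b]) = leb `]a, b]%classic.
Proof.
have -> : (fun x : R => x + c) @^-1` `]a, b] = `]a - c, b - c]%classic.
  by apply/seteqP; split => x; rewrite /= !in_itv/= ltrBlDr lerBrDr.
rewrite !lebesgue_measure_itv/= !lte_fin ltrD2r.
by case: ifP => // _; rewrite -!EFinD; congr EFin; ring.
Qed.

Lemma lebesgue_reflect (a b : R) :
  leb ((fun x : R => - x) @^-1` `]a, b]) = leb `]a, b]%classic.
Proof.
have -> : (fun x : R => - x) @^-1` `]a, b] = `[- b, - a[%classic.
  by apply/seteqP; split => x; rewrite /= !in_itv/= ltrNr lerNl andbC.
rewrite !lebesgue_measure_itv/= !lte_fin ltrN2.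
by case: ifP => // _; rewrite -!EFinD; congr EFin; ring.
Qed.

Let mshift (c : R) : measurable_fun setT ((fun x : R => x + c) : mR -> mR).
Proof. by apply: continuous_measurable_fun => x; apply: cvgD; [exact: cvg_id|exact: cvg_cst]. Qed.

Let mreflect : measurable_fun setT ((fun x : R => - x) : mR -> mR).
Proof. by apply: continuous_measurable_fun => x; apply: cvgN; exact: cvg_id. Qed.

Lemma Rintegral_shift (h : R -> R) (c : R) : measurable_fun setT (h : mR -> R) ->
  \int[leb]_x h (x + c) = \int[leb]_x h x.
Proof. exact: (Rintegral_pushforward (mshift c) (lebesgue_shift c)). Qed.

Lemma Rintegral_reflect (h : R -> R) : measurable_fun setT (h : mR -> R) ->
  \int[leb]_x h (- x) = \int[leb]_x h x.
Proof. exact: (Rintegral_pushforward mreflect lebesgue_reflect). Qed.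

Lemma integrable_shift (h : R -> R) (c : R) : leb.-integrable setT (EFin \o h) ->
  leb.-integrable setT (EFin \o (fun x => h (x + c))).
Proof. exact: (integrable_isometry (mshift c) (lebesgue_shift c)). Qed.

Lemma integrable_reflect (h : R -> R) : leb.-integrable setT (EFin \o h) ->
  leb.-integrable setT (EFin \o (fun x => h (- x))).
Proof. exact: (integrable_isometry mreflect lebesgue_reflect). Qed.

End lebesgue_isometry.

(** * The half-power weights *)

Section half_powers.
Context {R : realType}.
Local Notation leb := (@lebesgue_measure R).
Local Notation mR := (measurableTypeR R).
Implicit Types (p q : nat) (u s t M : R).

(* u_+^(p/2 - 1) *)
Definition hp p u : R := if 0 < u then Num.sqrt u ^+ p / u else 0.

Lemma hp_ge0 p u : 0 <= hp p u.
Proof. by rewrite /hp; case: ifP => // u0; rewrite divr_ge0 ?exprn_ge0 ?sqrtr_ge0// ltW. Qed.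

Lemma hp_eq0 p u : u <= 0 -> hp p u = 0.
Proof. by rewrite /hp leNgt => /negbTE ->. Qed.

Lemma hp_mul p s t : 0 < s -> 0 < t -> hp p (s * t) = hp p s * hp p t.
Proof.
move=> s0 t0; rewrite /hp mulr_gt0// s0 t0 sqrtrM ?(ltW s0)// exprMn invfM; ring.
Qed.

Lemma hp_add p q s : hp p s * hp q s * s = hp (p + q) s.
Proof.
rewrite /hp; case: ifP => s0; last by rewrite !mul0r.
by rewrite exprD; field; exact: lt0r_neq0.
Qed.

Lemma hp_double p k s : 0 < s -> hp (p + k.*2) s = hp p s * s ^+ k.
Proof.
move=> s0; rewrite /hp s0 exprD -mul2n exprM sqr_sqrtr ?(ltW s0)//; ring.
Qed.

Lemma hp2 s : 0 < s -> hp 2 s = 1.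
Proof. by move=> s0; rewrite /hp s0 sqr_sqrtr ?(ltW s0)// divff ?lt0r_neq0. Qed.

Lemma hp_continuous p u : 0 < u -> {for u, continuous (hp p)}.
Proof.
move=> u0; have H : {for u, continuous (fun v => Num.sqrt v ^+ p / v)}.
  apply: continuousM.
    apply: (continuous_comp (g := fun y : R => y ^+ p)); first exact: sqrt_continuous.
    exact: exprn_continuous.
  by apply: inv_continuous; rewrite gt_eqF.
apply: (continuous_local (V := R) u0 _ H) => y; rewrite ltr_norml => /andP[h1 h2].
by rewrite /hp ifT//; lra.
Qed.

Lemma hp_measurable p : measurable_fun setT (hp p : mR -> R).
Proof.
have mI : measurable (`]0, +oo[%classic : set mR) by exact: measurable_itv.
have -> : hp p = (hp p) \_ `]0, +oo[%classic.
  apply/funext => u; rewrite patchE; case: ifPn => // nu; apply: hp_eq0.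
  by move: nu; rewrite notin_setE/= in_itv/= andbT => /negP; rewrite -leNgt.
apply/(measurable_restrictT _ mI); apply: open_continuous_measurable_fun.
  exact: interval_open.
by move=> u; rewrite inE/= in_itv/= andbT; exact: hp_continuous.
Qed.

(** Under u = x^2 the measure u^(-1/2) du becomes 2 dx. *)
Lemma hp1_integrable M : 0 < M -> leb.-integrable `]0, M[%classic (EFin \o hp 1).
Proof.
move=> M0; pose K := Num.sqrt M; have K0 : 0 < K by rewrite sqrtr_gt0.
have KE : K * K = M by rewrite -expr2 sqr_sqrtr// ltW.
have mI : measurable (`]0, M[%classic : set mR) by exact: measurable_itv.
apply/integrableP; split.
  by apply/measurable_EFinP; apply: measurable_funTS; exact: hp_measurable.
have -> : (\int[leb]_(x in `]0%R, M[) `|(EFin \o hp 1) x| = \int[leb]_(x in `]0%R, M[) (hp 1 x)%:E)%E.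
  by apply: eq_integral => x _ /=; rewrite ger0_norm// hp_ge0.
have dF (x : R) : is_derive x 1 (fun x : R => x * x) (2 * x).
  have := is_deriveM (is_derive_id x 1) (is_derive_id x 1).
  by move=> H; apply: (is_derive_eq H); rewrite /GRing.scale/=; ring.
have cf : continuous (fun x : R => 2 * x).
  by apply: continuous_mul; [exact: cst_continuous|move=> x; exact: cvg_id].
have := ge0_substitution_open (G := hp 1) K0 dF cf; rewrite mul0r KE => -> //.
- rewrite (eq_integral (fun=> 2%:E)) => [|x].
    by rewrite integral_cst//= lebesgue_measure_itv/= lte_fin K0 -EFinD -EFinM ltry.
  rewrite inE/= in_itv/= => /andP[x0 _]; congr EFin.
  rewrite hp_mul// /hp x0 expr1; have := sqr_sqrtr (ltW x0).
  rewrite expr2; move: (Num.sqrt x) => r E.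
  have xn : x != 0 by exact: lt0r_neq0.
  have -> : r / x * (r / x) * (2 * x) = (r * r) / x * 2 by field.
  by rewrite E divff// mul1r.
- by move=> x /andP[x0 _]; rewrite mulr_gt0.
- by move=> y /andP[y0 _]; exact: hp_continuous.
- by move=> y _; exact: hp_ge0.
Qed.

Definition local_weight (c : R -> R) := measurable_fun setT (c : mR -> R) /\
  forall M : R, leb.-integrable `[- M, M]%classic (EFin \o c).

Lemma hp_local_weight p : (0 < p)%N -> local_weight (hp p).
Proof.
move=> p0; split=> [|M]; first exact: hp_measurable.
have mI : measurable (`[- M, M]%classic : set mR) by exact: measurable_itv.
have M1 : 0 < `|M| + 1 by rewrite ltr_wpDl.
have mJ : measurable (`]0, `|M| + 1[%classic : set mR) by exact: measurable_itv.
(* For u > 0, hp p u = (sqrt u)^(p-1) hp 1 u, and sqrt u <= 1 + |M| when u <= M. *)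
have iJ := integrableZl mJ ((1 + `|M|) ^+ p.-1) (hp1_integrable M1).
move: iJ; rewrite integrable_mkcond// => iJ; rewrite integrable_mkcond//.
apply: le_integrable iJ => //.
  apply/(measurable_restrictT _ mI); apply: measurable_funTS.
  by apply/measurable_EFinP; exact: hp_measurable.
move=> u _; rewrite !patchE; case: ifPn => [|_]; last by rewrite abse0 abse_ge0.
rewrite inE/= in_itv/= => /andP[_ uM].
have [u0|u0] := leP u 0.
  by rewrite /= (hp_eq0 p u0) normr0 abse_ge0.
rewrite mem_set; last first.
  by rewrite /= in_itv/= u0 (le_lt_trans uM)// (le_lt_trans (ler_norm M))// ltrDl.
rewrite /=; move: (normr_ge0 M) (ler_norm M); move: (`|M|) => m m0 Mm.
have m1 : 0 <= 1 + m by rewrite addr_ge0.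
rewrite lee_fin !ger0_norm ?mulr_ge0 ?exprn_ge0 ?hp_ge0//.
rewrite /hp u0 expr1 -{1}(prednK p0) exprSr -mulrA ler_wpM2r ?divr_ge0 ?sqrtr_ge0 ?(ltW u0)//.
rewrite lerXn2r ?nnegrE ?sqrtr_ge0//.
have r0 := sqrtr_ge0 u; have rE := sqr_sqrtr (ltW u0).
rewrite expr2 in rE; nra.
Qed.

End half_powers.

(** * Measurability of maps into normed spaces *)

Section continuous_measurability.
Context {R : realType}.
Local Notation mR := (measurableTypeR R).

(** Measurability of a map into a normed space on which no sigma-algebra is chosen: it is tested on
    continuous real functions. *)
Definition borel_map d (T : measurableType d) (V : normedModType R) (rho : T -> V) :=
  forall g : V -> R, continuous g -> measurable_fun setT (fun t => g (rho t)).

Lemma borel_map_id : borel_map (id : mR -> R).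
Proof. by move=> g cg; exact: continuous_measurable_fun. Qed.

(** As for Caratheodory functions: round the real coordinate down to the grid of step 1/(k+1), where
    preimages are countable unions of rectangles, and let k tend to infinity, using the continuity
    of g. *)
Lemma borel_map_pair d (T : measurableType d) (V : normedModType R) (rho : T -> V) :
  borel_map rho -> borel_map (fun z : mR * T => ((z.1, rho z.2) : R * V)).
Proof.
move=> brho g cg.
pose ap (k : nat) (x : R) : R := (Num.floor (k.+1%:R * x))%:~R / k.+1%:R.
have apx x : ap k x @[k --> \oo] --> x.
  apply/cvgrPdist_le => e e0; near=> k.
  have k0 : 0 < k.+1%:R :> R by [].
  have /andP[h1 h2] := floor_itv (k.+1%:R * x).
  have ke : k.+1%:R^-1 < e by near: k; exact: (near_infty_natSinv_lt (PosNum e0)).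
  apply: le_trans (ltW ke); rewrite /ap.
  have -> : x - (Num.floor (k.+1%:R * x))%:~R / k.+1%:R =
    (k.+1%:R * x - (Num.floor (k.+1%:R * x))%:~R) * k.+1%:R^-1 by field; rewrite gt_eqF.
  rewrite normrM [`|k.+1%:R^-1|]gtr0_norm ?invr_gt0// -[leRHS]mul1r ler_wpM2r ?invr_ge0//.
  rewrite ger0_norm ?subr_ge0//; move: h2; rewrite intrD; lra.
apply: (measurable_fun_cvg (h := fun k z => g (ap k z.1, rho z.2))); last first.
  move=> z _; have cz : {for (z.1, rho z.2), continuous g} by exact: cg.
  have cc : ((ap k z.1, rho z.2) : R * V) @[k --> \oo] --> ((z.1, rho z.2) : R * V).
    apply: (@cvg_pair _ _ _ (nbhs \oo) (nbhs z.1) (nbhs (rho z.2))); [exact: apx|exact: cvg_cst].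
  exact: (cvg_comp _ _ cc cz).
move=> k _ Y mY; rewrite setTI.
have -> : (fun z : mR * T => g (ap k z.1, rho z.2)) @^-1` Y =
  \bigcup_(m : int) ([set x : mR | Num.floor (k.+1%:R * x) = m] `*`
     [set t | Y (g (m%:~R / k.+1%:R, rho t))]).
  apply/seteqP; split => [z /= Yz|z [m _ /= [<-]]//].
  by exists (Num.floor (k.+1%:R * z.1)).
apply: countable_bigcupT_measurable; first exact: countableP.
move=> m; apply: measurableX.
  have -> : [set x : mR | Num.floor (k.+1%:R * x) = m] =
      `[m%:~R / k.+1%:R, (m + 1)%:~R / k.+1%:R[%classic.
    apply/seteqP; split => x /=; rewrite in_itv/= ler_pdivrMr// ltr_pdivlMr// mulrC.
      by move=> <-; exact: floor_itv.
    by move=> h; apply: floor_def.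
  exact: measurable_itv.
have cm : continuous (fun v : V => g (m%:~R / k.+1%:R, v)).
  apply: (continuous_app cg); apply: continuous_mkpair; [exact: cst_continuous|].
  by move=> v; exact: cvg_id.
by have := brho _ cm measurableT _ mY; rewrite setTI.
Unshelve. all: by end_near. Qed.

Lemma borel_map_comp d (T : measurableType d) (V V' : normedModType R) (rho : T -> V)
  (L : V -> V') : continuous L -> borel_map rho -> borel_map (fun t => L (rho t)).
Proof. by move=> cL br g cg; exact: (br _ (continuous_app cg cL)). Qed.

Lemma borel_map_precomp d d' (T : measurableType d) (T' : measurableType d')
  (V : normedModType R) (rho : T -> V) (j : T' -> T) :
  measurable_fun setT j -> borel_map rho -> borel_map (fun t => rho (j t)).
Proof. by move=> mj br g cg; exact: (measurableT_comp (br _ cg) mj). Qed.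

End continuous_measurability.

(** * Fubini under a majorant in product form *)

Section dominated_fubini.
Context {R : realType} d1 d2 (T1 : measurableType d1) (T2 : measurableType d2).
Context (m1 : {sigma_finite_measure set T1 -> \bar R})
  (m2 : {sigma_finite_measure set T2 -> \bar R}).
Context (phi : T1 * T2 -> R) (a : T1 -> R) (b : T2 -> R).
Context (mphi : measurable_fun setT phi).
Context (ia : m1.-integrable setT (EFin \o a)).
Context (ib : m2.-integrable setT (EFin \o b)).
Context (Hab : forall x y, `|phi (x, y)| <= a x * b y).

Lemma dominated_bound : exists2 a', m1.-integrable setT (EFin \o a') &
  forall x, (\int[m2]_y `|phi (x, y)|%:E <= (a' x)%:E)%E.
Proof.
pose B := \int[m2]_y `|b y|; exists (fun x => `|a x| * B).
  by apply: eq_integrable (integrableZr measurableT B (integrable_abse ia)).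
move=> x; have nb : m2.-integrable setT (EFin \o (fun y => `|b y|)).
  by apply: eq_integrable (integrable_abse ib).
rewrite EFinM /B /Rintegral fineK; last exact: (integrable_fin_num measurableT nb).
rewrite -(integralZl measurableT nb); apply: ge0_le_integral => //.
- by apply/measurable_EFinP; apply: measurableT_comp => //; exact: measurableT_comp (measurable_pair1 x).
- apply/measurable_EFinP/measurable_funM; first exact: measurable_cst.
  by apply/measurable_EFinP; have /integrableP[] := nb.
- move=> y _; rewrite /= lee_fin (le_trans (Hab x y))// (le_trans (ler_norm _))//.
  by rewrite normrM.
Qed.

Lemma dominated_integrable : (m1 \x m2)%E.-integrable setT (EFin \o phi).
Proof. by have [a' ia' Ha'] := dominated_bound; exact: (Rfubini_integrable mphi ia' Ha'). Qed.

Lemma dominated_fubini12 : \int[(m1 \x m2)%E]_z phi z = \int[m1]_x \int[m2]_y phi (x, y).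
Proof. by have [a' ia' Ha'] := dominated_bound; exact: (Rfubini12 mphi ia' Ha'). Qed.

Lemma dominated_fubini21 : \int[(m1 \x m2)%E]_z phi z = \int[m2]_y \int[m1]_x phi (x, y).
Proof. by have [a' ia' Ha'] := dominated_bound; exact: (Rfubini21 mphi ia' Ha'). Qed.

Lemma dominated_fubini : \int[m1]_x \int[m2]_y phi (x, y) = \int[m2]_y \int[m1]_x phi (x, y).
Proof. by rewrite -dominated_fubini12 dominated_fubini21. Qed.

End dominated_fubini.

(** * Integrals against locally integrable weights *)

Section weighted_integrals.
Context {R : realType}.
Local Notation leb := (@lebesgue_measure R).
Local Notation mR := (measurableTypeR R).
Implicit Types (c d : R -> R).

Lemma cutoff_integrable c (h : R -> R) (M : R) : local_weight c ->
  measurable_fun setT (h : mR -> R) -> (forall u, M < `|u| -> h u = 0) ->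
  (exists C, forall u, `|h u| <= C) -> leb.-integrable setT (EFin \o (fun u => c u * h u)).
Proof.
move=> [mc ic] mh hM [C hC].
have mI : measurable (`[- M, M]%classic : set mR) by exact: measurable_itv.
have := integrableZl mI C (ic M); rewrite integrable_mkcond// => iI.
have C0 : 0 <= C by exact: le_trans (hC 0).
apply: (le_integrable measurableT _ _ iI).
  by apply/measurable_EFinP; exact: measurable_funM.
move=> u _; rewrite !patchE; case: ifPn => [_|].
  by rewrite /= lee_fin !normrM mulrC ler_wpM2r// (ger0_norm C0).
rewrite notin_setE/= in_itv/= => /negP uM.
have h0 : h u = 0 by apply: hM; rewrite ltNge ler_norml.
by rewrite /= h0 mulr0 !normr0.
Qed.

Lemma cst_local_weight (k : R) : local_weight (fun=> k).
Proof.
split=> [|M]; first exact: measurable_cst.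
by apply: itv_continuous_integrable; exact: cst_continuous.
Qed.

Lemma hp_weight p : (0 < p)%N -> local_weight (@hp R p).
Proof. exact: hp_local_weight. Qed.

Lemma shift_local_weight c (k : R) : local_weight c -> local_weight (fun u => c (u + k)).
Proof.
move=> [mc ic]; have mk : measurable_fun setT ((fun u => u + k) : mR -> mR).
  by apply: continuous_measurable_fun => x; apply: cvgD; [exact: cvg_id|exact: cvg_cst].
split=> [|M]; first exact: (measurableT_comp mc mk).
have mI (a b : R) : measurable (`[a, b]%classic : set mR) by exact: measurable_itv.
have := ic (`|M| + `|k|); rewrite integrable_mkcond// => i1.
have i1' : leb.-integrable setT (EFin \o (c \_ `[- (`|M| + `|k|), `|M| + `|k|])).
  by apply: eq_integrable i1 => // u _; rewrite /= !patchE; case: ifP.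
have := integrable_shift k i1'; move=> i2.
apply: (@le_integrable _ _ _ leb _ (mI _ _) _ _ _ _ (integrableS measurableT (mI _ _) (@subsetT _ _) i2)).
  by apply: measurable_funTS; apply/measurable_EFinP; exact: (measurableT_comp mc mk).
move=> u /=; rewrite in_itv/= => /andP[u1 u2]; rewrite patchE ifT// inE/= in_itv/=.
have /andP[k1 k2] : - `|k| <= k <= `|k| by rewrite -ler_norml.
by have := ler_norm M; move=> MM; apply/andP; split; lra.
Qed.

Lemma reflect_local_weight c : local_weight c -> local_weight (fun u => c (- u)).
Proof.
move=> [mc ic]; have mk : measurable_fun setT ((fun u => - u) : mR -> mR).
  by apply: continuous_measurable_fun => x; apply: cvgN; exact: cvg_id.
split=> [|M]; first exact: (measurableT_comp mc mk).
have mI : measurable (`[- M, M]%classic : set mR) by exact: measurable_itv.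
have := ic M; rewrite integrable_mkcond// => i1; rewrite integrable_mkcond//.
have i1' : leb.-integrable setT (EFin \o (fun u => if u \in `[- M, M]%classic then c u else 0)).
  by apply: eq_integrable i1 => // u _; rewrite /= !patchE; case: ifP.
apply: eq_integrable (integrable_reflect i1') => // u _.
have E : (- u \in `[- M, M]%classic) = (u \in `[- M, M]%classic).
  by apply/idP/idP; rewrite !inE/= !in_itv/= => /andP[? ?]; apply/andP; split; lra.
by rewrite patchE /= E; case: ifP.
Qed.

Lemma Rintegral_cut (h : R -> R) (M : R) : (forall u, M < `|u| -> h u = 0) ->
  \int[leb]_u h u = \int[leb]_(u in `[- M, M]) h u.
Proof.
move=> hM; rewrite [RHS]Rintegral_mkcond; apply: eq_Rintegral => u _; rewrite patchE.
case: ifPn => //; rewrite notin_setE/= in_itv/= => /negP uM.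
have -> // : h u = 0.
by apply: hM; rewrite ltNge ler_norml.
Qed.

Lemma Rintegral_half (h : R -> R) (L : R) :
  (forall u, L <= u -> h u = 0) -> (forall u, u <= 0 -> h u = 0) ->
  \int[leb]_u h u = \int[leb]_(u in `]0, L[) h u.
Proof.
move=> hL h0; rewrite [RHS]Rintegral_mkcond; apply: eq_Rintegral => u _; rewrite patchE.
case: ifPn => //; rewrite notin_setE/= in_itv/= => /negP; rewrite negb_and -!leNgt.
by case/orP => [/h0|/hL] ->.
Qed.

Lemma weight_swap c d (h : R * R -> R) (M : R) : local_weight c -> local_weight d ->
  continuous h -> (forall x, M < `|x| -> h x = 0) -> (exists C, forall x, `|h x| <= C) ->
  \int[leb]_u (c u * \int[leb]_v (d v * h (u, v))) =
  \int[leb]_v (d v * \int[leb]_u (c u * h (u, v))).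
Proof.
move=> wc wd ch hM [C hC]; have C0 : 0 <= C by exact: le_trans (hC 0).
have [mc ic] := wc; have [md id_] := wd.
have mI : measurable (`[- M, M]%classic : set mR) by exact: measurable_itv.
have mh : measurable_fun setT (h : mR * mR -> R).
  rewrite (_ : h = (fun z => h (z.1, id z.2))); last by apply/funext => -[].
  exact: (borel_map_pair (@borel_map_id R) ch).
have hu u : measurable_fun setT ((fun v => h (u, v)) : mR -> R).
  exact: measurableT_comp mh (measurable_pair1 u).
have hv v : measurable_fun setT ((fun u => h (u, v)) : mR -> R).
  exact: measurableT_comp mh (measurable_pair2 v).
have hM1 u v : M < `|u| -> h (u, v) = 0.
  by move=> Mu; apply: hM; rewrite prod_normE/= lt_max Mu.
have hM2 u v : M < `|v| -> h (u, v) = 0.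
  by move=> Mv; apply: hM; rewrite prod_normE/= lt_max Mv orbT.
pose phi (z : mR * mR) : R := c z.1 * (d z.2 * h z).
have indM : measurable_fun setT (\1_(`[- M, M]%classic) : mR -> R) by exact: measurable_indic.
have i1 (e : R -> R) : local_weight e ->
    leb.-integrable setT (EFin \o (fun u => `|e u * \1_(`[- M, M]%classic) u|)).
  move=> we; apply: eq_integrable (integrable_abse (cutoff_integrable (M := M) we indM _ _)) => //.
    move=> u Mu; rewrite indicE memNset//= in_itv/= -ler_norml; apply/negP.
    by rewrite -ltNge.
  by exists 1 => u; rewrite indicE; case: (_ \in _); rewrite ?normr1 ?normr0.
transitivity (\int[leb]_u \int[leb]_v phi (u, v)).
  apply: eq_Rintegral => u _; rewrite /phi/= RintegralZl//.
  apply: (cutoff_integrable wd (hu u) (hM2 u)); by exists C.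
transitivity (\int[leb]_v \int[leb]_u phi (u, v)); last first.
  apply: eq_Rintegral => v _; rewrite /phi/=.
  rewrite -RintegralZl//; last by apply: (cutoff_integrable wc (hv v) (fun u => @hM1 u v)); exists C.
  by apply: eq_Rintegral => u _; ring.
apply: (@dominated_fubini _ _ _ _ _ leb leb phi (fun u => `|c u * \1_(`[- M, M]%classic) u|)
   (fun v => C * `|d v * \1_(`[- M, M]%classic) v|)).
- apply: measurable_funM; first exact: measurableT_comp.
  by apply: measurable_funM mh; exact: measurableT_comp.
- exact: i1.
- exact: (integrableZl measurableT C (i1 d wd)).
move=> u v; rewrite /phi/= !indicE.
have [Mu|uM] := ltP M `|u|; first by rewrite hM1// !mulr0 normr0 mulr_ge0// mulr_ge0.
have [Mv|vM] := ltP M `|v|; first by rewrite hM2// !mulr0 normr0 mulr_ge0// mulr_ge0.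
rewrite !mem_set/= ?in_itv/= -?ler_norml// !mulr1 !normrM.
by rewrite ler_wpM2l// mulrC ler_wpM2r.
Qed.

(** * Pushing half-power weights forward *)

Section parametric.
Context {W : normedModType R}.

Lemma tfun_blin (V V' : normedModType R) (L : V -> V') (K : R) (f : V' -> R) :
  blin L -> (forall x, `|x| <= K * `|L x|) -> tfun f -> tfun (fun x => f (L x)).
Proof.
move=> Ll LK [sf bf]; split=> [k|]; first exact: Ckb_comp_lin.
exact: bsupp_comp LK bf.
Qed.

(** The variable x.1 is dilated and also occurs undilated, as a parameter. Separating the two roles
    gives a dilation on R * (R * W), which is then restricted to the diagonal. *)
Lemma dilate_diag_tfun (a b : R) (c : R -> R) (f : R * (R * W) -> R) :
  leb.-integrable `[a, b]%classic (EFin \o c) -> tfun f ->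
  tfun (fun x : R * W => \int[leb]_(t in `[a, b]) (c t * f (t * x.1, x))).
Proof.
move=> ic tf; have [M M0 fM] := tfun_supp tf.
have mI : measurable (`[a, b]%classic : set mR) by exact: measurable_itv.
have idc : continuous (id : R -> R) by move=> ?; exact: cvg_id.
split=> [k|]; last first.
  exists M => x Mx; rewrite (_ : (fun t => _) = (fun=> 0)) ?Rintegral_zero//.
  by apply/funext => t; rewrite fM ?mulr0// prod_normE lt_max Mx orbT.
have mom : moments leb `[a, b]%classic id c.
  move=> m; have [K HK] := itv_bounded a b (@exprn_continuous R m).
  have := integrableZl mI K ic; apply: (le_integrable mI).
    have /integrableP[/measurable_EFinP mc _] := ic.
    apply/measurable_EFinP; apply: measurable_funM mc _.
    apply: measurable_funTS; apply: continuous_measurable_fun; exact: exprn_continuous.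
  move=> t It; rewrite /= lee_fin !normrM mulrC ler_wpM2r//.
  by rewrite (le_trans (HK t It))// ler_norm.
have mid : measurable_fun `[a, b]%classic (id : mR -> R) by exact: measurable_id.
have H : Ckb true k (dilate leb `[a, b]%classic id c f).
  by apply: dilate_Ckb => //; [right; exact: itv_bounded|exact: tf.1].
have Ll : blin (fun x : R * W => (x.1, x)) by apply: blin_pair; [exact/blin_fst/blin_id|exact: blin_id].
exact: (Ckb_comp_lin Ll H).
Qed.

Lemma weight_tfun c (f : R * W -> R) : local_weight c -> tfun f ->
  tfun (fun w : W => \int[leb]_u (c u * f (u, w))).
Proof.
move=> [mc ic] tf; have [M M0 fM] := tfun_supp tf.
have fM1 u w : M < `|u| -> f (u, w) = 0.
  by move=> Mu; apply: fM; rewrite prod_normE/= lt_max Mu.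
have fM2 u w : M < `|w| -> f (u, w) = 0.
  by move=> Mu; apply: fM; rewrite prod_normE/= lt_max Mu orbT.
have mI : measurable (`[- M, M]%classic : set mR) by exact: measurable_itv.
have idc : continuous (id : R -> R) by move=> ?; exact: cvg_id.
split=> [k|]; last first.
  exists M => w Mw; rewrite (_ : (fun t => _) = (fun=> 0)) ?Rintegral_zero//.
  by apply/funext => t; rewrite fM2 ?mulr0.
have mom : moments leb `[- M, M]%classic id c.
  move=> m; have [K HK] := itv_bounded (- M) M (@exprn_continuous R m).
  have := integrableZl mI K (ic M); apply: (le_integrable mI).
    apply/measurable_EFinP; apply: measurable_funTS; apply: measurable_funM mc _.
    by apply: continuous_measurable_fun; exact: exprn_continuous.
  move=> t It; rewrite /= lee_fin !normrM mulrC ler_wpM2r//.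
  by rewrite (le_trans (HK t It))// ler_norm.
have mid : measurable_fun `[- M, M]%classic (id : mR -> R) by exact: measurable_id.
have H : Ckb true k (dilate leb `[- M, M]%classic id c f).
  by apply: dilate_Ckb => //; [right; exact: itv_bounded|exact: tf.1].
have Ll : blin (fun w : W => ((0 : R), w)) by apply: blin_pair; [exact: blin_zero|exact: blin_id].
(* With the dilated variable frozen at 1 the dilation t * 1 is the integration variable itself. *)
have := Ckb_comp_blin ((1 : R), (0 : W)) Ll H.
set f1 := (fun _ => _); set f2 := (fun _ => _); have -> // : f2 = f1.
apply/funext => w; rewrite /f1 /f2; rewrite (Rintegral_cut (M := M)).
  by rewrite /dilate; apply: eq_Rintegral => t _ /=; rewrite addr0 mulr1 add0r.
by move=> u Mu; rewrite fM1 ?mulr0.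
Qed.

(* Whitney's theorem turns the integral of f against F(x^2) into one against F(u) u^(-1/2). *)
Lemma square_pushforward (f : R * W -> R) : tfun f -> exists2 g : R * W -> R, tfun g &
  forall (F : R -> R) w, continuous F ->
    \int[leb]_x (F (x ^+ 2) * f (x, w)) = \int[leb]_u (hp 1 u * (F u * g (u, w))).
Proof.
move=> tf; pose refl (x : R * W) : R * W := (- x.1, x.2).
have lr : blin refl.
  by apply: blin_pair; [exact/blin_opp/blin_fst/blin_id|exact/blin_snd/blin_id].
have tr : tfun (fun x => f (refl x)).
  by apply: (tfun_blin lr (K := 1)) => // x; rewrite mul1r !prod_normE/= normrN.
have te := tfunZ 2^-1 (tfunD tf tr).
have [|g tg gE] := whitney_even te.
  by move=> x w; rewrite /refl/= opprK addrC.
exists g => // F w cF; have [M M0 gM] := tfun_supp tg; have [N N0 fN] := tfun_supp tf.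
have [C C0 fC] := tfun_bounded tf.
have cid : continuous (id : R -> R) by move=> ?; exact: cvg_id.
have csq : continuous (fun x : R => x ^+ 2) by exact: exprn_continuous.
have cFs : continuous (fun x : R => F (x ^+ 2)) := continuous_app cF csq.
have cfw : continuous (fun x : R => f (x, w)).
  apply: (continuous_app (tfun_continuous tf)); apply: continuous_mkpair => //.
  exact: cst_continuous.
have cgw : continuous (fun u : R => g (u, w)).
  apply: (continuous_app (tfun_continuous tg)); apply: continuous_mkpair => //.
  exact: cst_continuous.
pose Phi x := F (x ^+ 2) * f (x, w).
have cPhi : continuous Phi by exact: continuous_mul.
pose Psi x := F (x ^+ 2) * g (x ^+ 2, w).
have cPsi : continuous Psi.
  by apply: continuous_mul => //; exact: (continuous_app cgw csq).
have cPhiN : continuous (fun x => Phi (- x)).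
  by apply: (continuous_app cPhi) => x; apply: cvgN; exact: cvg_id.
have PsiE x : 2 * Psi x = Phi x + Phi (- x).
  by rewrite /Psi/Phi sqrrN -mulrDr -gE mulrCA mulVKf.
(* K > N and K^2 > M, so ]- K, K[ exhausts the integral in x while its image ]0, K^2[ exhausts the
   integral in u. *)
pose K := Num.sqrt (Num.max M (N ^+ 2) + 1).
have K2 : K * K = Num.max M (N ^+ 2) + 1.
  by rewrite -expr2 sqr_sqrtr// addr_ge0// le_max M0.
have K0 : 0 < K by rewrite sqrtr_gt0 ltr_wpDl// le_max M0.
have MK : M < K * K by rewrite K2 ltr_pwDr// le_max lexx.
have NK : N < K.
  rewrite ltNge; apply/negP => KN; have : K * K <= N * N by rewrite ler_pM// ltW.
  by rewrite leNgt K2 => /negP; apply; rewrite ltr_pwDr// le_max -expr2 lexx orbT.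
have mo (a b : R) : measurable (`]a, b[%classic : set mR) by exact: measurable_itv.
have mc (a b : R) : measurable (`[a, b]%classic : set mR) by exact: measurable_itv.
have dF (x : R) : is_derive x 1 (fun x : R => x * x) (2 * x).
  have := is_deriveM (is_derive_id x 1) (is_derive_id x 1).
  by move=> H; apply: (is_derive_eq H); rewrite /GRing.scale/=; ring.
have cf2 : continuous (fun x : R => 2 * x) by apply: continuous_mul => //; exact: cst_continuous.
have cut (h : R -> R) (L : R) : 0 <= L -> (forall u, L <= `|u| -> h u = 0) ->
    \int[leb]_u h u = \int[leb]_(u in `]- L, L[) h u.
  move=> L0 hL; rewrite [RHS]Rintegral_mkcond; apply: eq_Rintegral => u _; rewrite patchE.
  case: ifPn => //; rewrite notin_setE/= in_itv/= -ltr_norml => /negP.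
  by rewrite -leNgt => /hL.
have icont (h : R -> R) (a b : R) : continuous h -> leb.-integrable `]a, b[%classic (EFin \o h).
  move=> chh; apply: (integrableS (mc a b) (mo a b)).
    by move=> u /=; rewrite !in_itv/= => /andP[? ?]; apply/andP; split; exact: ltW.
  exact: itv_continuous_integrable.
rewrite (Rintegral_half (h := fun u => hp 1 u * (F u * g (u, w))) (L := K * K)); first last.
- by move=> u u0; rewrite hp_eq0// mul0r.
- move=> u Ku; rewrite gM ?mulr0// prod_normE/= lt_max.
  by rewrite (lt_le_trans MK)// (le_trans Ku)// ler_norm.
have := substitution_open (F := fun x : R => x * x) (f := fun x => 2 * x)
  (G := fun u => hp 1 u * (F u * g (u, w))) K0 dF cf2; rewrite mulr0 => ->.
- rewrite (cut Phi K (ltW K0)); last first.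
    move=> u Ku; rewrite /Phi fN ?mulr0// prod_normE/= lt_max.
    by rewrite (lt_le_trans NK).
  have -> : \int[leb]_(u in `]- K, K[) Phi u = \int[leb]_(u in `]0, K[) (Phi u + Phi (- u)).
    rewrite (RintegralD (mo 0 K) (icont _ _ _ cPhi) (icont _ _ _ cPhiN)).
    rewrite addrC.
    have -> : \int[leb]_(u in `]0, K[) Phi (- u) = \int[leb]_(u in `]- K, 0[) Phi u.
      rewrite Rintegral_mkcond [RHS]Rintegral_mkcond.
      rewrite -(Rintegral_reflect (h := Phi \_ `]- K, 0[)).
        apply: eq_Rintegral => u _; rewrite !patchE.
        have -> // : (- u \in `]- K, 0[%classic) = (u \in `]0, K[%classic).
        by apply/idP/idP; rewrite !inE/= !in_itv/= => /andP[? ?]; apply/andP; split; lra.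
      apply/(measurable_restrictT _ (mo (- K) 0)); apply: measurable_funTS.
      exact: continuous_measurable_fun.
    have -> : \int[leb]_(u in `]- K, 0[) Phi u = \int[leb]_(u in `]- K, 0]) Phi u.
      by apply: Rintegral_itv_bndo_bndc; exact: icont.
    have UE : `]- K, K[%classic = `]- K, 0] `|` `]0, K[ :> set R.
      apply/seteqP; split => u /=; rewrite !in_itv/=.
        by move=> /andP[u1 u2]; have [u0|u0] := leP u 0; [left; rewrite u1|right].
      by case=> /andP[u1 u2]; apply/andP; split; lra.
    rewrite UE Rintegral_setU//.
    - by rewrite -UE; exact: icont.
    - rewrite disj_set2E; apply/eqP/seteqP; split => // u [].
      rewrite /= !in_itv/= => /andP[_ u0] /andP[u1 _].
      by exfalso; move: u1; rewrite ltNge u0.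
  apply: eq_Rintegral => x; rewrite inE/= in_itv/= => /andP[x0 _].
  rewrite -PsiE /Psi hp_mul// /hp x0 expr1 expr2.
  have := sqr_sqrtr (ltW x0); rewrite expr2; move: (Num.sqrt x) (F _) (g _) => r A B E.
  have xn : x != 0 by exact: lt0r_neq0.
  have -> : r / x * (r / x) * (A * B) * (2 * x) = (r * r) / x * 2 * (A * B) by field.
  by rewrite E divff// mul1r; ring.
- by move=> x /andP[x0 _]; rewrite mulr_gt0.
- move=> y /andP[y0 _]; apply: continuousM; first exact: hp_continuous.
  by apply: continuousM; [exact: cF|exact: cgw].
Qed.

End parametric.
End weighted_integrals.

(** * Convolution of two half powers *)

Section beta_convolution.
Context {R : realType} {W : normedModType R}.
Local Notation leb := (@lebesgue_measure R).
Local Notation mR := (measurableTypeR R).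

Lemma borel_plane (h : R * R -> R) : continuous h -> measurable_fun setT (h : mR * mR -> R).
Proof.
move=> ch; rewrite (_ : h = (fun z => h (z.1, id z.2))); last by apply/funext => -[].
exact: (borel_map_pair (@borel_map_id R) ch).
Qed.

Lemma hp_small p (u : R) : u <= 1 -> 2^-1 <= u -> hp p u <= 2.
Proof.
move=> u1 u2; have u0 : 0 < u by apply: lt_le_trans u2; rewrite invr_gt0.
rewrite /hp u0 ler_pdivrMr// (@le_trans _ _ 1)//; last first.
  by rewrite mulrC -ler_pdivrMr// mul1r.
rewrite exprn_ile1// ?sqrtr_ge0// -[leRHS]sqrtr1 ler_wsqrtr//.
Qed.

(** One of t and 1 - t is at least 1/2, where its half power is at most 2; the product is thus
    bounded by twice the sum of the factors. *)
Lemma beta_integrable p q : (0 < p)%N -> (0 < q)%N ->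
  leb.-integrable `[0, 1]%classic (EFin \o (fun t : R => hp p t * hp q (1 - t))).
Proof.
move=> p0 q0; have mI : measurable (`[0, 1]%classic : set mR) by exact: measurable_itv.
have m1 : measurable_fun setT ((fun t : R => 1 - t) : mR -> mR).
  by apply: continuous_measurable_fun => x; apply: cvgB; [exact: cvg_cst|exact: cvg_id].
have wq : local_weight (fun t : R => hp q (1 - t)).
  have := shift_local_weight (- 1) (reflect_local_weight (@hp_weight R _ q0)).
  by congr local_weight; apply/funext => t; rewrite opprD opprK addrC.
have sub c : local_weight c -> leb.-integrable `[0, 1]%classic (EFin \o c).
  move=> [_ ic]; apply: (integrableS _ mI _ (ic 1)); first exact: measurable_itv.
  by move=> t /=; rewrite !in_itv/= => /andP[? ?]; apply/andP; split; lra.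
have i1 := integrableZl mI 2 (sub _ (@hp_weight R _ p0)).
have i2 := integrableZl mI 2 (sub _ wq).
apply: (le_integrable mI _ _ (integrableD mI i1 i2)).
  apply/measurable_EFinP; apply: measurable_funTS; apply: measurable_funM.
    exact: hp_measurable.
  by case: wq.
move=> t /=; rewrite in_itv/= => /andP[t0 t1].
have a0 := hp_ge0 p t; have b0 := hp_ge0 q (1 - t).
rewrite lee_fin !ger0_norm ?mulr_ge0 ?addr_ge0 ?mulr_ge0//.
have [th|th] := leP t 2^-1.
  have : hp q (1 - t) <= 2 by apply: hp_small; lra.
  by move: a0 b0; move: (hp p t) (hp q _) => a b; clear; nra.
have : hp p t <= 2 by apply: hp_small => //; exact: ltW.
by move: a0 b0; move: (hp p t) (hp q _) => a b; clear; nra.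
Qed.

(* Fubini in the coordinates (s, v) with u = s + e v. *)
Lemma weight_shear (c d : R -> R) (e : R) (h : R * R -> R) (M : R) :
  local_weight c -> local_weight d -> (forall u, 0 <= c u) -> (forall u, 0 <= d u) ->
  continuous h -> (forall x, M < `|x| -> h x = 0) -> (exists2 D, 0 <= D & forall x, `|h x| <= D) ->
  \int[leb]_u (c u * \int[leb]_v (d v * h (u, v))) =
  \int[leb]_s \int[leb]_v (d v * (c (s + e * v) * h (s + e * v, v))).
Proof.
move=> w1 wp c0 d0 ch hM [D D0 hD].
have mh := borel_plane ch.
have mm1 : measurable_fun setT (c : mR -> R) by case: w1.
have mmp : measurable_fun setT (d : mR -> R) by case: wp.
rewrite (weight_swap w1 wp ch hM); last by exists D.
pose phi (z : mR * mR) := d z.1 * (c (z.2 + e * z.1) * h (z.2 + e * z.1, z.1)).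
have hv v : measurable_fun setT ((fun u => h (u, v)) : mR -> R).
  exact: measurableT_comp mh (measurable_pair2 v).
have mhv v : measurable_fun setT ((fun u => c u * h (u, v)) : mR -> R).
  exact: measurable_funM.
have hM1 u v : M < `|u| -> h (u, v) = 0.
  by move=> Mu; apply: hM; rewrite prod_normE/= lt_max Mu.
have ihv v : leb.-integrable setT (EFin \o (fun u => c u * h (u, v))).
  by apply: (cutoff_integrable w1 (hv v) (fun u => @hM1 u v)); exists D.
transitivity (\int[leb]_v \int[leb]_s phi (v, s)).
  apply: eq_Rintegral => v _; rewrite -(Rintegral_shift (e * v) (mhv v)) /phi/=.
  by rewrite RintegralZl//; exact: (integrable_shift (e * v) (ihv v)).
pose i1 := fun u : R => c u * \1_(`[- M, M]%classic) u.
have mI : measurable (`[- M, M]%classic : set mR) by exact: measurable_itv.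
have mind : measurable_fun setT (\1_(`[- M, M]%classic) : mR -> R) by exact: measurable_indic.
have ind0 u : M < `|u| -> \1_(`[- M, M]%classic) u = 0 :> R.
  move=> Mu; rewrite indicE memNset//= in_itv/= -ler_norml; apply/negP.
  by rewrite -ltNge.
have ind1 u : `|u| <= M -> \1_(`[- M, M]%classic) u = 1 :> R.
  by move=> uM; rewrite indicE mem_set//= in_itv/= -ler_norml.
have indb u : `|\1_(`[- M, M]%classic) u| <= 1 :> R.
  by rewrite indicE; case: (_ \in _); rewrite ?normr1 ?normr0.
have ii k : local_weight k -> leb.-integrable setT (EFin \o (fun u => k u * \1_(`[- M, M]%classic) u)).
  by move=> we; apply: (cutoff_integrable we mind ind0); exists 1.
pose B := \int[leb]_u (c u * \1_(`[- M, M]%classic) u).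
have ia : leb.-integrable setT (EFin \o (fun v => (D * B) * (d v * \1_(`[- M, M]%classic) v))).
  exact: (integrableZl measurableT _ (ii _ wp)).
rewrite (@Rfubini _ _ _ _ _ leb leb phi _ _ ia); last 2 first.
- have d21 : continuous (fun z : R * R => z.2 + e * z.1).
    by move=> z; apply: cvgD; [exact: cvg_snd|apply: cvgM; [exact: cvg_cst|exact: cvg_fst]].
  apply: measurable_funM; first exact: measurableT_comp.
  apply: measurable_funM; first exact: measurableT_comp mm1 (borel_plane d21).
  apply: (borel_plane (h := fun z => h (z.2 + e * z.1, z.1))).
  by apply: (continuous_app ch); apply: continuous_mkpair => // z; exact: cvg_fst.
- move=> v; rewrite /phi/=.
  have iD := integrableZl measurableT D (ii _ w1).
  have -> : ((D * B) * (d v * \1_(`[- M, M]%classic) v))%:E =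
     ((d v * \1_(`[- M, M]%classic) v)%:E * (D%:E * \int[leb]_u (c u * \1_(`[- M, M]%classic) u)%:E))%E.
    rewrite /B /Rintegral -[in RHS](fineK (integrable_fin_num measurableT (ii _ w1))) -!EFinM.
    by congr EFin; rewrite mulrC.
  rewrite -(integralZl measurableT (ii _ w1)).
  rewrite -(ge0_pushforward (g := fun s => (D%:E * (c s * \1_(`[- M, M]%classic) s)%:E)%E)
    (phi := fun s => s + e * v)); first last.
  - by move=> s; rewrite -EFinM lee_fin mulr_ge0// mulr_ge0 ?c0// indicE ler0n.
  - by have /integrableP[] := iD.
  - exact: lebesgue_shift.
  - by apply: continuous_measurable_fun => x; apply: cvgD; [exact: cvg_id|exact: cvg_cst].
  have [vM|Mv] := leP `|v| M; last first.
    rewrite ind0// mulr0 mul0e (eq_integral (fun=> 0%E)) ?integral0// => s _.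
    by rewrite hM ?mulr0 ?normr0// prod_normE/= lt_max Mv orbT.
  rewrite ind1// mulr1.
  have iDs := integrable_shift (e * v) (integrableZl measurableT D (ii _ w1)).
  have mg : measurable_fun setT ((fun s => c (s + e * v) * h (s + e * v, v)) : mR -> R).
    by have /integrableP[/measurable_EFinP] := integrable_shift (e * v) (ihv v).
  rewrite -ge0_integralZl//; first last.
  - by rewrite lee_fin d0.
  - by move=> s _; rewrite -EFinM lee_fin mulr_ge0// mulr_ge0 ?c0// indicE ler0n.
  - by have /integrableP[] := iDs.
  apply: ge0_le_integral => //.
  + by apply/measurable_EFinP; apply: measurableT_comp => //; apply: measurable_funM.
  + have /integrableP[/measurable_EFinP mm _] := iDs.
    by apply/measurable_EFinP; apply: measurable_funM.
  + move=> s _; rewrite -!EFinM lee_fin normrM (ger0_norm (d0 _)) ler_wpM2l ?c0 ?d0//.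
    rewrite [leLHS]normrM (ger0_norm (c0 _)) mulrCA ler_wpM2l ?c0 ?d0//.
    have [sM|Ms] := leP `|s + e * v| M; first by rewrite ind1// mulr1.
    by rewrite hM1// normr0 ind0// mulr0.
by [].
Qed.

(** After the shear s = u + v and the dilation v = t s, homogeneity extracts hp p s, hp 1 s and the
    Jacobian s, whose product is [hp p.+1 s]. The Beta kernel in t remains and averages f into the
    new density g. *)
Lemma beta_pushforward p (f : R * (R * W) -> R) : (0 < p)%N -> tfun f ->
  exists2 g : R * W -> R, tfun g & forall (F : R -> R) w, continuous F ->
  \int[leb]_u (hp 1 u * \int[leb]_v (hp p v * (F (u + v) * f (u, (v, w))))) =
  \int[leb]_s (hp p.+1 s * (F s * g (s, w))).
Proof.
(* k is f in the coordinates (v, (s, w)), with u = s - v. *)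
move=> p0 tf; pose k (z : R * (R * W)) := f (z.2.1 - z.1, (z.1, z.2.2)).
have tk : tfun k.
  pose L (z : R * (R * W)) := (z.2.1 - z.1, (z.1, z.2.2)).
  have l1 : blin (fun z : R * (R * W) => z.1) by exact/blin_fst/blin_id.
  have l2 : blin (fun z : R * (R * W) => z.2.1) by exact/blin_fst/blin_snd/blin_id.
  have Ll : blin L.
    apply: blin_pair; first by apply: blin_add => //; exact: blin_opp.
    by apply: blin_pair => //; exact/blin_snd/blin_snd/blin_id.
  apply: (tfun_blin Ll (K := 2)) => // -[a [s w]]; rewrite /L !prod_normE/=.
  set m := Num.max _ (Num.max `|a| _).
  have h1 : `|s - a| <= m by rewrite le_max lexx.
  have h2 : `|a| <= m by rewrite !le_max lexx orbT.
  have h3 : `|w| <= m by rewrite !le_max lexx !orbT.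
  have m0 : 0 <= m by apply: le_trans h3.
  have h4 : `|s| <= 2 * m.
    by rewrite -[s](subrK a) (le_trans (ler_normD _ _))// mulrDl mul1r lerD.
  by rewrite !ge_max h4/=; apply/andP; split; lra.
pose c (t : R) := hp p t * hp 1 (1 - t).
have ic := beta_integrable p0 (ltn0Sn 0).
exists (fun x => \int[leb]_(t in `[0, 1]) (c t * k (t * x.1, x))).
  exact: dilate_diag_tfun.
move=> F w cF; have [M M0 fM] := tfun_supp tf; have [C C0 fC] := tfun_bounded tf.
pose h (z : R * R) := F (z.1 + z.2) * f (z.1, (z.2, w)).
have c1 : continuous (fst : R * R -> R) by move=> z; exact: cvg_fst.
have c2 : continuous (snd : R * R -> R) by move=> z; exact: cvg_snd.
have ch : continuous h.
  apply: continuous_mul; first by apply: (continuous_app cF); exact: continuous_add.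
  apply: (continuous_app (tfun_continuous tf)); apply: continuous_mkpair => //.
  by apply: continuous_mkpair => //; exact: cst_continuous.
have hM z : M < `|z| -> h z = 0.
  rewrite prod_normE /h lt_max => Mz; rewrite fM ?mulr0// prod_normE/= lt_max prod_normE/= lt_max.
  by case/orP: Mz => ->; rewrite ?orbT.
have [D D0 hD] : exists2 D, 0 <= D & forall z, `|h z| <= D.
  have [B FB] := itv_bounded (- (M + M)) (M + M) cF.
  exists (`|B| * C); first by rewrite mulr_ge0.
  move=> z; have [Mz|zM] := ltP M `|z|; first by rewrite hM// normr0 mulr_ge0.
  rewrite /h normrM ler_pM//; rewrite (le_trans (FB _ _))// ?ler_norm//=.
  move: zM; rewrite prod_normE ge_max => /andP[z1 z2].
  rewrite in_itv/= -ler_norml (le_trans (ler_normD _ _))// lerD//.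
have w1 : local_weight (@hp R 1) by exact: hp_weight.
have wp : local_weight (@hp R p) by exact: hp_weight.
transitivity (\int[leb]_s \int[leb]_v (hp p v * (hp 1 (s + -1 * v) * h (s + -1 * v, v)))).
  apply: (weight_shear (-1) w1 wp (hp_ge0 1) (hp_ge0 p) ch hM); by exists D.
apply: eq_Rintegral => s _.
transitivity (\int[leb]_v (hp p v * (hp 1 (s - v) * h (s - v, v)))).
  by apply: eq_Rintegral => v _; rewrite mulN1r.
have [s0|s0] := leP s 0.
  rewrite hp_eq0// mul0r (_ : (fun v => _) = (fun=> 0)) ?Rintegral_zero//.
  apply/funext => v; have [v0|v0] := leP v 0; first by rewrite hp_eq0// mul0r.
  by rewrite [hp 1 _]hp_eq0 ?mul0r ?mulr0//; lra.
rewrite (Rintegral_half (L := s)); first last.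
- by move=> v v0; rewrite hp_eq0// mul0r.
- by move=> v vs; rewrite [hp 1 _]hp_eq0 ?mul0r ?mulr0//; lra.
have dF (x : R) : is_derive x 1 (fun x : R => x * s) s.
  have := is_deriveM (is_derive_id x 1) (is_derive_cst (s : R) x 1).
  by move=> H; apply: (is_derive_eq H); rewrite /GRing.scale/= mulr0 add0r mulr1.
have cs : continuous (fun _ : R => s) by exact: cst_continuous.
have := substitution_open (F := fun x : R => x * s) (f := fun=> s)
  (G := fun v => hp p v * (hp 1 (s - v) * h (s - v, v))) ltr01 dF cs.
rewrite mul0r mul1r => ->.
- have icc : leb.-integrable `[0, 1]%classic (EFin \o (fun t => c t * k (t * s, (s, w)))).
    have [Ck Ck0 kC] := tfun_bounded tk.
    have mJ : measurable (`[0, 1]%classic : set mR) by exact: measurable_itv.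
    apply: (le_integrable mJ _ _ (integrableZl mJ Ck ic)).
      have /integrableP[/measurable_EFinP mc _] := ic.
      apply/measurable_EFinP; apply: measurable_funM mc _; apply: measurable_funTS.
      apply: continuous_measurable_fun; apply: (continuous_app (tfun_continuous tk)).
      apply: continuous_mkpair; last exact: cst_continuous.
      by apply: continuous_mul => //; move=> x; exact: cvg_id.
    by move=> t _; rewrite /= lee_fin !normrM mulrC ler_wpM2r// (ger0_norm Ck0).
  have mJ : measurable (`[0, 1]%classic : set mR) by exact: measurable_itv.
  rewrite -(RintegralZl (F s) mJ icc).
  have icF : leb.-integrable `[0, 1]%classic (EFin \o (fun t => F s * (c t * k (t * s, (s, w))))).
    by apply: eq_integrable (integrableZl mJ (F s) icc).
  rewrite -(RintegralZl (hp p.+1 s) mJ icF).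
  rewrite Rintegral_mkcond [RHS]Rintegral_mkcond; apply: eq_Rintegral => t _.
  rewrite !patchE; case: ifPn => [|].
    rewrite inE/= in_itv/= => /andP[t0 t1]; rewrite mem_set; last by rewrite /= in_itv/= !ltW.
    rewrite hp_mul// (_ : s - t * s = (1 - t) * s); last by ring.
    rewrite [hp 1 (_ * s)]hp_mul ?subr_gt0//; have -> : hp p.+1 s = hp p s * hp 1 s * s by rewrite hp_add addn1.
    rewrite /h /c /k/= (_ : (1 - t) * s + t * s = s); last by ring.
    rewrite (_ : s - t * s = (1 - t) * s); last by ring.
    move: (f _) (F _) (hp p t) (hp p s) (hp 1 s) (hp 1 _) => a1 a2 a3 a4 a5 a6; ring.
  rewrite notin_setE/= in_itv/= => /negP; rewrite negb_and -!leNgt => t01.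
  case: ifP => // _; case/orP: t01 => t01; rewrite /c.
    by rewrite (hp_eq0 p t01) !(mul0r, mulr0).
  by rewrite [hp 1 (1 - t)]hp_eq0 ?subr_le0// !(mul0r, mulr0).
- by move=> x _.
- move=> y /andP[y0 ys]; apply: continuousM; first exact: hp_continuous.
  have sy : {for y, continuous (fun v : R => s - v)} by apply: cvgB; [exact: cvg_cst|exact: cvg_id].
  apply: continuousM.
    by apply: (continuous_comp (g := hp 1) sy); apply: hp_continuous; rewrite subr_gt0.
  apply: (continuous_app ch (g := fun v => (s - v, v))).
  by apply: continuous_mkpair => x; [apply: cvgB; [exact: cvg_cst|exact: cvg_id]|exact: cvg_id].
Qed.

End beta_convolution.

Ltac solve_maxle := rewrite ?prod_normE/= ?mul1r ?ge_max ?le_max ?lexx ?orbT /= ?lexx ?orbT.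

Section compositions.
Context {R : realType}.

Lemma tfun_affine (V V' : normedModType R) (L : V -> V') (K : R) (a : V') (f : V' -> R) :
  blin L -> (forall x, `|x| <= K * `|L x|) -> tfun f -> tfun (fun x => f (a + L x)).
Proof.
move=> Ll LK [sf [M HM]]; split=> [k|]; first exact: Ckb_comp_blin.
exists (`|K| * (`|M| + `|a|)) => x xM; apply: HM; rewrite ltNge; apply/negP => LM.
move: xM; rewrite ltNge => /negP; apply.
rewrite (le_trans (LK x))// (le_trans (ler_wpM2r _ (ler_norm K)))// ler_wpM2l//.
have := ler_normD (a + L x) (- a); rewrite addrAC subrr add0r normrN => h.
by rewrite (le_trans h)// lerD2r (le_trans LM)// ler_norm.
Qed.

Lemma is_derive_comp1 (V : normedModType R) (F : R -> R) (P : V -> R) x v (d e : R) :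
  is_derive x v P d -> is_derive (P x) 1 F e -> is_derive x v (fun y => F (P y)) (e * d).
Proof.
move=> dP dF; have := is_derive_line P x v 0 d; rewrite scale0r add0r => -[/(_ dP) h _].
have dF' : is_derive (P (0 *: v + x)) 1 F e by rewrite scale0r add0r.
have := is_derive1_comp dF' h => h2.
have := is_derive_line (fun y => F (P y)) x v 0 (e * d); rewrite scale0r add0r => -[_ h3].
exact: h3 h2.
Qed.

Lemma smoothb_comp1 (V : normedModType R) (F : R -> R) (P : V -> R) :
  smoothb true F -> smoothb false P -> smoothb false (fun x => F (P x)).
Proof.
move=> sF sP k; elim: k F sF => [|k IH] F sF.
  split=> // [|M].
    exact: (continuous_app (Ckb_continuous (sF 0%N)) (Ckb_continuous (sP 0%N))).
  by have [C HC] := Ckb_bounded (sF 0%N) 0; exists C => x _; exact: HC.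
apply: CkbS.
- exact: (continuous_app (Ckb_continuous (sF 0%N)) (Ckb_continuous (sP 0%N))).
- by move=> M; have [C HC] := Ckb_bounded (sF 0%N) 0; exists C => x _; exact: HC.
move=> v; exists (fun x => 'D_(1 : R) F (P x) * 'D_v P x).
  apply: CkbM; last exact: Ckb_derive (sP k.+1).
  by apply: (IH ('D_(1 : R) F)) => j; exact: Ckb_derive (sF j.+1).
move=> x; apply: is_derive_comp1; first exact: Ckb_is_derive (sP 1%N).
exact: Ckb_is_derive (sF 1%N).
Qed.

End compositions.

(** * Radial measures and their iterated integrals *)

Section radial_measures.
Context {R : realType}.
Local Notation leb := (@lebesgue_measure R).
Local Notation mR := (measurableTypeR R).

(* Image of Lebesgue measure on R^p under |x|^2, up to a constant; p = 0 gives a Dirac mass. *)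
Definition rad p (h : R -> R) : R :=
  if p is 0 then h 0 else \int[leb]_u (hp p u * h u).

Lemma eq_rad p (h k : R -> R) : (forall u, h u = k u) -> rad p h = rad p k.
Proof.
by move=> hk; rewrite /rad; case: p => // p; apply: eq_Rintegral => u _; rewrite hk.
Qed.

Lemma rad_tfun p (W : normedModType R) (f : R * W -> R) : tfun f ->
  tfun (fun w => rad p (fun u => f (u, w))).
Proof.
move=> tf; case: p => [|p] /=; last exact: (weight_tfun (hp_weight _)).
have Ll : blin (fun w : W => ((0 : R), w)) by apply: blin_pair; [exact: blin_zero|exact: blin_id].
by apply: (tfun_blin Ll (K := 1)) => // w; rewrite mul1r prod_normE le_max lexx orbT.
Qed.

Lemma pair_tfun (W : normedModType R) (f : R * (R * W) -> R) (w : W) : tfun f ->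
  tfun (fun x : R * R => f (x.1, (x.2, w))).
Proof.
move=> tf; have Ll : blin (fun x : R * R => (x.1, (x.2, 0 : W))).
  apply: blin_pair; first exact/blin_fst/blin_id.
  by apply: blin_pair; [exact/blin_snd/blin_id|exact: blin_zero].
have := tfun_affine (0, (0, w)) Ll (K := 1) _ tf.
have -> : (fun x : R * R => f ((0, (0, w)) + (x.1, (x.2, 0)))) = (fun x => f (x.1, (x.2, w))).
  by apply/funext => x; congr f; apply/pair_equal_spec; split; rewrite /= ?add0r//;
    apply/pair_equal_spec; split; rewrite /= ?add0r ?addr0.
by apply=> x; rewrite mul1r !prod_normE/= normr0; solve_maxle.
Qed.

Lemma weight_swap_tfun (W : normedModType R) c d (f : R * (R * W) -> R) (w : W) :
  local_weight c -> local_weight d -> tfun f ->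
  \int[leb]_u (c u * \int[leb]_v (d v * f (u, (v, w)))) =
  \int[leb]_v (d v * \int[leb]_u (c u * f (u, (v, w)))).
Proof.
move=> wc wd tf; have th := pair_tfun w tf; have [M M0 hM] := tfun_supp th.
have [C C0 hC] := tfun_bounded th.
by apply: (weight_swap (h := fun x : R * R => f (x.1, (x.2, w))) wc wd _ hM);
  [exact: tfun_continuous|exists C].
Qed.

Lemma rad_swap p q (W : normedModType R) (f : R * (R * W) -> R) (w : W) : tfun f ->
  rad p (fun u => rad q (fun v => f (u, (v, w)))) = rad q (fun v => rad p (fun u => f (u, (v, w)))).
Proof.
move=> tf; case: p => [|p]; case: q => [|q]; [by []|by []|by []|].
exact: weight_swap_tfun (hp_weight _) (hp_weight _) tf.
Qed.

Lemma Rintegral_rad_swap q (W : normedModType R) (f : R * (R * W) -> R) (w : W) : tfun f ->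
  \int[leb]_x rad q (fun v => f (x, (v, w))) = rad q (fun v => \int[leb]_x f (x, (v, w))).
Proof.
move=> tf; case: q => [|q] //=.
have := weight_swap_tfun w (cst_local_weight 1) (hp_weight (ltn0Sn q)) tf.
under eq_Rintegral do rewrite mul1r.
move=> ->; apply: eq_Rintegral => v _; congr (_ * _).
by apply: eq_Rintegral => x _; rewrite mul1r.
Qed.

Lemma rad_merge p (W : normedModType R) (f : R * (R * W) -> R) : tfun f ->
  exists2 g : R * W -> R, tfun g & forall (F : R -> R) w, continuous F ->
  rad 1 (fun u => rad p (fun v => F (u + v) * f (u, (v, w)))) = rad p.+1 (fun s => F s * g (s, w)).
Proof.
move=> tf; case: p => [|p]; last first.
  by have [g tg gE] := beta_pushforward (ltn0Sn p) tf; exists g.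
exists (fun x => f (x.1, (0, x.2))); last first.
  by move=> F w cF; apply: eq_rad => u; rewrite /= addr0.
have Ll : blin (fun x : R * W => (x.1, ((0 : R), x.2))).
  apply: blin_pair; first exact/blin_fst/blin_id.
  by apply: blin_pair; [exact: blin_zero|exact/blin_snd/blin_id].
apply: (tfun_blin Ll (K := 1)) => // x.
by rewrite !prod_normE/=; solve_maxle.
Qed.

End radial_measures.

(** * Integrals over tuples and diagonal quadratic forms *)

Section tuple_integrals.
Context {R : realType}.
Local Notation leb := (@lebesgue_measure R).
Local Notation mR := (measurableTypeR R).
Local Notation rot t := (row_of_tuple t).

Definition row_cons n (x : R * 'rV[R]_n) : 'rV[R]_n.+1 :=
  \row_i (if unlift ord0 i is Some j then x.2 ord0 j else x.1).

Lemma row_cons_tuple n (x : R) (t : n.-tuple mR) :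
  rot (tuple_consp (x, t)) = row_cons (x, rot t).
Proof.
apply/rowP => i; rewrite !mxE; case: unliftP => [j ->|->] /=.
  by rewrite mxE !(tnth_nth 0)/=.
by rewrite (tnth_nth 0).
Qed.

Lemma mx_norm_entry m n (A : 'M[R]_(m, n)) i j : `|A i j| <= `|A|.
Proof.
rewrite [`|A|]mx_normrE; exact: (le_bigmax _ (fun ij : 'I_m * 'I_n => `|A ij.1 ij.2|) (i, j)).
Qed.

Lemma mx_norm_le m n (A : 'M[R]_(m, n)) (K : R) : 0 <= K -> (forall i j, `|A i j| <= K) -> `|A| <= K.
Proof.
by move=> K0 H; rewrite [`|A|]mx_normrE; apply/bigmax_leP; split=> // ij _.
Qed.

Lemma blin_row_cons n : blin (@row_cons n).
Proof.
split=> [h x y|]; last first.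
  exists 1 => x; rewrite mul1r; apply: mx_norm_le => // i j; rewrite mxE prod_normE le_max.
  by case: unliftP => [k _|_]; rewrite ?lexx// mx_norm_entry orbT.
by apply/rowP => i; rewrite !mxE; case: unliftP => [k _|_]; rewrite ?mxE.
Qed.

Lemma row_cons_norm n (x : R * 'rV[R]_n) : `|x| <= `|row_cons x|.
Proof.
rewrite prod_normE ge_max; apply/andP; split.
  by have := mx_norm_entry (row_cons x) ord0 ord0; rewrite mxE unlift_none.
apply: mx_norm_le => // i j; rewrite ord1.
by have := mx_norm_entry (row_cons x) ord0 (lift ord0 j); rewrite mxE liftK.
Qed.

Lemma borel_map_row n d (T : measurableType d) (V : normedModType R) (rho : T -> V) :
  borel_map rho -> borel_map (fun z : n.-tuple mR * T => ((rot z.1, rho z.2) : 'rV[R]_n * V)).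
Proof.
elim: n d T V rho => [|n IH] d T V rho br.
  move=> g cg; have c0 : continuous (fun v : V => g (0, v)).
    by apply: (continuous_app cg); apply: continuous_mkpair; [exact: cst_continuous|move=> v; exact: cvg_id].
  have := measurableT_comp (br _ c0) (@measurable_snd _ _ (0.-tuple mR) T).
  congr (measurable_fun _ _); apply/funext => z /=; congr (g (_, _)).
  by apply/rowP => -[].
pose j (z : n.+1.-tuple mR * T) := (thead z.1, ([tuple of behead z.1] : n.-tuple mR, z.2)).
have mj : measurable_fun setT j.
  have m1 : measurable_fun setT (fst : n.+1.-tuple mR * T -> n.+1.-tuple mR) by exact: measurable_fst.
  apply/measurable_fun_pair.
    by apply: (measurableT_comp _ m1); exact: measurable_tnth.
  apply/measurable_fun_pair; last exact: measurable_snd.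
  have mb : measurable_fun setT (fun t : n.+1.-tuple mR => ([tuple of behead t] : n.-tuple mR)).
    exact: measurable_behead.
  exact: (measurableT_comp mb m1).
have b1 := borel_map_precomp mj (borel_map_pair (IH _ _ _ _ br)).
pose L (y : R * ('rV[R]_n * V)) : 'rV[R]_n.+1 * V := (row_cons (y.1, y.2.1), y.2.2).
have Ll : blin L.
  apply: blin_pair; last exact/blin_snd/blin_snd/blin_id.
  apply: (blin_comp (@blin_row_cons n)).
  by apply: blin_pair; [exact/blin_fst/blin_id|exact/blin_fst/blin_snd/blin_id].
have := borel_map_comp (blin_continuous Ll) b1.
congr borel_map; apply/funext => -[t v]; rewrite /L/j/=; congr pair.
by rewrite -row_cons_tuple; congr (rot _); apply/val_inj; rewrite /= [in RHS](tuple_eta t).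
Qed.

Lemma borel_row n : borel_map (fun t : n.-tuple mR => rot t).
Proof.
move=> g cg; have c2 : continuous (fun x : 'rV[R]_n * R => g x.1).
  by apply: (continuous_app cg) => x; exact: cvg_fst.
have H := @borel_map_row n _ mR R id (@borel_map_id R) _ c2.
exact: (measurableT_comp H (measurable_pair2 (0 : mR))).
Qed.

Lemma lebesgue_tuple_integrable_pushforward n (phi : n.+1.-tuple mR -> R) :
  measurable_fun setT phi ->
  (leb \x lebesgue_tuple R n)%E.-integrable setT (EFin \o (phi \o @tuple_consp R n)) ->
  (lebesgue_tuple R n.+1).-integrable setT (EFin \o phi) /\
  \int[lebesgue_tuple R n.+1]_t phi t = \int[(leb \x lebesgue_tuple R n)%E]_z phi (tuple_consp z).
Proof.
move=> mphi iphi; have mc := @measurable_tuple_consp R n.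
have mE : measurable_fun setT (EFin \o phi) by exact/measurable_EFinP.
pose mu : {measure set (n.+1.-tuple mR) -> \bar R} :=
  measure_function_pushforward__canonical__measure_function_Measure (leb \x lebesgue_tuple R n)%E mc.
have iphi' : (leb \x lebesgue_tuple R n)%E.-integrable (@tuple_consp R n @^-1` setT) ((EFin \o phi) \o @tuple_consp R n).
  by rewrite preimage_setT.
split; first exact: (integrable_pushforward mc mE iphi' measurableT).
rewrite /Rintegral; congr fine.
have := integral_pushforward mc mE iphi' measurableT; rewrite preimage_setT => <-.
exact: eq_measure_integral.
Qed.

(** The indicator of a cube around the ball of radius M, built one coordinate at a time; it supplies
    the majorants in all uses of Fubini on tuples. *)
Lemma tuple_box n (M : R) : exists2 b : n.-tuple mR -> R,
  (lebesgue_tuple R n).-integrable setT (EFin \o b) &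
  forall t, 0 <= b t /\ (`|rot t| <= M -> b t = 1).
Proof.
elim: n => [|n [b ib bP]].
  exists (fun=> 1); last by move=> t; split.
  apply/integrableP; split; first exact: measurable_cst.
  by rewrite integral_dirac//= diracT mul1e normr1 ltry.
have mI : measurable (`[- M, M]%classic : set mR) by exact: measurable_itv.
pose i1 (x : R) : R := \1_(`[- M, M]%classic) x.
have mi1 : measurable_fun setT (i1 : mR -> R) by exact: measurable_indic.
have ii1 : leb.-integrable setT (EFin \o i1).
  have := cutoff_integrable (M := M) (h := i1) (cst_local_weight 1) mi1.
  have -> : (fun u => 1 * i1 u) = i1 by apply/funext => u; rewrite mul1r.
  apply=> [u Mu|]; last by exists 1 => u; rewrite /i1 indicE; case: (_ \in _); rewrite ?normr1 ?normr0.
  by rewrite /i1 indicE memNset//= in_itv/= -ler_norml; apply/negP; rewrite -ltNge.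
exists (fun t => i1 (thead t) * b [tuple of behead t]); last first.
  move=> t; have [b0 b1] := bP [tuple of behead t]; split.
    by rewrite mulr_ge0// /i1 indicE ler0n.
  rewrite {1}(tuple_eta t) => tM; rewrite b1 ?mulr1.
    rewrite /i1 indicE mem_set//= in_itv/= -ler_norml; apply: le_trans tM.
    by have := mx_norm_entry (rot [tuple of thead t :: behead t]) ord0 ord0; rewrite mxE (tnth_nth 0).
  apply: le_trans tM; rewrite -[[tuple of thead t :: behead t]]/(tuple_consp (thead t, [tuple of behead t])) row_cons_tuple.
  by apply: le_trans (row_cons_norm _); rewrite prod_normE le_max lexx orbT.
have /integrableP[/measurable_EFinP mb _] := ib.
have mphi : measurable_fun setT (fun t : n.+1.-tuple mR => i1 (thead t) * b [tuple of behead t]).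
  apply: measurable_funM; first exact: (measurableT_comp mi1 (measurable_tnth _)).
  have mh : measurable_fun setT (fun t : n.+1.-tuple mR => ([tuple of behead t] : n.-tuple mR)).
    exact: measurable_behead.
  exact: (measurableT_comp mb mh).
apply: (lebesgue_tuple_integrable_pushforward mphi _).1.
have ia : leb.-integrable setT (EFin \o (fun x => `|i1 x|)) by apply: eq_integrable (integrable_abse ii1).
have ib' : (lebesgue_tuple R n).-integrable setT (EFin \o (fun t => `|b t|)).
  by apply: eq_integrable (integrable_abse ib).
apply: (dominated_integrable _ ia ib').
  exact: measurableT_comp mphi (@measurable_tuple_consp R n).
move=> x t; rewrite /= normrM theadE.
by have -> : [tuple of behead (tuple_consp (x, t))] = t by apply/val_inj.
Qed.

Lemma tuple_step n (g : 'rV[R]_n.+1 -> R) (M : R) : continuous g ->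
  (forall r, M < `|r| -> g r = 0) -> (exists C : R, forall r, `|g r| <= C) ->
  \int[lebesgue_tuple R n.+1]_t g (rot t) =
  \int[leb]_x \int[lebesgue_tuple R n]_t g (row_cons (x, rot t)).
Proof.
move=> cg gM [C gC]; have C0 : 0 <= C by exact: le_trans (gC 0).
have mg : measurable_fun setT (fun t : n.+1.-tuple mR => g (rot t)) by exact: borel_row.
have [b ib bP] := tuple_box n M.
have mI : measurable (`[- M, M]%classic : set mR) by exact: measurable_itv.
pose i1 (x : R) : R := \1_(`[- M, M]%classic) x.
have mi1 : measurable_fun setT (i1 : mR -> R) by exact: measurable_indic.
have ii1 : leb.-integrable setT (EFin \o i1).
  have := cutoff_integrable (M := M) (h := i1) (cst_local_weight 1) mi1.
  have -> : (fun u => 1 * i1 u) = i1 by apply/funext => u; rewrite mul1r.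
  apply=> [u Mu|]; last by exists 1 => u; rewrite /i1 indicE; case: (_ \in _); rewrite ?normr1 ?normr0.
  by rewrite /i1 indicE memNset//= in_itv/= -ler_norml; apply/negP; rewrite -ltNge.
have iC : leb.-integrable setT (EFin \o (fun x => C * i1 x)).
  by apply: eq_integrable (integrableZl measurableT C ii1).
pose phi (z : mR * n.-tuple mR) := g (rot (tuple_consp z)).
have mphi : measurable_fun setT phi by exact: measurableT_comp mg (@measurable_tuple_consp R n).
have dom x t : `|phi (x, t)| <= (C * i1 x) * b t.
  have [b0 b1'] := bP t; rewrite /phi row_cons_tuple.
  have i0 : 0 <= i1 x by rewrite /i1 indicE ler0n.
  have [rM|Mr] := leP `|row_cons (x, rot t)| M; last first.
    by rewrite gM// normr0 !mulr_ge0.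
  have := le_trans (row_cons_norm _) rM; rewrite prod_normE ge_max => /andP[xM tM].
  by rewrite b1'// mulr1 /i1 indicE mem_set ?mulr1//= in_itv/= -ler_norml.
have iphi : (leb \x lebesgue_tuple R n)%E.-integrable setT
    (EFin \o ((fun t => g (rot t)) \o @tuple_consp R n)).
  exact: (dominated_integrable mphi iC ib dom).
have [_ ->] := lebesgue_tuple_integrable_pushforward mg iphi.
rewrite (dominated_fubini12 mphi iC ib dom).
by apply: eq_Rintegral => x _; apply: eq_Rintegral => t _; rewrite /phi row_cons_tuple.
Qed.

End tuple_integrals.

(** * Reduction of a diagonal form to two radial variables *)

Section radial_form.
Context {R : realType}.
Local Notation leb := (@lebesgue_measure R).
Local Notation mR := (measurableTypeR R).
Local Notation rot t := (row_of_tuple t).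

Lemma tfun_swap2 (W : normedModType R) (f : R * (R * W) -> R) : tfun f ->
  tfun (fun x : R * (R * W) => f (x.2.1, (x.1, x.2.2))).
Proof.
move=> tf; have Ll : blin (fun x : R * (R * W) => (x.2.1, (x.1, x.2.2))).
  apply: blin_pair; first exact/blin_fst/blin_snd/blin_id.
  by apply: blin_pair; [exact/blin_fst/blin_id|exact/blin_snd/blin_snd/blin_id].
apply: (tfun_blin Ll (K := 1)) => // -[a [b c]].
by rewrite !prod_normE/=; solve_maxle.
Qed.

Lemma tfun_swap3 (W : normedModType R) (f : R * (R * (R * W)) -> R) : tfun f ->
  tfun (fun x : R * (R * (R * W)) => f (x.1, (x.2.2.1, (x.2.1, x.2.2.2)))).
Proof.
move=> tf; have Ll : blin (fun x : R * (R * (R * W)) => (x.1, (x.2.2.1, (x.2.1, x.2.2.2)))).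
  apply: blin_pair; first exact/blin_fst/blin_id.
  apply: blin_pair; first exact/blin_fst/blin_snd/blin_snd/blin_id.
  by apply: blin_pair; [exact/blin_fst/blin_snd/blin_id|exact/blin_snd/blin_snd/blin_snd/blin_id].
apply: (tfun_blin Ll (K := 1)) => // -[a [b [c w]]].
by rewrite !prod_normE/=; solve_maxle.
Qed.

Lemma tfun_comp1M (V : normedModType R) (F : R -> R) (P g : V -> R) :
  smoothb true F -> smoothb false P -> tfun g -> tfun (fun x => F (P x) * g x).
Proof. by move=> sF sP tg; apply: tfunM => //; exact: smoothb_comp1. Qed.

Lemma smoothb_affine (F : R -> R) (a b : R) : smoothb true F ->
  smoothb true (fun s => F (a + b * s)).
Proof.
move=> sF k; apply: (Ckb_comp_blin (L := fun s => b * s) a) => //.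
exact/blin_mul/blin_id.
Qed.

(** An arbitrary sign pattern, indexed by all naturals, makes the removal of the first coordinate a
    mere shift of the pattern. *)
Definition sgsq (sg : nat -> bool) n (x : 'rV[R]_n) : R :=
  \sum_(i < n) (-1) ^+ (~~ sg i) * x ord0 i ^+ 2.

Lemma continuous_sum (T : topologicalType) (I : Type) (s : seq I) (h : I -> T -> R) :
  (forall i, continuous (h i)) -> continuous (fun x => \sum_(i <- s) h i x).
Proof.
move=> ch; elim: s => [|i s IH].
  under eq_fun do rewrite big_nil; exact: cst_continuous.
by under eq_fun do rewrite big_cons; exact: continuous_add.
Qed.

Lemma sgsq_continuous sg n : continuous (@sgsq sg n).
Proof.
apply: continuous_sum => i; apply: continuous_mul; first exact: cst_continuous.
have Ll : blin (fun x : 'rV[R]_n => x ord0 i).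
  split=> [h y z|]; first by rewrite !mxE.
  by exists 1 => y; rewrite mul1r; exact: mx_norm_entry.
exact: (continuous_app (@exprn_continuous R 2) (blin_continuous Ll)).
Qed.

Lemma sgsq_row_cons sg n (x : R) (r : 'rV[R]_n) :
  sgsq sg (row_cons (x, r)) = (-1) ^+ (~~ sg 0%N) * x ^+ 2 + sgsq (fun i => sg i.+1) r.
Proof.
rewrite /sgsq big_ord_recl mxE unlift_none; congr (_ + _).
by apply: eq_bigr => i _; rewrite mxE liftK lift0.
Qed.

(** In the inductive step the first coordinate x joins the parameters while the other n are
    integrated. Then [square_pushforward] replaces x by u = x^2, and [rad_merge] fuses u with the
    group of its own sign. F enters shifted by the fixed variables, hence the quantification over F
    after g. *)
Lemma radial_form n (sg : nat -> bool) (W : normedModType R) (f : 'rV[R]_n * W -> R) : tfun f ->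
  exists2 g : R * (R * W) -> R, tfun g & forall (F : R -> R) w, smoothb true F ->
  \int[lebesgue_tuple R n]_t (F (sgsq sg (rot t)) * f (rot t, w)) =
  rad (\sum_(i < n) sg i) (fun z1 => rad (\sum_(i < n) ~~ sg i) (fun z2 =>
    F (z1 - z2) * g (z1, (z2, w)))).
Proof.
elim: n sg W f => [|n IH] sg W f tf.
  (* With no coordinates both radial measures are Dirac masses at 0; chi, equal to 1 there, gives g
     bounded support in the two idle variables. *)
  pose chi (u : R) := hat 0 1 u / hat 0 1 0.
  have h0 : 0 < hat 0 1 (0 : R) by apply: hat_gt0; rewrite subrr normr0.
  have schi k : Ckb true k chi.
    rewrite /chi (_ : (fun u : R => _) = (fun u => (hat 0 1 0)^-1 * hat 0 1 u)).
      by apply: CkbZ; exact: hat_Ckb.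
    by apply/funext => u; rewrite mulrC.
  have chi1 u : 1 < `|u| -> chi u = 0.
    by move=> u1; rewrite /chi hat_supp ?mul0r// subr0 ltW.
  have [M fM] := tf.2.
  exists (fun x => chi x.1 * (chi x.2.1 * f (0, x.2.2))).
    split=> [k|]; last first.
      exists (Num.max 1 M) => -[a [b w]]; rewrite !prod_normE/= !lt_max !gt_max.
      case/or3P => [/andP[a1 _]|/andP[b1 _]|/andP[_ w1]].
      - by rewrite (chi1 a)// mul0r.
      - by rewrite (chi1 b)// mul0r mulr0.
      - by rewrite fM ?mulr0// prod_normE/= lt_max w1 orbT.
    apply: CkbM; first by apply: (Ckb_comp_lin _ (schi k)); exact/blin_fst/blin_id.
    apply: CkbM; first by apply: (Ckb_comp_lin _ (schi k)); exact/blin_fst/blin_snd/blin_id.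
    apply: (Ckb_comp_lin (L := fun x : R * (R * W) => ((0 : 'rV[R]_0), x.2.2)) _ (tf.1 k)).
    by apply: blin_pair; [exact: blin_zero|exact/blin_snd/blin_snd/blin_id].
  move=> F w sF; rewrite !big_ord0 /= subrr /chi divff ?lt0r_neq0// !mul1r.
  have cG : continuous (fun r : 'rV[R]_0 => F (sgsq sg r) * f (r, w)).
    apply: continuous_mul.
      exact: (continuous_app (Ckb_continuous (sF 0%N)) (@sgsq_continuous sg 0)).
    apply: (continuous_app (tfun_continuous tf)); apply: continuous_mkpair; [move=> r; exact: cvg_id|exact: cst_continuous].
  rewrite /Rintegral integral_dirac//; last by apply/measurable_EFinP; exact: borel_row cG.
  rewrite diracT mul1e /= /sgsq big_ord0; congr (_ * f (_, _)).
  by apply/rowP => -[].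
pose e : R := (-1) ^+ (~~ sg 0%N).
pose f' (y : 'rV[R]_n * (R * W)) := f (row_cons (y.2.1, y.1), y.2.2).
have tf' : tfun f'.
  pose L (y : 'rV[R]_n * (R * W)) := (row_cons (y.2.1, y.1), y.2.2).
  have Ll : blin L.
    apply: blin_pair; last exact/blin_snd/blin_snd/blin_id.
    apply: (blin_comp (@blin_row_cons _ n)).
    by apply: blin_pair; [exact/blin_fst/blin_snd/blin_id|exact/blin_fst/blin_id].
  apply: (tfun_blin Ll (K := 1)) => // -[r [x w]]; rewrite mul1r /L.
  have := row_cons_norm (x, r); rewrite !prod_normE/= !ge_max => /andP[h1 h2].
  by rewrite !le_max h1 h2 lexx ?orbT.
have [g' tg' Hg'] := IH (fun i => sg i.+1) _ _ tf'.
set P' := (\sum_(i < n) sg i.+1)%N in Hg'; set N' := (\sum_(i < n) ~~ sg i.+1)%N in Hg'.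
(* The density of the induction hypothesis, reordered with x in front: it is the next variable to be
   squared. *)
pose f1 (x : R * (R * (R * W))) := g' (x.2.1, (x.2.2.1, (x.1, x.2.2.2))).
have tf1 : tfun f1 by exact: (tfun_swap2 (tfun_swap3 tg')).
have [g1 tg1 Hg1] := square_pushforward tf1.
have s1 : smoothb false (fun x : R * (R * (R * W)) => x.2.1 - x.2.2.1).
  move=> k; apply: Ckb_blin; apply: blin_add; first exact/blin_fst/blin_snd/blin_id.
  exact/blin_opp/blin_fst/blin_snd/blin_snd/blin_id.
have cF (F : R -> R) (a b : R) : smoothb true F -> continuous (fun s : R => F (a + b * s)).
  by move=> sF; exact: Ckb_continuous (smoothb_affine a b sF 0%N).
(* The formula after u = x^2 has been introduced and before it is merged; the sign e decides which
   group it joins. *)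
have A (F : R -> R) w : smoothb true F ->
  \int[lebesgue_tuple R n.+1]_t (F (sgsq sg (rot t)) * f (rot t, w)) =
  rad P' (fun z1 => rad N' (fun z2 => rad 1 (fun u =>
     F (e * u + (z1 - z2)) * g1 (u, (z1, (z2, w)))))).
  move=> sF; have cF0 := Ckb_continuous (sF 0%N).
  have [M fM] := tf.2; have [C C0 fC] := tfun_bounded tf.
  have [D HD] := Ckb_bounded (sF 0%N) 0.
  rewrite (tuple_step (g := fun r => F (sgsq sg r) * f (r, w)) (M := M)); first last.
  - exists (D * C) => r; rewrite normrM ler_pM//; exact: HD.
  - by move=> r Mr; rewrite fM ?mulr0// prod_normE lt_max Mr.
  - apply: continuous_mul; first exact: (continuous_app cF0 (@sgsq_continuous sg n.+1)).
    apply: (continuous_app (tfun_continuous tf)); apply: continuous_mkpair; last exact: cst_continuous.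
    by move=> r; exact: cvg_id.
  pose HH (x : R * (R * (R * W))) := F (e * x.1 ^+ 2 + (x.2.1 - x.2.2.1)) * f1 x.
  have tHH : tfun HH.
    apply: tfun_comp1M => // k; apply: CkbD; last exact: s1.
    by apply: CkbZ; apply: CkbX; apply: Ckb_blin; exact/blin_fst/blin_id.
  transitivity (\int[leb]_x rad P' (fun z1 => rad N' (fun z2 => HH (x, (z1, (z2, w)))))).
    apply: eq_Rintegral => x _.
    have sFx : smoothb true (fun s : R => F (e * x ^+ 2 + 1 * s)) by exact: smoothb_affine.
    transitivity (\int[lebesgue_tuple R n]_t (F (e * x ^+ 2 + 1 * sgsq (fun i => sg i.+1) (rot t)) *
       f' (rot t, (x, w)))).
      by apply: eq_Rintegral => t _; rewrite sgsq_row_cons mul1r.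
    rewrite (Hg' _ (x, w) sFx); apply: eq_rad => z1; apply: eq_rad => z2.
    by rewrite /HH /f1 /= mul1r.
  have t3 := tfun_swap3 tHH.
  have t2 : tfun (fun y : R * (R * W) => rad N' (fun z2 => HH (y.1, (y.2.1, (z2, y.2.2))))).
    exact: (rad_tfun N' (tfun_swap2 t3)).
  rewrite (Rintegral_rad_swap P' w t2); apply: eq_rad => z1 /=.
  rewrite (Rintegral_rad_swap N' (z1, w) t3); apply: eq_rad => z2 /=.
  have c2 : continuous (fun s : R => F (z1 - z2 + e * s)) by exact: cF.
  have := Hg1 _ (z1, (z2, w)) c2 => h.
  transitivity (\int[leb]_x (F (z1 - z2 + e * x ^+ 2) * f1 (x, (z1, (z2, w))))).
    by apply: eq_Rintegral => x _; rewrite /HH/= addrC.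
  by rewrite h; apply: eq_Rintegral => u _; rewrite [e * u + _]addrC.
have tKK (F : R -> R) : smoothb true F ->
    tfun (fun x : R * (R * (R * W)) => F (e * x.1 + (x.2.1 - x.2.2.1)) * g1 x).
  move=> sF; apply: tfun_comp1M => // k; apply: CkbD; last exact: s1.
  by apply: CkbZ; apply: Ckb_blin; exact/blin_fst/blin_id.
have s2 : smoothb false (fun x : R * (R * W) => x.1 - x.2.1).
  move=> k; apply: Ckb_blin; apply: blin_add; first exact/blin_fst/blin_id.
  exact/blin_opp/blin_fst/blin_snd/blin_id.
have PE : (\sum_(i < n.+1) sg i = sg 0 + P')%N by rewrite big_ord_recl.
have NE : (\sum_(i < n.+1) ~~ sg i = ~~ sg 0 + N')%N by rewrite big_ord_recl.
rewrite PE NE; case sg0 : (sg 0%N).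
  change (nat_of_bool true) with 1%N; change (nat_of_bool (~~ true)) with 0%N.
  rewrite add1n add0n.
  have e1 : e = 1 by rewrite /e sg0 expr0.
  (* Positive sign: z2 is frozen as a parameter, and u is merged with z1. *)
  have [g2 tg2 Hg2] := rad_merge P' tg1.
  exists g2 => // F w sF; rewrite (A _ _ sF).
  pose KK x := F (e * x.1 + (x.2.1 - x.2.2.1)) * g1 x.
  have tk : tfun KK by exact: tKK.
  rewrite (rad_swap P' N' w (rad_tfun 1 tk)).
  transitivity (rad N' (fun z2 => rad P'.+1 (fun s => F (s - z2) * g2 (s, (z2, w))))).
    apply: eq_rad => z2.
    rewrite -(rad_swap 1 P' (z2, w) tk).
    have c2 : continuous (fun s : R => F (- z2 + 1 * s)) by exact: cF.
    have h := Hg2 _ (z2, w) c2.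
    transitivity (rad 1 (fun u => rad P' (fun v => F (- z2 + 1 * (u + v)) * g1 (u, (v, (z2, w)))))).
      apply: eq_rad => u; apply: eq_rad => v; rewrite /KK/= e1.
      by congr (F _ * _); ring.
    by rewrite h; apply: eq_rad => s; rewrite mul1r addrC.
  have tl : tfun (fun x : R * (R * W) => F (x.1 - x.2.1) * g2 x) by exact: tfun_comp1M.
  exact: esym (rad_swap P'.+1 N' w tl).
change (nat_of_bool false) with 0%N; change (nat_of_bool (~~ false)) with 1%N.
rewrite add1n add0n.
have e1 : e = -1 by rewrite /e sg0 expr1.
(* Negative sign: the swap brings z2 next to u, and z1 is frozen. *)
have [g2 tg2 Hg2] := rad_merge N' (tfun_swap3 tg1).
exists (fun x => g2 (x.2.1, (x.1, x.2.2))); first exact: tfun_swap2.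
move=> F w sF; rewrite (A _ _ sF); apply: eq_rad => z1.
pose KK x := F (e * x.1 + (x.2.1 - x.2.2.1)) * g1 x.
have tk : tfun (fun x : R * (R * (R * W)) => KK (x.1, (x.2.2.1, (x.2.1, x.2.2.2)))).
  by apply: tfun_swap3; exact: tKK.
rewrite -(rad_swap 1 N' (z1, w) tk).
have c2 : continuous (fun s : R => F (z1 + -1 * s)) by exact: cF.
have h := Hg2 _ (z1, w) c2.
transitivity (rad 1 (fun u => rad N' (fun v => F (z1 + -1 * (u + v)) * g1 (u, (z1, (v, w)))))).
  apply: eq_rad => u; apply: eq_rad => v; rewrite /KK/= e1.
  by congr (F _ * _); ring.
by rewrite h; apply: eq_rad => s; rewrite mulN1r.
Qed.

End radial_form.

(** * The density of a difference of two half-power variables *)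

Section density.
Context {R : realType} {W : normedModType R}.
Local Notation leb := (@lebesgue_measure R).
Local Notation mR := (measurableTypeR R).
Implicit Types (g : R * (R * W) -> R).

(** For k = 1, the density at s of the image under u - v of the two weights times g. The scalar k,
    later F(s), is kept under the integral so that [density_form] is the bare change of variables s
    = u - v. *)
Definition inner p q g (k s : R) (w : W) : R :=
  \int[leb]_v (hp q v * (hp p (s + v) * (k * g (s + v, (v, w))))).

Lemma density_form p q g (F : R -> R) w : (0 < p)%N -> (0 < q)%N -> tfun g -> smoothb true F ->
  \int[leb]_u (hp p u * \int[leb]_v (hp q v * (F (u - v) * g (u, (v, w))))) =
  \int[leb]_s inner p q g (F s) s w.
Proof.
move=> p0 q0 tg sF; pose K (x : R * (R * W)) := F (x.1 - x.2.1) * g x.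
have tK : tfun K.
  apply: tfun_comp1M => // k; apply: Ckb_blin; apply: blin_add; first exact/blin_fst/blin_id.
  exact/blin_opp/blin_fst/blin_snd/blin_id.
have th := pair_tfun w tK; have [M M0 hM] := tfun_supp th.
have := weight_shear (c := hp p) (d := hp q) 1 (hp_weight p0) (hp_weight q0) (hp_ge0 p) (hp_ge0 q)
  (tfun_continuous th) hM (tfun_bounded th).
move=> ->; apply: eq_Rintegral => s _; apply: eq_Rintegral => v _.
by rewrite /K/= mul1r addrK.
Qed.

Lemma Rintegral_between (h : R -> R) (a b : R) :
  (forall u, b <= u -> h u = 0) -> (forall u, u <= a -> h u = 0) ->
  \int[leb]_u h u = \int[leb]_(u in `]a, b[) h u.
Proof.
move=> hb ha; rewrite [RHS]Rintegral_mkcond; apply: eq_Rintegral => u _; rewrite patchE.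
case: ifPn => //; rewrite notin_setE/= in_itv/= => /negP; rewrite negb_and -!leNgt.
by case/orP => [/ha|/hb] ->.
Qed.

Lemma hp_even b (u : R) : 0 < u -> hp b.+1.*2 u = u ^+ b.
Proof.
move=> u0; have -> : (b.+1.*2 = 2 + b.*2)%N by rewrite doubleS.
by rewrite hp_double// hp2// mul1r.
Qed.

Lemma hp_odd b (u : R) : 0 < u -> hp b.*2.+1 u = hp 1 u * u ^+ b.
Proof. by move=> u0; rewrite -add1n hp_double. Qed.

(** In the variable u = s + v the even weight is (u - s)^b on u > s. Integrated over all u the
    polynomial gives psi, smooth in s. The excess over u <= s lives on ]0, s[, and u = t s shows it
    to be [hp (p + b.+1.*2) s] times a smooth dilation average. *)
Lemma inner_even p b g : (0 < p)%N -> tfun g -> exists psi B : R * W -> R,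
  [/\ tfun psi, tfun B & forall k s w,
    inner p b.+1.*2 g k s w = k * (psi (s, w) - hp (p + b.+1.*2) s * B (s, w))].
Proof.
move=> p0 tg; pose L (x : R * (R * W)) := (x.1, (x.1 - x.2.1, x.2.2)).
have Ld : blin (fun x : R * (R * W) => x.1 - x.2.1).
  by apply: blin_add; [exact/blin_fst/blin_id|exact/blin_opp/blin_fst/blin_snd/blin_id].
have Ll : blin L.
  apply: blin_pair; first exact/blin_fst/blin_id.
  by apply: blin_pair => //; exact/blin_snd/blin_snd/blin_id.
pose k2 x := g (L x).
have tk2 : tfun k2.
  apply: (tfun_blin Ll (K := 2)) => // -[a [s w]]; rewrite /L !prod_normE/=.
  set m := Num.max `|a| (Num.max `|a - s| _).
  have h1 : `|a| <= m by rewrite le_max lexx.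
  have h2 : `|a - s| <= m by rewrite !le_max lexx !orbT.
  have h3 : `|w| <= m by rewrite !le_max lexx !orbT.
  have m0 : 0 <= m by apply: le_trans h3.
  have h4 : `|s| <= 2 * m.
    by rewrite -[s](subKr a) (le_trans (ler_normB _ _))// mulrDl mul1r lerD.
  by rewrite !ge_max h4/=; apply/andP; split; lra.
(* The integrand without the weight of u, in the coordinates (u, (s, w)), with v = u - s and the
   power extended polynomially to u < s. *)
pose K (x : R * (R * W)) := (x.1 - x.2.1) ^+ b * k2 x.
have tK : tfun K by apply: tfunM => // k; apply: CkbX; exact: Ckb_blin.
have mI : measurable (`[0, 1]%classic : set mR) by exact: measurable_itv.
pose c (t : R) := hp p t * (t - 1) ^+ b.
have cid : continuous (id : R -> R) by move=> x; exact: cvg_id.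
have cpow : continuous (fun t : R => (t - 1) ^+ b).
  apply: (continuous_app (@exprn_continuous R b)).
  by apply: continuous_add => //; exact: cst_continuous.
have wp : local_weight (@hp R p) by exact: hp_weight.
have [mp ip] := wp.
have ic : leb.-integrable `[0, 1]%classic (EFin \o c).
  have i01 : leb.-integrable `[0, 1]%classic (EFin \o @hp R p).
    apply: (integrableS _ mI _ (ip 1)); first exact: measurable_itv.
    by move=> t /=; rewrite !in_itv/= => /andP[? ?]; apply/andP; split; lra.
  apply: (le_integrable mI _ _ i01).
    apply/measurable_EFinP; apply: measurable_funTS; apply: measurable_funM => //.
    exact: continuous_measurable_fun.
  move=> t /=; rewrite in_itv/= => /andP[t0 t1]; rewrite lee_fin normrM ler_piMr//.
  by rewrite normrX exprn_ile1// ler_norml; apply/andP; split; lra.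
exists (fun x => \int[leb]_u (hp p u * K (u, x))),
  (fun x => \int[leb]_(t in `[0, 1]) (c t * k2 (t * x.1, x))).
split; [exact: weight_tfun|exact: dilate_diag_tfun|].
move=> k s w; have [M M0 KM] := tfun_supp tK; have [C C0 KC] := tfun_bounded tK.
pose H u := hp p u * K (u, (s, w)).
have cK : continuous (fun u : R => K (u, (s, w))).
  by apply: (continuous_app (tfun_continuous tK)); apply: continuous_mkpair => //; exact: cst_continuous.
have iH : leb.-integrable setT (EFin \o H).
  apply: (cutoff_integrable (M := M) wp).
  - exact: continuous_measurable_fun.
  - by move=> u Mu; rewrite KM// prod_normE/= lt_max Mu.
  - by exists C.
have UE : setT = `]-oo, s]%classic `|` `]s, +oo[%classic :> set R.
  apply/seteqP; split => // u _; rewrite /= !in_itv/= andbT.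
  by have [us|su] := leP u s; [left|right].
have mA : measurable (`]-oo, s]%classic : set mR) by exact: measurable_itv.
have mB : measurable (`]s, +oo[%classic : set mR) by exact: measurable_itv.
have split_ : \int[leb]_u H u = \int[leb]_(u in `]-oo, s]) H u + \int[leb]_(u in `]s, +oo[) H u.
  rewrite [in LHS]UE Rintegral_setU//; first by rewrite -UE.
  rewrite disj_set2E; apply/eqP/seteqP; split => // u [].
  rewrite /= !in_itv/= andbT => us su.
  by exfalso; move: su; rewrite ltNge us.
have iA : leb.-integrable `]-oo, s[%classic (EFin \o H).
  by apply: (integrableS _ _ _ iH) => //; exact: measurable_itv.
have iB : leb.-integrable `]s, +oo[%classic (EFin \o H).
  by apply: (integrableS _ _ _ iH).
have hi : inner p b.+1.*2 g k s w = k * \int[leb]_(u in `]s, +oo[) H u.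
  pose Y u := hp b.+1.*2 (u - s) * (hp p u * (k * g (u, (u - s, w)))).
  have cs : continuous (fun u : R => u - s).
    by apply: continuous_add => //; exact: cst_continuous.
  have mY : measurable_fun setT (Y : mR -> R).
    apply: measurable_funM.
      apply: (measurableT_comp (@hp_measurable R b.+1.*2)); exact: continuous_measurable_fun.
    apply: measurable_funM => //; apply: continuous_measurable_fun.
    apply: continuous_mul; first exact: cst_continuous.
    apply: (continuous_app (tfun_continuous tg)); apply: continuous_mkpair => //.
    by apply: continuous_mkpair => //; exact: cst_continuous.
  transitivity (\int[leb]_u Y u).
    rewrite -(Rintegral_shift s mY); apply: eq_Rintegral => v _.
    by rewrite /Y addrK [v + s]addrC.
  rewrite -(RintegralZl k mB iB) [RHS]Rintegral_mkcond; apply: eq_Rintegral => u _.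
  rewrite patchE; case: ifPn => [|].
    rewrite inE/= in_itv/= andbT => su; rewrite /Y hp_even ?subr_gt0// /H /K /k2 /L/=.
    move: (hp p u) (g _) ((u - s) ^+ b) => x1 x2 x3; ring.
  rewrite notin_setE/= in_itv/= andbT => /negP; rewrite -leNgt => us.
  by rewrite /Y hp_eq0 ?mul0r// subr_le0.
(* The excess: (t s - s)^b = (t - 1)^b s^b accounts for the factor (t - 1)^b in [c], and s^b times
   the Jacobian s raises the half power by b + 1. *)
have lo : \int[leb]_(u in `]-oo, s]) H u =
    hp (p + b.+1.*2) s * \int[leb]_(t in `[0, 1]) (c t * k2 (t * s, (s, w))).
  rewrite -Rintegral_itv_bndo_bndc//.
  have [s0|s0] := leP s 0.
    rewrite (hp_eq0 (p + _) s0) mul0r Rintegral_mkcond (_ : _ \_ _ = (fun=> 0)) ?Rintegral_zero//.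
    apply/funext => u; rewrite patchE; case: ifPn => //; rewrite inE/= in_itv/= => us.
    by rewrite /H hp_eq0 ?mul0r// ltW// (lt_le_trans us).
  transitivity (\int[leb]_(u in `]0, s[) H u).
    rewrite Rintegral_mkcond [RHS]Rintegral_mkcond; apply: eq_Rintegral => u _; rewrite !patchE.
    have [u0|u0] := leP u 0.
      have -> : H u = 0 by rewrite /H hp_eq0// mul0r.
      by case: ifP; case: ifP.
    have -> // : (u \in `]-oo, s[%classic) = (u \in `]0, s[%classic).
    by apply/idP/idP; rewrite !inE/= !in_itv/= u0.
  have dF (x : R) : is_derive x 1 (fun x : R => x * s) s.
    have := is_deriveM (is_derive_id x 1) (is_derive_cst (s : R) x 1).
    by move=> X; apply: (is_derive_eq X); rewrite /GRing.scale/= mulr0 add0r mulr1.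
  have cs : continuous (fun _ : R => s) by exact: cst_continuous.
  have [Ck Ck0 kC] := tfun_bounded tk2.
  have icc : leb.-integrable `[0, 1]%classic (EFin \o (fun t => c t * k2 (t * s, (s, w)))).
    apply: (le_integrable mI _ _ (integrableZl mI Ck ic)).
      have /integrableP[/measurable_EFinP mc _] := ic.
      apply/measurable_EFinP; apply: measurable_funM mc _; apply: measurable_funTS.
      apply: continuous_measurable_fun; apply: (continuous_app (tfun_continuous tk2)).
      apply: continuous_mkpair; last exact: cst_continuous.
      by apply: continuous_mul => //; exact: cst_continuous.
    by move=> t _; rewrite /= lee_fin !normrM mulrC ler_wpM2r// (ger0_norm Ck0).
  have sub1 : (`]0, 1[%classic : set R) `<=` `[0, 1]%classic.
    by move=> t /=; rewrite !in_itv/= => /andP[h1 h2]; rewrite (ltW h1) (ltW h2).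
  have sub2 : (`]0, 1]%classic : set R) `<=` `[0, 1]%classic.
    by move=> t /=; rewrite !in_itv/= => /andP[h1 h2]; rewrite (ltW h1) h2.
  have mo : measurable (`]0, 1[%classic : set mR) by exact: measurable_itv.
  have mo2 : measurable (`]0, 1]%classic : set mR) by exact: measurable_itv.
  have i1 := integrableS mI mo sub1 icc; have i2 := integrableS mI mo2 sub2 icc.
  rewrite -(Rintegral_itv_obnd_cbnd i2) -(Rintegral_itv_bndo_bndc i1).
  rewrite -(RintegralZl _ mo i1).
  have := substitution_open (F := fun x : R => x * s) (f := fun=> s) (G := H) ltr01 dF cs.
  rewrite mul0r mul1r => -> //.
    apply: eq_Rintegral => t; rewrite inE/= in_itv/= => /andP[t0 t1].
    rewrite /H hp_mul// hp_double// /K /c/= (_ : t * s - s = (t - 1) * s); last by ring.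
    rewrite exprMn exprS; move: (hp p t) (hp p s) (k2 _) ((t - 1) ^+ b) (s ^+ b) => x1 x2 x3 x4 x5; ring.
  move=> y /andP[y0 _]; apply: continuousM; [exact: hp_continuous|exact: cK].
by rewrite hi -lo -/(\int[leb]_u H u) split_; ring.
Qed.

(** Control is in the parameter only; since [inner_odd] puts a copy of s among the parameters, it
    yields bounded support in s too. *)
Lemma Jext_supp (G : R * W -> R) (M : R) : (forall x, M < `|x| -> G x = 0) ->
  forall x, M < `|x.2| -> Jext G x = 0.
Proof.
move=> GM x Mx.
have z (s : R) : G (s, x.2) = 0 by apply: GM; rewrite prod_normE/= lt_max Mx orbT.
have Jz (s : R) : Jreg G (s, x.2) = 0.
  rewrite /Jreg /Javg /cavg /idil /dilate /Jint /=.
  have I0 (D : set R) (f : R -> R) : \int[leb]_(y in D) (1 * G (f y, x.2)) = 0.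
    by under eq_Rintegral do rewrite z mulr0; exact: Rintegral_zero.
  by rewrite !I0 addr0 !mulr0 addr0.
rewrite /Jext; case: ifP => _; last by rewrite [x]surjective_pairing Jz.
by under eq_fun do rewrite Jz; exact: lim_cst.
Qed.

End density.

(** * The density when both numbers of squares are odd *)

Section density_odd.
Context {R : realType} {W : normedModType R}.
Local Notation leb := (@lebesgue_measure R).
Local Notation mR := (measurableTypeR R).

(** Put r = |s| and v = (r cosh y - s) / 2, so that s + v = (r cosh y + s) / 2. The product of these
    is ((r sinh y) / 2)^2, hence the Jacobian cancels both inverse square roots and J of a test
    function remains, with s also as a parameter. *)
Lemma inner_odd i j (g : R * (R * W) -> R) : tfun g -> exists psi0 psi1 : R * W -> R,
  [/\ tfun psi0, tfun psi1 & forall k s w, s != 0 ->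
    inner i.*2.+1 j.*2.+1 g k s w = k * (psi0 (s, w) + s ^+ (i + j) * ln `|s| * psi1 (s, w))].
Proof.
(* New coordinates x.1 = s + 2 v and x.2.1 = s, from which s + v and v are recovered as half sum and
   half difference. *)
move=> tg; pose L (x : R * (R * W)) := (2^-1 * (x.1 + x.2.1), (2^-1 * (x.1 - x.2.1), x.2.2)).
have L1 : blin (fun x : R * (R * W) => x.1 + x.2.1).
  by apply: blin_add; [exact/blin_fst/blin_id|exact/blin_fst/blin_snd/blin_id].
have L2 : blin (fun x : R * (R * W) => x.1 - x.2.1).
  by apply: blin_add; [exact/blin_fst/blin_id|exact/blin_opp/blin_fst/blin_snd/blin_id].
have Ll : blin L.
  apply: blin_pair; first exact: blin_mul.
  by apply: blin_pair; [exact: blin_mul|exact/blin_snd/blin_snd/blin_id].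
pose g2 x := g (L x).
have tg2 : tfun g2.
  apply: (tfun_blin Ll (K := 2)) => // -[a [s w]]; rewrite /L !prod_normE/=.
  set m := Num.max `|2^-1 * (a + s)| _.
  have h1 : `|2^-1 * (a + s)| <= m by rewrite le_max lexx.
  have h2 : `|2^-1 * (a - s)| <= m by rewrite !le_max lexx !orbT.
  have h3 : `|w| <= m by rewrite !le_max lexx !orbT.
  have m0 : 0 <= m by apply: le_trans h3.
  have h4 : `|s| <= 2 * m.
    have -> : s = 2^-1 * (a + s) - 2^-1 * (a - s) by field.
    by rewrite (le_trans (ler_normB _ _))// mulrDl mul1r lerD.
  have h5 : `|a| <= 2 * m.
    have -> : a = 2^-1 * (a + s) + 2^-1 * (a - s) by field.
    by rewrite (le_trans (ler_normD _ _))// mulrDl mul1r lerD.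
  by rewrite !ge_max h4 h5/=; lra.
(* By [hp_odd] each weight is [hp 1] times an integer power; G absorbs these powers. *)
pose G (x : R * (R * W)) := (2^-1 * (x.1 + x.2.1)) ^+ i * ((2^-1 * (x.1 - x.2.1)) ^+ j * g2 x).
have tG : tfun G.
  apply: tfunM; last by move=> k; apply: CkbX; apply: CkbZ; exact: Ckb_blin.
  by apply: tfunM => // k; apply: CkbX; apply: CkbZ; exact: Ckb_blin.
pose cc (al t : R) : R := (2^-1 * (al + 1)) ^+ i * (2^-1 * (al - 1)) ^+ j.
pose c1 t := cc (cos t) t; pose c2 t := cc (- cos t) t.
have ccont (al : R -> R) : continuous al -> continuous (fun t => cc (al t) t).
  move=> ca; apply: continuous_mul.
    apply: (continuous_app (@exprn_continuous R i)); apply: continuous_mul; first exact: cst_continuous.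
    by apply: continuous_add => //; exact: cst_continuous.
  apply: (continuous_app (@exprn_continuous R j)); apply: continuous_mul; first exact: cst_continuous.
  by apply: continuous_add => //; exact: cst_continuous.
have cos1 := ccont _ (@continuous_cos R); have cos2 := ccont _ (@cosN_continuous R).
have [M M0 GM] := tfun_supp tG; have [M' M0' gM'] := tfun_supp tg2.
have Ld : blin (fun x : R * W => (x.1, x)).
  by apply: blin_pair; [exact/blin_fst/blin_id|exact: blin_id].
(* The variable s occurs twice, as the argument of Jext and among its parameters. *)
have t0 : tfun (fun x : R * W => Jext G (x.1, x)).
  have bs : bsupp (fun x : R * W => Jext G (x.1, x)).
    by exists M => x Mx; exact: (Jext_supp GM).
  by split=> // k; apply: Ckb_bsupp => //; apply: (Ckb_comp_lin Ld); exact: Jext_smooth.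
have t1 : tfun (fun x : R * W => - pi^-1 * cavg c1 c2 g2 (x.1, x)).
  apply: tfunZ; split=> [k|].
    by apply: (Ckb_comp_lin Ld); apply: cavg_Ckb => //; exact: tg2.1.
  exists M' => x Mx; rewrite /cavg /idil /dilate /=.
  have I0 (al c : R -> R) : \int[leb]_(t in `[0, pi]) (c t * g2 (al t * x.1, x)) = 0.
    rewrite (_ : (fun t => _) = (fun=> 0)) ?Rintegral_zero//.
    by apply/funext => t; rewrite gM' ?mulr0// prod_normE/= lt_max Mx orbT.
  by rewrite !I0 addr0 mulr0.
exists (fun x => Jext G (x.1, x)), (fun x => - pi^-1 * cavg c1 c2 g2 (x.1, x)).
split => // k s w s0.
(* In the average the first argument of G is al(t) s, so the i + j linear factors in G are
   homogeneous in s; this is the power in front of the logarithm. *)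
have JE : Javg G (s, (s, w)) = s ^+ (i + j) * cavg c1 c2 g2 (s, (s, w)).
  have I1 (al : R -> R) : continuous al ->
      idil 0 pi al (fun=> 1) G (s, (s, w)) = s ^+ (i + j) * idil 0 pi al (fun t => cc (al t) t) g2 (s, (s, w)).
    move=> ca; rewrite -(idilZ 0 pi ca (s ^+ (i + j)) (s, (s, w)) (ccont _ ca) (tg2.1 0%N)).
    apply: eq_Rintegral => t _; rewrite /G /cc/= mul1r.
    have -> : 2^-1 * (al t * s + s) = s * (2^-1 * (al t + 1)) by ring.
    have -> : 2^-1 * (al t * s - s) = s * (2^-1 * (al t - 1)) by ring.
    rewrite !exprMn exprD; move: (g2 _) (s ^+ i) (s ^+ j) ((al t + 1) ^+ i) ((al t - 1) ^+ j) (2^-1 ^+ i) (2^-1 ^+ j).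
    by move=> x1 x2 x3 x4 x5 x6 x7; ring.
  rewrite /Javg /cavg (I1 _ (@continuous_cos R)) (I1 _ (@cosN_continuous R)).
  by rewrite -mulrDr mulrCA.
have JR : Jint (fun=> 1) G (s, (s, w)) =
    Jext G (s, (s, w)) - ln `|s| * (pi^-1 * (s ^+ (i + j) * cavg c1 c2 g2 (s, (s, w)))).
  by rewrite JextE// /Jreg JE/= addrK.
suff -> : inner i.*2.+1 j.*2.+1 g k s w = k * Jint (fun=> 1) G (s, (s, w)).
  rewrite JR /=; move: (Jext _ _) (ln _) (cavg _ _ _ _) (s ^+ _) => x1 x2 x3 x4; ring.
have [N N0 gN] := tfun_supp tg.
pose r := `|s|; have r0 : 0 < r by rewrite normr_gt0.
(* Enlarged so that r cosh Y > N' >= 2 N + |s|, whence F Y > N: the integrals in y and in v can both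
   be cut at the same Y. *)
pose N' := Num.max M (2 * N + r).
have N'0 : 0 <= N' by rewrite le_max M0.
have GN' x : N' < `|x| -> G x = 0.
  by rewrite gt_max => /andP[h _]; exact: GM.
pose Y := Jcut N' r; have YP := JcutP N'0 r0 (lexx r); rewrite -/Y in YP.
have Y1 : 0 <= Y by exact: Jcut_ge0.
have Y0 : 0 < Y.
  rewrite lt_def Y1 andbT; apply/negP => /eqP YE; move: YP; rewrite YE expr0n/= mulr0.
  by rewrite ltNge mulr_ge0.
have YE := JintE (fun=> 1) (x := (s, (s, w))) GN' Y1 YP.
pose F (y : R) := 2^-1 * (r * ch y - s).
have dF (y : R) : is_derive y 1 F (2^-1 * (r * sh y)).
  have := is_deriveZ 2^-1 (is_deriveB (is_deriveZ r (is_derive_ch y)) (is_derive_cst (s : R) y 1)).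
  by move=> X; apply: (is_derive_eq X); rewrite /GRing.scale/= subr0.
have cF : continuous (fun y : R => 2^-1 * (r * sh y)).
  apply: continuous_mul; first exact: cst_continuous.
  by apply: continuous_mul; [exact: cst_continuous|exact: sh_continuous].
have shp (y : R) : 0 < y -> 0 < sh y.
  by move=> y0; rewrite /sh divr_gt0// subr_gt0 ltr_expR; lra.
have ch0 : ch 0 = 1 :> R by rewrite /ch oppr0 expR0; lra.
have rs : s <= r /\ - s <= r by rewrite /r ler_norm; split => //; rewrite -normrN ler_norm.
have FY : N < F Y.
  have h1 := ch_ge_sqr Y1; have : r * (Y ^+ 2 / 4) <= r * ch Y by rewrite ler_wpM2l// ltW.
  have : 2 * N + r <= N' by rewrite le_max lexx orbT.
  by rewrite /F; lra.
have chp (y : R) : 0 < y -> 1 < ch y.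
  move=> y0; rewrite ltNge; apply/negP => c1'.
  have h2 : 1 < ch y * ch y by rewrite ch_sqr ltrDl mulr_gt0// shp.
  have : ch y * ch y <= 1 by rewrite mulr_ile1// (le_trans ler01 (ch_ge1 y)).
  by rewrite leNgt h2.
have pos (y : R) : 0 < y -> 0 < F y /\ 0 < s + F y.
  move=> y0; have h := chp y y0; have : r < r * ch y by rewrite ltr_pMr.
  by rewrite /F; split; lra.
pose X v := hp j.*2.+1 v * (hp i.*2.+1 (s + v) * (k * g (s + v, (v, w)))).
have FYF : s + F Y = 2^-1 * (r * ch Y + s) by rewrite /F; field.
(* F 0 = (|s| - s) / 2 = max(0, - s), below which one of the two half powers vanishes. *)
rewrite /inner (Rintegral_between (a := F 0) (b := F Y) (h := X)); first last.
- move=> u; rewrite /F ch0 mulr1 => u0; rewrite /X.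
  have [un|up] := leP u 0; first by rewrite hp_eq0 ?mul0r.
  rewrite [hp i.*2.+1 _]hp_eq0 ?mul0r ?mulr0//.
  move: u0 up rs; rewrite /r; have [sp|sn] := leP 0 s => u0 up _; move: u0.
    by rewrite (ger0_norm sp); lra.
  by rewrite (ltr0_norm sn); lra.
- move=> u Yu; rewrite /X gN ?mulr0// !prod_normE/= !lt_max.
  by rewrite (lt_le_trans FY (le_trans Yu (ler_norm _))) orbT.
rewrite (substitution_open Y0 dF cF); first last.
- move=> v /andP[+ _]; rewrite /F ch0 mulr1 => v0.
  have v1 : 0 < v by move: rs v0 => [? ?]; lra.
  have v2 : 0 < s + v by move: rs v0 => [? ?]; lra.
  have csv : {for v, continuous (fun v : R => s + v)} by apply: cvgD; [exact: cvg_cst|exact: cvg_id].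
  apply: continuousM; first exact: hp_continuous.
  apply: continuousM.
    by apply: (continuous_comp (g := hp i.*2.+1) csv); exact: hp_continuous.
  apply: (continuous_mul (g := fun v => g (s + v, (v, w)))); first exact: cst_continuous.
  apply: (continuous_app (tfun_continuous tg)); apply: continuous_mkpair.
    by move=> x; apply: cvgD; [exact: cvg_cst|exact: cvg_id].
  by apply: continuous_mkpair; [move=> x; exact: cvg_id|exact: cst_continuous].
- by move=> y /andP[y0 _]; apply: mulr_gt0 => //; apply: mulr_gt0 => //; exact: shp.
rewrite YE /idil /dilate /=.
have cG : continuous (fun t : R => G (ch t * r, (s, w))).
  apply: (continuous_app (tfun_continuous tG)); apply: continuous_mkpair; last exact: cst_continuous.
  by apply: continuous_mul; [exact: ch_continuous|exact: cst_continuous].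
have mI : measurable (`[0, Y]%classic : set mR) by exact: measurable_itv.
have mo : measurable (`]0, Y[%classic : set mR) by exact: measurable_itv.
have mo2 : measurable (`]0, Y]%classic : set mR) by exact: measurable_itv.
have ii : leb.-integrable `[0, Y]%classic (EFin \o (fun t => 1 * G (ch t * r, (s, w)))).
  by apply: itv_continuous_integrable; apply: continuous_mul => //; exact: cst_continuous.
have sub1 : (`]0, Y[%classic : set R) `<=` `[0, Y]%classic.
  by move=> t /=; rewrite !in_itv/= => /andP[h1 h2]; rewrite (ltW h1) (ltW h2).
have sub2 : (`]0, Y]%classic : set R) `<=` `[0, Y]%classic.
  by move=> t /=; rewrite !in_itv/= => /andP[h1 h2]; rewrite (ltW h1) h2.
have i1 := integrableS mI mo sub1 ii; have i2 := integrableS mI mo2 sub2 ii.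
rewrite -/r -(Rintegral_itv_obnd_cbnd i2) -(Rintegral_itv_bndo_bndc i1) -(RintegralZl k mo i1).
apply: eq_Rintegral => y; rewrite inE/= in_itv/= => /andP[y0 _].
have [p1 p2] := pos y y0.
have E1 : s + F y = 2^-1 * (ch y * r + s) by rewrite /F; field.
have E2 : F y = 2^-1 * (ch y * r - s) by rewrite /F; ring.
(* The Jacobian is the product of the two square roots. *)
have S : hp 1 (F y) * hp 1 (s + F y) * (2^-1 * (r * sh y)) = 1.
  have a1 := sqr_sqrtr (ltW p1); have a2 := sqr_sqrtr (ltW p2).
  have b1 : 0 < Num.sqrt (F y) by rewrite sqrtr_gt0.
  have b2 : 0 < Num.sqrt (s + F y) by rewrite sqrtr_gt0.
  have rr : r * r = s * s by rewrite -!expr2 /r real_normK// num_real.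
  have e3 : F y * (s + F y) = (2^-1 * (r * sh y)) ^+ 2.
    rewrite E1 E2 !expr2.
    have -> : 2^-1 * (ch y * r - s) * (2^-1 * (ch y * r + s)) = 2^-1 * 2^-1 * (ch y * ch y * (r * r) - s * s) by ring.
    have -> : 2^-1 * (r * sh y) * (2^-1 * (r * sh y)) = 2^-1 * 2^-1 * ((r * r) * (sh y * sh y)) by ring.
    by rewrite ch_sqr rr; ring.
  have e4 : Num.sqrt (F y) * Num.sqrt (s + F y) = 2^-1 * (r * sh y).
    have pp : 0 <= 2^-1 * (r * sh y).
      by apply: mulr_ge0 => //; apply: mulr_ge0; apply: ltW => //; exact: shp.
    by rewrite -sqrtrM ?(ltW p1)// e3 sqrtr_sqr ger0_norm.
  rewrite /hp p1 p2 !expr1 -e4.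
  rewrite -{2}a1 -{2}a2; move: b1 b2; move: (Num.sqrt (F y)) (Num.sqrt (s + F y)) => x1 x2 b1 b2.
  by field; rewrite !lt0r_neq0.
rewrite /X (hp_odd _ p1) (hp_odd _ p2) /G /g2 /L/= -E1 -E2.
rewrite -[LHS]mulr1; move: S; move: (g _) (hp 1 _) (hp 1 _) (2^-1 * (r * sh y)) ((F y) ^+ j) ((s + F y) ^+ i).
move=> x1 x2 x3 x4 x5 x6 S.
have -> : x3 * x5 * (x2 * x6 * (k * x1)) * x4 * 1 = (x3 * x2 * x4) * (x5 * x6 * (k * x1)) by ring.
rewrite S; ring.
Qed.

End density_odd.

(** * Quadratic averages *)

Section singular_weights.
Context {R : realType}.
Local Notation leb := (@lebesgue_measure R).
Local Notation mR := (measurableTypeR R).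
Implicit Types (c b : R -> R).

(** Singularity functions are compared with half powers only off 0; at 0 itself the expressions may
    differ, as in [hp_even_sgn] with n = 0. *)
Lemma measurable_off0 c c' : measurable_fun setT (c' : mR -> R) ->
  (forall s, s != 0 -> c s = c' s) -> measurable_fun setT (c : mR -> R).
Proof.
move=> mc' cc'.
have -> : c = (fun s => c' s + \1_[set 0 : R] s * (c 0 - c' 0)).
  apply/funext => s; have [->|s0] := eqVneq s 0.
    by rewrite indicE mem_set// mul1r addrC subrK.
  by rewrite indicE memNset ?mul0r ?addr0 ?cc'//=; exact/eqP.
apply: measurable_funD => //; apply: measurable_funM; last exact: measurable_cst.
exact: measurable_indic.
Qed.

Lemma Rintegral_off0 c c' : measurable_fun setT (c' : mR -> R) ->
  (forall s, s != 0 -> c s = c' s) -> \int[leb]_s c s = \int[leb]_s c' s.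
Proof.
move=> mc' cc'; have mc := measurable_off0 mc' cc'.
rewrite /Rintegral; congr fine; apply: ae_eq_integral => //.
- exact/measurable_EFinP.
- exact/measurable_EFinP.
exists [set 0 : R]; split => //; first exact: lebesgue_measure_set1.
move=> s /= H; apply/eqP/negPn/negP => s0; apply: H => _.
by rewrite cc'.
Qed.

Lemma local_weightM c b : local_weight c -> measurable_fun setT (b : mR -> R) ->
  (forall M, exists K : R, forall u, `|u| <= M -> `|b u| <= K) -> local_weight (fun u => c u * b u).
Proof.
move=> [mc ic] mb bb; split=> [|M]; first exact: measurable_funM.
have [K bK] := bb M.
have mI : measurable (`[- M, M]%classic : set mR) by exact: measurable_itv.
apply: (le_integrable mI _ _ (integrableZl mI K (ic M))).
  by apply/measurable_EFinP; apply: measurable_funTS; exact: measurable_funM.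
move=> u; rewrite /= in_itv/= -ler_norml => uM; rewrite lee_fin !normrM mulrC ler_wpM2r//.
by rewrite (le_trans (bK u uM))// ler_norm.
Qed.

Lemma local_weightD c b : local_weight c -> local_weight b -> local_weight (fun u => c u + b u).
Proof.
move=> [mc ic] [mb ib]; split=> [|M]; first exact: measurable_funD.
have mI : measurable (`[- M, M]%classic : set mR) by exact: measurable_itv.
by apply: eq_integrable (integrableD mI (ic M) (ib M)).
Qed.

Lemma continuous_weight b : continuous b -> local_weight b.
Proof.
move=> cb; have := local_weightM (cst_local_weight 1) (b := b).
have -> : (fun u => 1 * b u) = b by apply/funext => u; rewrite mul1r.
apply; first exact: continuous_measurable_fun.
move=> M; have [K bK] := itv_bounded (- M) M cb; exists K => u uM; apply: bK.
by rewrite /= in_itv/= -ler_norml.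
Qed.

Lemma local_weight_off0 c c' : local_weight c' -> (forall s, s != 0 -> c s = c' s) -> local_weight c.
Proof.
move=> wc' cc'.
have -> : c = (fun s => c' s + (c 0 - c' 0) * \1_[set 0 : R] s).
  apply/funext => s; have [->|s0] := eqVneq s 0.
    by rewrite indicE mem_set// mulr1 addrC subrK.
  by rewrite indicE memNset ?mulr0 ?addr0 ?cc'//=; exact/eqP.
apply: local_weightD => //; apply: local_weightM; first exact: cst_local_weight.
  exact: measurable_indic.
by move=> M; exists 1 => u _; rewrite indicE; case: (_ \in _); rewrite ?normr1 ?normr0.
Qed.

Lemma hp_powR n (t : R) : 0 < t -> t `^ (n%:R / 2 - 1) = hp n t.
Proof.
move=> t0; rewrite /hp t0 powRB ?lt0r_neq0 ?implybT// powRr1 ?ltW//; congr (_ / _).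
by rewrite mulrC powRrM powR12_sqrt ?ltW// powR_mulrn// sqrtr_ge0.
Qed.

(** This is t_+^n = (1 + sgn t) t^n / 2: one half is a polynomial and goes into the smooth part, the
    other is the singularity for p and q even. *)
Lemma hp_even_sgn n (t : R) : t != 0 ->
  hp n.+1.*2 t = 2^-1 * t ^+ n + 2^-1 * Num.sg t * t ^+ n.
Proof.
move=> t0; have [tp|tn] := ltP 0 t.
  by rewrite hp_even// gtr0_sg// mulr1; move: (t ^+ n) => x; field.
rewrite hp_eq0// ltr0_sg ?lt_neqAle ?t0//; ring.
Qed.

Lemma sqrt_ln_bound (t : R) : `|Num.sqrt `|t| * ln `|t| | <= 2 * (`|t| + 1).
Proof.
have [->|t0] := eqVneq t 0; first by rewrite normr0 sqrtr0 mul0r normr0 add0r mulr1.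
have a0 : 0 < `|t| by rewrite normr_gt0.
have r0 : 0 < Num.sqrt `|t| by rewrite sqrtr_gt0.
have rE := sqr_sqrtr (ltW a0).
rewrite normrM (gtr0_norm r0) -{2}rE.
apply: le_trans (ler_wpM2l (ltW r0) (norm_ln_le r0)) _.
rewrite -[in leRHS]rE; move: r0; move: (Num.sqrt `|t|) => r r0.
rewrite le_eqVlt; apply/orP; left; apply/eqP; field; exact: lt0r_neq0.
Qed.

Lemma singularity_weight p q : (0 < p)%N -> (0 < q)%N -> local_weight (@singularity_fun R p q).
Proof.
move=> p0 q0; have n0 : (0 < p + q)%N by rewrite addn_gt0 p0.
have wn := @hp_weight R _ n0.
rewrite /singularity_fun; case po : (odd p); case qo : (odd q).
(* t^n ln |t| is |t|^(-1/2) times t^n sqrt|t| ln |t|; the first factor is locally integrable and the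
   second locally bounded. *)
- pose b (t : R) := t ^+ ((p + q)./2).-1 * (Num.sqrt `|t| * ln `|t|).
  have w1 : local_weight (fun t : R => hp 1 t + hp 1 (- t)).
    by apply: local_weightD; [exact: hp_weight|apply: reflect_local_weight; exact: hp_weight].
  have wb : local_weight (fun t : R => (hp 1 t + hp 1 (- t)) * b t).
    apply: local_weightM => //.
      apply: measurable_funM; first by apply: continuous_measurable_fun; exact: exprn_continuous.
      have mn : measurable_fun setT (fun t : mR => `|t| : mR).
        by apply: continuous_measurable_fun; exact: norm_continuous.
      apply: measurable_funM.
        by apply: (measurableT_comp _ mn); apply: continuous_measurable_fun; exact: sqrt_continuous.
      by apply: (measurableT_comp _ mn); exact: measurable_ln.
    move=> M; exists (`|M| ^+ ((p + q)./2).-1 * (2 * (`|M| + 1))) => u uM.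
    have uM' : `|u| <= `|M| by rewrite (le_trans uM)// ler_norm.
    rewrite /b normrM ler_pM//; first by rewrite normrX lerXn2r ?nnegrE.
    by rewrite (le_trans (sqrt_ln_bound u))// ler_wpM2l// lerD2r.
  apply: (local_weight_off0 wb) => t t0; rewrite /b.
  suff E : (hp 1 t + hp 1 (- t)) * Num.sqrt `|t| = 1 by rewrite mulrCA [(_ + _) * _]mulrA E mul1r.
  have a0 : 0 < `|t| by rewrite normr_gt0.
  have -> : hp 1 t + hp 1 (- t) = hp 1 `|t|.
    have [tp|tn] := ltP 0 t; first by rewrite gtr0_norm// [hp 1 (- t)]hp_eq0 ?addr0// oppr_le0 ltW.
    by rewrite (hp_eq0 1 tn) add0r ler0_norm.
  rewrite /hp a0 expr1 mulrAC -expr2 sqr_sqrtr ?(ltW a0)// divff// gt_eqF//.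
- apply: (local_weight_off0 wn) => t t0; rewrite /heaviside.
  have [tp|tn] := ltP 0 t; first by rewrite mul1r hp_powR.
  by rewrite mul0r hp_eq0.
- apply: (local_weight_off0 (reflect_local_weight wn)) => t t0; rewrite /heaviside.
  have [tp|tn] := ltP 0 (- t); first by rewrite mul1r hp_powR.
  by rewrite mul0r hp_eq0.
set n := ((p + q)./2).-1.
have nE : (p + q = n.+1.*2)%N.
  rewrite /n prednK; first by rewrite -[LHS]odd_double_half oddD po qo.
  rewrite -double_gt0 -(ltn_add2l (odd (p + q))) odd_double_half oddD po qo/=; lia.
rewrite nE in wn.
have w2 : local_weight (fun t : R => hp n.+1.*2 t + - 2^-1 * t ^+ n).
  apply: local_weightD => //; apply: continuous_weight.
  by apply: continuous_mul; [exact: cst_continuous|exact: exprn_continuous].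
apply: (local_weight_off0 w2) => t t0; rewrite (hp_even_sgn n t0); ring.
Qed.

End singular_weights.

(** * The density of a single quadratic form *)

Section quadratic_density.
Context {R : realType} {W : normedModType R}.
Local Notation leb := (@lebesgue_measure R).
Local Notation mR := (measurableTypeR R).

Lemma tfun_reflect (f : R * W -> R) : tfun f -> tfun (fun x => f (- x.1, x.2)).
Proof.
move=> tf; have Ll : blin (fun x : R * W => (- x.1, x.2)).
  by apply: blin_pair; [exact/blin_opp/blin_fst/blin_id|exact/blin_snd/blin_id].
by apply: (tfun_blin Ll (K := 1)) => // x; rewrite mul1r !prod_normE/= normrN.
Qed.

(** The translation v -> v + s exchanges the two groups and turns s into - s; it reduces p even to q
    even. *)
Lemma inner_swap p q (g : R * (R * W) -> R) k s w : tfun g ->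
  inner p q g k s w = inner q p (fun x => g (x.2.1, (x.1, x.2.2))) k (- s) w.
Proof.
move=> tg; pose Y v := hp p v * (hp q (- s + v) * (k * g (v, (- s + v, w)))).
have cid : continuous (id : R -> R) by move=> x; exact: cvg_id.
have cs : continuous (fun v : R => - s + v) by apply: continuous_add => //; exact: cst_continuous.
have mY : measurable_fun setT (Y : mR -> R).
  apply: measurable_funM; first exact: hp_measurable.
  apply: measurable_funM.
    by apply: (measurableT_comp (@hp_measurable R q)); exact: continuous_measurable_fun.
  apply: continuous_measurable_fun; apply: continuous_mul; first exact: cst_continuous.
  apply: (continuous_app (tfun_continuous tg)); apply: continuous_mkpair => //.
  by apply: continuous_mkpair => //; exact: cst_continuous.
transitivity (\int[leb]_v Y (v + s)); last exact: Rintegral_shift.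
apply: eq_Rintegral => v _; rewrite /Y (_ : - s + (v + s) = v); last by ring.
by rewrite [v + s]addrC mulrCA.
Qed.

Lemma inner_density p q (g : R * (R * W) -> R) : (0 < p)%N -> (0 < q)%N -> tfun g ->
  exists psi0 psi1 : R * W -> R, [/\ tfun psi0, tfun psi1 & forall k s w, s != 0 ->
    inner p q g k s w = k * (psi0 (s, w) + singularity_fun p q s * psi1 (s, w))].
Proof.
move=> p0 q0 tg; rewrite /singularity_fun.
have evenE n : ~~ odd n -> (0 < n)%N -> exists b, n = b.+1.*2.
  move=> on n0; exists (n./2).-1; have := odd_double_half n; rewrite (negbTE on) add0n => E.
  by rewrite prednK// -double_gt0 E.
case po : (odd p); case qo : (odd q).
- have pE : p = (p./2).*2.+1 by rewrite -[LHS]odd_double_half po.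
  have qE : q = (q./2).*2.+1 by rewrite -[LHS]odd_double_half qo.
  have [psi0 [psi1 [t0 t1 H]]] := inner_odd p./2 q./2 tg.
  exists psi0, psi1; split => // k s w s0.
  rewrite {1}pE {1}qE H//; congr (_ * (_ + _ ^+ _ * _ * _)).
  by rewrite {2}pE {2}qE; lia.
- have [b qE] := evenE q (negbT qo) q0.
  have [psi [B [t0 t1 H]]] := inner_even b p0 tg.
  exists psi, (fun x => -1 * B x); split => //; first exact: tfunZ.
  move=> k s w s0; rewrite {1}qE H -qE; congr (_ * _).
  suff -> : heaviside s * s `^ ((p + q)%:R / 2 - 1) = hp (p + q) s by ring.
  rewrite /heaviside; have [tp|tn] := ltP 0 s; first by rewrite mul1r hp_powR.
  by rewrite mul0r hp_eq0.
- have [b pE] := evenE p (negbT po) p0.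
  have [psi [B [t0 t1 H]]] := inner_even b q0 (tfun_swap2 tg).
  exists (fun x => psi (- x.1, x.2)), (fun x => -1 * B (- x.1, x.2)).
  split; [exact: tfun_reflect|by apply: tfunZ; exact: tfun_reflect|].
  move=> k s w s0; rewrite (inner_swap p q k s w tg) {1}pE H -pE /=; congr (_ * _).
  suff -> : heaviside (- s) * (- s) `^ ((p + q)%:R / 2 - 1) = hp (q + p) (- s) by ring.
  rewrite addnC /heaviside; have [tp|tn] := ltP 0 (- s); first by rewrite mul1r hp_powR.
  by rewrite mul0r hp_eq0.
have [b qE] := evenE q (negbT qo) q0.
have [psi [B [t0 t1 H]]] := inner_even b p0 tg.
set n := ((p + q)./2).-1.
have nE : (p + q = n.+1.*2)%N.
  rewrite /n prednK; first by rewrite -[LHS]odd_double_half oddD po qo.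
  rewrite -double_gt0 -(ltn_add2l (odd (p + q))) odd_double_half oddD po qo/=; lia.
(* The polynomial half of the half power joins psi, as [hp_even_sgn] prescribes. *)
exists (fun x => psi x + (- 2^-1 * x.1 ^+ n) * B x), (fun x => -1 * B x); split.
- apply: tfunD => //; apply: tfunM => // k; apply: CkbZ; apply: CkbX; apply: Ckb_blin.
  exact/blin_fst/blin_id.
- exact: tfunZ.
move=> k s w s0; rewrite {1}qE H -qE nE (hp_even_sgn n s0) /=; congr (_ * _); ring.
Qed.

Lemma quad_form_sgsq p q (x : 'rV[R]_(p + q)) : quad_form x = sgsq (fun i => (i < p)%N) x.
Proof.
rewrite /quad_form /sgsq big_split_ord/=; congr (_ + _).
  by apply: eq_bigr => i _; rewrite ltn_ord mul1r.
rewrite -sumrN; apply: eq_bigr => i _.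
by rewrite ltnNge leq_addr/= expr1 mulN1r.
Qed.

Theorem quad_density p q (f : 'rV[R]_(p + q) * W -> R) : (0 < p)%N -> (0 < q)%N -> tfun f ->
  exists psi0 psi1 : R * W -> R, [/\ tfun psi0, tfun psi1 &
    forall (F : R -> R) w, smoothb true F ->
    \int[lebesgue_tuple R (p + q)]_t (F (quad_form (row_of_tuple t)) * f (row_of_tuple t, w)) =
    \int[leb]_s (F s * (psi0 (s, w) + singularity_fun p q s * psi1 (s, w)))].
Proof.
move=> p0 q0 tf; have [g tg Hg] := radial_form (fun i => (i < p)%N) tf.
have [psi0 [psi1 [t0 t1 H]]] := inner_density p0 q0 tg.
exists psi0, psi1; split => // F w sF.
have pE : (\sum_(i < p + q) (i < p) = p)%N.
  rewrite big_split_ord/= (eq_bigr (fun=> 1%N)); last by move=> i _; rewrite ltn_ord.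
  rewrite sum1_card card_ord big1 ?addn0// => i _.
  by rewrite ltnNge leq_addr.
have qE : (\sum_(i < p + q) ~~ (i < p) = q)%N.
  rewrite big_split_ord/= big1 ?add0n; last by move=> i _; rewrite ltn_ord.
  rewrite (eq_bigr (fun=> 1%N)); last by move=> i _; rewrite ltnNge leq_addr.
  by rewrite sum1_card card_ord.
under eq_Rintegral do rewrite quad_form_sgsq.
rewrite (Hg F w sF) pE qE.
have -> h : rad p h = \int[leb]_u (hp p u * h u) by case: (p) p0.
have radq h : rad q h = \int[leb]_u (hp q u * h u) by case: (q) q0.
under eq_Rintegral do rewrite radq.
rewrite (density_form w p0 q0 tg sF); apply: Rintegral_off0; last by move=> s s0; exact: H.
have [ms _] := @singularity_weight R p q p0 q0.
have cc (psi : R * W -> R) : tfun psi -> measurable_fun setT ((fun s => psi (s, w)) : mR -> R).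
  move=> tpsi; apply: continuous_measurable_fun; apply: (continuous_app (tfun_continuous tpsi)).
  by apply: continuous_mkpair; [move=> x; exact: cvg_id|exact: cst_continuous].
apply: measurable_funM.
  by apply: continuous_measurable_fun; exact: (Ckb_continuous (sF 0%N)).
by apply: measurable_funD; [exact: cc|apply: measurable_funM => //; exact: cc].
Qed.

End quadratic_density.

(** * Compact support versus bounded support *)

Section test_functions_tfun.
Context {R : realType}.

(** Iterated derivatives are continuous and vanish off the compact closure of the support, hence are
    globally bounded. *)
Lemma test_function_tfun (V : normedModType R) (f : V -> R) : test_function f -> tfun f.
Proof.
move=> [sf cK]; set K := closure _ in cK.
have closedK : closed K by exact: closed_closure.
have f0 x : ~ K x -> f x = 0.
  by move=> nK; apply/eqP/negPn/negP => fx; apply: nK; exact: subset_closure.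
have df0 vs x : ~ K x -> iter_derive f vs x = 0.
  elim: vs x => [|v vs IH] x nK; first exact: f0.
  have oK : open (~` K) by exact: closed_openC.
  have /nbhs_ballP[r /= r0 rK] := open_nbhs_nbhs (conj oK nK : open_nbhs x (~` K)).
  have [_ ->//] : is_derive x v (iter_derive f vs) 0.
  have d0 : is_derive x v (fun _ : V => (0 : R)) 0 by exact: is_derive_cst.
  apply: (is_derive_local r0 _ d0) => y xy; apply: IH; apply: rK.
  by rewrite -ball_normE/= distrC.
have ci vs : continuous (iter_derive f vs) by move=> x; have [] := sf vs x I.
have bd vs : exists C, forall x, `|iter_derive f vs x| <= C.
  have cI : compact (iter_derive f vs @` K).
    by apply: continuous_compact => //; exact: continuous_subspaceT.
  have [C [_ HC]] := compact_bounded cI; exists (Num.max 0 (C + 1)) => x.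
  have [Kx|nK] := pselect (K x); last by rewrite df0// normr0 le_max lexx.
  rewrite le_max; apply/orP; right; apply: (HC (C + 1)); first by rewrite ltrDl.
  by exists x.
split; last first.
  have [C [_ HC]] := compact_bounded cK; exists (C + 1) => x Cx.
  apply: f0 => Kx; move: Cx; rewrite ltNge => /negP; apply.
  by apply: (HC (C + 1)) => //; rewrite ltrDl.
move=> k; suff H : forall vs, Ckb true k (iter_derive f vs) by exact: (H [::]).
elim: k => [|k IH] vs.
  by split=> // M; have [C HC] := bd vs; exists C => x _; exact: HC.
apply: CkbS => //; first by move=> M; have [C HC] := bd vs; exists C => x _; exact: HC.
move=> v; exists (iter_derive f (v :: vs)); first exact: IH.
by move=> x; have [dv _] := sf vs x I; exact: DeriveDef (dv v) erefl.
Qed.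

Lemma tfun_test_function (f : R * R -> R) : tfun f -> test_function f.
Proof.
move=> tf.
have ti vs : tfun (iter_derive f vs).
  by elim: vs => [//|v vs IH]; exact: (tfun_derive v IH).
split=> [vs x _|].
  split; last exact: tfun_continuous.
  by move=> v; have [] := Ckb_is_derive x v ((ti vs).1 1%N).
have [M M0 fM] := tfun_supp tf.
have cI : compact (`[- M, M]%classic : set R) by exact: segment_compact.
have cB := compact_setX cI cI.
apply: (@subclosed_compact _ (closure [set x : R * R | f x != 0]) (`[- M, M]%classic `*` `[- M, M]%classic)).
- exact: closed_closure.
- exact: cB.
have hB : closed (`[- M, M]%classic `*` `[- M, M]%classic : set (R * R)).
  by apply: compact_closed cB; exact: norm_hausdorff.
rewrite [X in _ `<=` X]((closure_id _).1 hB); apply: closure_subset => x /= fx.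
have : `|x| <= M by rewrite leNgt; apply/negP => Mx; move: fx; rewrite fM// eqxx.
by rewrite prod_normE ge_max /= !in_itv/= -!ler_norml => /andP[].
Qed.

Lemma tfun_tensor (F1 F2 : R -> R) : tfun F1 -> tfun F2 ->
  tfun (fun x : R * R => F1 x.1 * F2 x.2).
Proof.
move=> [s1 [M1 H1]] [s2 [M2 H2]]; split=> [k|].
  apply: CkbM; first by apply: (Ckb_comp_lin _ (s1 k)); exact/blin_fst/blin_id.
  by apply: (Ckb_comp_lin _ (s2 k)); exact/blin_snd/blin_id.
exists (Num.max M1 M2) => x; rewrite prod_normE lt_max !gt_max.
by case/orP => /andP[h1 h2]; [rewrite H1 ?mul0r|rewrite H2 ?mulr0].
Qed.

End test_functions_tfun.

(** * Functions determined by their integrals against tensor products *)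

Section uniqueness.
Context {R : realType}.
Local Notation leb := (@lebesgue_measure R).
Local Notation mR := (measurableTypeR R).

(** If D t > 0, two bumps of radius r give a product supported in the r-ball around t, for the
    maximum norm, where D stays above D t / 2; its integral against D would be positive. *)
Lemma tensor_unique (D : R * R -> R) (t : R * R) : {for t, continuous D} ->
  (forall F1 F2 : R -> R, tfun F1 -> tfun F2 ->
    (leb \x leb)%E.-integrable setT (fun z => (F1 z.1 * F2 z.2 * D z)%:E) /\
    \int[(leb \x leb)%E]_z (F1 z.1 * F2 z.2 * D z) = 0) -> D t = 0.
Proof.
move=> cD H; apply/eqP/negPn/negP => Dt0.
wlog Dt : D cD H Dt0 / 0 < D t.
  move=> W; have [//|Dn] := ltP 0 (D t); first exact: (W D).
  apply: (W (fun z => - D z)).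
  - by apply: continuousN.
  - move=> F1 F2 t1 t2; have [i1 e1] := H F1 F2 t1 t2; split.
      have := integrableN i1; apply: eq_integrable => // z _.
      by rewrite /= mulrN EFinN.
    have := RintegralZl (-1) measurableT i1; rewrite e1 mulr0 => <-.
    by apply: eq_Rintegral => z _; rewrite mulN1r mulrN.
  - by rewrite oppr_eq0.
  - by rewrite oppr_gt0 lt_neqAle Dt0.
have Dt2 : 0 < D t / 2 by rewrite divr_gt0.
have /cvgrPdist_lt/(_ _ Dt2)/nbhs_ballP[r /= r0 Hr] := cD.
pose F1 := hat t.1 r; pose F2 := hat t.2 r.
have t1 : tfun F1 by exact: hat_tfun.
have t2 : tfun F2 by exact: hat_tfun.
have [iD eD] := H F1 F2 t1 t2.
have F10 : 0 < F1 t.1 by apply: hat_gt0; rewrite subrr normr0.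
have F20 : 0 < F2 t.2 by apply: hat_gt0; rewrite subrr normr0.
have bump (F : R -> R) (a : R) : tfun F -> 0 < F a ->
    exists2 d, 0 < d & forall x, `[a - d, a + d]%classic x -> F a / 2 <= F x.
  move=> tF Fa; have Fa2 : 0 < F a / 2 by rewrite divr_gt0.
  have cF := tfun_continuous tF.
  have /cvgrPdist_lt/(_ _ Fa2)/nbhs_ballP[d /= d0 Hd] := cF a.
  exists (d / 2); first by rewrite divr_gt0.
  move=> x; rewrite /= in_itv/= => /andP[x1 x2].
  have : `|F a - F x| < F a / 2.
    by apply: Hd; rewrite /ball/= ltr_norml; apply/andP; split; lra.
  by rewrite ltr_norml => /andP[h1 h2]; lra.
have [d1 d10 B1] := bump F1 t.1 t1 F10; have [d2 d20 B2] := bump F2 t.2 t2 F20.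
pose I1 : set mR := `[t.1 - d1, t.1 + d1]%classic; pose I2 : set mR := `[t.2 - d2, t.2 + d2]%classic.
have mI1 : measurable I1 by exact: measurable_itv.
have mI2 : measurable I2 by exact: measurable_itv.
pose B := I1 `*` I2; have mB : measurable B by exact: measurableX.
(* On the box B each bump exceeds half its central value; being positive, the bumps force z into the
   ball where D z >= D t / 2. So k bounds the integrand from below on B. *)
pose k : R := F1 t.1 / 2 * (F2 t.2 / 2) * (D t / 2).
have k0 : 0 < k by apply: mulr_gt0 => //; apply: mulr_gt0; rewrite divr_gt0.
have muB : ((leb \x leb)%E B = (2 * d1 * (2 * d2))%:E)%E.
  have L (a d : R) : 0 < d -> leb (`[a - d, a + d]%classic : set R) = (2 * d)%:E.
    move=> d0; rewrite lebesgue_measure_itv/= lte_fin ifT; last by lra.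
    by rewrite -EFinB; congr EFin; ring.
  transitivity (leb I1 * leb I2)%E; first exact: product_measure1E.
  by rewrite EFinM; congr (_ * _)%E; exact: L.
have ge0 z : 0 <= F1 z.1 * F2 z.2 * D z.
  have [zr|rz] := ltP `|t - z| r.
    have := Hr z; rewrite -ball_normE/= => /(_ zr); rewrite ltr_norml => /andP[_ h].
    have Dz : 0 <= D z by lra.
    by apply: (mulr_ge0 _ Dz); apply: mulr_ge0; exact: hat_ge0.
  have [z1|z1] := leP r `|z.1 - t.1|; first by rewrite /F1 hat_supp// !mul0r.
  have [z2|z2] := leP r `|z.2 - t.2|; first by rewrite /F2 hat_supp// mulr0 mul0r.
  by move: rz; rewrite prod_normE/= leNgt gt_max distrC z1 distrC z2.
have low z : k * \1_B z <= F1 z.1 * F2 z.2 * D z.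
  rewrite indicE; have [Bz|nB] := boolP (z \in B); last by rewrite mulr0.
  rewrite mulr1; move: Bz; rewrite inE => -[/B1 b1 /B2 b2].
  have F1z : 0 < F1 z.1 by apply: lt_le_trans b1; rewrite divr_gt0.
  have F2z : 0 < F2 z.2 by apply: lt_le_trans b2; rewrite divr_gt0.
  have zr : `|t - z| < r.
    rewrite prod_normE/= gt_max !ltNge; apply/andP; split; apply/negP => h.
      by move: F1z; rewrite /F1 hat_supp ?ltxx// distrC.
    by move: F2z; rewrite /F2 hat_supp ?ltxx// distrC.
  have := Hr z; rewrite -ball_normE/= => /(_ zr); rewrite ltr_norml => /andP[_ h].
  have D2z : D t / 2 <= D z by lra.
  have f10 := divr_ge0 (ltW F10) (ler0n R 2); have f20 := divr_ge0 (ltW F20) (ler0n R 2).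
  exact: (ler_pM (mulr_ge0 f10 f20) (ltW Dt2) (ler_pM f10 f20 b1 b2) D2z).
have : (k%:E * (leb \x leb)%E B <= \int[(leb \x leb)%E]_z (F1 z.1 * F2 z.2 * D z)%:E)%E.
  rewrite -[X in (_ * (leb \x leb)%E X)%E]setIT -integral_indic//.
  have mi : measurable_fun setT (EFin \o (\1_B : mR * mR -> R)).
    by apply/measurable_EFinP; exact: measurable_indic.
  rewrite -ge0_integralZl_EFin//; last exact: ltW.
  apply: ge0_le_integral => //.
  - by move=> z _; rewrite -EFinM lee_fin mulr_ge0// ltW.
  - exact: measurable_funeM.
  - by have /integrableP[] := iD.
  - by move=> z _; rewrite -EFinM lee_fin; exact: low.
have -> : (\int[(leb \x leb)%E]_z (F1 z.1 * F2 z.2 * D z)%:E = 0)%E.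
  rewrite -(fineK (integrable_fin_num measurableT iD)); congr EFin; exact: eD.
rewrite muB -EFinM lee_fin leNgt => /negP; apply.
by apply: mulr_gt0 => //; apply: mulr_gt0; apply: mulr_gt0.
Qed.

End uniqueness.

(** * The joint density of the two forms *)

Section two_forms.
Context {R : realType}.
Local Notation leb := (@lebesgue_measure R).
Local Notation mR := (measurableTypeR R).
Local Notation rot t := (row_of_tuple t).

Lemma tuple_tfun_integrable n (g : 'rV[R]_n -> R) (M : R) : continuous g ->
  (forall r, M < `|r| -> g r = 0) -> (exists C : R, forall r, `|g r| <= C) ->
  (lebesgue_tuple R n).-integrable setT (EFin \o (fun t => g (rot t))).
Proof.
move=> cg gM [C gC]; have [b ib bP] := tuple_box n M.
apply: (le_integrable measurableT _ _ (integrableZl measurableT C ib)).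
  by apply/measurable_EFinP; exact: borel_row.
move=> t _; have [b0 b1] := bP t.
have C0 : 0 <= C by exact: le_trans (gC 0).
rewrite /= lee_fin (ger0_norm (mulr_ge0 C0 b0)).
have [tM|Mt] := leP `|rot t| M; first by rewrite b1// mulr1.
by rewrite gM// normr0 mulr_ge0.
Qed.

Lemma quad_form_continuous p q : continuous (@quad_form R p q).
Proof.
rewrite (_ : @quad_form R p q = @sgsq R (fun i => (i < p)%N) (p + q)); first exact: sgsq_continuous.
by apply/funext => x; exact: quad_form_sgsq.
Qed.

(** The first form, with the second row vector as parameter, yields two coefficients a0, a1; the
    second form, with t1 as parameter, splits each of them in two. This gives the four functions. *)
Lemma two_forms_density p1 q1 p2 q2 (f : 'rV[R]_(p1 + q1) * 'rV[R]_(p2 + q2) -> R) :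
  (0 < p1)%N -> (0 < q1)%N -> (0 < p2)%N -> (0 < q2)%N -> tfun f ->
  exists psi0 psi1 psi2 psi3 : R * R -> R,
    [/\ tfun psi0, tfun psi1, tfun psi2 & tfun psi3] /\
    forall F1 F2 : R -> R, tfun F1 -> tfun F2 ->
    let N t := psi0 t + singularity_fun p1 q1 t.1 * psi1 t + singularity_fun p2 q2 t.2 * psi2 t
        + singularity_fun p1 q1 t.1 * singularity_fun p2 q2 t.2 * psi3 t in
    (leb \x leb)%E.-integrable setT (fun z => (F1 z.1 * F2 z.2 * N z)%:E) /\
    \int[(lebesgue_tuple R (p1 + q1) \x lebesgue_tuple R (p2 + q2))%E]_z
      (F1 (quad_form (rot z.1)) * F2 (quad_form (rot z.2)) * f (rot z.1, rot z.2)) =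
    \int[(leb \x leb)%E]_z (F1 z.1 * F2 z.2 * N z).
Proof.
move=> p10 q10 p20 q20 tf.
have [a0 [a1 [ta0 ta1 Ha]]] := quad_density p10 q10 tf.
(* Exchanges t1 and the second row vector, which becomes the integrated variable; the resulting
   functions come in the order (t2, t1) and are swapped back. *)
pose sw (g : R * 'rV[R]_(p2 + q2) -> R) (x : 'rV[R]_(p2 + q2) * R) := g (x.2, x.1).
have tsw g : tfun g -> tfun (sw g).
  move=> tg; have Ll : blin (fun x : 'rV[R]_(p2 + q2) * R => (x.2, x.1)).
    by apply: blin_pair; [exact/blin_snd/blin_id|exact/blin_fst/blin_id].
  by apply: (tfun_blin Ll (K := 1)) => // x; rewrite mul1r !prod_normE/= maxC.
have [b00 [b01 [tb00 tb01 Hb0]]] := quad_density p20 q20 (tsw _ ta0).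
have [b10 [b11 [tb10 tb11 Hb1]]] := quad_density p20 q20 (tsw _ ta1).
have tsw2 (g : R * R -> R) : tfun g -> tfun (fun x : R * R => g (x.2, x.1)).
  move=> tg; have Ll : blin (fun x : R * R => (x.2, x.1)).
    by apply: blin_pair; [exact/blin_snd/blin_id|exact/blin_fst/blin_id].
  by apply: (tfun_blin Ll (K := 1)) => // x; rewrite mul1r !prod_normE/= maxC.
exists (fun x => b00 (x.2, x.1)), (fun x => b10 (x.2, x.1)),
  (fun x => b01 (x.2, x.1)), (fun x => b11 (x.2, x.1)).
split; first by split; exact: tsw2.
move=> F1 F2 tF1 tF2 N.
have sF1 := tF1.1; have sF2 := tF2.1.
have cF1 := tfun_continuous tF1; have cF2 := tfun_continuous tF2.
have [D1 D10 HD1] := tfun_bounded tF1; have [D2 D20 HD2] := tfun_bounded tF2.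
have [Mf fM] := tf.2; have [Cf Cf0 fC] := tfun_bounded tf.
set e1 := @singularity_fun R p1 q1 in N *; set e2 := @singularity_fun R p2 q2 in N Ha Hb0 Hb1 *.
have we1 : local_weight e1 by exact: singularity_weight.
have we2 : local_weight e2 by exact: singularity_weight.
have [me1 _] := we1; have [me2 _] := we2.
have mF1 : measurable_fun setT (F1 : mR -> R) by exact: continuous_measurable_fun.
have mF2 : measurable_fun setT (F2 : mR -> R) by exact: continuous_measurable_fun.
have [K1 FK1] := tF1.2.
have [K2 FK2] := tF2.2.
have iw e (F : R -> R) K D : local_weight e -> measurable_fun setT (F : mR -> R) ->
   (forall u, K < `|u| -> F u = 0) -> (forall u, `|F u| <= D) ->
   leb.-integrable setT (EFin \o (fun u => (1 + `|e u|) * `|F u|)).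
  move=> we mF FK FD.
  have w1 : local_weight (fun u => 1 + `|e u|).
    apply: local_weightD; first exact: cst_local_weight.
    have [me ie] := we; split=> [|M]; first exact: measurableT_comp.
    by apply: eq_integrable (integrable_abse (ie M)).
  apply: (cutoff_integrable w1 (M := K)); first exact: measurableT_comp.
    by move=> u Ku; rewrite FK// normr0.
  by exists D => u; rewrite normr_id.
have i1 := iw e1 F1 K1 D1 we1 mF1 FK1 HD1.
have i2 := iw e2 F2 K2 D2 we2 mF2 FK2 HD2.
have [c00 c000 B00] := tfun_bounded tb00; have [c01 c010 B01] := tfun_bounded tb01.
have [c10 c100 B10] := tfun_bounded tb10; have [c11 c110 B11] := tfun_bounded tb11.
have [ca0 ca00 A0] := tfun_bounded ta0; have [ca1 ca10 A1] := tfun_bounded ta1.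
pose phi (z : mR * mR) := F1 z.1 * F2 z.2 * N z.
have mf1 : measurable_fun setT (fst : mR * mR -> mR) by exact: measurable_fst.
have mf2 : measurable_fun setT (snd : mR * mR -> mR) by exact: measurable_snd.
have mpsi (g : R * R -> R) : tfun g -> measurable_fun setT ((fun x => g (x.2, x.1)) : mR * mR -> R).
  by move=> tg; apply: borel_plane; apply: tfun_continuous; exact: tsw2.
have mN : measurable_fun setT (N : mR * mR -> R).
  have mx1 := measurableT_comp me1 mf1; have mx2 := measurableT_comp me2 mf2.
  apply: measurable_funD; last first.
    by apply: measurable_funM; [exact: measurable_funM|exact: mpsi].
  apply: measurable_funD; last first.
    by apply: measurable_funM; [exact: mx2|exact: mpsi].
  apply: measurable_funD; last first.
    by apply: measurable_funM; [exact: mx1|exact: mpsi].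
  exact: mpsi.
have mphi : measurable_fun setT phi.
  apply: measurable_funM => //; apply: measurable_funM.
    exact: (measurableT_comp mF1 mf1).
  exact: (measurableT_comp mF2 mf2).
pose C := c00 + c10 + c01 + c11.
have C0 : 0 <= C by rewrite !addr_ge0.
have iC : leb.-integrable setT (EFin \o (fun u => C * ((1 + `|e1 u|) * `|F1 u|))).
  by apply: eq_integrable (integrableZl measurableT C i1).
(* N is dominated by a product of functions of one variable, locally integrable in each, as the
   later uses of Fubini require. *)
have domN x y : `|N (x, y)| <= C * ((1 + `|e1 x|) * (1 + `|e2 y|)).
  have x0 := normr_ge0 (e1 x); have y0 := normr_ge0 (e2 y).
  rewrite /N /=; apply: (@le_trans _ _ (c00 + `|e1 x| * c10 + `|e2 y| * c01 + `|e1 x| * `|e2 y| * c11)).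
    rewrite (le_trans (ler_normD _ _))// lerD//; last by rewrite !normrM ler_wpM2l// mulr_ge0.
    rewrite (le_trans (ler_normD _ _))// lerD//; last by rewrite !normrM ler_wpM2l.
    by rewrite (le_trans (ler_normD _ _))// lerD// !normrM ler_wpM2l.
  rewrite /C; move: x0 y0; move: (`|e1 x|) (`|e2 y|) => x1 y1 x0 y0.
  have xy := mulr_ge0 x0 y0.
  have -> : (c00 + c10 + c01 + c11) * ((1 + x1) * (1 + y1)) =
    (c00 + x1 * c10 + y1 * c01 + x1 * y1 * c11) +
    (c00 * (x1 + y1 + x1 * y1) + c10 * (1 + y1 + x1 * y1) + c01 * (1 + x1 + x1 * y1)
     + c11 * (1 + x1 + y1)) by ring.
  by rewrite lerDl !addr_ge0// mulr_ge0// !addr_ge0.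
have dom x y : `|phi (x, y)| <= (C * ((1 + `|e1 x|) * `|F1 x|)) * ((1 + `|e2 y|) * `|F2 y|).
  rewrite /phi /= 2!normrM; apply: le_trans (ler_wpM2l _ (domN x y)) _; first by rewrite mulr_ge0.
  by rewrite le_eqVlt; apply/orP; left; apply/eqP; ring.
split; first exact: (dominated_integrable mphi iC i2 dom).
rewrite -/phi (dominated_fubini12 mphi iC i2 dom).
have [bb1 ibb1 bb1P] := tuple_box (p1 + q1) Mf; have [bb2 ibb2 bb2P] := tuple_box (p2 + q2) Mf.
pose Q1 (r : 'rV[R]_(p1 + q1)) := F1 (quad_form r).
pose Q2 (r : 'rV[R]_(p2 + q2)) := F2 (quad_form r).
have cQ1 : continuous Q1 by exact: (continuous_app cF1 (@quad_form_continuous p1 q1)).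
have cQ2 : continuous Q2 by exact: (continuous_app cF2 (@quad_form_continuous p2 q2)).
pose chi (z : (p1 + q1).-tuple mR * (p2 + q2).-tuple mR) := Q1 (rot z.1) * Q2 (rot z.2) * f (rot z.1, rot z.2).
have mchi : measurable_fun setT chi.
  apply: (@borel_map_row R (p1 + q1) _ _ _ _ (@borel_row R (p2 + q2))
     (fun x => Q1 x.1 * Q2 x.2 * f (x.1, x.2))).
  apply: continuous_mul; first apply: continuous_mul.
  - by apply: (continuous_app cQ1) => x; exact: cvg_fst.
  - by apply: (continuous_app cQ2) => x; exact: cvg_snd.
  - apply: (continuous_app (tfun_continuous tf)).
    by apply: continuous_mkpair => x; [exact: cvg_fst|exact: cvg_snd].
have iD : (lebesgue_tuple R (p1 + q1)).-integrable setT (EFin \o (fun t => (D1 * D2 * Cf) * bb1 t)).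
  by apply: eq_integrable (integrableZl measurableT (D1 * D2 * Cf) ibb1).
have domchi x y : `|chi (x, y)| <= (D1 * D2 * Cf) * bb1 x * bb2 y.
  have [u0 u1] := bb1P x; have [v0 v1] := bb2P y.
  have R0 : 0 <= D1 * D2 * Cf * bb1 x * bb2 y by rewrite !mulr_ge0.
  rewrite /chi/=; have [fx|Mx] := leP `|(rot x, rot y)| Mf; last by rewrite fM// mulr0 normr0.
  move: fx; rewrite prod_normE ge_max => /andP[x1 y1].
  rewrite u1// v1// !mulr1 2!normrM; apply: ler_pM (fC _) => //.
  by apply: ler_pM; rewrite ?normr_ge0//; [exact: HD1|exact: HD2].
rewrite -/chi (dominated_fubini21 mchi iD ibb2 domchi).
pose Phi (z : (p2 + q2).-tuple mR * mR) := F1 z.2 * (Q2 (rot z.1) * (a0 (z.2, rot z.1) + e1 z.2 * a1 (z.2, rot z.1))).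
transitivity (\int[lebesgue_tuple R (p2 + q2)]_y \int[leb]_s Phi (y, s)).
  apply: eq_Rintegral => y _; rewrite /chi/=.
  transitivity (Q2 (rot y) * \int[lebesgue_tuple R (p1 + q1)]_x (Q1 (rot x) * f (rot x, rot y))).
    rewrite -RintegralZl//; first by apply: eq_Rintegral => x _; rewrite mulrAC mulrC.
    apply: (tuple_tfun_integrable (g := fun r => Q1 r * f (r, rot y)) (M := Mf)).
    - apply: continuous_mul => //; apply: (continuous_app (tfun_continuous tf)).
      by apply: continuous_mkpair; [move=> r; exact: cvg_id|exact: cst_continuous].
    - by move=> r Mr; rewrite fM ?mulr0// prod_normE lt_max Mr.
    - by exists (D1 * Cf) => r; rewrite normrM; apply: (ler_pM (normr_ge0 _) (normr_ge0 _) (HD1 _) (fC _)).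
  rewrite (Ha F1 (rot y) sF1) -RintegralZl//.
    by apply: eq_Rintegral => s _; rewrite /Phi/= mulrCA.
  apply: (le_integrable measurableT _ _ (integrableZl measurableT (ca0 + ca1) i1)).
    have cc (g : R * 'rV[R]_(p2 + q2) -> R) : tfun g -> measurable_fun setT ((fun s => g (s, rot y)) : mR -> R).
      move=> tg; apply: continuous_measurable_fun; apply: (continuous_app (tfun_continuous tg)).
      by apply: continuous_mkpair; [move=> r; exact: cvg_id|exact: cst_continuous].
    apply/measurable_EFinP; apply: measurable_funM => //; apply: measurable_funD; first exact: cc.
    by apply: measurable_funM => //; exact: cc.
  move=> s _; rewrite /= lee_fin !normrM normr_id (ger0_norm (addr_ge0 ca00 ca10)).
  rewrite (ger0_norm (addr_ge0 ler01 (normr_ge0 (e1 s)))) mulrC mulrA ler_wpM2r//.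
  have x0 := normr_ge0 (e1 s).
  rewrite (le_trans (ler_normD _ _))// normrM.
  have := ler_wpM2l x0 (A1 (s, rot y)); have := A0 (s, rot y) => h1 h2.
  apply: le_trans (lerD h1 h2) _; move: x0; move: (`|e1 s|) => u u0.
  have -> : (ca0 + ca1) * (1 + u) = ca0 + u * ca1 + (ca0 * u + ca1) by ring.
  by rewrite lerDl addr_ge0// mulr_ge0.
have [Ma0 a0M] := ta0.2; have [Ma1 a1M] := ta1.2.
pose Ma := Num.max Ma0 Ma1.
have [bb ibb bbP] := tuple_box (p2 + q2) Ma.
have idom : (lebesgue_tuple R (p2 + q2)).-integrable setT (EFin \o (fun t => (D2 * (ca0 + ca1)) * bb t)).
  by apply: eq_integrable (integrableZl measurableT (D2 * (ca0 + ca1)) ibb).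
have mPhi : measurable_fun setT Phi.
  have mg (g : 'rV[R]_(p2 + q2) * R -> R) : continuous g ->
      measurable_fun setT (fun z : (p2 + q2).-tuple mR * mR => g (rot z.1, z.2)).
    by move=> cg; exact: (@borel_map_row R (p2 + q2) _ mR R id (@borel_map_id R) g cg).
  have ma (g : R * 'rV[R]_(p2 + q2) -> R) : tfun g ->
      measurable_fun setT (fun z : (p2 + q2).-tuple mR * mR => g (z.2, rot z.1)).
    move=> tg; apply: (mg (fun x => g (x.2, x.1))); apply: (continuous_app (tfun_continuous tg)).
    by apply: continuous_mkpair => x; [exact: cvg_snd|exact: cvg_fst].
  have m2 : measurable_fun setT (snd : (p2 + q2).-tuple mR * mR -> mR) by exact: measurable_snd.
  apply: measurable_funM; first exact: (measurableT_comp mF1 m2).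
  apply: measurable_funM.
    by apply: (mg (fun x => Q2 x.1)); apply: (continuous_app cQ2) => x; exact: cvg_fst.
  apply: measurable_funD; first exact: ma.
  by apply: measurable_funM; [exact: (measurableT_comp me1 m2)|exact: ma].
have domPhi y s : `|Phi (y, s)| <= (D2 * (ca0 + ca1)) * bb y * ((1 + `|e1 s|) * `|F1 s|).
  have [u0 u1] := bbP y; have x0 := normr_ge0 (e1 s).
  have R0 : 0 <= D2 * (ca0 + ca1) * bb y * ((1 + `|e1 s|) * `|F1 s|).
    by rewrite !mulr_ge0// addr_ge0.
  rewrite /Phi/=; have [yM|My] := leP `|rot y| Ma; last first.
    move: My; rewrite gt_max => /andP[y0 y1].
    rewrite a0M ?a1M ?mulr0 ?addr0 ?mulr0 ?normr0//; rewrite prod_normE lt_max ?y0 ?y1 orbT//.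
  rewrite u1// mulr1 !normrM.
  have hh : `|a0 (s, rot y) + e1 s * a1 (s, rot y)| <= (ca0 + ca1) * (1 + `|e1 s|).
    rewrite (le_trans (ler_normD _ _))// normrM.
    have := ler_wpM2l x0 (A1 (s, rot y)); have := A0 (s, rot y) => h1 h2.
    apply: le_trans (lerD h1 h2) _; move: x0; move: (`|e1 s|) => u u0'.
    have -> : (ca0 + ca1) * (1 + u) = ca0 + u * ca1 + (ca0 * u + ca1) by ring.
    by rewrite lerDl addr_ge0// mulr_ge0.
  have h3 := ler_pM (normr_ge0 _) (normr_ge0 _) (HD2 (quad_form (rot y))) hh.
  apply: le_trans (ler_wpM2l (normr_ge0 (F1 s)) h3) _.
  by rewrite le_eqVlt; apply/orP; left; apply/eqP; ring.
rewrite (dominated_fubini mPhi idom i1 domPhi).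
apply: eq_Rintegral => s _; rewrite /Phi /phi /=.
have it (a : R * 'rV[R]_(p2 + q2) -> R) : tfun a ->
    (lebesgue_tuple R (p2 + q2)).-integrable setT (EFin \o (fun t => Q2 (rot t) * sw a (rot t, s))).
  move=> ta; have [Ca Ca0 aC] := tfun_bounded ta; have [Mt aM] := ta.2.
  apply: (tuple_tfun_integrable (g := fun r => Q2 r * sw a (r, s)) (M := Mt)).
  - apply: continuous_mul => //; apply: (continuous_app (tfun_continuous ta)).
    by apply: continuous_mkpair; [exact: cst_continuous|move=> r; exact: cvg_id].
  - by move=> r Mr; rewrite /sw aM ?mulr0// prod_normE lt_max Mr orbT.
  - by exists (D2 * Ca) => r; rewrite normrM; apply: (ler_pM (normr_ge0 _) (normr_ge0 _) (HD2 _) (aC _)).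
transitivity (F1 s * (\int[lebesgue_tuple R (p2 + q2)]_t (Q2 (rot t) * sw a0 (rot t, s)) +
    e1 s * \int[lebesgue_tuple R (p2 + q2)]_t (Q2 (rot t) * sw a1 (rot t, s)))).
  rewrite -(RintegralZl (e1 s) measurableT (it _ ta1)).
  have iz : (lebesgue_tuple R (p2 + q2)).-integrable setT
      (EFin \o (fun t => e1 s * (Q2 (rot t) * sw a1 (rot t, s)))).
    by apply: eq_integrable (integrableZl measurableT (e1 s) (it _ ta1)).
  rewrite -(RintegralD measurableT (it _ ta0) iz).
  rewrite -(RintegralZl (F1 s) measurableT (integrableD measurableT (it _ ta0) iz)).
  by apply: eq_Rintegral => t _; rewrite /sw/= mulrDr [e1 s * (_ * _)]mulrCA.
rewrite (Hb0 F2 s sF2) (Hb1 F2 s sF2).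
have ib (c0 c1 : R * R -> R) : tfun c0 -> tfun c1 ->
    leb.-integrable setT (EFin \o (fun t => F2 t * (c0 (t, s) + e2 t * c1 (t, s)))).
  move=> tc0 tc1; have [k0 k00 hk0] := tfun_bounded tc0; have [k1 k10 hk1] := tfun_bounded tc1.
  apply: (le_integrable measurableT _ _ (integrableZl measurableT (k0 + k1) i2)).
    have cc (g : R * R -> R) : tfun g -> measurable_fun setT ((fun t => g (t, s)) : mR -> R).
      move=> tg; apply: continuous_measurable_fun; apply: (continuous_app (tfun_continuous tg)).
      by apply: continuous_mkpair; [move=> r; exact: cvg_id|exact: cst_continuous].
    apply/measurable_EFinP; apply: measurable_funM => //; apply: measurable_funD; first exact: cc.
    by apply: measurable_funM => //; exact: cc.
  move=> t _; rewrite /= lee_fin !normrM normr_id (ger0_norm (addr_ge0 k00 k10)).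
  rewrite (ger0_norm (addr_ge0 ler01 (normr_ge0 (e2 t)))) mulrC mulrA ler_wpM2r//.
  have x0 := normr_ge0 (e2 t).
  rewrite (le_trans (ler_normD _ _))// normrM.
  have := ler_wpM2l x0 (hk1 (t, s)); have := hk0 (t, s) => h1 h2.
  apply: le_trans (lerD h1 h2) _; move: x0; move: (`|e2 t|) => u u0.
  have -> : (k0 + k1) * (1 + u) = k0 + u * k1 + (k0 * u + k1) by ring.
  by rewrite lerDl addr_ge0// mulr_ge0.
rewrite -(RintegralZl (e1 s) measurableT (ib _ _ tb10 tb11)).
have iz : leb.-integrable setT (EFin \o (fun t => e1 s * (F2 t * (b10 (t, s) + e2 t * b11 (t, s))))).
  by apply: eq_integrable (integrableZl measurableT (e1 s) (ib _ _ tb10 tb11)).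
rewrite -(RintegralD measurableT (ib _ _ tb00 tb01) iz).
rewrite -(RintegralZl (F1 s) measurableT (integrableD measurableT (ib _ _ tb00 tb01) iz)).
apply: eq_Rintegral => t _; rewrite /N/=.
move: (b00 _) (b01 _) (b10 _) (b11 _) (e1 s) (e2 t) (F1 s) (F2 t) => x1 x2 x3 x4 x5 x6 x7 x8; ring.
Qed.

End two_forms.

(** * Continuity of the singularity functions off 0 *)

Section singularity_continuity.
Context {R : realType}.

Lemma heaviside_powR_continuous (n : nat) (u : R) : u != 0 ->
  {for u, continuous (fun t : R => heaviside t * t `^ (n%:R / 2 - 1))}.
Proof.
move=> u0; have [up|un] := ltP 0 u.
  apply: (continuous_local (g := hp n) up _ (hp_continuous up)) => v vu.
  have vp : 0 < v by move: vu; rewrite ltr_norml => /andP[h _]; move: h; rewrite ltrBrDl subrr.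
  by rewrite /heaviside vp mul1r hp_powR.
have nu : 0 < - u by rewrite oppr_gt0 lt_neqAle u0.
have c0 : {for u, continuous (fun _ : R => 0 : R)} by exact: cst_continuous.
apply: (continuous_local nu _ c0) => v vu.
have vn : v < 0 by move: vu; rewrite ltr_norml => /andP[_ h]; move: h; rewrite ltrBlDr addNr.
by rewrite /heaviside ltNge (ltW vn) mul0r.
Qed.

Lemma singularity_continuous p q (u : R) : u != 0 -> {for u, continuous (@singularity_fun R p q)}.
Proof.
move=> u0; rewrite /singularity_fun; case: (odd p); case: (odd q).
- apply: continuousM; first exact: exprn_continuous.
  apply: (@continuous_comp _ _ _ (fun t : R => `|t|) (@ln R)); first exact: norm_continuous.
  by apply: continuous_ln; rewrite normr_gt0.
- exact: heaviside_powR_continuous.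
- apply: (@continuous_comp _ _ _ (fun t : R => - t)
    (fun t : R => heaviside t * t `^ ((p + q)%N%:R / 2 - 1))); first exact: opp_continuous.
  by apply: heaviside_powR_continuous; rewrite oppr_eq0.
- have u1 : 0 < `|u| by rewrite normr_gt0.
  have cg : {for u, continuous (fun t : R => 2^-1 * Num.sg u * t ^+ ((p + q)./2).-1)}.
    by apply: continuousM; [exact: cst_continuous|exact: exprn_continuous].
  apply: (continuous_local u1 _ cg) => v vu; congr (_ * _ * _).
  have [up|un] := ltP 0 u.
    move: vu; rewrite (gtr0_norm up) ltr_norml ltrBrDl subrr => /andP[vp _].
    by rewrite !gtr0_sg.
  have un' : u < 0 by rewrite lt_neqAle u0.
  move: vu; rewrite (ltr0_norm un') ltr_norml => /andP[_]; rewrite ltrBlDr addNr => vn.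
  by rewrite !ltr0_sg.
Qed.

End singularity_continuity.

Theorem mainTheorem3 (R : realType) (p1 q1 p2 q2 : nat)
    (hp1 : (1 <= p1)%N) (hq1 : (1 <= q1)%N)
    (hp2 : (1 <= p2)%N) (hq2 : (1 <= q2)%N)
    (f : 'rV[R]_(p1 + q1) * 'rV[R]_(p2 + q2) -> R) (hf : test_function f)
    (Mf : R * R -> R) (hMf : is_quad_average f Mf) :
  exists psi0 psi1 psi2 psi3 : R * R -> R,
    [/\ test_function psi0, test_function psi1,
        test_function psi2 & test_function psi3] /\
    forall t1 t2 : R, t1 != 0 -> t2 != 0 ->
      Mf (t1, t2) =
        psi0 (t1, t2)
        + singularity_fun p1 q1 t1 * psi1 (t1, t2)
        + singularity_fun p2 q2 t2 * psi2 (t1, t2)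
        + singularity_fun p1 q1 t1 * singularity_fun p2 q2 t2 * psi3 (t1, t2).
Proof.
have [psi0 [psi1 [psi2 [psi3 [[h0 h1 h2 h3] H]]]]] :=
  two_forms_density hp1 hq1 hp2 hq2 (test_function_tfun hf).
exists psi0, psi1, psi2, psi3; split; first by split; exact: tfun_test_function.
move=> t1 t2 t10 t20.
pose N (t : R * R) := psi0 t + singularity_fun p1 q1 t.1 * psi1 t
  + singularity_fun p2 q2 t.2 * psi2 t
  + singularity_fun p1 q1 t.1 * singularity_fun p2 q2 t.2 * psi3 t.
suff : Mf (t1, t2) - N (t1, t2) = 0 by move=> /eqP; rewrite subr_eq0 => /eqP.
have [sM iM qM] := hMf.
(* Both functions are continuous off the axes, so agreement of their integrals against products
   gives equality at the point itself, not merely almost everywhere. *)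
apply: (@tensor_unique R (fun t => Mf t - N t)).
  have cM : {for (t1, t2), continuous Mf} by have [] := sM [::] (t1, t2) (conj t10 t20).
  have ce1 : {for (t1, t2), continuous (fun t : R * R => @singularity_fun R p1 q1 t.1)}.
    apply: (@continuous_comp _ _ _ (fst : R * R -> R) (singularity_fun p1 q1)); first exact: cvg_fst.
    exact: singularity_continuous.
  have ce2 : {for (t1, t2), continuous (fun t : R * R => @singularity_fun R p2 q2 t.2)}.
    apply: (@continuous_comp _ _ _ (snd : R * R -> R) (singularity_fun p2 q2)); first exact: cvg_snd.
    exact: singularity_continuous.
  have c0 := tfun_continuous h0; have c1 := tfun_continuous h1.
  have c2 := tfun_continuous h2; have c3 := tfun_continuous h3.
  apply: continuousB; first exact: cM.
  apply: continuousD; last by apply: continuousM; [exact: continuousM|exact: c3].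
  apply: continuousD; last by apply: continuousM; [exact: ce2|exact: c2].
  apply: continuousD; last by apply: continuousM; [exact: ce1|exact: c1].
  exact: c0.
move=> F1 F2 tF1 tF2; have [iN eN] := H F1 F2 tF1 tF2.
have tF := tfun_tensor tF1 tF2; have [C C0 FC] := tfun_bounded tF.
have mF : measurable_fun setT (fun z : measurableTypeR R * measurableTypeR R => F1 z.1 * F2 z.2).
  exact: (borel_plane (tfun_continuous tF)).
have iFM : (@lebesgue_measure R \x @lebesgue_measure R)%E.-integrable setT
    (fun z : measurableTypeR R * measurableTypeR R => (F1 z.1 * F2 z.2 * Mf z)%:E).
  have /integrableP[/measurable_EFinP mM _] := iM.
  apply: (le_integrable measurableT _ _ (integrableZl measurableT C (integrable_abse iM))).
    by apply/measurable_EFinP; exact: measurable_funM.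
  by move=> z _; rewrite /= lee_fin !normrM normr_id (ger0_norm C0) ler_wpM2r// -normrM.
have iFN : (@lebesgue_measure R \x @lebesgue_measure R)%E.-integrable setT
    (fun z : measurableTypeR R * measurableTypeR R => (F1 z.1 * F2 z.2 * N z)%:E) by exact: iN.
split.
  have := integrableB measurableT iFM iFN; apply: eq_integrable => // z _.
  by rewrite /= -EFinB mulrBr.
have := RintegralB measurableT iFM iFN => eB.
transitivity (\int[(@lebesgue_measure R \x @lebesgue_measure R)%E]_z (F1 z.1 * F2 z.2 * Mf z - F1 z.1 * F2 z.2 * N z)).
  by apply: eq_Rintegral => z _; rewrite mulrBr.
rewrite eB; apply/eqP; rewrite subr_eq0; apply/eqP.
(* The defining property of [Mf] is an equality of extended integrals; [fine] turns it into the
   real-valued form of the density formula. *)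
have eM := congr1 fine (qM _ (tfun_test_function tF)).
exact: (etrans (esym eM) eN).
Qed.
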